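(* Let $\tau\colon \mathbb{Z}\to\mathbb{Z}_{\geq 0}$ be a function with finite support $i_1<\cdots<i_r$, let $n_j:=\tau(i_j)$, $J=(n_r,\ldots,n_1)$, $n:=n_1+\cdots+n_r$, and ${}^JW=(S_{n_r}\times\cdots\times S_{n_1})\backslash S_n$. Let $\underline{M}=(M,C^\bullet,D_\bullet,\varphi_\bullet)$ be an $F$-zip of type $\tau$ over a scheme $S$ of characteristic $p$. For $u\in{}^JW$ define a subfunctor $S^u_{\underline{M}}$ of $S$ by the condition that a morphism $g\colon T\to S$ factors through $S^u_{\underline{M}}$ if and only if $g^*\underline{M}$ is fppf-locally isomorphic to $\underline{M}^u_\tau\otimes_{\mathbb{F}_p}\mathcal{O}_T$, where $\underline{M}^u_\tau$ is the standard $F$-zip (described in the context). Then $S^u_{\underline{M}}\subset S$ is representable by a locally closed subscheme of $S$, and the map $$\coprod_{u\in{}^JW}S^u_{\underline{M}}\longrightarrow S$$ is a bijective monomorphism (i.e., a partition of $S$).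
   Context: For a scheme $S$ of characteristic $p$ and an $\mathcal{O}_S$-module $M$, $M^{(p)}$ denotes the pull-back of $M$ under the absolute Frobenius ($x\mapsto x^p$) of $S$. **$F$-zips.** An $F$-zip over $S$ (with respect to $q=p$) is a tuple $\underline{M}=(M,C^\bullet,D_\bullet,\varphi_\bullet)$ where $M$ is a locally free $\mathcal{O}_S$-module of finite rank; $C^\bullet=(C^i)_{i\in\mathbb{Z}}$ is a descending filtration of $M$ (each $C^i$ is locally a direct summand of $C^{i-1}$, $C^i=M$ for $i\ll0$, $C^i=0$ for $i\gg0$); $D_\bullet=(D_i)_{i\in\mathbb{Z}}$ is an ascending filtration of $M$ (with the analogous conditions); and $\varphi_i\colon (\mathrm{gr}^i_C)^{(p)}\to\mathrm{gr}_i^D$ ($i\in\mathbb{Z}$) are $\mathcal{O}_S$-linear isomorphisms, where $\mathrm{gr}^i_C=C^i/C^{i+1}$, $\mathrm{gr}^D_i=D_i/D_{i-1}$. An isomorphism of $F$-zips is an isomorphism of the underlying modules compatible with both filtrations and with all $\varphi_i$. The $F$-zip has type $\tau$ if $\mathrm{rank}(\mathrm{gr}^i_C)=\tau(i)$ for all $i$ (everywhere on $S$). $F$-zips can be pulled back along morphisms $T\to S$. The flag associated to a filtration is its set of submodules, forgetting the enumeration. **The set ${}^JW$.** Let $W=S_n$ be the group of permutations of $\{1,\ldots,n\}$, put $m_j:=n_1+\cdots+n_j$ ($m_0=0$), and regard $W_J=S_{n_r}\times\cdots\times S_{n_1}$ as a subgroup of $S_n$ in the usual way (preserving the blocks $\{n-m_j+1,\ldots,n-m_{j-1}\}$).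 The coset space $W_J\backslash W$ is identified with the set ${}^JW$ of $u\in W$ with $u^{-1}(n-m_j+1)<u^{-1}(n-m_j+2)<\cdots<u^{-1}(n-m_{j-1})$ for all $j=1,\ldots,r$, i.e. of those $u$ that are of minimal length in their coset $W_Ju$. **Standard $F$-zips.** Let $x\in W$ be given by $x(i)=i+m_j+m_{j-1}-n$ if $n-m_j<i\le n-m_{j-1}$; this is the element of minimal length in $w_0W_J$, where $w_0$ is the longest element of $W$. For $A\subset\{1,\ldots,n\}$ let $\mathbb{F}_p^A\subset\mathbb{F}_p^n$ be the span of the standard basis vectors $e_a$, $a\in A$. For $u\in{}^JW$, the standard $F$-zip $\underline{M}^u_\tau$ over $\mathbb{F}_p$ is given as follows: - the underlying module is $\mathbb{F}_p^n$; - $C^\bullet$ is the unique filtration of type $\tau$ whose associated flag is $\mathbb{F}_p^n\supset\mathbb{F}_p^{\{u(1),\ldots,u(m_{r-1})\}}\supset\mathbb{F}_p^{\{u(1),\ldots,u(m_{r-2})\}}\supset\cdots\supset\mathbb{F}_p^{\{u(1),\ldots,u(m_1)\}}\supset(0)$; - $D_\bullet$ is the unique filtration of type $\tau$ whose associated flag is $(0)\subset\mathbb{F}_p^{\{1,\ldots,n-m_{r-1}\}}\subset\mathbb{F}_p^{\{1,\ldots,n-m_{r-2}\}}\subset\cdots\subset\mathbb{F}_p^{\{1,\ldots,n-m_0\}}=\mathbb{F}_p^n$; - $\varphi_i=0$ for $i\notin\{i_1,\ldots,i_r\}$, and for $i=i_j$ it is the isomorphism $(\mathrm{gr}^i_C)^{(p)}=\mathbb{F}_p^{\{u(m_{r-j}+1),\ldots,u(m_{r-j+1})\}}\to\mathrm{gr}^D_i=\mathbb{F}_p^{\{n-m_{r-j+1}+1,\ldots,n-m_{r-j}\}}$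 induced by the permutation matrix associated to $x^{-1}u^{-1}$.
   Formalization: The formal statement takes n_j := τ(i_{r+1-j}) instead of n_j := τ(i_j); with the literal choice the described flags have graded ranks n_r,…,n_1 and carry no filtration of type τ unless (n_1,…,n_r) is palindromic, in which case both agree. *)

(* Defs.v *)
(* Schemes are handled through their functors of points: a scheme is a
   functor from commutative rings to sets which is a Zariski sheaf covered by
   affine open subfunctors; a quasi-coherent module is a family of modules, one
   over each R-valued point, compatible with base change. *)
From HB Require Import structures.
From mathcomp Require Import all_boot all_order all_algebra all_fingroup.
From mathcomp Require Import boolp.
From mathcomp Require Import zify.
Set Implicit Arguments. Unset Strict Implicit. Unset Printing Implicit Defensive.
Import Order.TTheory GRing.Theory.
Local Open Scope ring_scope.

Definition unit_family (R : comPzRingType) k (f : 'I_k -> R) : Prop :=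
  exists c : 'I_k -> R, \sum_a c a * f a = 1.

(* [phi] exhibits [R'] as the localization of [R] at the powers of [f] *)
Definition is_localization (R R' : comPzRingType) (f : R)
    (phi : {rmorphism R -> R'}) : Prop :=
  [/\ exists b, phi f * b = 1,
      forall y, exists r k, phi f ^+ k * y = phi r
    & forall r, phi r = 0 -> exists k, f ^+ k * r = 0].

Definition is_basis (R : comPzRingType) (M : lmodType R) n (e : 'I_n -> M) :
    Prop :=
  forall v, exists! c : {ffun 'I_n -> R}, v = \sum_a c a *: e a.

(* [beta : M -> M'] is [sigma]-semilinear and exhibits [M'] as
   [M (x)_(R, sigma) R'], i.e. its linearization is an isomorphism. *)
Definition is_base_change (R R' : comPzRingType) (sigma : R -> R')
    (M : lmodType R) (M' : lmodType R') (beta : M -> M') : Prop :=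
  linear_for (fun a v => sigma a *: v) beta /\
  forall (N : lmodType R') (gamma : M -> N),
    linear_for (fun a v => sigma a *: v) gamma ->
    exists! delta : M' -> N, linear delta /\ forall v, delta (beta v) = gamma v.

Definition flat (R R' : comPzRingType) (phi : {rmorphism R -> R'}) : Prop :=
  forall (A B : lmodType R) (A' B' : lmodType R')
         (alpha : A -> A') (beta : B -> B') (f : A -> B) (f' : A' -> B'),
    is_base_change phi alpha -> is_base_change phi beta ->
    linear f -> linear f' -> (forall v, f' (alpha v) = beta (f v)) ->
    injective f -> injective f'.

(* [P], with structure map [iota], is the polynomial ring over [R] in the
   variables [X a] *)
Definition is_polynomial_ring (R P : comPzRingType) (iota : {rmorphism R -> P})
    n (X : 'I_n -> P) : Prop :=
  forall (B : comPzRingType) (f : {rmorphism R -> B}) (b : 'I_n -> B),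
    exists g : {rmorphism P -> B},
      [/\ forall r, g (iota r) = f r, forall a, g (X a) = b a
        & forall g' : {rmorphism P -> B}, (forall r, g' (iota r) = f r) ->
            (forall a, g' (X a) = b a) -> g' =1 g].

Definition finitely_presented (R R' : comPzRingType)
    (phi : {rmorphism R -> R'}) : Prop :=
  exists n (P : comPzRingType) (iota : {rmorphism R -> P}) (X : 'I_n -> P)
         (pi : {rmorphism P -> R'}) k (h : 'I_k -> P),
    [/\ is_polynomial_ring iota X, forall r, pi (iota r) = phi r,
        forall y, exists q, pi q = y
      & forall q, pi q = 0 <-> exists c : 'I_k -> P, q = \sum_a c a * h a].

Definition Spec_surjective (R R' : comPzRingType)
    (phi : {rmorphism R -> R'}) : Prop :=
  forall (K : fieldType) (x : {rmorphism R -> K}),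
    exists (L : fieldType) (e : {rmorphism K -> L}) (y : {rmorphism R' -> L}),
      forall r, y (phi r) = e (x r).

Definition fppf_cover (R R' : comPzRingType) (phi : {rmorphism R -> R'}) :
    Prop :=
  [/\ flat phi, finitely_presented phi & Spec_surjective phi].

Record submod (R : comPzRingType) (M : lmodType R) := Submod {
  smem :> M -> Prop;
  smem0 : smem 0;
  smemP : forall a v w, smem v -> smem w -> smem (a *: v + w) }.

Section Subquotient.
Variables (R : comPzRingType) (M : lmodType R) (A B : submod M).

Lemma smemD (C : submod M) v w : C v -> C w -> C (v + w).
Proof. by move=> Cv Cw; rewrite -[v]scale1r; apply: smemP. Qed.

Lemma smemZ (C : submod M) a v : C v -> C (a *: v).
Proof. by move=> Cv; rewrite -[_ *: _]addr0; apply: smemP => //; apply: smem0. Qed.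

Lemma smemN (C : submod M) v : C v -> C (- v).
Proof. by move=> Cv; rewrite -scaleN1r; apply: smemZ. Qed.

Let cong (v w : M) : bool := `[< A (v - w) /\ B (v - w) >].

Fact cong_refl v : exists w, cong v w.
Proof. by exists v; apply/asboolP; rewrite subrr; split; apply: smem0. Qed.

(* a representative of [v + A :&: B] that depends only on this coset *)
Definition rep (v : M) : M := xchoose (cong_refl v).

Lemma rep_cong v : A (v - rep v) /\ B (v - rep v).
Proof. exact/asboolP/(xchooseP (cong_refl v)). Qed.

Lemma rep_eq v w : A (v - w) -> B (v - w) -> rep v = rep w.
Proof.
move=> Avw Bvw; apply: eq_xchoose => z; apply/asboolP/asboolP => -[Az Bz].
  have -> : w - z = - (v - w) + (v - z) by rewrite opprB addrA subrK.
  by split; apply: smemD => //; apply: smemN.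
have -> : v - z = (v - w) + (w - z) by rewrite addrA subrK.
by split; apply: smemD.
Qed.

Lemma rep_id v : rep (rep v) = rep v.
Proof. by have [Av Bv] := rep_cong v; apply: rep_eq; rewrite -opprB; apply: smemN. Qed.

Lemma repDl v w : rep (rep v + w) = rep (v + w).
Proof.
have [Av Bv] := rep_cong v.
have e : rep v + w - (v + w) = - (v - rep v).
  by rewrite opprD addrACA subrr addr0 opprB.
by apply: rep_eq; rewrite e; apply: smemN.
Qed.

Lemma repDr v w : rep (v + rep w) = rep (v + w).
Proof. by rewrite addrC repDl addrC. Qed.

Lemma repZ a v : rep (a *: rep v) = rep (a *: v).
Proof.
have [Av Bv] := rep_cong v.
by apply: rep_eq; rewrite -scalerBr -opprB scalerN; apply: smemN; apply: smemZ.
Qed.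

Lemma smem_rep v : A v -> A (rep v).
Proof.
move=> Av; have [/smemN Arv _] := rep_cong v.
by rewrite -[rep v](subrK v) -opprB; apply: smemD.
Qed.

(* the module [A / (A :&: B)], carried by the representatives *)
Record subquo := Subquo {
  sqval : M;
  sqvalP : `[< A sqval >] && (rep sqval == sqval) }.

HB.instance Definition _ := [isSub for sqval].
HB.instance Definition _ := [Choice of subquo by <:].

Fact mksq_proof v : A v -> `[< A (rep v) >] && (rep (rep v) == rep v).
Proof. by move=> /smem_rep Av; rewrite rep_id eqxx andbT; apply/asboolP. Qed.

Definition mksq v (Av : A v) : subquo := Subquo (mksq_proof Av).

Lemma sqval_mem (z : subquo) : A (sqval z).
Proof. by have /andP[/asboolP] := sqvalP z. Qed.

Lemma rep_sqval (z : subquo) : rep (sqval z) = sqval z.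
Proof. by have /andP[_ /eqP] := sqvalP z. Qed.

Definition sq0 := mksq (smem0 A).
Definition sqopp z := mksq (smemN (sqval_mem z)).
Definition sqadd z t := mksq (smemD (sqval_mem z) (sqval_mem t)).
Definition sqscale a z := mksq (smemZ a (sqval_mem z)).

Fact sqaddA : associative sqadd.
Proof. by move=> z t w; apply: val_inj; rewrite /= repDl repDr addrA. Qed.
Fact sqaddC : commutative sqadd.
Proof. by move=> z t; apply: val_inj; rewrite /= addrC. Qed.
Fact sqadd0 : left_id sq0 sqadd.
Proof. by move=> z; apply: val_inj; rewrite /= repDl add0r rep_sqval. Qed.
Fact sqaddN : left_inverse sq0 sqopp sqadd.
Proof. by move=> z; apply: val_inj; rewrite /= repDl addNr. Qed.

HB.instance Definition _ :=
  GRing.isZmodule.Build subquo sqaddA sqaddC sqadd0 sqaddN.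

Fact sqscaleA a b z : sqscale a (sqscale b z) = sqscale (a * b) z.
Proof. by apply: val_inj; rewrite /= repZ scalerA. Qed.
Fact sqscale1 : left_id 1 sqscale.
Proof. by move=> z; apply: val_inj; rewrite /= scale1r rep_sqval. Qed.
Fact sqscaleDr : right_distributive sqscale +%R.
Proof. by move=> a z t; apply: val_inj; rewrite /= repZ repDl repDr scalerDr. Qed.
Fact sqscaleDl z : {morph sqscale^~ z : a b / a + b}.
Proof. by move=> a b; apply: val_inj; rewrite /= repDl repDr scalerDl. Qed.

HB.instance Definition _ := GRing.Zmodule_isLmodule.Build R subquo
  sqscaleA sqscale1 sqscaleDr sqscaleDl.

(* the class of [v] if [v] lies in [A]; a junk value otherwise *)
Definition sqclass (v : M) : subquo :=
  if pselect (A v) is left Av then mksq Av else 0.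
End Subquotient.

Definition generated (R : comPzRingType) (M : lmodType R) (E : M -> Prop)
    (v : M) : Prop :=
  exists k (c : 'I_k -> R) (e : 'I_k -> M),
    (forall a, E (e a)) /\ v = \sum_a c a *: e a.

Definition direct_summand (R : comPzRingType) (M : lmodType R)
    (A B : submod M) : Prop :=
  (forall v, A v -> B v) /\
  exists Q : submod M,
    [/\ forall v, Q v -> B v,
        forall v, B v -> exists a q, [/\ A a, Q q & v = a + q]
      & forall v, A v -> Q v -> v = 0].

Record zfunctor := ZFunctor {
  pts :> comPzRingType -> Type;
  act : forall R R' : comPzRingType, {rmorphism R -> R'} -> pts R -> pts R';
  act_id : forall (R : comPzRingType) (phi : {rmorphism R -> R}) (s : pts R),
    phi =1 id -> act phi s = s;
  act_comp : forall (R R' R'' : comPzRingType) (phi : {rmorphism R -> R'})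
      (psi : {rmorphism R' -> R''}) (chi : {rmorphism R -> R''}) (s : pts R),
    chi =1 psi \o phi -> act chi s = act psi (act phi s) }.

Record zmor (S T : zfunctor) := ZMor {
  app :> forall R : comPzRingType, S R -> T R;
  app_nat : forall (R R' : comPzRingType) (phi : {rmorphism R -> R'}) (s : S R),
    app (act phi s) = act phi (app s) }.

(* families are compatible when they agree over every ring receiving maps from
   two members [L a], [L b] that coincide on [R], in particular over the ring
   [L a (x)_R L b] of the overlap *)
Definition zariski_sheaf (S : zfunctor) : Prop :=
  forall (R : comPzRingType) k (f : 'I_k -> R) (L : 'I_k -> comPzRingType)
         (l : forall a, {rmorphism R -> L a}) (t : forall a, S (L a)),
    unit_family f -> (forall a, is_localization (f a) (l a)) ->
    (forall a b (B : comPzRingType) (alpha : {rmorphism L a -> B})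
            (beta : {rmorphism L b -> B}),
        (forall r, alpha (l a r) = beta (l b r)) ->
        act alpha (t a) = act beta (t b)) ->
    exists! s : S R, forall a, act (l a) s = t a.

Definition subfun (S : zfunctor) := forall R : comPzRingType, S R -> Prop.

(* [E] plays the role of generators of the ideal of the closed complement *)
Definition open_subfun (S : zfunctor) (U : subfun S) : Prop :=
  forall (R : comPzRingType) (s : S R), exists E : R -> Prop,
    forall (R' : comPzRingType) (phi : {rmorphism R -> R'}),
      U R' (act phi s) <->
      exists k (e : 'I_k -> R), (forall a, E (e a)) /\
                                unit_family (fun a => phi (e a)).

Definition closed_in (S : zfunctor) (U Z : subfun S) : Prop :=
  (forall R s, Z R s -> U R s) /\
  forall (R : comPzRingType) (s : S R), U R s -> exists E : R -> Prop,
    forall (R' : comPzRingType) (phi : {rmorphism R -> R'}),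
      Z R' (act phi s) <-> forall r, E r -> phi r = 0.

Definition affine_subfun (S : zfunctor) (U : subfun S) : Prop :=
  exists (A : comPzRingType) (a : S A), U A a /\
    forall (R : comPzRingType) (s : S R), U R s ->
      exists phi : {rmorphism A -> R}, act phi a = s /\
        forall psi : {rmorphism A -> R}, act psi a = s -> psi =1 phi.

(* the affine open subfunctors cover [S] on field-valued points *)
Definition is_scheme (S : zfunctor) : Prop :=
  zariski_sheaf S /\
  forall (K : fieldType) (s : S K), exists U : subfun S,
    [/\ open_subfun U, affine_subfun U & U K s].

Record scheme := Scheme { fpts :> zfunctor; schemeP : is_scheme fpts }.

Definition has_characteristic (p : nat) (S : scheme) : Prop :=
  forall (R : comPzRingType) (s : S R), p%:R = 0 :> R.

Definition comp_eq (X Y Z : zfunctor) (g : zmor Y Z) (f : zmor X Y)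
    (h : zmor X Z) : Prop :=
  forall (R : comPzRingType) (x : X R), g R (f R x) = h R x.

Definition eq_mor (X Y : zfunctor) (f g : zmor X Y) : Prop :=
  forall (R : comPzRingType) (x : X R), f R x = g R x.

Definition monomorphism (X S : scheme) (f : zmor X S) : Prop :=
  forall (T : scheme) (a b : zmor T X),
    (forall (R : comPzRingType) (t : T R), f R (a R t) = f R (b R t)) ->
    eq_mor a b.

Definition image (X S : zfunctor) (f : zmor X S) : subfun S :=
  fun R s => exists x : X R, f R x = s.

Definition locally_closed_immersion (X S : scheme) (f : zmor X S) : Prop :=
  (forall R : comPzRingType, injective (f R)) /\
  exists U : subfun S, open_subfun U /\ closed_in U (image f).

(* The underlying set of [S] consists of the field-valued points modulo this
   equivalence. *)
Definition same_point (S : zfunctor) (K L : fieldType) (x : S K) (y : S L) :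
    Prop :=
  exists (E : fieldType) (a : {rmorphism K -> E}) (b : {rmorphism L -> E}),
    act a x = act b y.

Definition bijective_on_points (X S : zfunctor) (f : zmor X S) : Prop :=
  (forall (K L : fieldType) (x : X K) (y : X L),
     same_point (f K x) (f L y) -> same_point x y) /\
  (forall (L : fieldType) (s : S L),
     exists (K : fieldType) (x : X K), same_point (f K x) s).

Definition is_coproduct (I : Type) (X : I -> scheme) (P : scheme)
    (inj : forall i, zmor (X i) P) : Prop :=
  forall (Y : scheme) (f : forall i, zmor (X i) Y),
    exists g : zmor P Y, (forall i, comp_eq g (inj i) (f i)) /\
      forall g' : zmor P Y, (forall i, comp_eq g' (inj i) (f i)) -> eq_mor g' g.

(* Over a ring of characteristic [p], an O-linear map from the Frobenius
   pull-back of [gr^i_C] to [gr_i^D] is given as a Frobenius-semilinear map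
   [zphi i : gr^i_C -> gr_i^D]; see [is_fzip]. *)
Record zip_data (R : comPzRingType) := ZipData {
  zmod :> lmodType R;
  zC : int -> submod zmod;
  zD : int -> submod zmod;
  zphi : forall i : int,
    subquo (zC i) (zC (i + 1)) -> subquo (zD i) (zD (i - 1)) }.

Definition zgrC (R : comPzRingType) (M : zip_data R) (i : int) : lmodType R :=
  subquo (zC M i) (zC M (i + 1)).
Definition zgrD (R : comPzRingType) (M : zip_data R) (i : int) : lmodType R :=
  subquo (zD M i) (zD M (i - 1)).
Definition clC (R : comPzRingType) (M : zip_data R) (i : int) (v : M) :
  zgrC M i := sqclass (zC M i) (zC M (i + 1)) v.
Definition clD (R : comPzRingType) (M : zip_data R) (i : int) (v : M) :
  zgrD M i := sqclass (zD M i) (zD M (i - 1)) v.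

(* [f v] represents [phi_i] of the class of [v], whenever [v] represents an
   element of [gr^i_C] *)
Definition phi_compatible (R R' : comPzRingType) (M : zip_data R)
    (N : zip_data R') (f : M -> N) : Prop :=
  forall (i : int) (v w : M), zC M i v -> zD M i w ->
    zphi (clC i v) = clD i w -> zphi (clC i (f v)) = clD i (f w).

Definition zip_iso (R : comPzRingType) (M N : zip_data R) : Prop :=
  exists f : M -> N,
    [/\ linear f, bijective f,
        forall i v, zC M i v <-> zC N i (f v),
        forall i v, zD M i v <-> zD N i (f v)
      & phi_compatible f].

(* [fib s] is the pull-back along the morphism [Spec R -> S] given by [s] *)
Record fzip_data (S : zfunctor) := FzipData {
  fib :> forall R : comPzRingType, S R -> zip_data R;
  rst : forall (R R' : comPzRingType) (phi : {rmorphism R -> R'})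
      (s : S R) (s' : S R'), act phi s = s' -> fib s -> fib s' }.

Arguments rst {S} M {R R' phi s s'} e v : rename.

Definition zariski_locally (S : zfunctor)
    (P : forall R : comPzRingType, S R -> Prop) (R : comPzRingType) (s : S R) :
    Prop :=
  exists k (f : 'I_k -> R), unit_family f /\
    forall a (R' : comPzRingType) (phi : {rmorphism R -> R'}),
      is_localization (f a) phi -> P R' (act phi s).

Record is_fzip (p : nat) (S : zfunctor) (M : fzip_data S) : Prop := IsFzip {
  rst_base_change : forall (R R' : comPzRingType) (phi : {rmorphism R -> R'})
      (s : S R) (s' : S R') (e : act phi s = s'),
    is_base_change phi (rst M e);
  rst_comp : forall (R R' R'' : comPzRingType) (phi : {rmorphism R -> R'})
      (psi : {rmorphism R' -> R''}) (chi : {rmorphism R -> R''})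
      (s : S R) (s' : S R') (s'' : S R'') (e : act phi s = s')
      (e' : act psi s' = s'') (e'' : act chi s = s''),
    chi =1 psi \o phi -> forall v, rst M e'' v = rst M e' (rst M e v);
  fzip_locally_free : forall (R : comPzRingType) (s : S R),
    zariski_locally
      (fun R' s' => exists n (e : 'I_n -> M R' s'), is_basis e) s;
  C_base_change : forall i (R R' : comPzRingType) (phi : {rmorphism R -> R'})
      (s : S R) (s' : S R') (e : act phi s = s') (v : M R' s'),
    zC (M R' s') i v <->
    generated (fun v' => exists2 w, zC (M R s) i w & v' = rst M e w) v;
  D_base_change : forall i (R R' : comPzRingType) (phi : {rmorphism R -> R'})
      (s : S R) (s' : S R') (e : act phi s = s') (v : M R' s'),
    zD (M R' s') i v <->
    generated (fun v' => exists2 w, zD (M R s) i w & v' = rst M e w) v;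
  C_summand : forall i (R : comPzRingType) (s : S R),
    zariski_locally (fun R' s' =>
      direct_summand (zC (M R' s') i) (zC (M R' s') (i - 1))) s;
  D_summand : forall i (R : comPzRingType) (s : S R),
    zariski_locally (fun R' s' =>
      direct_summand (zD (M R' s') i) (zD (M R' s') (i + 1))) s;
  C_full : exists lo : int, forall i, i <= lo ->
    forall (R : comPzRingType) (s : S R) (v : M R s), zC (M R s) i v;
  C_zero : exists hi : int, forall i, hi <= i ->
    forall (R : comPzRingType) (s : S R) (v : M R s), zC (M R s) i v -> v = 0;
  D_zero : exists lo : int, forall i, i <= lo ->
    forall (R : comPzRingType) (s : S R) (v : M R s), zD (M R s) i v -> v = 0;
  D_full : exists hi : int, forall i, hi <= i ->
    forall (R : comPzRingType) (s : S R) (v : M R s), zD (M R s) i v;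
  (* the linearization of [phi_i] on the Frobenius pull-back is bijective *)
  phi_iso : forall i (R : comPzRingType) (s : S R),
    is_base_change (fun r : R => r ^+ p)
      (zphi (i := i) : zgrC (M R s) i -> zgrD (M R s) i);
  phi_base_change : forall (R R' : comPzRingType) (phi : {rmorphism R -> R'})
      (s : S R) (s' : S R') (e : act phi s = s'), phi_compatible (rst M e) }.

Record fzip (p : nat) (S : scheme) := Fzip {
  fzipd :> fzip_data S;
  fzipP : is_fzip p fzipd }.

Definition has_type (p : nat) (S : scheme) (M : fzip p S) (tau : int -> nat) :
    Prop :=
  forall i (R : comPzRingType) (s : S R),
    zariski_locally
      (fun R' s' => exists e : 'I_(tau i) -> zgrC (M R' s') i, is_basis e) s.

Section Pullback.
Variables (p : nat) (S T : scheme) (g : zmor T S) (M : fzip p S).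

Definition pull_data : fzip_data T :=
  @FzipData T (fun R t => M R (g R t))
    (fun R R' phi t t' e =>
       rst M (etrans (esym (app_nat g phi t)) (congr1 (g R') e))).

Lemma zariski_locally_pull (P : forall R : comPzRingType, S R -> Prop)
    (R : comPzRingType) (t : T R) :
  zariski_locally P (g R t) -> zariski_locally (fun R' t' => P R' (g R' t')) t.
Proof.
move=> [k [f [fu fP]]]; exists k, f; split=> // a R' phi floc.
by rewrite app_nat; apply: fP floc.
Qed.

Lemma pull_is_fzip : is_fzip p pull_data.
Proof.
case: (fzipP M) => bc cp lf Cb Db Cs Ds [c1 Cf] [c2 Cz] [d1 Dz] [d2 Df] ph pb.
split.
- by move=> R R' phi t t' e; apply: bc.
- by move=> R R' R'' phi psi chi t t' t'' e e' e'' E v; apply: cp E v.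
- by move=> R t; apply: zariski_locally_pull (lf R (g R t)).
- by move=> i R R' phi t t' e v; apply: Cb.
- by move=> i R R' phi t t' e v; apply: Db.
- by move=> i R t; apply: zariski_locally_pull (Cs i R (g R t)).
- by move=> i R t; apply: zariski_locally_pull (Ds i R (g R t)).
- by exists c1 => i ic R t; apply: Cf.
- by exists c2 => i ic R t; apply: Cz.
- by exists d1 => i ic R t; apply: Dz.
- by exists d2 => i ic R t; apply: Df.
- by move=> i R t; apply: ph.
- by move=> R R' phi t t' e; apply: pb.
Qed.

Definition pull : fzip p T := Fzip pull_is_fzip.
End Pullback.

(* [supp] lists the support of [tau] as [i_1 < ... < i_r].  The flags below
   carry filtrations of type [tau] exactly when the bottom step of the flag of
   [C], which has rank [n_1], is the step of index [i_r]; hence [n_j] is [tau]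
   at the [j]-th element of the support counted from the top.  The indices
   [1 .. n] of the basis vectors are shifted to [0 .. n - 1]. *)
Section Standard.
Variables (tau : int -> nat) (supp : seq int).

Let r := size supp.

Definition nsz (j : nat) : nat := tau (nth 0 supp (r - j)).

Definition msz (j : nat) : nat := \sum_(1 <= k < j.+1) nsz k.

Definition dimz : nat := msz r.

(* the set ^J W, J = (n_r, ..., n_1) *)
Definition in_JW (u : 'S_dimz) : bool :=
  [forall j : 'I_r.+1, forall a : 'I_dimz, forall b : 'I_dimz,
     [&& 0 < j, dimz - msz j <= a, a < b & b < dimz - msz j.-1] ==>
     ((u^-1)%g a < (u^-1)%g b)]%N.

Definition JW : Type := {u : 'S_dimz | in_JW u}.

(* the index [j >= 1] of the block [n - m_j <= a < n - m_(j-1)] *)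
Definition blk (a : nat) : nat :=
  (find (fun j => dimz - msz j.+1 <= a)%N (iota 0 r)).+1.

Definition xnat (a : nat) : nat := (a + msz (blk a) + msz (blk a).-1 - dimz)%N.

Lemma mszS j : msz j.+1 = (msz j + nsz j.+1)%N.
Proof. by rewrite /msz big_nat_recr. Qed.

Lemma leq_msz j k : (j <= k)%N -> (msz j <= msz k)%N.
Proof.
elim: k => [|k IH]; first by case: j.
rewrite leq_eqVlt => /orP[/eqP-> //|jk].
by rewrite mszS; apply: leq_trans (IH jk) _; apply: leq_addr.
Qed.

Lemma blkP (a : 'I_dimz) : [/\ (0 < blk a <= r)%N,
  (dimz - msz (blk a) <= a)%N & (a < dimz - msz (blk a).-1)%N].
Proof.
have r0 : (0 < r)%N.
  rewrite lt0n; apply/eqP => E; case: a => a.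
  by rewrite /dimz E /msz big_geq.
have H : has (fun j => dimz - msz j.+1 <= a)%N (iota 0 r).
  apply/hasP; exists r.-1; first by rewrite mem_iota /= add0n prednK.
  by rewrite prednK // /dimz subnn.
have lt := H; rewrite has_find size_iota in lt.
split; rewrite /blk //=.
  by have := nth_find 0%N H; rewrite nth_iota.
move E : (find _ _) => [|j]; first by rewrite /msz big_geq // subn0.
have := @before_find _ 0%N (fun j => dimz - msz j.+1 <= a)%N (iota 0 r) j.
rewrite E ltnS leqnn => /(_ isT); rewrite nth_iota ?add0n; last first.
  by rewrite E in lt; apply: ltn_trans lt.
by move/negbT; rewrite -ltnNge.
Qed.

Lemma xnat_bounds (a : 'I_dimz) :
  (msz (blk a).-1 <= xnat a < msz (blk a) /\ msz (blk a) <= dimz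
   /\ xnat a + dimz = a + msz (blk a) + msz (blk a).-1)%N.
Proof.
have [/andP[b0 br] l1 l2] := blkP a.
have h1 := leq_msz br; have h2 := leq_msz (leq_pred (blk a)).
rewrite -/dimz in h1; rewrite /xnat; lia.
Qed.

Definition xfun (a : 'I_dimz) : 'I_dimz := insubd a (xnat a).

Lemma val_xfun a : val (xfun a) = xnat a.
Proof.
have [/andP[_ h1] [h2 _]] := xnat_bounds a.
by rewrite val_insubd (leq_trans h1 h2).
Qed.

Lemma xfun_inj : injective xfun.
Proof.
move=> a b /(congr1 val); rewrite !val_xfun => E.
have [/andP[a1 a2] [a3 a4]] := xnat_bounds a.
have [/andP[b1 b2] [b3 b4]] := xnat_bounds b.
have nlt (j k l : nat) : (msz j.-1 <= l < msz j -> msz k.-1 <= l < msz k ->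
    j <= k)%N.
  move=> /andP[h1 h2] /andP[h3 h4]; rewrite leqNgt; apply/negP => kj.
  have : (msz k <= msz j.-1)%N by apply: leq_msz; lia.
  lia.
have Ej : blk a = blk b.
  by apply/eqP; rewrite eqn_leq; apply/andP; split; apply: (nlt _ _ (xnat a));
    rewrite ?E ?b1 ?b2 //; rewrite -E a1 a2.
apply: val_inj => /=; rewrite Ej in a4; lia.
Qed.

Definition xperm : 'S_dimz := perm xfun_inj.

(* number of steps [i_j >= i], resp. [i_j <= i] *)
Definition nge (i : int) : nat := count (fun k => i <= k) supp.
Definition nle (i : int) : nat := count (fun k => k <= i) supp.

Variables (p : nat) (u : 'S_dimz) (R : comPzRingType).

Fact coord_smem0 (A : pred 'I_dimz) :
  forall a, ~~ A a -> (0 : 'cV[R]_dimz) a 0 = 0.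
Proof. by move=> a _; rewrite mxE. Qed.

Fact coord_smemP (A : pred 'I_dimz) (c : R) (v w : 'cV[R]_dimz) :
  (forall a, ~~ A a -> v a 0 = 0) -> (forall a, ~~ A a -> w a 0 = 0) ->
  forall a, ~~ A a -> (c *: v + w) a 0 = 0.
Proof. by move=> hv hw a Aa; rewrite !mxE hv ?hw // mulr0 addr0. Qed.

(* the span of the standard basis vectors [e_a], [a] in [A] *)
Definition coord_sub (A : pred 'I_dimz) : submod ('cV[R]_dimz) :=
  Submod (coord_smem0 (A := A)) (@coord_smemP A).

Definition stdC (i : int) : submod ('cV[R]_dimz) :=
  coord_sub (fun a => (u^-1)%g a < msz (nge i))%N.

Definition stdD (i : int) : submod ('cV[R]_dimz) :=
  coord_sub (fun a => a < dimz - msz (r - nle i))%N.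

(* [e_a |-> e_(x^-1 (u^-1 a))] for [u^-1 a] in the block of [gr^i_C], extended
   Frobenius-semilinearly and by [0] on the other basis vectors *)
Definition stdF (i : int) (v : 'cV[R]_dimz) : 'cV[R]_dimz :=
  \col_b (if (msz (nge (i + 1)) <= xperm b < msz (nge i))%N
          then v (u (xperm b)) 0 ^+ p else 0).

(* the base change to [R] of the standard F-zip over the prime field *)
Definition std_zip : zip_data R :=
  @ZipData R 'cV[R]_dimz stdC stdD
    (fun i z => sqclass (stdD i) (stdD (i - 1)) (stdF i (sqval z))).
End Standard.

Definition fppf_locally_standard (p : nat) (T : scheme) (N : fzip p T)
    (tau : int -> nat) (supp : seq int) (u : 'S_(dimz tau supp)) : Prop :=
  forall (R : comPzRingType) (t : T R),
    exists (R' : comPzRingType) (phi : {rmorphism R -> R'}),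
      fppf_cover phi /\ zip_iso (N R' (act phi t)) (std_zip p u R').

(* [iota : X -> S] represents the subfunctor of [S] attached to [u] *)
Definition represents_stratum (p : nat) (S : scheme) (M : fzip p S)
    (tau : int -> nat) (supp : seq int) (u : 'S_(dimz tau supp))
    (X : scheme) (iota : zmor X S) : Prop :=
  forall (T : scheme) (g : zmor T S),
    (exists h : zmor T X, comp_eq iota h g) <->
    fppf_locally_standard (pull g M) u.

(* Main.v *)
(* A permutation [pi = x^-1 u^-1] is attached to the standard F-zip of [u].  A frame
   of an F-zip is a basis adapted to both filtrations, where [pi] says how the
   labels of the basis vectors in [C] and in [D] correspond; phi is then given by
   an invertible matrix.  Pushing [C] forward along phi refines the filtration [D]
   again and again; after finitely many steps the refinement is stable, and its
   relative position to itself determines [pi].  A point lies in the stratum of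
   [u] when it has a frame for [pi] whose matrix is triangular for the stable
   refinement.  Over a field such a frame exists for exactly one [u] (Bruhat
   decomposition at each step, uniqueness because transition matrices respect
   the refinements).  Being in a given relative position is a locally closed
   condition on pairs of flags, expressed by the vanishing of Schur complements,
   so by induction on the steps each stratum is locally closed.

   An F-zip with a triangular frame is fppf locally standard: the change of
   frame [T] solves [T^(p) = Psi T_D P] with [Psi] the inverse of the matrix of
   phi, [P] a permutation matrix, and [T_D] a block diagonal part of [T].  These
   equations define a free algebra of finite rank, in which [D = det T]
   satisfies [D^p = kappa D] with [kappa] a unit; [D^(p-1) / kappa] is a nonzero
   idempotent, and on the corresponding direct factor [T] is invertible.
   Conversely a fppf locally standard F-zip lies in its stratum: this holds at
   each point, and the local equations of the stratum vanish after a faithfully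
   flat extension, hence vanish. *)
Require Import Defs.
From HB Require Import structures.
From mathcomp Require Import all_boot all_order all_algebra all_fingroup.
From mathcomp Require Import boolp zify ring.
From mathcomp Require classical_sets.
Import Defs.
Set Implicit Arguments. Unset Strict Implicit. Unset Printing Implicit Defensive.
Import Order.TTheory GRing.Theory.
Local Open Scope ring_scope.

(** Frames exist only Zariski-locally, so conditions are tested at field-valued points and spread
    out from there: [near] and [locus] say that a condition holds, or is closed, in a neighbourhood
    of a point. A stratum asks for triangular frames near every point, which makes it a local
    condition. Spreading out a relative position requires lifting matrices from the field to the
    ring up to denominators; this works for the residue field of the point, not for an arbitrary
    field-valued point. Triangularity descends to the residue field because [pi] exists there and is
    unique over the extension, so no frame has to be descended. The number of refinements is n!, a
    common multiple of the orders of all permutations: after that many steps the labels along an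
    orbit repeat.

    Base change is known only through its universal property. Flatness therefore comes from
    coordinates with values in sequences up to eventual equality, a form that covers localizations
    and finite algebras alike. The disjoint union of the strata is realized inside [S] by the points
    that lie locally in one stratum; two different strata meet only over the zero ring. *)

Section MkRmorph.
Variables (R S : pzRingType) (f : R -> S).
Hypotheses (fD : forall x y, f (x + y) = f x + f y)
  (f1 : f 1 = 1) (fM : forall x y, f (x * y) = f x * f y).

Definition mkf : R -> S := f.

Fact mkf_zmod : zmod_morphism mkf.
Proof.
have f0 : f 0 = 0 by apply: (@addIr _ (f 0)); rewrite -fD !add0r.
move=> x y; rewrite /mkf fD; congr (_ + _).
by apply: (@addIr _ (f y)); rewrite -fD !addNr f0.
Qed.
HB.instance Definition _ := GRing.isZmodMorphism.Build R S mkf mkf_zmod.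
HB.instance Definition _ :=
  GRing.isMonoidMorphism.Build R S mkf (pair f1 fM : monoid_morphism mkf).

Definition mkrm : {rmorphism R -> S} := mkf.

Lemma mkrmE x : mkrm x = f x. Proof. by []. Qed.
End MkRmorph.

Definition rcomp (R S T : pzRingType) (g : {rmorphism S -> T})
  (f : {rmorphism R -> S}) : {rmorphism R -> T} := g \o f.

Definition ridm (R : pzRingType) : {rmorphism R -> R} := idfun.

(** * Rings as quotients by congruences *)

(** Operations on representatives together with a congruence. Ideal quotients, localizations and
    polynomial rings are all given in this form, so the passage to a ring is made once. *)
Record prering := PreRing {
  pr_car :> Type;
  pr_eq : pr_car -> pr_car -> Prop;
  pr_0 : pr_car; pr_1 : pr_car;
  pr_add : pr_car -> pr_car -> pr_car;
  pr_mul : pr_car -> pr_car -> pr_car;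
  pr_opp : pr_car -> pr_car;
  pr_refl : forall x, pr_eq x x;
  pr_sym : forall x y, pr_eq x y -> pr_eq y x;
  pr_trans : forall x y z, pr_eq x y -> pr_eq y z -> pr_eq x z;
  pr_addE : forall x x' y y', pr_eq x x' -> pr_eq y y' ->
    pr_eq (pr_add x y) (pr_add x' y');
  pr_mulE : forall x x' y y', pr_eq x x' -> pr_eq y y' ->
    pr_eq (pr_mul x y) (pr_mul x' y');
  pr_oppE : forall x x', pr_eq x x' -> pr_eq (pr_opp x) (pr_opp x');
  pr_addA : forall x y z, pr_eq (pr_add x (pr_add y z)) (pr_add (pr_add x y) z);
  pr_addC : forall x y, pr_eq (pr_add x y) (pr_add y x);
  pr_add0 : forall x, pr_eq (pr_add pr_0 x) x;
  pr_addN : forall x, pr_eq (pr_add (pr_opp x) x) pr_0;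
  pr_mulA : forall x y z, pr_eq (pr_mul x (pr_mul y z)) (pr_mul (pr_mul x y) z);
  pr_mulC : forall x y, pr_eq (pr_mul x y) (pr_mul y x);
  pr_mul1 : forall x, pr_eq (pr_mul pr_1 x) x;
  pr_mulD : forall x y z,
    pr_eq (pr_mul (pr_add x y) z) (pr_add (pr_mul x z) (pr_mul y z)) }.

Section QuotientRing.
Variable P : prering.
Implicit Types (x y : P).

Let eqb (x : P) (y : {classic P}) : bool := `[< pr_eq x y >].

Fact prep_ex x : exists y : {classic P}, eqb x y.
Proof. by exists x; apply/asboolP/pr_refl. Qed.

(** The choice is made from the class as a set, hence it is the same for congruent elements, and
    equality of classes becomes equality of representatives. *)
Definition prep x : {classic P} := xchoose (prep_ex x).

Fact prepP x : pr_eq x (prep x).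
Proof. exact/asboolP/(xchooseP (prep_ex x)). Qed.

Fact prep_eq x y : pr_eq x y -> prep x = prep y.
Proof.
move=> xy; apply: eq_xchoose => z; apply/asboolP/asboolP.
  exact/pr_trans/pr_sym.
exact/pr_trans.
Qed.

Record qring := QRing { qval : {classic P}; _ : prep qval == qval }.
HB.instance Definition _ := [isSub for qval].
HB.instance Definition _ := [Choice of qring by <:].

Fact qcl_proof x : prep (prep x) == prep x.
Proof. by apply/eqP/prep_eq/pr_sym/prepP. Qed.

Definition qcl x : qring := QRing (qcl_proof x).

Lemma qclP x y : qcl x = qcl y <-> pr_eq x y.
Proof.
split=> [/(congr1 qval) /= e|/prep_eq e]; last exact/val_inj.
by apply: pr_trans (prepP x) _; rewrite e; apply/pr_sym/prepP.
Qed.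

Lemma qvalK (q : qring) : qcl (qval q) = q.
Proof. by apply: val_inj => /=; case: q => q /= /eqP. Qed.

Let c x x' : pr_eq x x' -> qcl x = qcl x'. Proof. by move/qclP. Qed.
Let vc x : pr_eq (qval (qcl x)) x. Proof. exact/pr_sym/prepP. Qed.

Definition q_add a b := qcl (pr_add (qval a) (qval b)).
Definition q_mul a b := qcl (pr_mul (qval a) (qval b)).
Definition q_opp a := qcl (pr_opp (qval a)).

Let addE x y : q_add (qcl x) (qcl y) = qcl (pr_add x y).
Proof. exact/c/pr_addE. Qed.
Let mulE x y : q_mul (qcl x) (qcl y) = qcl (pr_mul x y).
Proof. exact/c/pr_mulE. Qed.
Let oppE x : q_opp (qcl x) = qcl (pr_opp x).
Proof. exact/c/pr_oppE. Qed.

Lemma qringW (Q : qring -> Prop) : (forall x, Q (qcl x)) -> forall q, Q q.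
Proof. by move=> h q; rewrite -(qvalK q). Qed.

Fact q_addA : associative q_add.
Proof. by elim/qringW=> x; elim/qringW=> y; elim/qringW=> z; rewrite !addE; apply/c/pr_addA. Qed.
Fact q_addC : commutative q_add.
Proof. by elim/qringW=> x; elim/qringW=> y; rewrite !addE; apply/c/pr_addC. Qed.
Fact q_add0 : left_id (qcl (pr_0 P)) q_add.
Proof. by elim/qringW=> x; rewrite !addE; apply/c/pr_add0. Qed.
Fact q_addN : left_inverse (qcl (pr_0 P)) q_opp q_add.
Proof. by elim/qringW=> x; rewrite oppE addE; apply/c/pr_addN. Qed.
Fact q_mulA : associative q_mul.
Proof. by elim/qringW=> x; elim/qringW=> y; elim/qringW=> z; rewrite !mulE; apply/c/pr_mulA. Qed.
Fact q_mulC : commutative q_mul.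
Proof. by elim/qringW=> x; elim/qringW=> y; rewrite !mulE; apply/c/pr_mulC. Qed.
Fact q_mul1 : left_id (qcl (pr_1 P)) q_mul.
Proof. by elim/qringW=> x; rewrite !mulE; apply/c/pr_mul1. Qed.

HB.instance Definition _ := GRing.isZmodule.Build qring q_addA q_addC q_add0 q_addN.

Fact q_mulD : left_distributive q_mul +%R.
Proof.
elim/qringW=> x; elim/qringW=> y; elim/qringW=> z.
by rewrite -[LHS]/(q_mul (q_add _ _) _) -[RHS]/(q_add _ _) !(addE, mulE); apply/c/pr_mulD.
Qed.

HB.instance Definition _ := GRing.Zmodule_isComPzRing.Build qring
  q_mulA q_mulC q_mul1 q_mulD.

Lemma qclD x y : qcl (pr_add x y) = qcl x + qcl y.
Proof. by rewrite -addE. Qed.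
Lemma qclM x y : qcl (pr_mul x y) = qcl x * qcl y.
Proof. by rewrite -mulE. Qed.
Lemma qcl0 : qcl (pr_0 P) = 0. Proof. by []. Qed.
Lemma qcl1 : qcl (pr_1 P) = 1. Proof. by []. Qed.
Lemma qclN x : qcl (pr_opp x) = - qcl x.
Proof. by rewrite -oppE. Qed.

Section Lift.
Variables (S : pzRingType) (f : P -> S).
Hypotheses (fE : forall x y, pr_eq x y -> f x = f y)
  (fD : forall x y, f (pr_add x y) = f x + f y)
  (f1 : f (pr_1 P) = 1) (fM : forall x y, f (pr_mul x y) = f x * f y).

Let g (q : qring) : S := f (qval q).
Let gE x : g (qcl x) = f x. Proof. exact/fE/vc. Qed.
Let gD a b : g (a + b) = g a + g b.
Proof. by move: a b; elim/qringW=> x; elim/qringW=> y; rewrite -qclD !gE fD. Qed.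
Let gM a b : g (a * b) = g a * g b.
Proof. by move: a b; elim/qringW=> x; elim/qringW=> y; rewrite -qclM !gE fM. Qed.
Let g1 : g 1 = 1. Proof. by rewrite -qcl1 gE. Qed.

Definition qlift : {rmorphism qring -> S} := mkrm gD g1 gM.
Lemma qliftE x : qlift (qcl x) = f x. Proof. exact: gE. Qed.
End Lift.
End QuotientRing.

(** * Quotients by ideals, localizations, polynomial rings *)

Definition ideal (R : comPzRingType) (I : R -> Prop) : Prop :=
  [/\ I 0, forall x y, I x -> I y -> I (x + y) & forall a x, I x -> I (a * x)].

Definition span (R : comPzRingType) (E : R -> Prop) (x : R) : Prop :=
  exists k (c e : 'I_k -> R), (forall a, E (e a)) /\ x = \sum_a c a * e a.

Lemma sum_split_ord (V : nmodType) k l (F : 'I_k -> V) (G : 'I_l -> V) :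
  \sum_(a < k + l) (match split a with inl b => F b | inr c => G c end)
  = \sum_a F a + \sum_a G a.
Proof.
rewrite big_split_ord /=; congr (_ + _); apply: eq_bigr => a _.
  case: (splitP (lshift l a)) => [b /= e|b /= e]; first by congr F; apply: val_inj.
  by have := ltn_ord a; rewrite e; lia.
case: (splitP (rshift k a)) => [b /= e|b /= e]; last by congr G; apply: val_inj => /=; lia.
by have := ltn_ord b; rewrite -e; lia.
Qed.

Lemma span_ideal (R : comPzRingType) (E : R -> Prop) : ideal (span E).
Proof.
split.
- by exists 0, (fun=> 0), (fun=> 0); split; [case|rewrite big_ord0].
- move=> x y [k [c [e [h ->]]]] [l [d [f [h' ->]]]].
  exists (k + l)%N, (fun a => match split a with inl b => c b | inr b => d b end),
    (fun a => match split a with inl b => e b | inr b => f b end); split.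
    by move=> a; case: (split a).
  by rewrite -sum_split_ord; apply: eq_bigr => a _; case: (split a).
- move=> a x [k [c [e [h ->]]]]; exists k, (fun b => a * c b), e; split=> //.
  by rewrite mulr_sumr; apply: eq_bigr => b _; rewrite mulrA.
Qed.

Lemma span_sub (R : comPzRingType) (E : R -> Prop) x : E x -> span E x.
Proof. by move=> Ex; exists 1, (fun=> 1), (fun=> x); rewrite big_ord1 mul1r. Qed.

Lemma ideal_sum (R : comPzRingType) (I : R -> Prop) k (F : 'I_k -> R) :
  ideal I -> (forall a, I (F a)) -> I (\sum_a F a).
Proof.
by case=> I0 ID _ h; elim/big_ind: _ => // a _; apply: h.
Qed.

Lemma span_min (R : comPzRingType) (E I : R -> Prop) x :
  ideal I -> (forall y, E y -> I y) -> span E x -> I x.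
Proof.
move=> iI h [k [c [e [he ->]]]]; apply: ideal_sum => // a.
by case: iI => _ _; apply; apply/h.
Qed.

Lemma ideal_ker (R S : comPzRingType) (f : {rmorphism R -> S}) :
  ideal (fun x => f x = 0).
Proof.
by split=> [|x y fx fy|a x fx]; rewrite ?rmorph0 ?rmorphD ?rmorphM ?fx ?fy ?addr0 ?mulr0.
Qed.

Section IdealQuotient.
Variables (R : comPzRingType) (E : R -> Prop).
Let I := span E.

Let I0 : I 0. Proof. by case: (span_ideal E). Qed.
Let ID x y : I x -> I y -> I (x + y).
Proof. by case: (span_ideal E) => _ h _; apply: h. Qed.
Let IM a x : I x -> I (a * x).
Proof. by case: (span_ideal E) => _ _; apply. Qed.
Let IN x : I x -> I (- x).
Proof. by rewrite -mulN1r; apply: IM. Qed.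

Definition idq_pre : prering.
Proof.
refine (@PreRing R (fun x y => I (x - y)) 0 1 +%R *%R -%R
  _ _ _ _ _ _ _ _ _ _ _ _ _ _).
- move=> x /=; by rewrite subrr; exact: I0.
- by move=> x y /IN /=; rewrite opprB.
- by move=> x y z /= h1 h2; have := ID h1 h2; rewrite addrA subrK.
- move=> x x' y y' /= h1 h2; have := ID h1 h2.
  by rewrite /=; congr I; ring.
- move=> x x' y y' /= h1 h2; have := ID (IM y h1) (IM x' h2).
  by rewrite /=; congr I; ring.
- by move=> x x' /IN /=; congr I; ring.
- move=> x y z /=; by rewrite addrA subrr; exact: I0.
- move=> x y /=; by rewrite [x + y]addrC subrr; exact: I0.
- move=> x /=; by rewrite add0r subrr; exact: I0.
- move=> x /=; by rewrite addNr subrr; exact: I0.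
- move=> x y z /=; by rewrite mulrA subrr; exact: I0.
- move=> x y /=; by rewrite [x * y]mulrC subrr; exact: I0.
- move=> x /=; by rewrite mul1r subrr; exact: I0.
- move=> x y z /=; by rewrite mulrDl subrr; exact: I0.
Defined.

Definition idq : comPzRingType := qring idq_pre.

Let emb (x : R) : idq := qcl (P := idq_pre) x.
Let embD x y : emb (x + y) = emb x + emb y. Proof. exact: (qclD (P := idq_pre)). Qed.
Let embM x y : emb (x * y) = emb x * emb y. Proof. exact: (qclM (P := idq_pre)). Qed.
Let emb1 : emb 1 = 1. Proof. by []. Qed.

Definition idq_pi : {rmorphism R -> idq} := mkrm embD emb1 embM.

Lemma idq_pi_surj (y : idq) : exists x, idq_pi x = y.
Proof. by exists (qval y); rewrite mkrmE; apply: qvalK. Qed.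

Lemma idq_pi0 x : idq_pi x = 0 <-> span E x.
Proof.
rewrite mkrmE -[0 in X in X <-> _](qcl0 idq_pre); split.
  by move/qclP => /=; rewrite subr0.
by move=> h; apply/qclP => /=; rewrite subr0.
Qed.

Lemma idq_pi_gen x : E x -> idq_pi x = 0.
Proof. by move=> Ex; apply/idq_pi0/span_sub. Qed.

Lemma idq_lift (S : comPzRingType) (f : {rmorphism R -> S}) :
  (forall x, E x -> f x = 0) ->
  exists g : {rmorphism idq -> S}, forall x, g (idq_pi x) = f x.
Proof.
move=> fE.
have h (x y : idq_pre) : pr_eq x y -> f x = f y.
  move=> h; apply/eqP; rewrite -subr_eq0 -rmorphB; apply/eqP.
  exact: (span_min (ideal_ker f)) h.
exists (qlift (P := idq_pre) (f := f) h (rmorphD f) (rmorph1 f) (rmorphM f)) => x.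
exact: (qliftE (P := idq_pre) h (rmorphD f) (rmorph1 f) (rmorphM f)) x.
Qed.
End IdealQuotient.

Section Localization.
Variables (R : comPzRingType) (f : R).

(** The pair [(x, i)] stands for the fraction x / f^i. The factor [f ^+ m] in the relation accounts
    for zero divisors. *)
Definition loc_pre : prering.
Proof.
refine (@PreRing (R * nat)
  (fun x y => exists m, f ^+ m * (f ^+ y.2 * x.1 - f ^+ x.2 * y.1) = 0) (0, 0%N) (1, 0%N)
  (fun x y => (f ^+ y.2 * x.1 + f ^+ x.2 * y.1, (x.2 + y.2)%N))
  (fun x y => (x.1 * y.1, (x.2 + y.2)%N))
  (fun x => (- x.1, x.2)) _ _ _ _ _ _ _ _ _ _ _ _ _ _).
- by move=> x; exists 0%N; rewrite subrr mulr0.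
- by move=> x y [m h]; exists m; rewrite -[LHS]opprK -mulrN opprB h oppr0.
- move=> [x i] [y j] [z k] /= [m h] [l h']; exists (m + l + j)%N.
  transitivity (f ^+ l * f ^+ k * (f ^+ m * (f ^+ j * x - f ^+ i * y))
    + f ^+ m * f ^+ i * (f ^+ l * (f ^+ k * y - f ^+ j * z))).
    by rewrite !exprD; ring.
  by rewrite h h' !mulr0 addr0.
- move=> [x i] [x' i'] [y j] [y' j'] /= [m h] [l h']; exists (m + l)%N.
  transitivity (f ^+ l * f ^+ j * f ^+ j' * (f ^+ m * (f ^+ i' * x - f ^+ i * x'))
    + f ^+ m * f ^+ i * f ^+ i' * (f ^+ l * (f ^+ j' * y - f ^+ j * y'))).
    by rewrite !exprD; ring.
  by rewrite h h' !mulr0 addr0.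
- move=> [x i] [x' i'] [y j] [y' j'] /= [m h] [l h']; exists (m + l)%N.
  transitivity (f ^+ l * f ^+ j' * y * (f ^+ m * (f ^+ i' * x - f ^+ i * x'))
    + f ^+ m * f ^+ i * x' * (f ^+ l * (f ^+ j' * y - f ^+ j * y'))).
    by rewrite !exprD; ring.
  by rewrite h h' !mulr0 addr0.
- move=> [x i] [y j] /= [m h]; exists m.
  by rewrite !mulrN -opprD mulrN h oppr0.
- by move=> [x i] [y j] [z k] /=; exists 0%N; rewrite !exprD; ring.
- by move=> [x i] [y j] /=; exists 0%N; rewrite !exprD; ring.
- by move=> [x i] /=; exists 0%N; rewrite !exprD; ring.
- by move=> [x i] /=; exists 0%N; rewrite !exprD; ring.
- by move=> [x i] [y j] [z k] /=; exists 0%N; rewrite !exprD; ring.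
- by move=> [x i] [y j] /=; exists 0%N; rewrite !exprD; ring.
- by move=> [x i] /=; exists 0%N; rewrite !exprD; ring.
- by move=> [x i] [y j] [z k] /=; exists 0%N; rewrite !exprD; ring.
Defined.

Definition locr : comPzRingType := qring loc_pre.

Let emb (x : R) : locr := qcl (P := loc_pre) (x, 0%N).
Let embD x y : emb (x + y) = emb x + emb y.
Proof. by rewrite -qclD /= !mul1r. Qed.
Let embM x y : emb (x * y) = emb x * emb y.
Proof. by rewrite -qclM. Qed.
Let emb1 : emb 1 = 1. Proof. by []. Qed.

Definition loc_in : {rmorphism R -> locr} := mkrm embD emb1 embM.

Lemma locP : is_localization f loc_in.
Proof.
split.
- exists (qcl (P := loc_pre) (1, 1%N)); rewrite mkrmE -qclM -(qcl1 loc_pre); apply/qclP.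
  by exists 0%N => /=; rewrite !mul1r; ring.
- elim/qringW=> -[x i]; exists x, i; rewrite -rmorphXn !mkrmE -qclM /=; apply/qclP.
  by exists 0%N => /=; ring.
- move=> r rE; have /qclP[m /=] : emb r = qcl (pr_0 loc_pre) by [].
  by rewrite mul1r mulr0 subr0; exists m.
Qed.
End Localization.

Lemma unit_pow (R : comPzRingType) (f b : R) k : f * b = 1 -> f ^+ k * b ^+ k = 1.
Proof. by move=> h; rewrite -exprMn h expr1n. Qed.

Section LocLift.
Variables (R L S : comPzRingType) (f : R) (l : {rmorphism R -> L}).
Hypothesis loc : is_localization f l.

Lemma loc_lift (g : {rmorphism R -> S}) : (exists b, g f * b = 1) ->
  exists h : {rmorphism L -> S}, forall r, h (l r) = g r.
Proof.
case=> b gb; case: loc => -[fi fb] fr ker.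
have ex y : exists rk : R * nat, l f ^+ rk.2 * y = l rk.1.
  by have [r [k]] := fr y; exists (r, k).
have [rk rkE] := choice ex; pose h y := b ^+ (rk y).2 * g (rk y).1.
(* The value of [h] does not depend on the fraction chosen for [y]: two such fractions agree after
   multiplication by a power of [f], which [g] makes invertible. *)
have hE y r k : l f ^+ k * y = l r -> h y = b ^+ k * g r.
  move=> yE; rewrite /h; move: (rkE y); case: (rk y) => s m /= sE.
  have : l (f ^+ m * r - f ^+ k * s) = 0.
    by rewrite rmorphB !rmorphM !rmorphXn -yE -sE; ring.
  move/ker=> [j /(congr1 g)]; rewrite rmorph0 rmorphM rmorphB !rmorphM !rmorphXn.
  move/(congr1 ( *%R (b ^+ j))); rewrite mulr0 mulrA -exprMn [b * _]mulrC gb expr1n mul1r.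
  move/eqP; rewrite subr_eq0 => /eqP/(congr1 ( *%R (b ^+ m * b ^+ k))).
  have -> : b ^+ m * b ^+ k * (g f ^+ m * g r) = (g f * b) ^+ m * (b ^+ k * g r).
    by rewrite exprMn; ring.
  have -> : b ^+ m * b ^+ k * (g f ^+ k * g s) = (g f * b) ^+ k * (b ^+ m * g s).
    by rewrite exprMn; ring.
  by rewrite gb !expr1n !mul1r.
have hD x y : h (x + y) = h x + h y.
  rewrite (hE (x + y) (f ^+ (rk y).2 * (rk x).1 + f ^+ (rk x).2 * (rk y).1) ((rk x).2 + (rk y).2)%N).
    rewrite /h rmorphD !rmorphM !rmorphXn exprD mulrDr.
    congr (_ + _).
      rewrite -[RHS]mul1r -(expr1n _ (rk y).2) -gb exprMn; ring.
    rewrite -[RHS]mul1r -(expr1n _ (rk x).2) -gb exprMn; ring.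
  by rewrite rmorphD !rmorphM !rmorphXn -!rkE exprD; ring.
have hM x y : h (x * y) = h x * h y.
  rewrite (hE (x * y) ((rk x).1 * (rk y).1) ((rk x).2 + (rk y).2)%N).
    by rewrite /h rmorphM exprD; ring.
  by rewrite rmorphM -!rkE exprD; ring.
have hl r : h (l r) = g r by rewrite (hE (l r) r 0%N) ?expr0 ?mul1r.
have h1 : h 1 = 1 by rewrite -(rmorph1 l) hl rmorph1.
by exists (mkrm hD h1 hM).
Qed.
End LocLift.

(** * Polynomial rings and finite presentations *)

Inductive term (R : Type) (V : Type) : Type :=
| TC of R | TV of V | TD of term R V & term R V | TM of term R V & term R V
| TN of term R V.
Arguments TC {R V}. Arguments TV {R V}.

Fixpoint teval (R : Type) (V : Type) (B : pzRingType) (f : R -> B) (b : V -> B)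
    (t : term R V) : B :=
  match t with
  | TC r => f r | TV v => b v
  | TD s t => teval f b s + teval f b t
  | TM s t => teval f b s * teval f b t
  | TN s => - teval f b s
  end.

Section PolynomialRing.
Variables (R : comPzRingType) (V : Type).
Notation T := (term R V).

(** Polynomials are terms modulo equality under all evaluations. This avoids normal forms, and the
    universal property holds by construction. *)
Definition teqv (s t : T) : Prop :=
  forall (B : comPzRingType) (f : {rmorphism R -> B}) (b : V -> B),
    teval f b s = teval f b t.

Definition poly_pre : prering.
Proof.
refine (@PreRing T teqv (TC 0) (TC 1) (@TD _ _) (@TM _ _) (@TN _ _)
   _ _ _ _ _ _ _ _ _ _ _ _ _ _).
- by [].
- by move=> x y h B f b; rewrite h.
- by move=> x y z h h' B f b; rewrite h h'.
- by move=> x x' y y' h h' B f b /=; rewrite h h'.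
- by move=> x x' y y' h h' B f b /=; rewrite h h'.
- by move=> x x' h B f b /=; rewrite h.
- by move=> x y z B f b /=; rewrite addrA.
- by move=> x y B f b /=; rewrite addrC.
- by move=> x B f b /=; rewrite rmorph0 add0r.
- by move=> x B f b /=; rewrite rmorph0 addNr.
- by move=> x y z B f b /=; rewrite mulrA.
- by move=> x y B f b /=; rewrite mulrC.
- by move=> x B f b /=; rewrite rmorph1 mul1r.
- by move=> x y z B f b /=; rewrite mulrDl.
Defined.
End PolynomialRing.

Section PolynomialRingTheory.
Variables (R : comPzRingType) (V : Type).

Definition polyr : comPzRingType := qring (poly_pre R V).

Let emb (x : R) : polyr := qcl (P := poly_pre R V) (TC x).
Let embD x y : emb (x + y) = emb x + emb y.
Proof. by rewrite -qclD; apply/qclP => B f b /=; rewrite rmorphD. Qed.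
Let embM x y : emb (x * y) = emb x * emb y.
Proof. by rewrite -qclM; apply/qclP => B f b /=; rewrite rmorphM. Qed.
Let emb1 : emb 1 = 1. Proof. by []. Qed.

Definition poly_in : {rmorphism R -> polyr} := mkrm embD emb1 embM.
Definition poly_X (v : V) : polyr := qcl (P := poly_pre R V) (TV v).

Lemma qcl_teval (t : term R V) :
  qcl (P := poly_pre R V) t = teval poly_in poly_X t.
Proof.
elim: t => [//|//|s hs t ht|s hs t ht|s hs] /=; rewrite -hs -?ht.
- exact: qclD.
- exact: qclM.
- exact: qclN.
Qed.

Lemma poly_ind (Q : polyr -> Prop) :
  (forall t, Q (teval poly_in poly_X t)) -> forall q, Q q.
Proof. by move=> h q; rewrite -(qvalK q) qcl_teval; apply: h. Qed.

Lemma poly_ev (B : comPzRingType) (f : {rmorphism R -> B}) (b : V -> B) :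
  exists g : {rmorphism polyr -> B},
    (forall r, g (poly_in r) = f r) /\ (forall v, g (poly_X v) = b v).
Proof.
have h (x y : poly_pre R V) : pr_eq x y -> teval f b x = teval f b y by exact.
have gE := @qliftE (poly_pre R V) B (teval f b) h (fun x y => erefl) (rmorph1 f)
  (fun x y => erefl).
exists (@qlift (poly_pre R V) B (teval f b) h (fun x y => erefl) (rmorph1 f)
  (fun x y => erefl)).
by split=> z; [exact: (gE (TC z))|exact: (gE (TV z))].
Qed.
End PolynomialRingTheory.

Lemma rmorph_teval (R : Type) (V : Type) (B C : pzRingType) (g : {rmorphism B -> C})
    (f : R -> B) (b : V -> B) t : g (teval f b t) = teval (g \o f) (g \o b) t.
Proof.
by elim: t => //= [s hs t ht|s hs t ht|s hs]; rewrite -hs -?ht (rmorphD, rmorphM, rmorphN).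
Qed.

Lemma eq_teval (R V : Type) (B : pzRingType) (f f' : R -> B) (b b' : V -> B) t :
  f =1 f' -> b =1 b' -> teval f b t = teval f' b' t.
Proof. by move=> ef eb; elim: t => //= [s -> t ->|s -> t ->|s ->]. Qed.

(** Finite presentation by generators, relations and their universal property. In this form it
    composes easily and is checked without computing a kernel. *)
Definition presented (R R' : comPzRingType) (phi : {rmorphism R -> R'}) : Prop :=
  exists (V : finType) (y : V -> R') (I : finType) (h : I -> term R V),
    [/\ forall i, teval phi y (h i) = 0, forall z, exists t, teval phi y t = z
      & forall (B : comPzRingType) (f : {rmorphism R -> B}) (b : V -> B),
         (forall i, teval f b (h i) = 0) ->
         exists g : {rmorphism R' -> B},
           (forall r, g (phi r) = f r) /\ forall v, g (y v) = b v].

Lemma span_fin (R : comPzRingType) k (h : 'I_k -> R) x :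
  span (fun y => exists a, y = h a) x <-> exists c : 'I_k -> R, x = \sum_a c a * h a.
Proof.
split=> [|[c ->]]; last first.
  by apply: ideal_sum (span_ideal _) _ => a; case: (span_ideal (fun y => exists a, y = h a))
    => _ _; apply; apply: span_sub; exists a.
apply: (span_min (I := fun x => exists c : 'I_k -> R, x = \sum_a c a * h a)) => [|y [a ->]].
  split; first by exists (fun=> 0); rewrite big1 // => a _; rewrite mul0r.
    move=> y z [c ->] [d ->]; exists (fun a => c a + d a).
    by rewrite -big_split; apply: eq_bigr => a _; rewrite mulrDl.
  move=> b y [c ->]; exists (fun a => b * c a); rewrite mulr_sumr.
  by apply: eq_bigr => a _; rewrite mulrA.
exists (fun b => (b == a)%:R); rewrite (bigD1 a) //= eqxx mul1r big1 ?addr0 // => b ba.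
by rewrite (negbTE ba) mul0r.
Qed.

Lemma presented_fp (R R' : comPzRingType) (phi : {rmorphism R -> R'}) :
  presented phi -> finitely_presented phi.
Proof.
case=> V [y [I [h [hy gen univ]]]].
pose P := polyr R V; pose X (a : 'I_#|V|) : P := poly_X R (enum_val a).
pose h' (a : 'I_#|I|) : P := teval (poly_in R V) (poly_X R (V := V)) (h (enum_val a)).
have [pi [pi1 pi2]] := poly_ev phi y.
have piE t : pi (teval (poly_in R V) (poly_X R (V := V)) t) = teval phi y t.
  by rewrite rmorph_teval; apply: eq_teval.
exists #|V|, P, (poly_in R V), X, pi, #|I|, h'; split=> //.
- move=> B f b; have [g [g1 g2]] := poly_ev f (b \o enum_rank).
  exists g; split=> // [a|g' g'1 g'2]; first by rewrite g2 /= enum_valK.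
  elim/poly_ind => t; rewrite !rmorph_teval; apply: eq_teval => r /=.
    by rewrite g1 g'1.
  by rewrite g2 -{1}[r]enum_rankK g'2.
- by move=> z; have [t <-] := gen z; exists (teval (poly_in R V) (poly_X R (V := V)) t).
- move=> q; rewrite -span_fin; split; last first.
    apply: (span_min (I := fun q => pi q = 0)); first exact: ideal_ker.
    by move=> _ [a ->]; rewrite piE hy.
  set E := fun _ => _.
  (* The quotient of [P] by the relations satisfies them, so it receives a map [g] from [R'] whose
     composite with [pi] is the projection. The kernel of [pi] thus lies in the span of the
     relations. *)
  have [|g [g1 g2]] := univ (idq E) (rcomp (idq_pi E) (poly_in R V)) (idq_pi E \o poly_X R (V := V)).
    move=> i; rewrite -rmorph_teval; apply: idq_pi_gen; exists (enum_rank i).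
    by rewrite /h' enum_rankK.
  move: q; elim/poly_ind => t; rewrite piE => /(congr1 g); rewrite rmorph0 => e.
  apply/idq_pi0; rewrite rmorph_teval -[RHS]e rmorph_teval.
  by apply: eq_teval => r /=; rewrite ?g1 ?g2.
Qed.

(** Each coefficient in [R1] is replaced by a term over [R] that represents it, in the variables of
    [V1]. *)
Fixpoint tlift (R R1 V1 V2 : Type) (c : R1 -> term R V1) (t : term R1 V2) :
    term R (V1 + V2) :=
  match t with
  | TC r => (fix tmap s := match s with
      | TC r => TC r | TV v => TV (inl v)
      | TD s t => TD (tmap s) (tmap t) | TM s t => TM (tmap s) (tmap t)
      | TN s => TN (tmap s) end) (c r)
  | TV v => TV (inr v)
  | TD s t => TD (tlift c s) (tlift c t)
  | TM s t => TM (tlift c s) (tlift c t)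
  | TN s => TN (tlift c s)
  end.

Lemma teval_tlift (R R1 V1 V2 : Type) (c : R1 -> term R V1) (t : term R1 V2)
    (B : pzRingType) (f : R -> B) (b : V1 + V2 -> B) :
  teval f b (tlift c t) =
  teval (fun r => teval f (b \o inl) (c r)) (b \o inr) t.
Proof.
elim: t => //= [r|s -> t ->|s -> t ->|s ->] //.
by elim: (c r) => //= [s -> t ->|s -> t ->|s ->].
Qed.

Lemma presented_comp (R R1 R2 : comPzRingType) (phi : {rmorphism R -> R1})
    (psi : {rmorphism R1 -> R2}) :
  presented phi -> presented psi -> presented (rcomp psi phi).
Proof.
case=> V1 [y1 [I1 [h1 [hy1 gen1 univ1]]]] [V2 [y2 [I2 [h2 [hy2 gen2 univ2]]]]].
have [c cE] := choice gen1.
pose y (v : V1 + V2) := match v with inl v => psi (y1 v) | inr v => y2 v end.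
have yE t : teval (rcomp psi phi) y (tlift c t) = teval psi y2 t.
  rewrite teval_tlift; apply: eq_teval => // r.
  by rewrite -{2}[r]cE rmorph_teval; apply: eq_teval.
(* Lifting the term [TC tt] along a constant function merely renames the variables of [h1 i] into
   the left summand. *)
pose h (i : I1 + I2) := match i with
  | inl i => tlift (fun _ : unit => h1 i) (TC tt : term unit V2)
  | inr i => tlift c (h2 i) end.
exists (V1 + V2)%type, y, (I1 + I2)%type, h; split.
- case=> i; rewrite ?yE ?hy2 // teval_tlift /=.
  by rewrite -(rmorph0 psi) -(hy1 i) rmorph_teval; apply: eq_teval.
- by move=> z; have [t <-] := gen2 z; exists (tlift c t).
- move=> B f b hb.
  have [|g1 [g1E g1y]] := univ1 B f (b \o inl).
    by move=> i; have := hb (inl i); rewrite teval_tlift.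
  have [|g2 [g2E g2y]] := univ2 B g1 (b \o inr).
    move=> i; have := hb (inr i); rewrite teval_tlift => <-.
    apply: eq_teval => // r; rewrite -{1}[r]cE rmorph_teval.
    by apply: eq_teval => z /=.
  exists g2; split=> [r|[v|v]] /=; first by rewrite g2E g1E.
    by rewrite g2E g1y.
  by rewrite g2y.
Qed.

(** * Residue fields *)

Definition has_inv (R : comPzRingType) : Prop :=
  forall x : R, x != 0 -> exists y, y * x = 1.

(* the hypotheses are phantom arguments, so that the field structure below is
   inferred from the type *)
Definition fieldof (R : comPzRingType) (_ : 1 != 0 :> R) (_ : has_inv R) : Type := R.

Section FieldOf.
Variables (R : comPzRingType) (nz : 1 != 0 :> R) (inv : has_inv R).
Notation F := (fieldof nz inv).
HB.instance Definition _ := GRing.ComPzRing.copy F R.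
HB.instance Definition _ := GRing.PzSemiRing_isNonZero.Build F nz.

Fact fieldof_inv_ex (x : R) : exists y : R, if x == 0 then y == 0 else y * x == 1.
Proof.
by case: eqP => [_|/eqP /inv[y yx]]; [exists 0|exists y; rewrite yx].
Qed.

Let vinv (x : F) : F := xchoose (fieldof_inv_ex x).

Fact fieldof_mulVf (x : F) : x != 0 -> vinv x * x = 1.
Proof.
move=> x0.
have : if (x : R) == 0 then vinv x == 0 :> R else (vinv x : R) * x == 1 :=
  xchooseP (fieldof_inv_ex x).
by rewrite (negbTE (x0 : (x : R) != 0)) => /eqP.
Qed.

Fact fieldof_inv0 : vinv 0 = 0.
Proof.
have : if (0 : R) == 0 then vinv 0 == 0 :> R else (vinv 0 : R) * 0 == 1 :=
  xchooseP (fieldof_inv_ex 0).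
by rewrite eqxx => /eqP.
Qed.

HB.instance Definition _ := GRing.ComNzRing_isField.Build F fieldof_mulVf fieldof_inv0.

Definition to_field : {rmorphism R -> (F : fieldType)} :=
  mkrm (R := R) (S := F) (f := id) (fun x y => erefl) erefl (fun x y => erefl).
End FieldOf.

(** Zorn's lemma is applied to the sets whose union with [I] is a proper ideal, so that the empty
    chain needs no separate treatment. *)
Lemma ex_maximal_ideal (R : comPzRingType) (I : R -> Prop) : ideal I -> ~ I 1 ->
  exists J : R -> Prop, [/\ ideal J, forall x, I x -> J x, ~ J 1
    & forall J', ideal J' -> (forall x, J x -> J' x) -> ~ J' 1 ->
        forall x, J' x -> J x].
Proof.
move=> [I0 ID IM] I1.
pose U (X : R -> Prop) x := X x \/ I x.
pose P (X : R -> Prop) := ideal (U X) /\ ~ U X 1.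
have [|A [[AI A1] Amax]] := @classical_sets.Zorn_bigcup R P.
  move=> F FP tot; split; last first.
    case=> [[X FX X1]|//]; have [_] := FP X FX; apply; by left.
  split; first by right.
    move=> x y [[X FX Xx]|Ix] [[Y FY Yy]|Iy].
    - have [le|le] := tot X Y FX FY.
        have [[_ D _] _] := FP Y FY; have [h|h] := D x y (or_introl (le _ Xx)) (or_introl Yy).
          by left; exists Y.
        by right.
      have [[_ D _] _] := FP X FX; have [h|h] := D x y (or_introl Xx) (or_introl (le _ Yy)).
        by left; exists X.
      by right.
    - have [[_ D _] _] := FP X FX; have [h|h] := D x y (or_introl Xx) (or_intror Iy).
        by left; exists X.
      by right.
    - have [[_ D _] _] := FP Y FY; have [h|h] := D x y (or_intror Ix) (or_introl Yy).
        by left; exists Y.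
      by right.
    - by right; apply: ID.
  move=> a x [[X FX Xx]|Ix]; last by right; apply: IM.
  have [[_ _ M] _] := FP X FX; have [h|h] := M a x (or_introl Xx).
    by left; exists X.
  by right.
exists (U A); split=> //; first by right.
move=> J' J'I sub J'1 x J'x; apply: contrapT => nU.
have UJ' y : U J' y <-> J' y by split; [case=> // Iy; apply: sub; right|left].
case: (Amax J').
  by split=> [y Ay|sb]; [apply: sub; left|apply: nU; left; apply: sb].
split; last by rewrite UJ'.
case: J'I => a b c; split; first by rewrite UJ'.
  by move=> y z; rewrite !UJ'; apply: b.
by move=> y z; rewrite !UJ'; apply: c.
Qed.

(** The field is the quotient by a maximal ideal containing [I]. *)
Lemma residue_field (R : comPzRingType) (I : R -> Prop) : ideal I -> ~ I 1 ->
  exists (K : fieldType) (x : {rmorphism R -> K}), forall r, I r -> x r = 0.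
Proof.
move=> iI I1; have [J [iJ IJ J1 Jmax]] := ex_maximal_ideal iI I1.
have sJ x : span J x -> J x by apply: span_min.
have nz : 1 != 0 :> idq J.
  by apply/eqP; rewrite -(rmorph1 (idq_pi J)) => /idq_pi0/sJ.
have inv : has_inv (idq J).
  move=> x; have [r <-] := idq_pi_surj x => /eqP r0.
  pose J' y := exists a j, J j /\ y = a * r + j.
  have iJ' : ideal J'.
    case: iJ => J0 JD JM; split.
    - by exists 0, 0; rewrite mul0r addr0.
    - move=> _ _ [a [j [Jj ->]]] [b [i [Ji ->]]]; exists (a + b), (j + i).
      by split; [apply: JD|ring].
    - move=> c _ [a [j [Jj ->]]]; exists (c * a), (c * j).
      by split; [apply: JM|ring].
  have [[a [j [Jj e]]]|n1] := pselect (J' 1).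
    exists (idq_pi J a); rewrite -rmorphM -(rmorph1 (idq_pi J)) e rmorphD.
    by rewrite [X in _ = _ + X](_ : _ = 0) ?addr0 //; apply/idq_pi0/span_sub.
  have J0 : J 0 by case: iJ.
  case: r0; apply/idq_pi0/span_sub; apply: (Jmax _ iJ' _ n1).
    by move=> y Jy; exists 0, y; rewrite mul0r add0r.
  by exists 1, 0; rewrite mul1r addr0.
exists (fieldof nz inv), (rcomp (to_field nz inv) (idq_pi J)) => r Ir.
by have e : idq_pi J r = 0 by apply/idq_pi0/span_sub/IJ.
Qed.

(** Otherwise a residue field of the proper ideal generated by [E] is a point where all of [E]
    vanishes. This quasi-compactness turns pointwise data into finite Zariski covers. *)
Lemma span_unit (R : comPzRingType) (E : R -> Prop) :
  (forall (K : fieldType) (x : {rmorphism R -> K}), exists2 e, E e & x e != 0) ->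
  span E 1.
Proof.
move=> h; apply: contrapT => n1.
have [K [x xE]] := residue_field (span_ideal E) n1.
have [e Ee] := h K x; by rewrite xE ?eqxx //; apply: span_sub.
Qed.

(** The annihilator of [e] is not contained in the kernel of any point, so it contains 1. *)
Lemma local_zero (R : comPzRingType) (e : R) :
  (forall (K : fieldType) (x : {rmorphism R -> K}), exists2 r, x r != 0 & r * e = 0) ->
  e = 0.
Proof.
move=> h; have iI : ideal (fun r => r * e = 0).
  split=> [|x y hx hy|a x hx]; first by rewrite mul0r.
    by rewrite mulrDl hx hy addr0.
  by rewrite -mulrA hx mulr0.
rewrite -[LHS]mul1r; apply: (span_min (E := fun r => r * e = 0) iI) => //.
by apply: span_unit => K x; have [r] := h K x; exists r.
Qed.

Lemma no_points (R : comPzRingType) :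
  (forall (K : fieldType), {rmorphism R -> K} -> False) -> 1 = 0 :> R.
Proof. by move=> h; apply: local_zero => K x; case: (h K x). Qed.

Lemma span_unit_family (R : comPzRingType) (E : R -> Prop) : span E 1 ->
  exists k (e : 'I_k -> R), (forall a, E (e a)) /\ unit_family e.
Proof. by case=> k [c [e [h e1]]]; exists k, e; split=> //; exists c. Qed.

Lemma unit_family_point (R : comPzRingType) k (f : 'I_k -> R) (K : fieldType)
    (x : {rmorphism R -> K}) : unit_family f -> exists a, x (f a) != 0.
Proof.
case=> c e; apply: contrapT => h.
have : x 1 = 0.
  rewrite -e rmorph_sum big1 // => a _; rewrite rmorphM.
  have [->|fa] := eqVneq (x (f a)) 0; first by rewrite mulr0.
  by case: h; exists a.
by move/eqP; rewrite rmorph1 oner_eq0.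
Qed.

Lemma loc_point (R L : comPzRingType) (f : R) (l : {rmorphism R -> L}) (K : fieldType)
    (x : {rmorphism R -> K}) : is_localization f l -> x f != 0 ->
  exists y : {rmorphism L -> K}, forall r, y (l r) = x r.
Proof. by move=> loc xf; apply: (loc_lift loc); exists (x f)^-1; rewrite divff. Qed.

Lemma unit_not0 (R : comPzRingType) (K : fieldType) (x : {rmorphism R -> K}) r b :
  r * b = 1 -> x r != 0.
Proof.
move/(congr1 x); rewrite rmorphM rmorph1 => h; apply/eqP => e.
by move/eqP: h; rewrite e mul0r eq_sym oner_eq0.
Qed.

(** * Finite products of rings *)

Section ProductRing.
Variables (k : nat) (L : 'I_k -> comPzRingType).

(** With [L] a family of localizations, a finite Zariski cover becomes a single ring map into this
    product. *)
Definition prodr : Type := forall a, L a.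
HB.instance Definition _ := gen_eqMixin prodr.
HB.instance Definition _ := gen_choiceMixin prodr.
Implicit Types u v w : prodr.

Let ext u v : (forall a, u a = v a) -> u = v.
Proof. exact: functional_extensionality_dep. Qed.

Let padd u v : prodr := fun a => u a + v a.
Let popp u : prodr := fun a => - u a.
Let pmul u v : prodr := fun a => u a * v a.
Fact padA : associative padd. Proof. by move=> u v w; apply: ext => a; apply: addrA. Qed.
Fact padC : commutative padd. Proof. by move=> u v; apply: ext => a; apply: addrC. Qed.
Fact pad0 : left_id (fun=> 0 : _) padd. Proof. by move=> u; apply: ext => a; apply: add0r. Qed.
Fact padN : left_inverse (fun=> 0 : _) popp padd. Proof. by move=> u; apply: ext => a; apply: addNr. Qed.
HB.instance Definition _ := GRing.isZmodule.Build prodr padA padC pad0 padN.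
Fact pmuA : associative pmul. Proof. by move=> u v w; apply: ext => a; apply: mulrA. Qed.
Fact pmuC : commutative pmul. Proof. by move=> u v; apply: ext => a; apply: mulrC. Qed.
Fact pmu1 : left_id (fun=> 1 : _) pmul. Proof. by move=> u; apply: ext => a; apply: mul1r. Qed.
Fact pmuD : left_distributive pmul +%R. Proof. by move=> u v w; apply: ext => a; apply: mulrDl. Qed.
HB.instance Definition _ := GRing.Zmodule_isComPzRing.Build prodr pmuA pmuC pmu1 pmuD.

Definition prod_pi a : {rmorphism prodr -> L a} :=
  mkrm (R := prodr) (f := fun u : prodr => u a) (fun u v => erefl) erefl (fun u v => erefl).

Definition prod_in a (x : L a) : prodr := dfwith (fun b => 0 : L b) x.

Lemma prod_in_id a x : prod_in x a = x.
Proof. by rewrite /prod_in dfwith_in. Qed.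

Lemma prod_in_neq a b x : a != b -> prod_in (a := a) x b = 0.
Proof. by move=> ab; rewrite /prod_in dfwith_out. Qed.

Lemma prod_inD a (x y : L a) : prod_in (x + y) = prod_in x + prod_in y.
Proof.
apply: ext => b; rewrite -[RHS]/(prod_in x b + prod_in y b).
have [<-|ab] := eqVneq a b; first by rewrite !prod_in_id.
by rewrite !prod_in_neq // addr0.
Qed.

Lemma prod_in0 a : prod_in (0 : L a) = 0.
Proof. by apply: (@addIr _ (prod_in (0 : L a))); rewrite -prod_inD !add0r. Qed.

Lemma prod_inM a (x : L a) u : u * prod_in x = prod_in (u a * x).
Proof.
apply: ext => b; rewrite -[LHS]/(u b * prod_in x b).
have [<-|ab] := eqVneq a b; first by rewrite !prod_in_id.
by rewrite !prod_in_neq // mulr0.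
Qed.

Lemma prod_sumE (I : finType) (F : I -> prodr) a : (\sum_i F i) a = \sum_i F i a.
Proof. exact: (rmorph_sum (prod_pi a)). Qed.

Lemma prod_in_sum u : \sum_a prod_in (u a) = u.
Proof.
apply: ext => b; rewrite prod_sumE (bigD1 b) //= prod_in_id big1 ?addr0 // => a ab.
exact: prod_in_neq.
Qed.

Lemma prod_lift (R : comPzRingType) (l : forall a, {rmorphism R -> L a}) :
  exists g : {rmorphism R -> prodr}, forall r a, g r a = l a r.
Proof.
pose g r : prodr := fun a => l a r.
have h1 : g 1 = 1 by apply: ext => a; apply: rmorph1.
have hD r s : g (r + s) = g r + g s by apply: ext => a; apply: rmorphD.
have hM r s : g (r * s) = g r * g s by apply: ext => a; apply: rmorphM.
by exists (mkrm hD h1 hM).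
Qed.
End ProductRing.

(** * The Frobenius endomorphism *)

Section Frobenius.
Variables (p : nat) (R : comPzRingType).
Hypotheses (p_prime : prime p) (char_p : p%:R = 0 :> R).

Lemma frobD (x y : R) : (x + y) ^+ p = x ^+ p + y ^+ p.
Proof.
case: p p_prime char_p => [//|q] q_prime char_q.
rewrite exprDn big_ord_recl big_ord_recr /= bin0 subn0 expr0 mulr1 mulr1n.
rewrite /bump /= add1n binn subnn expr0 mul1r mulr1n.
rewrite big1 ?add0r // => i _.
have /dvdnP[k ->] : (q.+1 %| 'C(q.+1, 1 + i))%N.
  by apply: prime_dvd_bin => //; have := ltn_ord i; lia.
by rewrite mulrnA -mulr_natr char_q mulr0.
Qed.

Definition frob : {rmorphism R -> R} :=
  mkrm (f := fun x => x ^+ p) frobD (expr1n _ _) (fun x y => exprMn _ x y).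

Lemma frobE x : frob x = x ^+ p. Proof. exact: mkrmE. Qed.
End Frobenius.

(** * Subquotients and base change of modules *)

Section SubquoTheory.
Variables (R : comPzRingType) (M : lmodType R) (A B : submod M).
Implicit Types v w : M.

Lemma smemB (C : submod M) v w : C v -> C w -> C (v - w).
Proof. by move=> Cv Cw; apply: smemD => //; apply: smemN. Qed.

Lemma smem_sum (C : submod M) (I : finType) (F : I -> M) :
  (forall i, C (F i)) -> C (\sum_i F i).
Proof.
by move=> h; elim/big_ind: _ => // [|v w]; [apply: smem0|apply: smemD].
Qed.

Lemma sqclass_in v (Av : A v) : sqclass A B v = mksq B Av.
Proof. by rewrite /sqclass; case: pselect => // Av'; apply: val_inj. Qed.

Lemma sqclassP v w : A v -> A w -> (sqclass A B v = sqclass A B w <-> B (v - w)).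
Proof.
move=> Av Aw; rewrite !sqclass_in; split=> [/(congr1 (@sqval _ _ _ _)) /= e|h].
  have [_ Bv] := rep_cong A B v; have [_ Bw] := rep_cong A B w.
  by rewrite e in Bv; have := smemB Bv Bw; rewrite opprB addrA subrK.
by apply: val_inj; apply: rep_eq => //; apply: smemB.
Qed.

Lemma sqclass_val (z : subquo A B) : sqclass A B (sqval z) = z.
Proof. by rewrite (sqclass_in (sqval_mem z)); apply: val_inj; apply: rep_sqval. Qed.

Lemma sqclassL a v w : A v -> A w ->
  sqclass A B (a *: v + w) = a *: sqclass A B v + sqclass A B w.
Proof.
move=> Av Aw; have Avw := smemP a Av Aw.
rewrite (sqclass_in Av) (sqclass_in Aw) (sqclass_in Avw); apply: val_inj => /=.
by rewrite repZ repDl repDr.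
Qed.

Lemma sqclass0 : sqclass A B 0 = 0.
Proof. by rewrite (sqclass_in (smem0 A)). Qed.

Lemma sqclass_sum (I : finType) (c : I -> R) (F : I -> M) : (forall i, A (F i)) ->
  sqclass A B (\sum_i c i *: F i) = \sum_i c i *: sqclass A B (F i).
Proof.
move=> AF; rewrite -!big_enum /=; elim: (enum I) => [|i s IH].
  by rewrite !big_nil sqclass0.
rewrite !big_cons sqclassL ?IH //.
by elim/big_ind: _ => // [|v w|j _]; [apply: smem0|apply: smemD|apply: smemZ].
Qed.

Lemma sqclass_eq0 v : A v -> (sqclass A B v = 0 <-> B v).
Proof. by move=> Av; rewrite -sqclass0 sqclassP ?subr0 //; apply: smem0. Qed.
End SubquoTheory.

Section FullSub.
Variables (R : comPzRingType) (M : lmodType R).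

Definition fullsub : submod M := @Submod R M (fun=> True) I (fun _ _ _ _ _ => I).

Variable E : M -> Prop.

Fact generated0 : generated E 0.
Proof. by exists 0%N, (fun=> 0), (fun=> 0); split; [case|rewrite big_ord0]. Qed.

Lemma generatedZ a v : generated E v -> generated E (a *: v).
Proof.
case=> k [c [e [h ->]]]; exists k, (fun b => a * c b), e; split=> //.
by rewrite scaler_sumr; apply: eq_bigr => b _; rewrite scalerA.
Qed.

Lemma generatedD v w : generated E v -> generated E w -> generated E (v + w).
Proof.
move=> [k [c [e [h ->]]]] [l [d [f [h' ->]]]].
exists (k + l)%N, (fun a => match split a with inl b => c b | inr b => d b end),
  (fun a => match split a with inl b => e b | inr b => f b end); split.
  by move=> a; case: (split a).
by rewrite -sum_split_ord; apply: eq_bigr => a _; case: (split a).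
Qed.

Lemma generated_sub v : E v -> generated E v.
Proof. by move=> Ev; exists 1%N, (fun=> 1), (fun=> v); rewrite big_ord1 scale1r. Qed.

Definition gensub : submod M :=
  Submod generated0 (fun a v w hv hw => generatedD (generatedZ a hv) hw).

Lemma generated_min (C : submod M) v : (forall w, E w -> C w) -> generated E v -> C v.
Proof.
by move=> h [k [c [e [he ->]]]]; apply: smem_sum => a; apply: smemZ; apply/h.
Qed.
End FullSub.

Section LinearFor.
Variables (R R' : comPzRingType) (sigma : {rmorphism R -> R'})
  (M : lmodType R) (M' : lmodType R') (beta : M -> M').
Hypothesis betaL : linear_for (fun a v => sigma a *: v) beta.

Lemma semi0 : beta 0 = 0.
Proof.
have := betaL 1 0 0; rewrite scale1r addr0 rmorph1 scale1r => /(congr1 (+%R^~ (- beta 0))).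
by rewrite addrK subrr.
Qed.

Lemma semiD v w : beta (v + w) = beta v + beta w.
Proof. by have := betaL 1 v w; rewrite rmorph1 !scale1r. Qed.

Lemma semiZ a v : beta (a *: v) = sigma a *: beta v.
Proof. by have := betaL a v 0; rewrite !addr0 semi0 addr0. Qed.

Lemma semiN v : beta (- v) = - beta v.
Proof. by rewrite -scaleN1r semiZ rmorphN1 scaleN1r. Qed.

Lemma semiB v w : beta (v - w) = beta v - beta w.
Proof. by rewrite semiD semiN. Qed.

Lemma semi_sum (I : finType) (P : pred I) (F : I -> M) :
  beta (\sum_(i | P i) F i) = \sum_(i | P i) beta (F i).
Proof. by rewrite (big_morph beta semiD semi0). Qed.

Lemma semi_lin (I : finType) (c : I -> R) (F : I -> M) :
  beta (\sum_i c i *: F i) = \sum_i sigma (c i) *: beta (F i).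
Proof. by rewrite semi_sum; apply: eq_bigr => i _; apply: semiZ. Qed.
End LinearFor.

Section Lin.
Variables (R : comPzRingType) (M N : lmodType R) (f : M -> N).
Hypothesis fL : linear f.
Let fL' : linear_for (fun a v => ridm R a *: v) f. Proof. exact: fL. Qed.
Lemma lin0 : f 0 = 0. Proof. exact: (semi0 fL'). Qed.
Lemma linZ a v : f (a *: v) = a *: f v. Proof. exact: (semiZ fL'). Qed.
Lemma linB v w : f (v - w) = f v - f w. Proof. exact: (semiB fL'). Qed.
Lemma lin_sum (I : finType) (c : I -> R) (F : I -> M) :
  f (\sum_i c i *: F i) = \sum_i c i *: f (F i).
Proof. exact: (semi_lin fL'). Qed.
End Lin.

Section BaseChange.
Variables (R R' : comPzRingType) (sigma : {rmorphism R -> R'})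
  (M : lmodType R) (M' : lmodType R') (beta : M -> M').
Hypothesis bc : is_base_change sigma beta.

Lemma bc_lin : linear_for (fun a v => sigma a *: v) beta.
Proof. by case: bc. Qed.

(** The projection of [M'] modulo the span of the image and the zero map both restrict to zero on
    [M]; by uniqueness of extensions they coincide. *)
Lemma bc_gen v' : generated (fun w => exists v, w = beta v) v'.
Proof.
set E := fun _ => _; pose N : lmodType R' := subquo (fullsub M') (gensub E).
case: bc => _ /(_ N (fun=> 0)) [].
  by move=> a v w; rewrite scaler0 addr0.
move=> d [[dL dE] dU].
have e1 : d = (fun=> 0).
  by apply: dU; split=> // a v w; rewrite scaler0 addr0.
have e2 : d = sqclass (fullsub M') (gensub E).
  apply: dU; split=> [a v w|v]; first exact: sqclassL.
  by apply/sqclass_eq0 => //; apply: generated_sub; exists v.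
by apply/(sqclass_eq0 (A := fullsub M') (gensub E)) => //; rewrite -e2 e1.
Qed.

Lemma bc_gen' v' : exists k (y : 'I_k -> R') (a : 'I_k -> M), v' = \sum_j y j *: beta (a j).
Proof.
have [k [y [e [he ->]]]] := bc_gen v'; have [a aE] := choice he.
by exists k, y, a; apply: eq_bigr => j _; rewrite aE.
Qed.

Lemma basis_coord n (e : 'I_n -> M) : is_basis e ->
  exists c : M -> {ffun 'I_n -> R},
    [/\ forall v, v = \sum_a c v a *: e a,
        forall v d, v = \sum_a d a *: e a -> c v = [ffun a => d a]
      & forall r v w, c (r *: v + w) = [ffun a => r * c v a + c w a]].
Proof.
move=> eb; have [c cE] := choice eb; exists c.
have U v d : v = \sum_a d a *: e a -> c v = [ffun a => d a].
  move=> h; have [_] := cE v; apply; rewrite {1}h.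
  by apply: eq_bigr => a _; rewrite ffunE.
split=> // [v|r v w]; first by have [] := cE v.
apply: U; have [vE _] := cE v; have [wE _] := cE w.
rewrite {1}vE {1}wE scaler_sumr -big_split; apply: eq_bigr => a _.
by rewrite scalerDl scalerA.
Qed.

Lemma bc_basis n (e : 'I_n -> M) : is_basis e -> is_basis (beta \o e).
Proof.
move=> eb; have [c [cE cU cL]] := basis_coord eb.
pose N : lmodType R' := 'rV[R']_n.
(* The coordinates on [M], pushed along [sigma], extend to [M'] by the universal property; the
   extension [d] gives independence. *)
pose g v : N := \row_a sigma (c v a).
case: bc => bL /(_ N g) [].
  by move=> a v w; apply/rowP => i; rewrite !mxE cL ffunE rmorphD rmorphM.
move=> d [[dL dE] _] v'.
have [k [y [a ->]]] := bc_gen' v'.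
have dS (x : 'I_n -> R') : d (\sum_i x i *: beta (e i)) = \row_i x i.
  rewrite (lin_sum dL); apply/rowP => j; rewrite summxE (bigD1 j) //= big1 => [|i ij].
    rewrite dE !mxE (cU _ (fun i => (i == j)%:R)); last first.
      by rewrite (bigD1 j) //= eqxx scale1r big1 ?addr0 // => i /negbTE->; rewrite scale0r.
    by rewrite ffunE eqxx rmorph1 mulr1 addr0.
  rewrite dE !mxE (cU _ (fun l => (l == i)%:R)); last first.
    by rewrite (bigD1 i) //= eqxx scale1r big1 ?addr0 // => l /negbTE->; rewrite scale0r.
  by rewrite ffunE eq_sym (negbTE ij) rmorph0 mulr0.
exists [ffun i => \sum_j y j * sigma (c (a j) i)]; split.
  under [RHS]eq_bigr => i _ do rewrite ffunE scaler_suml.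
  rewrite exchange_big; apply: eq_bigr => j _.
  rewrite {1}(cE (a j)) (semi_lin bL) scaler_sumr; apply: eq_bigr => i _.
  by rewrite scalerA.
move=> x /(congr1 d); rewrite -[in X in d X](eq_bigr _ (fun i _ => erefl)) dS => e1.
apply/ffunP => i; rewrite ffunE.
have -> : x i = (\row_i x i : N) 0 i by rewrite mxE.
rewrite -e1 (lin_sum dL) summxE; apply: eq_bigr => j _.
by rewrite dE !mxE.
Qed.
End BaseChange.

(** * A criterion for flatness *)

Definition ev (P : nat -> Prop) : Prop := exists m, forall n, (m <= n)%N -> P n.

Lemma ev_and P Q : ev P -> ev Q -> ev (fun n => P n /\ Q n).
Proof.
move=> [m hm] [k hk]; exists (maxn m k) => n; rewrite geq_max => /andP[h1 h2].
by split; [apply: hm|apply: hk].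
Qed.

Lemma ev_imp (P Q : nat -> Prop) : (forall n, P n -> Q n) -> ev P -> ev Q.
Proof. by move=> h [m hm]; exists m => n /hm/h. Qed.

Lemma ev_all (I : finType) (P : I -> nat -> Prop) :
  (forall i, ev (P i)) -> ev (fun n => forall i, P i n).
Proof.
move=> h; have [m hm] := choice h; exists (\max_i m i) => n hn i.
by apply: hm; apply: leq_trans hn; apply: leq_bigmax.
Qed.

Lemma ev_ex P : ev P -> exists n, P n.
Proof. by case=> m h; exists m; apply: h. Qed.

Section Sequences.
Variables (R : comPzRingType) (M : lmodType R).

Definition nfun : Type := nat -> M.
HB.instance Definition _ := gen_eqMixin nfun.
HB.instance Definition _ := gen_choiceMixin nfun.
Implicit Types u v w : nfun.

Let ext u v : (forall n, u n = v n) -> u = v.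
Proof. exact: functional_extensionality_dep. Qed.
Let nadd u v : nfun := fun n => u n + v n.
Let nopp u : nfun := fun n => - u n.
Let nscale a u : nfun := fun n => a *: u n.
Fact nadA : associative nadd. Proof. by move=> u v w; apply: ext => n; apply: addrA. Qed.
Fact nadC : commutative nadd. Proof. by move=> u v; apply: ext => n; apply: addrC. Qed.
Fact nad0 : left_id (fun=> 0 : M) nadd. Proof. by move=> u; apply: ext => n; apply: add0r. Qed.
Fact nadN : left_inverse (fun=> 0 : M) nopp nadd. Proof. by move=> u; apply: ext => n; apply: addNr. Qed.
HB.instance Definition _ := GRing.isZmodule.Build nfun nadA nadC nad0 nadN.
Fact nscA a b u : nscale a (nscale b u) = nscale (a * b) u.
Proof. by apply: ext => n; apply: scalerA. Qed.
Fact nsc1 : left_id 1 nscale. Proof. by move=> u; apply: ext => n; apply: scale1r. Qed.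
Fact nscDr : right_distributive nscale +%R.
Proof. by move=> a u v; apply: ext => n; apply: scalerDr. Qed.
Fact nscDl u : {morph nscale^~ u : a b / a + b}.
Proof. by move=> a b; apply: ext => n; apply: scalerDl. Qed.
HB.instance Definition _ := GRing.Zmodule_isLmodule.Build R nfun nscA nsc1 nscDr nscDl.

Fact evz0 : ev (fun n => (0 : nfun) n = 0). Proof. by exists 0%N. Qed.
Fact evzP a u v : ev (fun n => u n = 0) -> ev (fun n => v n = 0) ->
  ev (fun n => (a *: u + v) n = 0).
Proof.
move=> hu hv; apply: ev_imp (ev_and hu hv) => n [un vn].
by rewrite -[LHS]/(a *: u n + v n) un vn scaler0 addr0.
Qed.
Definition evzero : submod nfun := Submod evz0 evzP.

(** Sequences modulo eventual equality. A coordinate on a localized ring is only a fraction;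
    multiplied by f^n it lies in [R] for large [n], and the sequence of these values is well defined
    as a germ. *)
Definition germs : lmodType R := subquo (fullsub nfun) evzero.
Definition germ (u : nfun) : germs := sqclass (fullsub nfun) evzero u.

Lemma germP u v : germ u = germ v <-> ev (fun n => u n = v n).
Proof.
rewrite sqclassP //; split; apply: ev_imp => n.
  by move=> h; apply/eqP; rewrite -subr_eq0; apply/eqP.
move=> h; suff : u n - v n = 0 by [].
by rewrite h subrr.
Qed.

Lemma germD u v : germ (u + v) = germ u + germ v.
Proof. by have := sqclassL (A := fullsub nfun) evzero 1 I I (v := u) (w := v); rewrite !scale1r. Qed.

Lemma germ_sum (I : finType) (F : I -> nfun) : \sum_i germ (F i) = germ (fun n => \sum_i F i n).
Proof.
have -> : (fun n => \sum_i F i n) = \sum_i F i :> nfun.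
  apply: ext => n; apply: (big_ind2 (fun (x : M) (u : nfun) => x = u n)) => //.
  by move=> x u y v -> ->.
by rewrite (big_morph germ germD (sqclass0 _ _)).
Qed.
End Sequences.

Section Coinduced.
Variables (R' : comPzRingType) (G : zmodType).

(** The coinduced module of additive maps from [R'] to [G]. A family of additive maps into a group
    without [R']-action becomes a map into an [R']-module, to which the universal property of a base
    change applies; evaluation at 1 recovers the original values. *)
Record coind := Coind { cfun : R' -> G; cfunD : forall y z, cfun (y + z) = cfun y + cfun z }.
HB.instance Definition _ := gen_eqMixin coind.
HB.instance Definition _ := gen_choiceMixin coind.
Implicit Types u v w : coind.

Lemma coind_ext u v : (forall y, cfun u y = cfun v y) -> u = v.
Proof.
case: u v => u hu [v hv] /= uv.
have e : u = v by apply: functional_extensionality_dep.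
by case: _ / e hv {uv} => hv; congr Coind; apply: Prop_irrelevance.
Qed.

Fact cadd_proof u v y z : cfun u (y + z) + cfun v (y + z) = cfun u y + cfun v y + (cfun u z + cfun v z).
Proof. by rewrite !cfunD addrACA. Qed.
Fact copp_proof u y z : - cfun u (y + z) = - cfun u y + - cfun u z.
Proof. by rewrite cfunD opprD. Qed.
Fact c0_proof (y z : R') : 0 = 0 + 0 :> G. Proof. by rewrite addr0. Qed.
Fact cscale_proof a u y z : cfun u (a * (y + z)) = cfun u (a * y) + cfun u (a * z).
Proof. by rewrite mulrDr cfunD. Qed.
Let cadd u v := Coind (cadd_proof u v).
Let copp u := Coind (copp_proof u).
Let c0 := Coind c0_proof.
Let cscale a u := Coind (cscale_proof a u).
Fact cadA : associative cadd. Proof. by move=> u v w; apply: coind_ext => n; apply: addrA. Qed.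
Fact cadC : commutative cadd. Proof. by move=> u v; apply: coind_ext => n; apply: addrC. Qed.
Fact cad0 : left_id c0 cadd. Proof. by move=> u; apply: coind_ext => n; apply: add0r. Qed.
Fact cadN : left_inverse c0 copp cadd. Proof. by move=> u; apply: coind_ext => n; apply: addNr. Qed.
HB.instance Definition _ := GRing.isZmodule.Build coind cadA cadC cad0 cadN.
Fact cscA a b u : cscale a (cscale b u) = cscale (a * b) u.
Proof. by apply: coind_ext => n /=; rewrite mulrA [b * a]mulrC. Qed.
Fact csc1 : left_id 1 cscale. Proof. by move=> u; apply: coind_ext => n /=; rewrite mul1r. Qed.
Fact cscDr : right_distributive cscale +%R.
Proof. by move=> a u v; apply: coind_ext. Qed.
Fact cscDl u : {morph cscale^~ u : a b / a + b}.
Proof. by move=> a b; apply: coind_ext => n /=; rewrite mulrDl cfunD. Qed.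
HB.instance Definition _ := GRing.Zmodule_isLmodule.Build R' coind cscA csc1 cscDr cscDl.

Lemma cfun_lin (I : finType) (y : I -> R') (u : I -> coind) :
  cfun (\sum_i y i *: u i) 1 = \sum_i cfun (u i) (y i).
Proof.
apply: (big_ind2 (fun (v : coind) (g : G) => cfun v 1 = g)) => //.
  by move=> v g w h <- <-.
by move=> i _ /=; rewrite mulr1.
Qed.
End Coinduced.

(* A dual basis up to eventually vanishing errors: the "coordinate" functionals
   take values in sequences, [lam i y n] standing for [f ^ n] times a
   coordinate when [R'] involves inverting [f]. *)
Definition germ_dual (R R' : comPzRingType) (phi : {rmorphism R -> R'}) (I : finType)
    (lam : I -> R' -> nat -> R) (c : I -> nat -> R') : Prop :=
  [/\ forall i y z, ev (fun n => lam i (y + z) n = lam i y n + lam i z n),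
      forall i r y, ev (fun n => lam i (phi r * y) n = r * lam i y n)
    & forall y, ev (fun n => y = \sum_i c i n * phi (lam i y n))].

Section GermDual.
Variables (R R' : comPzRingType) (phi : {rmorphism R -> R'}) (I : finType)
    (lam : I -> R' -> nat -> R) (c : I -> nat -> R').
Hypothesis dual : germ_dual phi lam c.

(** Sending [v] to the map z |-> germ of [lam i z n *: v] is semilinear into the coinduced module of
    germs, hence extends to [M']. The extension is applied to the relation and evaluated at 1. *)
Lemma germ_dual_kernel (M : lmodType R) (M' : lmodType R') (alpha : M -> M') k
    (y : 'I_k -> R') (a : 'I_k -> M) i :
  is_base_change phi alpha -> \sum_j y j *: alpha (a j) = 0 ->
  ev (fun n => \sum_j lam i (y j) n *: a j = 0).
Proof.
case: dual => lamD lamZ _ [_] bc e.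
pose gf v (z : R') : germs M := germ (fun n => lam i z n *: v).
have gfD v z t : gf v (z + t) = gf v z + gf v t.
  rewrite -germD; apply/germP; apply: ev_imp (lamD i z t) => n ->.
  by rewrite scalerDl.
pose g v : coind R' (germs M) := Coind (gfD v).
have [|d [[dL dE] _]] := bc (coind R' (germs M)) g.
  move=> r v w; apply: coind_ext => z.
  rewrite -[RHS]/(gf v (phi r * z) + gf w z) -germD; apply/germP.
  apply: ev_imp (lamZ i r z) => n h.
  by rewrite -[RHS]/(lam i (phi r * z) n *: v + lam i z n *: w) h scalerDr !scalerA mulrC.
have := congr1 (fun v => cfun (d v) 1) e.
rewrite (lin_sum dL) cfun_lin (lin0 dL) -[RHS](sqclass0 (fullsub _) (evzero M)).
under eq_bigr => j _ do rewrite dE.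
by rewrite germ_sum => /germP.
Qed.

(** For an element killed by [f'], the coordinates are killed by [f] for large [n], hence vanish by
    injectivity; the dual basis recovers the element from them. *)
Lemma germ_dual_flat : flat phi.
Proof.
move=> A B A' B' alpha beta f f' bca bcb fL f'L comm finj z1 z2 e12.
apply/eqP; rewrite -subr_eq0; apply/eqP.
have : f' (z1 - z2) = 0 by rewrite (linB f'L) e12 subrr.
move: (z1 - z2) => z; have [k [y [a ->]]] := bc_gen' bca z.
rewrite (lin_sum f'L) => e.
have ker i : ev (fun n => \sum_j lam i (y j) n *: a j = 0).
  have {}e : \sum_j y j *: beta (f (a j)) = 0.
    by rewrite -[RHS]e; apply: eq_bigr => j _; rewrite comm.
  apply: ev_imp (germ_dual_kernel i bcb e) => n h; apply: finj; rewrite (lin_sum fL) (lin0 fL); exact: h.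
case: dual => _ _ rec.
have [n [h1 h2]] := ev_ex (ev_and (ev_all ker) (ev_all (fun j => rec (y j)))).
transitivity (\sum_i c i n *: alpha (\sum_j lam i (y j) n *: a j)); last first.
  by rewrite big1 // => i _; rewrite h1 (semi0 (bc_lin bca)) scaler0.
under eq_bigr => j _ do rewrite h2 scaler_suml.
rewrite exchange_big; apply: eq_bigr => i _.
rewrite (semi_lin (bc_lin bca)) scaler_sumr; apply: eq_bigr => j _.
by rewrite scalerA.
Qed.
End GermDual.

(** * Zariski covers: flatness and finite presentation *)

Section LocalizationDual.
Variables (R L : comPzRingType) (f : R) (l : {rmorphism R -> L}).
Hypothesis loc : is_localization f l.

Lemma loc_num : exists rk : L -> R * nat, forall y, l f ^+ (rk y).2 * y = l (rk y).1.
Proof.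
case: loc => _ h _; have h' y : exists rk : R * nat, l f ^+ rk.2 * y = l rk.1.
  by have [r [k]] := h y; exists (r, k).
by have [rk rkE] := choice h'; exists rk.
Qed.

(** A single term of the sequence that dies in [L] is killed by some f^m, and [m] steps further the
    sequence has acquired this factor. *)
Lemma loc_seq0 (d : nat -> R) : ev (fun n => d n.+1 = f * d n) ->
  ev (fun n => l (d n) = 0) -> ev (fun n => d n = 0).
Proof.
move=> h1 h2; have [n0 h] := ev_and h1 h2; case: loc => _ _ ker.
have [m hm] := ker (d n0) (proj2 (h n0 (leqnn _))).
have dE j : d (n0 + j)%N = f ^+ j * d n0.
  elim: j => [|j IH]; first by rewrite addn0 mul1r.
  have [dS _] := h (n0 + j)%N (leq_addr _ _).
  by rewrite addnS dS IH exprS mulrA.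
exists (n0 + m)%N => n hn.
have -> : n = (n0 + ((n - n0 - m) + m))%N by lia.
by rewrite dE exprD -mulrA hm mulr0.
Qed.

(** The value [lam y n] is a numerator of f^n y, meaningful once [n] exceeds the exponent of the
    chosen denominator. By the third clause the germ is determined by its image in [L], which makes
    it additive and linear. *)
Lemma loc_lam : exists lam : L -> nat -> R,
  [/\ forall y, ev (fun n => l (lam y n) = l f ^+ n * y),
      forall y, ev (fun n => lam y n.+1 = f * lam y n)
    & forall y d, ev (fun n => d n.+1 = f * d n) ->
       ev (fun n => l (d n) = l f ^+ n * y) -> ev (fun n => lam y n = d n)].
Proof.
have [rk rkE] := loc_num.
pose lam y n := f ^+ (n - (rk y).2) * (rk y).1.
have h1 y : ev (fun n => l (lam y n) = l f ^+ n * y).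
  exists (rk y).2 => n hn; rewrite rmorphM -rkE rmorphXn mulrA -exprD; congr (_ ^+ _ * _).
  by lia.
have h2 y : ev (fun n => lam y n.+1 = f * lam y n).
  by exists (rk y).2 => n hn; rewrite /lam subSn // exprS mulrA.
exists lam; split=> // y d h3 h4.
have : ev (fun n => lam y n - d n = 0).
  apply: loc_seq0.
    by apply: ev_imp (ev_and (h2 y) h3) => n [-> ->]; rewrite mulrBr.
  by apply: ev_imp (ev_and (h1 y) h4) => n [e1 e2]; rewrite rmorphB e1 e2 subrr.
by apply: ev_imp => n /eqP; rewrite subr_eq0 => /eqP.
Qed.
End LocalizationDual.

Section LocalizationCover.
Variables (R : comPzRingType) (k : nat) (L : 'I_k -> comPzRingType) (f : 'I_k -> R)
  (l : forall a, {rmorphism R -> L a}).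
Hypothesis loc : forall a, is_localization (f a) (l a).
Variable phi : {rmorphism R -> prodr L}.
Hypothesis phiE : forall r a, phi r a = l a r.

(** The dual basis element at [a] is the [n]-th power of the inverse of [f a], placed in the factor
    [a]; it cancels the factor f^n contained in the coordinates. *)
Lemma prod_germ_dual : exists (lam : 'I_k -> prodr L -> nat -> R) c, germ_dual phi lam c.
Proof.
have [lam lamP] := fin_all_exists (fun a => loc_lam (loc a)).
have hb a : exists b, l a (f a) * b = 1 by case: (loc a).
have [b bE] := fin_all_exists hb.
exists (fun a y n => lam a (y a) n), (fun a n => prod_in (b a ^+ n)); split.
- move=> a y z; have [h1 h2 h3] := lamP a; apply: h3.
    by apply: ev_imp (ev_and (h2 (y a)) (h2 (z a))) => n [-> ->]; rewrite mulrDr.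
  apply: ev_imp (ev_and (h1 (y a)) (h1 (z a))) => n [e1 e2].
  by rewrite rmorphD e1 e2 -mulrDr.
- move=> a r y; have [h1 h2 h3] := lamP a; apply: h3.
    by apply: ev_imp (h2 (y a)) => n ->; ring.
  apply: ev_imp (h1 (y a)) => n e; rewrite rmorphM e.
  by rewrite -[(phi r * y) a]/(phi r a * y a) phiE; ring.
- move=> y.
  have ha a : ev (fun n => l a (lam a (y a) n) = l a (f a) ^+ n * y a) by case: (lamP a).
  apply: ev_imp (ev_all ha) => n h.
  rewrite -{1}(prod_in_sum y); apply: eq_bigr => a _.
  rewrite mulrC prod_inM phiE h; congr prod_in.
  by rewrite mulrAC -exprMn bE expr1n mul1r.
Qed.

Lemma prod_Spec_surj : unit_family f -> Spec_surjective phi.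
Proof.
move=> fu K x; have [a xa] := unit_family_point x fu.
have [y yE] := loc_point (loc a) xa.
exists K, (ridm K), (rcomp y (prod_pi L a)) => r.
by rewrite -[LHS]/(y (phi r a)) phiE yE.
Qed.

Fixpoint tpow (V : Type) (t : term R V) n : term R V :=
  if n is n.+1 then TM t (tpow t n) else TC 1.
Definition tsum (V : Type) (s : seq (term R V)) : term R V := foldr (@TD R V) (TC 0) s.

Lemma teval_tpow (V : Type) (B : comPzRingType) (g : {rmorphism R -> B}) (b : V -> B) t n :
  teval g b (tpow t n) = teval g b t ^+ n.
Proof. by elim: n => [|n IH] /=; rewrite ?rmorph1 // IH exprS. Qed.

Lemma teval_tsum (V : Type) (B : comPzRingType) (g : {rmorphism R -> B}) (b : V -> B)
    (I : finType) (F : I -> term R V) :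
  teval g b (tsum [seq F i | i <- enum I]) = \sum_i teval g b (F i).
Proof.
rewrite -[RHS]big_enum /=; elim: (enum I) => [|i s IH] /=.
  by rewrite big_nil rmorph0.
by rewrite big_cons IH.
Qed.

(** The generators are the units t_a of the factors and the inverses s_a of [f a] in them. The
    relations are t_a t_c = 0 for distinct a, c, sum_a t_a = 1, f_a s_a = t_a and s_a t_a = s_a;
    they imply that the t_a are idempotent. *)
Lemma prod_presented : unit_family f -> presented phi.
Proof.
move=> fu.
have [rk rkE] := fin_all_exists (fun a => loc_num (loc a)).
have hb a : exists b, l a (f a) * b = 1 by case: (loc a).
have [b bE] := fin_all_exists hb.
pose y (v : 'I_k + 'I_k) : prodr L := match v with inl a => prod_in (1 : L a) | inr a => prod_in (b a) end.
pose T := term R ('I_k + 'I_k).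
pose t a : T := TV (inl a). pose s a : T := TV (inr a).
pose h (i : ('I_k * 'I_k + unit) + ('I_k + 'I_k)) : T := match i with
  | inl (inl (a, c)) => if a == c then TC 0 else TM (t a) (t c)
  | inl (inr _) => TD (tsum [seq t a | a <- enum 'I_k]) (TN (TC 1))
  | inr (inl a) => TD (TM (TC (f a)) (s a)) (TN (t a))
  | inr (inr a) => TD (TM (s a) (t a)) (TN (s a)) end.
have one : \sum_a y (inl a) = 1.
  by rewrite /y -[RHS]prod_in_sum.
exists ('I_k + 'I_k)%type, y, (('I_k * 'I_k + unit) + ('I_k + 'I_k))%type, h; split.
- case=> [[[a c]|[]]|[a|a]] /=.
  + have [_|ac] := eqVneq a c; first by rewrite /= rmorph0.
    by rewrite /= prod_inM prod_in_neq ?mul0r ?prod_in0 ?rmorph0.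
  + by rewrite teval_tsum one rmorph1 subrr.
  + by rewrite prod_inM phiE bE subrr.
  + by rewrite prod_inM prod_in_id mulr1 subrr.
- move=> z; exists (tsum [seq TM (tpow (s a) (rk a (z a)).2) (TM (TC (rk a (z a)).1) (t a)) | a <- enum 'I_k]).
  rewrite teval_tsum -[RHS]prod_in_sum; apply: eq_bigr => a _ /=.
  rewrite teval_tpow /= !prod_inM mulr1; congr prod_in.
  rewrite phiE -rkE.
  have -> m : (prod_in (b a) ^+ m : prodr L) a = b a ^+ m.
    elim: m => [|m IH]; first by rewrite !expr0.
    by rewrite !exprS -IH -[LHS]/(prod_in (b a) a * _) prod_in_id.
  by rewrite mulrA -exprMn mulrC [b a * _]mulrC bE expr1n mulr1.
- move=> B g e he; pose ta a := e (inl a); pose sa a := e (inr a).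
  have r1 a c : a != c -> ta a * ta c = 0.
    by move=> /negbTE ac; have := he (inl (inl (a, c))); rewrite /= ac.
  have r2 : \sum_a ta a = 1.
    have := he (inl (inr tt)); rewrite /= teval_tsum rmorph1 => /eqP.
    by rewrite subr_eq0 => /eqP.
  have r3 a : g (f a) * sa a = ta a.
    by have := he (inr (inl a)) => /eqP; rewrite subr_eq0 => /eqP.
  have r4 a : sa a * ta a = sa a.
    by have := he (inr (inr a)) => /eqP; rewrite subr_eq0 => /eqP.
  have r5 a : ta a * ta a = ta a.
    rewrite -[RHS]mulr1 -r2 mulr_sumr (bigD1 a) //= big1 ?addr0 // => c ca.
    by rewrite r1 // eq_sym.
  have r6 a m : (g (f a) * sa a) ^+ m * ta a = ta a.
    by elim: m => [|m IH]; rewrite ?mul1r // exprS -mulrA IH r3 r5.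
  (* The image of the component [z] = r / f_a^m is s_a^m g(r) t_a. The final factor confines it to
     the direct factor cut out by t_a, where [f a] is invertible. *)
  pose h1 a z := sa a ^+ (rk a z).2 * g (rk a z).1 * ta a.
  have h1E a z r m : l a (f a) ^+ m * z = l a r -> h1 a z = sa a ^+ m * g r * ta a.
    rewrite /h1; have := rkE a z; case: (rk a z) => r' m' /= e1 e2.
    have : l a (f a ^+ m' * r - f a ^+ m * r') = 0.
      by rewrite rmorphB !rmorphM !rmorphXn -e1 -e2; ring.
    case: (loc a) => _ _ ker /ker[j] /(congr1 g).
    rewrite rmorph0 rmorphM rmorphB !rmorphM !rmorphXn => e3.
    have : sa a ^+ j * sa a ^+ m * sa a ^+ m' * (g (f a) ^+ j *
       (g (f a) ^+ m' * g r - g (f a) ^+ m * g r')) * ta a = 0.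
      by rewrite e3 mulr0 mul0r.
    have -> : sa a ^+ j * sa a ^+ m * sa a ^+ m' * (g (f a) ^+ j *
       (g (f a) ^+ m' * g r - g (f a) ^+ m * g r')) * ta a =
       sa a ^+ m * g r * ((g (f a) * sa a) ^+ j * ((g (f a) * sa a) ^+ m' * ta a))
       - sa a ^+ m' * g r' * ((g (f a) * sa a) ^+ j * ((g (f a) * sa a) ^+ m * ta a)).
      by rewrite !exprMn; ring.
    by rewrite !r6 => /eqP; rewrite subr_eq0 => /eqP->.
  have h1D a z w : h1 a (z + w) = h1 a z + h1 a w.
    rewrite (h1E a _ (f a ^+ (rk a w).2 * (rk a z).1 + f a ^+ (rk a z).2 * (rk a w).1)
       ((rk a z).2 + (rk a w).2)%N); last first.
      by rewrite rmorphD !rmorphM !rmorphXn -!rkE exprD; ring.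
    transitivity (sa a ^+ (rk a z).2 * g (rk a z).1 * ((g (f a) * sa a) ^+ (rk a w).2 * ta a)
       + sa a ^+ (rk a w).2 * g (rk a w).1 * ((g (f a) * sa a) ^+ (rk a z).2 * ta a)).
      by rewrite rmorphD !rmorphM !rmorphXn !exprMn exprD; ring.
    by rewrite !r6.
  have h1M a z w : h1 a (z * w) = h1 a z * h1 a w.
    rewrite (h1E a _ ((rk a z).1 * (rk a w).1) ((rk a z).2 + (rk a w).2)%N); last first.
      by rewrite rmorphM -!rkE exprD; ring.
    transitivity (sa a ^+ ((rk a z).2 + (rk a w).2) * g ((rk a z).1 * (rk a w).1) * (ta a * ta a)).
      by rewrite r5.
    by rewrite /h1 rmorphM exprD; ring.
  have h1t a z : h1 a z = h1 a z * ta a by rewrite /h1 -[RHS]mulrA r5.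
  have h11 a : h1 a 1 = ta a by rewrite (h1E a 1 1 0%N) ?expr0 ?mul1r ?rmorph1 ?mul1r.
  have h10 a : h1 a 0 = 0 by rewrite (h1E a 0 0 0%N) ?mulr0 ?rmorph0 // mulr0 mul0r.
  pose G (z : prodr L) := \sum_a h1 a (z a).
  have GD z w : G (z + w) = G z + G w.
    by rewrite -big_split; apply: eq_bigr => a _; apply: h1D.
  have GM z w : G (z * w) = G z * G w.
    rewrite mulr_suml; apply: eq_bigr => a _.
    rewrite -[(z * w) a]/(z a * w a) h1M mulr_sumr (bigD1 a) //= big1 ?addr0 // => c ca.
    by rewrite h1t [h1 c _]h1t mulrACA r1 1?eq_sym // mulr0.
  have G1 : G 1 = 1 by rewrite -[RHS]r2; apply: eq_bigr => a _; apply: h11.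
  have Gin a z : G (prod_in (a := a) z) = h1 a z.
    rewrite /G (bigD1 a) //= prod_in_id big1 ?addr0 // => c ca.
    by rewrite prod_in_neq ?h10 // eq_sym.
  exists (mkrm GD G1 GM); split=> [r|[a|a]]; rewrite mkrmE.
  + rewrite -[RHS]mulr1 -r2 mulr_sumr; apply: eq_bigr => a _.
    by rewrite (h1E a _ r 0%N) ?expr0 ?mul1r ?phiE.
  + by rewrite Gin h11.
  + rewrite Gin (h1E a _ 1 1%N) ?bE ?rmorph1 // expr1 mulr1; exact: r4.
Qed.
End LocalizationCover.

Definition finite_dual (R R' : comPzRingType) (phi : {rmorphism R -> R'}) (J : finType)
    (mu : J -> R' -> R) (e : J -> R') : Prop :=
  [/\ forall j y z, mu j (y + z) = mu j y + mu j z,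
      forall j r y, mu j (phi r * y) = r * mu j y
    & forall y, y = \sum_j e j * phi (mu j y)].

Lemma germ_dual_comp (R R1 R2 : comPzRingType) (phi : {rmorphism R -> R1})
    (psi : {rmorphism R1 -> R2}) (I J : finType) (lam : I -> R1 -> nat -> R) c
    (mu : J -> R2 -> R1) e :
  germ_dual phi lam c -> finite_dual psi mu e ->
  germ_dual (rcomp psi phi) (I := (I * J)%type)
    (fun ij y n => lam ij.1 (mu ij.2 y) n) (fun ij n => psi (c ij.1 n) * e ij.2).
Proof.
case=> h1 h2 h3 [k1 k2 k3]; split.
- by move=> [i j] y z /=; rewrite k1; apply: h1.
- by move=> [i j] r y /=; rewrite k2; apply: h2.
- move=> y; apply: ev_imp (ev_all (fun j => h3 (mu j y))) => n h.
  rewrite -(pair_bigA _ (fun i j => psi (c i n) * e j * psi (phi (lam i (mu j y) n)))) /=.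
  rewrite exchange_big {1}[y]k3; apply: eq_bigr => j _.
  rewrite {1}(h j) rmorph_sum mulr_sumr; apply: eq_bigr => i _.
  by rewrite rmorphM; ring.
Qed.

Lemma finite_germ_dual (R R' : comPzRingType) (phi : {rmorphism R -> R'}) (J : finType)
    (mu : J -> R' -> R) (e : J -> R') :
  finite_dual phi mu e -> germ_dual phi (fun j y _ => mu j y) (fun j _ => e j).
Proof.
case=> h1 h2 h3; split.
- by move=> j y z; exists 0%N => n _; apply: h1.
- by move=> j r y; exists 0%N => n _; apply: h2.
- by move=> y; exists 0%N => n _; apply: h3.
Qed.

(** A localization has a dual basis with one functional, whose value at 1 is eventually f^n;
    [germ_dual_kernel] applied to it is the claim. *)
Lemma loc_bc_kernel (R L : comPzRingType) (f : R) (l : {rmorphism R -> L})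
    (M : lmodType R) (M' : lmodType L) (alpha : M -> M') v :
  is_localization f l -> is_base_change l alpha -> alpha v = 0 ->
  exists n, f ^+ n *: v = 0.
Proof.
move=> loc bc av0; have [lam [h1 h2 h3]] := loc_lam loc.
have [b bE] : exists b, l f * b = 1 by case: loc.
have dual : germ_dual l (I := unit) (fun _ => lam) (fun _ n => b ^+ n).
  split=> [_ y z|_ r y|y].
  - apply: h3.
      by apply: ev_imp (ev_and (h2 y) (h2 z)) => n [-> ->]; rewrite mulrDr.
    by apply: ev_imp (ev_and (h1 y) (h1 z)) => n [e1 e2]; rewrite rmorphD e1 e2 -mulrDr.
  - apply: h3; first by apply: ev_imp (h2 y) => n ->; ring.
    by apply: ev_imp (h1 y) => n e; rewrite rmorphM e; ring.
  - apply: ev_imp (h1 y) => n e.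
    rewrite (bigD1 tt) //= big1 ?addr0 => [|[]] //.
    by rewrite e mulrA -exprMn [b * _]mulrC bE expr1n mul1r.
have := germ_dual_kernel dual (k := 1) (y := fun=> 1) (a := fun=> v) tt bc.
rewrite big_ord1 av0 scaler0 => /(_ erefl) e.
have e1 : ev (fun n => lam 1 n = f ^+ n).
  by apply: h3; exists 0%N => n _; rewrite ?exprS // rmorphXn mulr1.
have [n []] := ev_ex (ev_and e e1); rewrite big_ord1 => e2 e3.
by exists n; rewrite -e3.
Qed.

(** * Faithfully flat maps are injective *)

(** Multiplication by [r] embeds R / Ann(r) into [R]. If [phi r = 0], its base change is the zero
    map, and flatness forces Ann(r) to generate the unit ideal of [R']. For nonzero [r] this
    contradicts the lifting of a point of [R] at which Ann(r) vanishes. *)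
Lemma flat_inj (R R' : comPzRingType) (phi : {rmorphism R -> R'}) r :
  flat phi -> Spec_surjective phi -> phi r = 0 -> r = 0.
Proof.
move=> fl surj e.
have ann0 : (0 : R^o) * r = 0 by rewrite mul0r.
have annP (a v w : R) : v * r = 0 -> w * r = 0 -> (a * v + w) * r = 0.
  by move=> hv hw; rewrite mulrDl -mulrA hv hw mulr0 addr0.
pose ann : submod R^o := @Submod R R^o (fun v => (v : R) * r = 0) ann0 annP.
pose annR' : submod R'^o := gensub (fun y : R'^o => exists2 a, ann a & y = phi a).
pose A : lmodType R := subquo (fullsub R^o) ann.
pose A' : lmodType R' := subquo (fullsub R'^o) annR'.
pose clA (a : R^o) : A := sqclass (fullsub R^o) ann a.
pose clA' (a : R'^o) : A' := sqclass (fullsub R'^o) annR' a.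
pose alpha (z : A) : A' := clA' (phi (sqval z)).
have alphaE a : alpha (clA a) = clA' (phi a).
  apply/sqclassP => //; apply: generated_sub; exists (sqval (clA a) - a); last by rewrite rmorphB.
  by apply/(sqclassP (A := fullsub R^o) ann) => //; rewrite sqclass_val.
have surjA (z : A) : exists a, z = clA a by exists (sqval z); rewrite /clA sqclass_val.
have surjA' (z : A') : exists a, z = clA' a by exists (sqval z); rewrite /clA' sqclass_val.
have clAL a v w : clA (a *: v + w) = a *: clA v + clA w by apply: sqclassL.
have clA'L a v w : clA' (a *: v + w) = a *: clA' v + clA' w by apply: sqclassL.
have bcA : is_base_change phi alpha.
  split=> [a v w|N g gL].
    have [x ->] := surjA v; have [y ->] := surjA w.
    by rewrite -clAL !alphaE -clA'L -[RHS]/(clA' (phi a * phi x + phi y)) -rmorphM -rmorphD.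
  have g1 a : g (clA a) = phi a *: g (clA 1).
    by rewrite -(semiZ gL) -[in LHS](mulr1 a) -[a * 1]addr0 clAL [clA 0]sqclass0 addr0.
  pose d (z : A') := (sqval z : R') *: g (clA 1).
  have dE y : d (clA' y) = (y : R') *: g (clA 1).
    have : annR' (sqval (clA' y) - y).
      by apply/(sqclassP (A := fullsub R'^o) annR') => //; rewrite sqclass_val.
    case=> k [c [b [hb eb]]]; rewrite /d -[sqval _](subrK y) eb scalerDl.
    rewrite scaler_suml big1 ?add0r // => i _.
    have [a ar ->] := hb i; rewrite -scalerA -g1.
    have -> : clA a = 0 by apply/sqclass_eq0.
    by rewrite (semi0 gL) scaler0.
  exists d; split; first split.
  - move=> a v w; have [x ->] := surjA' v; have [y ->] := surjA' w.
    by rewrite -clA'L !dE -[LHS]/((a * x + y) *: _) scalerDl scalerA.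
  - by move=> v; have [x ->] := surjA v; rewrite alphaE dE -g1.
  - move=> d' [d'L d'E]; apply: functional_extensionality_dep => z.
    have [y ->] := surjA' z; rewrite dE -d'E alphaE rmorph1 -(linZ d'L).
    congr (d' _); rewrite -[in RHS](mulr1 y) -[in RHS](addr0 (y * 1)) clA'L.
    by rewrite [clA' 0]sqclass0 addr0.
have bcB : is_base_change phi (phi : R^o -> R'^o).
  split=> [a v w|N g gL]; first by rewrite rmorphD rmorphM.
  exists (fun y : R'^o => (y : R') *: g 1); split; first split.
  - by move=> a v w; rewrite -[LHS]/((a * v + w) *: _) scalerDl scalerA.
  - by move=> v; rewrite -(semiZ gL); congr (g _); apply: mulr1.
  - move=> d' [d'L d'E]; apply: functional_extensionality_dep => z.
    by rewrite -d'E rmorph1 -(linZ d'L); congr (d' _); apply: mulr1.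
pose f (z : A) : R^o := (sqval z : R) * r.
have fE a : f (clA a) = (a : R) * r.
  have : ann (sqval (clA a) - a).
    by apply/(sqclassP (A := fullsub R^o) ann) => //; rewrite sqclass_val.
  by rewrite /= mulrBl => /eqP; rewrite subr_eq0 => /eqP.
have fL : linear f.
  move=> a v w; have [x ->] := surjA v; have [y ->] := surjA w.
  by rewrite -clAL !fE -[LHS]/((a * x + y) * r) mulrDl -mulrA.
have finj : injective f.
  move=> z t; have [x ->] := surjA z; have [y ->] := surjA t; rewrite !fE => h.
  by apply/sqclassP => //; rewrite /= mulrBl h subrr.
have := fl A R^o A' R'^o alpha phi f (fun=> 0) bcA bcB fL _ _ finj.
move=> /(_ _ _ (clA' 1) (clA' 0) erefl) inj.
have : annR' (1 - 0).
  apply/(sqclassP (A := fullsub R'^o) annR') => //; apply: inj.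
    by move=> a v w; rewrite scaler0 addr0.
  by move=> v; have [x ->] := surjA v; rewrite fE rmorphM e mulr0.
rewrite subr0 => a1.
have [//|nr] := pselect (r = 0).
have iann : ideal (fun a : R => a * r = 0).
  split=> [|x y hx hy|a x hx]; first by rewrite mul0r.
    by rewrite mulrDl hx hy addr0.
  by rewrite -mulrA hx mulr0.
have [|K [x xE]] := residue_field iann; first by rewrite mul1r.
have [F [em [y yE]]] := surj K x.
case: a1 => k [c [b [hb]]] /(congr1 y); rewrite rmorph1 rmorph_sum big1 => [/eqP|i _].
  by rewrite oner_eq0.
by have [a ar ->] := hb i; rewrite rmorphM yE xE // rmorph0 mulr0.
Qed.

(** * The algebra R[X]/(X_k^p - sum_j A_kj X_j) *)

Section AdditiveAlgebra.
Variables (R : comPzRingType) (V : finType) (p : nat) (p_gt1 : (1 < p)%N) (A : V -> V -> R).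

Notation mexp := {ffun V -> nat}.
Notation redexp := {ffun V -> 'I_p}.

(** The free module on the monomials with all exponents below [p]. Rewriting X_k^p into sum_j A_kj
    X_j is confluent, so these monomials form a basis of the algebra. *)
Definition addalg_mod : Type := {ffun redexp -> R^o}.
Notation F := addalg_mod.
HB.instance Definition _ := GRing.Lmodule.on F.
Implicit Types (f g h : F) (m : mexp).

Definition mon (al : redexp) : mexp := [ffun k => val (al k)].

Definition delta_exp m : F := [ffun al => (mon al == m)%:R].

Definition emul m m' : mexp := [ffun i => (m i + m' i)%N].
Definition eone : mexp := [ffun=> 0%N].
Definition evar k : mexp := [ffun i => (i == k : nat)].
Definition estep m k j : mexp := [ffun i => (m i - p * (i == k) + (i == j))%N].
Definition edeg m : nat := (\sum_i m i)%N.

(** Rewriting to normal form with fuel [d]. A step lowers the degree by p - 1 > 0, so fuel exceeding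
    the degree suffices, and the value 0 for exhausted fuel is never reached. *)
Fixpoint nff (d : nat) m : F :=
  if d is d.+1 then
    if [pick k | p <= m k]%N is Some k then \sum_j A k j *: nff d (estep m k j)
    else delta_exp m
  else 0.

Definition nf m : F := nff (edeg m).+1 m.

Lemma sum_eqb (k : V) c : (\sum_i c * (i == k) = c)%N.
Proof.
rewrite (bigD1 k) //= eqxx muln1 big1 ?addn0 // => i /negbTE->.
by rewrite muln0.
Qed.

Lemma edeg_step m k j : (p <= m k)%N -> (edeg (estep m k j) + p = (edeg m).+1)%N.
Proof.
move=> pk; have : (edeg (estep m k j) + \sum_i p * (i == k) = edeg m + \sum_i 1 * (i == j))%N.
  rewrite /edeg -!big_split; apply: eq_bigr => i _; rewrite ffunE /=.
  by case: (i =P k) => [->|_]; lia.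
by rewrite !sum_eqb addn1.
Qed.

Lemma nff_stable d d' m : (edeg m < d)%N -> (edeg m < d')%N -> nff d m = nff d' m.
Proof.
elim: d d' m => // d IH [//|d'] m h1 h2 /=; case: pickP => // k pk.
apply: eq_bigr => j _; congr (_ *: _); have := edeg_step j pk => e.
by apply: IH; lia.
Qed.

Lemma estepC m k l i j : k != l -> (p <= m k)%N -> (p <= m l)%N ->
  estep (estep m k i) l j = estep (estep m l j) k i.
Proof.
move=> kl pk pl; apply/ffunP => a; rewrite !ffunE.
have [->|ak] := eqVneq a k; first by rewrite (negbTE kl); lia.
by have [->|al] := eqVneq a l; lia.
Qed.

(** Confluence, by induction on the degree: if the rewriting starts at another variable [l], the
    steps at [k] and [l] commute by [estepC]. *)
Lemma nf_step m k : (p <= m k)%N -> nf m = \sum_j A k j *: nf (estep m k j).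
Proof.
move: {-1}(edeg m) (leqnn (edeg m)) => d; elim: d m k => [|d IH] m k md pk.
  by have := edeg_step k pk; lia.
rewrite {1}/nf /=; case: pickP => [l pl|/(_ k)]; last by rewrite pk.
have e1 : \sum_j A l j *: nff (edeg m) (estep m l j) = \sum_j A l j *: nf (estep m l j).
  apply: eq_bigr => j _; congr (_ *: _); apply: nff_stable => //.
  by have := edeg_step j pl; lia.
rewrite {}e1; have [->//|kl] := eqVneq k l.
have h1 j : nf (estep m l j) = \sum_i A k i *: nf (estep (estep m l j) k i).
  apply: IH; first by have := edeg_step j pl; lia.
  by rewrite ffunE (negbTE kl); lia.
have h2 j : nf (estep m k j) = \sum_i A l i *: nf (estep (estep m k j) l i).
  apply: IH; first by have := edeg_step j pk; lia.
  by rewrite ffunE eq_sym (negbTE kl); lia.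
transitivity (\sum_j \sum_i (A l j * A k i) *: nf (estep (estep m l j) k i)).
  by apply: eq_bigr => j _; rewrite h1 scaler_sumr; apply: eq_bigr => i _; rewrite scalerA.
transitivity (\sum_j \sum_i (A k j * A l i) *: nf (estep (estep m k j) l i)); last first.
  by apply: eq_bigr => j _; rewrite h2 scaler_sumr; apply: eq_bigr => i _; rewrite scalerA.
rewrite exchange_big; apply: eq_bigr => i _; apply: eq_bigr => j _.
by rewrite mulrC (estepC _ _ kl).
Qed.

Definition reduced m := [forall k, m k < p]%N.

Lemma nf_reduced m : reduced m -> nf m = delta_exp m.
Proof.
move/forallP => h; rewrite /nf /=; case: pickP => // k pk.
by have := h k; lia.
Qed.

Lemma reduced_mon al : reduced (mon al).
Proof. by apply/forallP => k; rewrite ffunE; apply: ltn_ord. Qed.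

Lemma mon_inj : injective mon.
Proof.
by move=> a b /ffunP e; apply/ffunP => k; apply: val_inj; have := e k; rewrite !ffunE.
Qed.

Lemma reducedP m : reduced m -> exists al, m = mon al.
Proof.
move/forallP => h; exists [ffun k => Ordinal (h k)].
by apply/ffunP => k; rewrite !ffunE.
Qed.

Lemma nf_monE al be : nf (mon al) be = (be == al)%:R.
Proof. by rewrite nf_reduced ?reduced_mon // ffunE (inj_eq mon_inj). Qed.

Lemma ffun_sumE (I : finType) (c : I -> R) (G : I -> F) al :
  (\sum_i c i *: G i) al = \sum_i c i * G i al.
Proof. by rewrite sum_ffunE; apply: eq_bigr => i _; rewrite ffunE. Qed.

Lemma addalg_expand f : f = \sum_al f al *: nf (mon al).
Proof.
apply/ffunP => be; rewrite ffun_sumE (bigD1 be) //= nf_monE eqxx mulr1 big1 ?addr0 //.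
by move=> al ab; rewrite nf_monE eq_sym (negbTE ab) mulr0.
Qed.

Lemma nf_ind (Q : mexp -> Prop) : (forall al, Q (mon al)) ->
  (forall m k, (p <= m k)%N -> (forall j, Q (estep m k j)) -> Q m) -> forall m, Q m.
Proof.
move=> h1 h2 m; move: {-1}(edeg m) (leqnn (edeg m)) => d.
elim: d m => [|d IH] m md; have [/reducedP[al ->] //|] := boolP (reduced m);
  rewrite negb_forall => /existsP[k]; rewrite -leqNgt => pk; apply: (h2 m k pk) => j.
  by have := edeg_step k pk; lia.
by apply: IH; have := edeg_step j pk; lia.
Qed.

Definition addalg_mul f g : F :=
  \sum_al \sum_be (f al * g be) *: nf (emul (mon al) (mon be)).

Lemma emulC m m' : emul m m' = emul m' m.
Proof. by apply/ffunP => k; rewrite !ffunE addnC. Qed.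
Lemma emulA m m' m'' : emul m (emul m' m'') = emul (emul m m') m''.
Proof. by apply/ffunP => k; rewrite !ffunE addnA. Qed.
Lemma emul1 m : emul eone m = m.
Proof. by apply/ffunP => k; rewrite !ffunE add0n. Qed.

Fact addalg_mulC : commutative addalg_mul.
Proof.
move=> f g; rewrite /addalg_mul exchange_big; apply: eq_bigr => al _.
by apply: eq_bigr => be _; rewrite mulrC emulC.
Qed.

Fact addalg_mulL a f f' g :
  addalg_mul (a *: f + f') g = a *: addalg_mul f g + addalg_mul f' g.
Proof.
rewrite /addalg_mul scaler_sumr -big_split; apply: eq_bigr => al _.
rewrite scaler_sumr -big_split; apply: eq_bigr => be _.
transitivity ((a * (f al * g be) + f' al * g be) *: nf (emul (mon al) (mon be))).
  by rewrite !ffunE [in RHS]mulrA -mulrDl.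
by rewrite scalerDl scalerA.
Qed.

Lemma lin_ext (h1 h2 : F -> F) :
  (forall a f f', h1 (a *: f + f') = a *: h1 f + h1 f') ->
  (forall a f f', h2 (a *: f + f') = a *: h2 f + h2 f') ->
  (forall m, h1 (nf m) = h2 (nf m)) -> h1 =1 h2.
Proof.
move=> l1 l2 e f; rewrite (addalg_expand f) (lin_sum l1) (lin_sum l2).
by apply: eq_bigr => al _; rewrite e.
Qed.

(** Multiplication commutes with rewriting either factor, which reduces the claim to reduced
    monomials. Associativity thereby becomes that of the addition of exponents. *)
Lemma addalg_mul_nf m m' : addalg_mul (nf m) (nf m') = nf (emul m m').
Proof.
have base al be : addalg_mul (nf (mon al)) (nf (mon be)) = nf (emul (mon al) (mon be)).
  rewrite /addalg_mul (bigD1 al) //= (bigD1 be) //= !nf_monE !eqxx mulr1 scale1r.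
  rewrite !big1 ?addr0 // => [a /negbTE ab|a /negbTE ab].
    by rewrite big1 // => b _; rewrite !nf_monE ab mul0r scale0r.
  by rewrite !nf_monE ab mulr0 scale0r.
have step m1 m2 k : (p <= m1 k)%N ->
   nf (emul m1 m2) = \sum_j A k j *: nf (emul (estep m1 k j) m2).
  move=> pk; rewrite (@nf_step _ k) ?ffunE; last by lia.
  apply: eq_bigr => j _; congr (_ *: nf _); apply/ffunP => i; rewrite !ffunE.
  by case: (i =P k) => [->|_]; lia.
have lin (g : F) : linear (addalg_mul^~ g) by move=> a f f'; apply: addalg_mulL.
elim/nf_ind: m m' => [al m'|m k pk IH m']; last first.
  rewrite (step _ _ _ pk) (nf_step pk) (lin_sum (lin _)).
  by apply: eq_bigr => j _; rewrite IH.
elim/nf_ind: m' => [be|m k pk IH]; first exact: base.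
rewrite emulC (step _ _ _ pk) (nf_step pk) addalg_mulC (lin_sum (lin _)).
by apply: eq_bigr => j _; rewrite addalg_mulC IH emulC.
Qed.

Fact addalg_mulA : associative addalg_mul.
Proof.
move=> f g h.
apply: (lin_ext (h1 := fun f => addalg_mul f (addalg_mul g h))
  (h2 := fun f => addalg_mul (addalg_mul f g) h)) => [a u v|a u v|m].
- exact: addalg_mulL.
- by rewrite !addalg_mulL.
rewrite [addalg_mul (nf m) (addalg_mul _ _)]addalg_mulC [addalg_mul (nf m) g]addalg_mulC.
apply: (lin_ext (h1 := fun g => addalg_mul (addalg_mul g h) (nf m))
  (h2 := fun g => addalg_mul (addalg_mul g (nf m)) h)) => [a u v|a u v|m'].
- by rewrite !addalg_mulL.
- by rewrite !addalg_mulL.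
rewrite [addalg_mul (nf m') h]addalg_mulC [addalg_mul (addalg_mul _ _) h]addalg_mulC.
apply: (lin_ext (h1 := fun h => addalg_mul (addalg_mul h (nf m')) (nf m))
  (h2 := fun h => addalg_mul h (addalg_mul (nf m') (nf m)))) => [a u v|a u v|m''].
- by rewrite !addalg_mulL.
- by rewrite !addalg_mulL.
by rewrite !addalg_mul_nf emulA.
Qed.

Fact addalg_mul1 : left_id (nf eone) addalg_mul.
Proof.
move=> f; rewrite addalg_mulC.
apply: (lin_ext (h1 := fun f => addalg_mul f (nf eone)) (h2 := id)) => [a u v|//|m].
  exact: addalg_mulL.
by rewrite addalg_mulC addalg_mul_nf emul1.
Qed.

Fact addalg_mulD : left_distributive addalg_mul +%R.
Proof. by move=> f f' g; have := addalg_mulL 1 f f' g; rewrite !scale1r. Qed.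

Definition addalg : Type := F.
HB.instance Definition _ := GRing.Lmodule.on addalg.
HB.instance Definition _ := GRing.Zmodule_isComPzRing.Build addalg
  addalg_mulA addalg_mulC addalg_mul1 addalg_mulD.

Definition addalg_ring : comPzRingType := addalg.

Definition nfa m : addalg := nf m.

Lemma nfaM m m' : nfa m * nfa m' = nfa (emul m m').
Proof. exact: addalg_mul_nf. Qed.

Lemma addalg_scaleAl a (f g : addalg) : a *: f * g = a *: (f * g).
Proof.
have := addalg_mulL a f (0 : F) g; rewrite addr0 => h.
by rewrite -[LHS]/(addalg_mul (a *: (f : F)) g) h -[addalg_mul 0 g]/((0 : addalg) * g) mul0r addr0.
Qed.

Let emb a : addalg := a *: (1 : addalg).
Let embD a b : emb (a + b) = emb a + emb b. Proof. exact: scalerDl. Qed.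
Let embM a b : emb (a * b) = emb a * emb b.
Proof. by rewrite /emb addalg_scaleAl mul1r scalerA. Qed.
Let emb1 : emb 1 = 1. Proof. exact: scale1r. Qed.
Definition addalg_in : {rmorphism R -> addalg} := mkrm embD emb1 embM.

Lemma addalg_inE a (f : addalg) : addalg_in a * f = a *: f.
Proof. by rewrite mkrmE /emb addalg_scaleAl mul1r. Qed.

Definition addalg_X k : addalg := nfa (evar k).

Lemma nfa_prod m : nfa m = \prod_k addalg_X k ^+ m k.
Proof.
have h (s : seq V) : uniq s ->
    nfa [ffun i => (i \in s) * m i]%N = \prod_(k <- s) addalg_X k ^+ m k.
  elim: s => [_|k s IH /= /andP[ks us]].
    by rewrite big_nil; congr nf; apply/ffunP => i; rewrite !ffunE.
  rewrite big_cons -IH //.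
  have -> c : addalg_X k ^+ c = nfa [ffun i => (i == k) * c]%N.
    elim: c => [|c IHc]; first by congr nf; apply/ffunP => i; rewrite !ffunE muln0.
    rewrite exprS IHc nfaM; congr nfa; apply/ffunP => i; rewrite !ffunE mulnS.
    by [].
  rewrite nfaM; congr nfa; apply/ffunP => i; rewrite !ffunE inE.
  by have [->|_] := eqVneq i k; rewrite ?(negbTE ks) /= ?mul1n ?mul0n ?addn0.
rewrite -big_enum -h ?enum_uniq //; congr nfa; apply/ffunP => i.
by rewrite ffunE mem_enum mul1n.
Qed.

Lemma nfa_step m k : (p <= m k)%N -> nfa m = \sum_j A k j *: nfa (estep m k j).
Proof. exact: nf_step. Qed.

Lemma addalg_rel k : addalg_X k ^+ p = \sum_j addalg_in (A k j) * addalg_X j.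
Proof.
have -> : addalg_X k ^+ p = nfa [ffun i => (p * (i == k))%N].
  rewrite nfa_prod (bigD1 k) //= ffunE eqxx muln1 big1 ?mulr1 // => i /negbTE ik.
  by rewrite ffunE ik muln0.
rewrite (@nfa_step _ k) ?ffunE ?eqxx ?muln1 //; apply: eq_bigr => j _.
rewrite addalg_inE; congr (_ *: nfa _); apply/ffunP => i; rewrite !ffunE.
by case: (i == k); lia.
Qed.

Lemma addalg_expandE (f : addalg) : f = \sum_al nfa (mon al) * addalg_in (f al).
Proof.
rewrite [LHS]addalg_expand; apply: eq_bigr => al _.
by rewrite mulrC addalg_inE.
Qed.

Lemma addalg_nf_monE al be : nfa (mon al) be = (be == al)%:R.
Proof. exact: nf_monE. Qed.

Lemma addalg_finite_dual :
  finite_dual addalg_in (fun al (f : addalg) => f al : R) (fun al => nfa (mon al)).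
Proof.
split=> [al f g|al r f|f]; first by rewrite ffunE.
  by rewrite addalg_inE ffunE.
exact: addalg_expandE.
Qed.

Section Eval.
Variables (B : comPzRingType) (g : {rmorphism R -> B}) (b : V -> B).
Hypothesis rel : forall k, b k ^+ p = \sum_j g (A k j) * b j.

Let bm m := \prod_k b k ^+ m k.
Let e (f : addalg) : B := \sum_al g (f al) * bm (mon al).

Let eL a (f f' : F) : e (a *: f + f') = g a *: (e f : B^o) + e f'.
Proof.
rewrite -[g a *: _]/(g a * e f) /e mulr_sumr -big_split; apply: eq_bigr => al _.
have -> : (a *: f + f') al = a * f al + f' al by rewrite !ffunE.
by rewrite rmorphD rmorphM mulrDl mulrA.
Qed.

Let eZ a (f : F) : e (a *: f) = g a * e f.
Proof.
exact: (@semiZ R B g F B^o e eL).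
Qed.

Let eS (I : finType) (c : I -> R) (G : I -> F) : e (\sum_i c i *: G i) = \sum_i g (c i) * e (G i).
Proof. exact: (@semi_lin R B g F B^o e eL). Qed.

Let bmM m m' : bm (emul m m') = bm m * bm m'.
Proof. by rewrite /bm -big_split; apply: eq_bigr => k _; rewrite ffunE exprD. Qed.

(** By [rel] a rewriting step does not change the value, so evaluation may be computed on monomials
    before reduction. *)
Let e_nf m : e (nf m) = bm m.
Proof.
elim/nf_ind: m => [al|m k pk IH].
  rewrite /e (bigD1 al) //= nf_monE eqxx rmorph1 mul1r big1 ?addr0 // => be /negbTE ba.
  by rewrite nf_monE ba rmorph0 mul0r.
rewrite (nf_step pk) eS.
pose m0 : mexp := [ffun i => (m i - p * (i == k))%N].
have -> : bm m = bm m0 * b k ^+ p.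
  have -> : m = emul m0 [ffun i => (p * (i == k))%N].
    by apply/ffunP => i; rewrite !ffunE; case: (i =P k) => [->|_]; lia.
  rewrite bmM; congr (_ * _).
  rewrite /bm (bigD1 k) //= ffunE eqxx muln1 big1 ?mulr1 // => i /negbTE ik.
  by rewrite ffunE ik muln0.
rewrite rel mulr_sumr; apply: eq_bigr => j _; rewrite IH mulrCA; congr (_ * _).
have -> : estep m k j = emul m0 (evar j).
  by apply/ffunP => i; rewrite !ffunE.
rewrite bmM; congr (_ * _).
rewrite /bm (bigD1 j) //= ffunE eqxx expr1 big1 ?mulr1 // => i /negbTE ij.
by rewrite ffunE ij.
Qed.

Lemma addalg_ev : exists h : {rmorphism addalg -> B},
  [/\ forall r, h (addalg_in r) = g r, forall k, h (addalg_X k) = b k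
    & forall f, h f = \sum_al g (f al) * \prod_k b k ^+ mon al k].
Proof.
have hD (f f' : addalg) : e (f + f') = e f + e f'.
  by have := eL 1 f f'; rewrite rmorph1 !scale1r.
have h1 : e 1 = 1.
  by rewrite [LHS](e_nf eone) /bm big1 // => k _; rewrite ffunE.
have hM (f f' : addalg) : e (f * f') = e f * e f'.
  rewrite -[f * f']/(addalg_mul f f') /addalg_mul pair_bigA.
  under eq_bigr => ij _ do [].
  rewrite (eS (fun ij : redexp * redexp => f ij.1 * f' ij.2)
    (fun ij => nf (emul (mon ij.1) (mon ij.2)))).
  rewrite -(pair_bigA _ (fun i j => g (f i * f' j) * e (nf (emul (mon i) (mon j))))) /=.
  rewrite {2}/e mulr_suml; apply: eq_bigr => al _.
  rewrite /e mulr_sumr; apply: eq_bigr => be _.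
  by rewrite -/(e _) e_nf bmM rmorphM; ring.
exists (mkrm hD h1 hM); split=> // [r|k]; rewrite mkrmE.
  by rewrite mkrmE /emb eZ h1 mulr1.
rewrite [LHS]e_nf /bm (bigD1 k) //= ffunE eqxx expr1 big1 ?mulr1 // => i /negbTE ik.
by rewrite ffunE ik.
Qed.
End Eval.

Lemma addalg_presented : presented addalg_in.
Proof.
pose h k : term R V := TD (tpow (TV k) p)
  (TN (tsum [seq TM (TC (A k j)) (TV j) | j <- enum V])).
have hE (B : comPzRingType) (g : {rmorphism R -> B}) b k :
   teval g b (h k) = b k ^+ p - \sum_j g (A k j) * b j.
  by rewrite /= teval_tpow teval_tsum.
exists V, addalg_X, V, h; split.
- by move=> k; rewrite hE addalg_rel subrr.
- move=> f; pose tm (al : redexp) : term R V :=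
    foldr (@TM R V) (TC 1) [seq tpow (TV k) (mon al k) | k <- enum V].
  have tmE al : teval addalg_in addalg_X (tm al) = nfa (mon al).
    rewrite nfa_prod -big_enum /= /tm; elim: (enum V) => [|k s IH] /=.
      by rewrite big_nil rmorph1.
    by rewrite big_cons IH teval_tpow.
  exists (tsum [seq TM (tm al) (TC (f al)) | al <- enum redexp]).
  rewrite teval_tsum [RHS]addalg_expandE; apply: eq_bigr => al _.
  by rewrite /= tmE.
- move=> B g b hb; have [|e [e1 e2 _]] := @addalg_ev B g b.
    by move=> k; have := hb k; rewrite hE => /eqP; rewrite subr_eq0 => /eqP.
  by exists e.
Qed.
End AdditiveAlgebra.

(** * Direct factors cut out by an idempotent *)

Lemma quotient_presented (U : comPzRingType) (u : U) :
  presented (idq_pi (fun y => y = u)).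
Proof.
exists void, (fun v : void => match v with end), unit, (fun=> TC u); split.
- by move=> _ /=; apply: idq_pi_gen.
- by move=> z; have [x <-] := idq_pi_surj z; exists (TC x).
- move=> B f b h; have [|g gE] := @idq_lift U (fun y => y = u) B f.
    by move=> _ ->; apply: (h tt).
  by exists g; split=> // -[].
Qed.

(** Multiplication by [e] identifies the quotient by 1 - e with the ideal generated by [e], so the
    functionals of [U] restrict to it. *)
Lemma idempotent_finite_dual (R U : comPzRingType) (phi : {rmorphism R -> U}) (e : U)
    (J : finType) (mu : J -> U -> R) (b : J -> U) :
  e * e = e -> finite_dual phi mu b ->
  exists mu', finite_dual (rcomp (idq_pi (fun y => y = 1 - e)) phi) (J := J) mu'
    (fun j => idq_pi (fun y => y = 1 - e) (b j)).
Proof.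
set E := fun y => _; move=> ee [h1 h2 h3]; have [s sE] := choice (@idq_pi_surj U E).
have ker x : idq_pi E x = 0 -> e * x = 0.
  move/idq_pi0; apply: (span_min (I := fun x => e * x = 0)) => [|_ ->].
    split=> [|x' y hx hy|a x' hx]; first by rewrite mulr0.
      by rewrite mulrDr hx hy addr0.
    by rewrite mulrCA hx mulr0.
  by rewrite mulrBr mulr1 ee subrr.
have eq x y : idq_pi E x = idq_pi E y -> e * x = e * y.
  move=> h; apply/eqP; rewrite -subr_eq0 -mulrBr; apply/eqP/ker.
  by rewrite rmorphB h subrr.
exists (fun j z => mu j (e * s z)); split.
- by move=> j y z; rewrite -h1 -mulrDr; congr mu; apply: eq; rewrite rmorphD !sE.
- move=> j r y; rewrite -h2; congr mu; rewrite mulrCA; apply: eq.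
  by rewrite rmorphM !sE.
- move=> z; rewrite -{1}[z]sE.
  have -> : idq_pi E (s z) = idq_pi E (e * s z).
    apply/eqP; rewrite -subr_eq0 -rmorphB -{1}[s z]mul1r -mulrBl rmorphM.
    by rewrite (idq_pi_gen (E := E)) ?mul0r.
  rewrite {1}[e * s z]h3 rmorph_sum; apply: eq_bigr => j _.
  by rewrite rmorphM.
Qed.

(** * Matrices with zeros prescribed by a preorder *)

Section Patterns.
Variables (R : comPzRingType) (n : nat).
Implicit Types (X Y : 'M[R]_n) (r : rel 'I_n).

Definition pat r X : Prop := forall b a, ~~ r b a -> X b a = 0.

Definition minv X : Prop := exists Y, X *m Y = 1%:M.

Lemma minv_det X : minv X <-> exists d, \det X * d = 1.
Proof.
split=> [[Y /(congr1 determinant)]|[d h]].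
  by rewrite det_mulmx det1; exists (\det Y).
exists (d *: \adj X); rewrite -scalemxAr mul_mx_adj.
by apply/matrixP => i j; rewrite !mxE mulrnAr mulrC h.
Qed.

Lemma minvM X Y : minv X -> minv Y -> minv (X *m Y).
Proof.
move=> [X' hX] [Y' hY]; exists (Y' *m X').
by rewrite mulmxA -(mulmxA X) hY mulmx1.
Qed.

Lemma minvMl X Y : minv (X *m Y) -> minv X.
Proof. by case=> Z h; exists (Y *m Z); rewrite mulmxA. Qed.

Lemma minvK X Y : X *m Y = 1%:M -> minv Y.
Proof. by move/mulmx1C => h; exists X. Qed.

Lemma patM r X Y : transitive r -> pat r X -> pat r Y -> pat r (X *m Y).
Proof.
move=> tr hX hY b a nba; rewrite mxE big1 // => c _.
have [bc|bc] := boolP (r b c); last by rewrite hX ?mul0r.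
have [ca|ca] := boolP (r c a); last by rewrite hY ?mulr0.
by rewrite (tr _ _ _ bc ca) in nba.
Qed.

Lemma patZ r c X : pat r X -> pat r (c *: X).
Proof. by move=> h b a nba; rewrite mxE h ?mulr0. Qed.

Let proj (A : pred 'I_n) : 'M[R]_n := \matrix_(i, j) ((i == j) && A i)%:R.

Let projl A X i j : (proj A *m X) i j = (A i)%:R * X i j.
Proof.
rewrite mxE (bigD1 i) //= big1 => [|k /negbTE ki].
  by rewrite mxE eqxx /= addr0.
by rewrite mxE eq_sym ki mul0r.
Qed.

Let projr A X i j : (X *m proj A) i j = X i j * (A j)%:R.
Proof.
rewrite mxE (bigD1 j) //= big1 => [|k /negbTE ki].
  by rewrite mxE eqxx /= addr0.
by rewrite mxE ki mulr0.
Qed.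

(** The block of [Y] on [f] is a right inverse of the block of [X] on [f], hence also a left
    inverse; this yields f Y = f Y f. *)
Lemma block_inv (e f X Y : 'M[R]_n) : e + f = 1%:M -> e *m e = e -> f *m f = f ->
  e *m f = 0 -> f *m e = 0 -> f *m X *m e = 0 -> X *m Y = 1%:M -> f *m Y *m e = 0.
Proof.
move=> ef ee ff ef0 fe fXe XY.
have fX : f *m X *m f = f *m X.
  by rewrite -[RHS]mulmx1 -ef mulmxDr fXe add0r.
have h0 Z T : (f *m Z *m f + e) *m (f *m T *m f + e) = f *m Z *m f *m (f *m T *m f) + e.
  rewrite mulmxDl 2!mulmxDr ee -[f *m Z *m f *m e]mulmxA fe mulmx0 addr0.
  by rewrite -[f *m T *m f]mulmxA [e *m (f *m _)]mulmxA ef0 mul0mx add0r.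
have h1 : (f *m X *m f + e) *m (f *m Y *m f + e) = 1%:M.
  rewrite h0 fX -mulmxA (mulmxA X) (mulmxA X) -(mulmxA (X *m f)).
  rewrite 3!mulmxA fX -(mulmxA f X Y) XY mulmx1 ff.
  by rewrite addrC.
have h2 : f *m Y *m f *m (f *m X *m f) = f.
  by apply: (@addIr _ e); rewrite -h0 (mulmx1C h1) addrC ef.
have -> : f *m Y = f *m Y *m f.
  rewrite -{1}h2 fX -mulmxA -(mulmxA f X Y) XY mulmx1 -(mulmxA _ f f) ff.
  by [].
by rewrite -mulmxA fe mulmx0.
Qed.

(** For a fixed column [a], transitivity makes [X] block triangular for the partition into the [i]
    with [r i a] and the others; the entry [Y b a] lies in the block that must vanish. *)
Lemma pat_inv r X Y : reflexive r -> transitive r -> pat r X ->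
  X *m Y = 1%:M -> pat r Y.
Proof.
move=> rr tr hX XY b a nba; have YX := mulmx1C XY.
pose A := [pred i | r i a]; pose e := proj A; pose f := proj (predC A).
have fXe : f *m X *m e = 0.
  apply/matrixP => i j; rewrite projr projl mxE.
  have [rj|/negbTE rj] := boolP (r j a); rewrite /= ?rj ?mulr0 //.
  have [ri|ri] := boolP (r i a); rewrite /= ?ri /= ?mul0r //.
  rewrite mul1r hX ?mul0r //.
  by apply: contra ri => ij; apply: tr ij rj.
have ef : e + f = 1%:M.
  apply/matrixP => i j; rewrite !mxE /=.
  by case: (i == j); case: (r i a); rewrite /= ?addr0 ?add0r.
have ee : e *m e = e.
  by apply/matrixP => i j; rewrite projl !mxE /= ; case: (r i a); rewrite ?andbT ?andbF /= ?mul1r ?mulr0.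
have ff : f *m f = f.
  by apply/matrixP => i j; rewrite projl !mxE /= ; case: (r i a); rewrite ?andbT ?andbF /= ?mul1r ?mulr0.
have fe : f *m e = 0.
  by apply/matrixP => i j; rewrite projl !mxE /=; case: (r i a); rewrite ?andbF ?mul0r ?mulr0.
have ef0 : e *m f = 0.
  by apply/matrixP => i j; rewrite projl !mxE /=; case: (r i a); rewrite ?andbF ?mul0r ?mulr0.
have h7 : f *m Y *m e = 0 by apply: (block_inv ef ee ff ef0 fe fXe XY).
have := congr1 (fun Z : 'M[R]_n => Z b a) h7.
by rewrite projr projl mxE /= rr nba mul1r mulr1.
Qed.

(** The sum of the levels is invariant under a permutation, so a permutation that does not preserve
    them raises some level, and its term in the expansion vanishes. *)
Lemma det_level (l : 'I_n -> nat) X : (forall b a, (l a < l b)%N -> X b a = 0) ->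
  \det X = \det (\matrix_(i, j) if l i == l j then X i j else 0).
Proof.
move=> h; rewrite -det_tr -[RHS]det_tr; apply: eq_bigr => s _; congr (_ * _).
have [/forallP hs|] := boolP [forall i, l (s i) == l i].
  by apply: eq_bigr => i _; rewrite !mxE (eqP (hs i)) eqxx.
rewrite negb_forall => /existsP[i0 h0].
rewrite [RHS](bigD1 i0) //= !mxE (negbTE h0) mul0r.
have [i hi] : exists i, (l i < l (s i))%N.
  apply: contrapT => no.
  have le i : (l (s i) <= l i)%N by rewrite leqNgt; apply/negP => lt; apply: no; exists i.
  have : (\sum_i l (s i) < \sum_i l i)%N.
    rewrite [X in (X < _)%N](bigD1 i0) // [X in (_ < X)%N](bigD1 i0) //= -addSn.
    by apply: leq_add; [rewrite ltn_neqAle h0 le|apply: leq_sum].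
  rewrite [X in (_ < X)%N](reindex_inj (perm_inj (s := s))) ltnn //.
by rewrite (bigD1 i) //= !mxE h ?mul0r.
Qed.

(** The block of [X] on [S], completed by the identity so as to keep the size [n]. *)
Definition maskm (S : pred 'I_n) X : 'M[R]_n :=
  \matrix_(i, j) if S i && S j then X i j else (i == j)%:R.

Lemma maskm_sum (S : pred 'I_n) X i (F : 'I_n -> R) : S i -> (forall j, ~~ S j -> F j = 0) ->
  \sum_j maskm S X i j * F j = \sum_j X i j * F j.
Proof.
move=> Si F0; apply: eq_bigr => j _; rewrite mxE Si /=.
by have [//|/F0->] := boolP (S j); rewrite !mulr0.
Qed.
End Patterns.

Lemma minv_map (R R' : comPzRingType) (f : {rmorphism R -> R'}) n (X : 'M[R]_n) :
  minv X -> minv (map_mx f X).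
Proof. by case=> Y h; exists (map_mx f Y); rewrite -map_mxM h map_mx1. Qed.

Lemma pat_map (R R' : comPzRingType) (f : {rmorphism R -> R'}) n r (X : 'M[R]_n) :
  pat r X -> pat r (map_mx f X).
Proof. by move=> h b a nba; rewrite mxE h ?rmorph0. Qed.

Lemma minv_field (K : fieldType) n (X : 'M[K]_n) : minv X <-> \det X != 0.
Proof.
rewrite minv_det; split=> [[d h]|h]; last by exists (\det X)^-1; rewrite divff.
by apply/eqP => e; move/eqP: h; rewrite e mul0r eq_sym oner_eq0.
Qed.

Lemma common_denominator (B : comPzRingType) (K : fieldType) (x : {rmorphism B -> K})
    (frac : forall z, exists a b, x b != 0 /\ z * x b = x a) (I : finType) (z : I -> K) :
  exists b, x b != 0 /\ exists a : I -> B, forall i, z i * x b = x (a i).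
Proof.
have [a h1] := choice (fun i => frac (z i)); have [b h2] := choice h1.
exists (\prod_i b i); split.
  by rewrite rmorph_prod; apply/prodf_neq0 => i _; case: (h2 i).
exists (fun i => a i * \prod_(j | j != i) b j) => i.
rewrite [\prod_j b j](bigD1 i) //= [in LHS]rmorphM [in RHS]rmorphM mulrA.
by case: (h2 i) => _ ->.
Qed.

(* At a point where the two flags are in the position given by the preorders [rc]
   and [rl], this position is near the point a closed condition: the Schur
   complements of the pivots on [S a] vanish. *)
Section TwoFlags.
Variables (n : nat) (rc rl : rel 'I_n).
Hypotheses (rcr : reflexive rc) (rct : transitive rc)
  (rlr : reflexive rl) (rlt : transitive rl).

Definition in_position (R : comPzRingType) (G : 'M[R]_n) : Prop :=
  exists p q : 'M[R]_n,
    [/\ pat rc p, pat rl q, minv p, minv q & G *m q = p].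

Variables (B : comPzRingType) (K : fieldType) (x : {rmorphism B -> K}) (G : 'M[B]_n).
Hypothesis frac : forall z, exists a b, x b != 0 /\ z * x b = x a.
Hypothesis posK : in_position (map_mx x G).

(** Column operations allowed by [rl] may add the column [e] to the column [a] when [rl e a]; the
    rows [e] with [rc e a] need no clearing. The pivots for the column [a] are the remaining
    indices. *)
Let S (a : 'I_n) : pred 'I_n := [pred e | rl e a && ~~ rc e a].

Lemma two_flags : exists (r : B) (E : B -> Prop), x r != 0 /\
  forall (R' : comPzRingType) (phi : {rmorphism B -> R'}), (exists b, phi r * b = 1) ->
    (in_position (map_mx phi G) -> forall e, E e -> phi e = 0) /\
    ((forall e, E e -> phi e = 0) -> in_position (map_mx phi G)).
Proof.
have [p0 [q0 [hp0 hq0 ip0 iq0 e0]]] := posK.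
have [b0 [b0n [lft lftE]]] := common_denominator frac
  (fun i : ('I_n * 'I_n) + ('I_n * 'I_n) => match i with inl i => p0 i.1 i.2 | inr i => q0 i.1 i.2 end).
pose P : 'M[B]_n := \matrix_(i, j) if rc i j then lft (inl (i, j)) else 0.
pose Q : 'M[B]_n := \matrix_(i, j) if rl i j then lft (inr (i, j)) else 0.
have hP : pat rc P by move=> i j /negbTE h; rewrite mxE h.
have hQ : pat rl Q by move=> i j /negbTE h; rewrite mxE h.
have xP : map_mx x P = x b0 *: p0.
  apply/matrixP => i j; rewrite !mxE; have [h|h] := boolP (rc i j).
    by rewrite -(lftE (inl (i, j))) mulrC.
  by rewrite hp0 // rmorph0 mulr0.
have xQ : map_mx x Q = x b0 *: q0.
  apply/matrixP => i j; rewrite !mxE; have [h|h] := boolP (rl i j).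
    by rewrite -(lftE (inr (i, j))) mulrC.
  by rewrite hq0 // rmorph0 mulr0.
pose dl := \det P.
have dlx : x dl != 0.
  by rewrite -det_map_mx xP detZ mulf_neq0 ?expf_neq0 //; apply/minv_field.
have dQx : x (\det Q) != 0.
  by rewrite -det_map_mx xQ detZ mulf_neq0 ?expf_neq0 //; apply/minv_field.
(* Multiplication by the lifts of [p0] and [q0] normalizes [G]: at [x] the result is a nonzero
   scalar matrix, so all pivot minors are nonzero there. *)
have [G1 G1d] : exists G1, G1 = \adj P *m G *m Q by exists (\adj P *m G *m Q).
have xG1 : map_mx x G1 = (x dl)%:M.
  rewrite G1d !map_mxM map_mx_adj xQ -mulmxA -scalemxAr e0 -xP mul_adj_mx.
  by rewrite det_map_mx.
pose H a := maskm (S a) G1; pose D a := \det (H a).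
have Sa a : ~~ S a a by rewrite /S /= rcr andbF.
have diag_det (X : 'M[K]_n) (d : 'I_n -> K) : (forall i j, X i j = if i == j then d i else 0) ->
    (forall i, d i != 0) -> \det X != 0.
  move=> h dn; have -> : X = diag_mx (\row_i d i).
    by apply/matrixP => i j; rewrite h !mxE; case: eqP => [->|]; rewrite ?mulr1n ?mulr0n.
  by rewrite det_diag; apply/prodf_neq0 => i _; rewrite mxE.
have G1E i j : x (G1 i j) = if i == j then x dl else 0.
  have := congr1 (fun Z : 'M[K]_n => Z i j) xG1; rewrite !mxE => ->.
  by case: eqP; rewrite ?mulr1n ?mulr0n.
have Dx a : x (D a) != 0.
  rewrite -det_map_mx; apply: (diag_det _ (fun i => if S a i then x dl else 1)).
    move=> i j; rewrite !mxE; have [->|ij] := eqVneq i j.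
      by rewrite andbb; case: ifP => _; rewrite ?G1E ?eqxx ?rmorph1.
    by case: ifP => _; rewrite ?G1E ?(negbTE ij) ?rmorph0.
  by move=> i; case: ifP; rewrite ?oner_neq0.
(* Cramer's rule: the column [a] of [q1] is [D a] times the basis vector plus the combination on
   [S a] that clears the rows of [S a] in [G1 *m q1]. *)
pose q1 : 'M[B]_n := \matrix_(e, a) if e == a then D a
  else if S a e then - \sum_f \adj (H a) e f * (if S a f then G1 f a else 0) else 0.
have hq1 : pat rl q1.
  move=> e a nr; rewrite mxE; case: eqP => [ea|_]; first by rewrite ea rlr in nr.
  by rewrite /S /= (negbTE nr).
pose p1 := G1 *m q1.
have p1S a b : S a b -> p1 b a = 0.
  move=> Sb; rewrite mxE (bigD1 a) //= [q1 a a]mxE eqxx.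
  have -> : \sum_(e < n | e != a) G1 b e * q1 e a =
     - \sum_e G1 b e * (if S a e then \sum_f \adj (H a) e f * (if S a f then G1 f a else 0) else 0).
    rewrite [in RHS](bigD1 a) //= -/(S a a) (negbTE (Sa a)) mulr0 add0r -sumrN.
    apply: eq_bigr => e ea; rewrite mxE (negbTE ea).
    by case: ifP => _; rewrite ?mulrN ?mulr0 ?oppr0.
  rewrite -(@maskm_sum _ _ (S a)) //; last by move=> j /negbTE->.
  pose v : 'cV[B]_n := \col_f (if S a f then G1 f a else 0).
  have adjv e : ~~ S a e -> \sum_f \adj (H a) e f * v f 0 = 0.
    move=> nS; have : (H a *m (\adj (H a) *m v)) e 0 = 0.
      by rewrite mulmxA mul_mx_adj mul_scalar_mx !mxE (negbTE nS) mulr0.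
    rewrite mxE (bigD1 e) //= big1 => [|j /negbTE je].
      by rewrite mxE (negbTE nS) eqxx mul1r addr0 mxE.
    by rewrite mxE (negbTE nS) eq_sym je mul0r.
  have : (H a *m (\adj (H a) *m v)) b 0 = D a * G1 b a.
    by rewrite mulmxA mul_mx_adj mul_scalar_mx !mxE Sb.
  rewrite mxE => h; rewrite [X in _ - X](_ : _ = D a * G1 b a); last first.
    rewrite -h; apply: eq_bigr => e _; congr (_ * _); rewrite mxE.
    have [_|nS] := boolP (S a e); last by rewrite adjv.
    by apply: eq_bigr => f _; rewrite [v f 0]mxE.
  by rewrite mulrC subrr.
have q1x : x (\det q1) != 0.
  rewrite -det_map_mx; apply: (diag_det _ (fun i => x (D i))) => // i j.
  rewrite !mxE; case: eqP => [->//|_]; case: ifP => _; last by rewrite rmorph0.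
  rewrite rmorphN rmorph_sum big1 ?oppr0 // => f _; rewrite rmorphM.
  have [->|fj] := eqVneq f j; first by rewrite (negbTE (Sa j)) rmorph0 mulr0.
  by case: ifP => _; rewrite ?rmorph0 ?mulr0 // G1E (negbTE fj) mulr0.
have G1x : x (\det G1) != 0.
  by rewrite -det_map_mx xG1 det_scalar expf_neq0.
(* All determinants used are inverted. The equations are the entries of [p1] outside the pattern
   [rc]; those in the rows of [S a] already vanish identically. *)
exists (dl * \det Q * \det G1 * \det q1 * \prod_a D a),
  (fun e => exists a b, ~~ rc b a /\ e = p1 b a); split.
  by rewrite !rmorphM !mulf_neq0 // rmorph_prod; apply/prodf_neq0.
move=> R' phi [b]; rewrite !rmorphM rmorph_prod => bE.
have iP : minv (map_mx phi P).
  rewrite minv_det det_map_mx; exists (phi (\det Q) * phi (\det G1) * phi (\det q1) * \prod_a phi (D a) * b).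
  by rewrite -[RHS]bE /dl; ring.
have iQ : minv (map_mx phi Q).
  rewrite minv_det det_map_mx; exists (phi dl * phi (\det G1) * phi (\det q1) * \prod_a phi (D a) * b).
  by rewrite -[RHS]bE /dl; ring.
have iG1 : minv (map_mx phi G1).
  rewrite minv_det det_map_mx; exists (phi dl * phi (\det Q) * phi (\det q1) * \prod_a phi (D a) * b).
  by rewrite -[RHS]bE /dl; ring.
have iq1 : minv (map_mx phi q1).
  rewrite minv_det det_map_mx; exists (phi dl * phi (\det Q) * phi (\det G1) * \prod_a phi (D a) * b).
  by rewrite -[RHS]bE /dl; ring.
have iH a : minv (map_mx phi (H a)).
  rewrite minv_det det_map_mx; exists (phi dl * phi (\det Q) * phi (\det G1) * phi (\det q1) *
     \prod_(c | c != a) phi (D c) * b).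
  by rewrite -[RHS]bE [in RHS](bigD1 a) //= /D; ring.
have [Pi PiE] := iP; have [Qi QiE] := iQ.
have hPi : pat rc Pi by apply: pat_inv PiE => //; apply: pat_map.
have hQi : pat rl Qi by apply: pat_inv QiE => //; apply: pat_map.
have adjE : map_mx phi (\adj P) = phi dl *: Pi.
  rewrite -[LHS]mulmx1 -PiE mulmxA map_mx_adj mul_adj_mx mul_scalar_mx.
  by rewrite det_map_mx.
split; last first.
  move=> hE; exists (map_mx phi (P *m p1)), (map_mx phi (dl *: (Q *m q1))); split.
  - rewrite map_mxM; apply: patM => //; first exact: pat_map.
    by move=> i j nij; rewrite mxE; apply: hE; exists j, i.
  - by rewrite map_mxZ map_mxM; apply/patZ/patM => //; apply: pat_map.
  - by rewrite !map_mxM; apply: minvM => //; apply: minvM.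
  - rewrite map_mxZ map_mxM -mul_scalar_mx; apply: minvM; last exact: minvM.
    have [d] : exists d, phi dl * d = 1 by move: iP; rewrite minv_det det_map_mx.
    move=> dE; exists (d%:M); rewrite -scalar_mxM dE.
    by [].
  - rewrite -map_mxM; congr map_mx.
    rewrite -scalemxAr /p1 G1d !mulmxA mul_mx_adj -!mulmxA.
    by rewrite mul_scalar_mx.
case=> p [q [hp hq ip iq eq]] _ [a [b1 [nrc ->]]].
have [p' p'd] : exists p', p' = phi dl *: (Pi *m p) by exists (phi dl *: (Pi *m p)).
have [q' q'd] : exists q', q' = Qi *m q by exists (Qi *m q).
have hp' : pat rc p' by rewrite p'd; apply/patZ/patM.
have hq' : pat rl q' by rewrite q'd; apply: patM.
have e1 : map_mx phi G1 *m q' = p'.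
  rewrite G1d q'd p'd !map_mxM !mulmxA -(mulmxA _ (map_mx phi Q)) QiE mulmx1 adjE.
  by rewrite -!scalemxAl -mulmxA eq.
have [q'i q'iE] : minv q'.
  by rewrite q'd; apply: minvM => //; apply: minvK QiE.
have hq'i : pat rl q'i by apply: pat_inv q'iE.
have G1F : map_mx phi G1 = p' *m q'i by rewrite -e1 -mulmxA q'iE mulmx1.
have Tsub i f : ~~ rc i a -> rc f a -> p' i f = 0.
  by move=> ni rf; apply: hp'; apply: contra ni => /rct; apply.
have Lsub g f : ~~ rl g a -> rl f a -> q'i g f = 0.
  by move=> ng rf; apply: hq'i; apply: contra ng => /rlt; apply.
(* On [S a] the factorization of [G1] into [p'] and [q'i] restricts to blocks, because the other
   indices contribute zero by the two patterns. Since [H a] is invertible, so is the block of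
   [p']. *)
have iPS : minv (maskm (S a) p').
  apply: (@minvMl _ _ _ (maskm (S a) q'i)).
  suff -> : maskm (S a) p' *m maskm (S a) q'i = map_mx phi (H a) by [].
  apply/matrixP => i j; rewrite [LHS]mxE.
  have [Si|nSi] := boolP (S a i); last first.
    rewrite (bigD1 i) //= !mxE (negbTE nSi) eqxx mul1r /= rmorph_nat big1 ?addr0 // => k /negbTE ki.
    by rewrite mxE (negbTE nSi) /= eq_sym ki mul0r.
  have [Sj|nSj] := boolP (S a j); last first.
    rewrite (bigD1 j) //= !mxE (negbTE nSj) andbF eqxx mulr1 rmorph_nat big1 ?addr0 // => k /negbTE kj.
    by rewrite [maskm _ q'i _ _]mxE (negbTE nSj) andbF kj mulr0.
  rewrite maskm_sum //; last first.
    move=> k nSk; rewrite mxE (negbTE nSk) /=; case: eqP => // kj.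
    by move: nSk; rewrite kj => /negP[].
  have := congr1 (fun Z : 'M[R']_n => Z i j) G1F; rewrite [map_mx phi G1 i j]mxE [RHS]mxE => G1ij.
  rewrite 2![in RHS]mxE Si Sj /= G1ij.
  apply: eq_bigr => k _; rewrite [maskm _ _ k j]mxE Sj andbT; case: ifP => // /negbT.
  have /andP[li ci] := Si; have /andP[lj cj] := Sj.
  rewrite negb_and negbK => /orP[nl|ck]; last by rewrite (Tsub _ _ ci ck) !mul0r.
  rewrite (Lsub _ _ nl lj); case: eqP => // kj.
  by rewrite kj lj in nl.
have [y' y'd] : exists y', y' = q'i *m map_mx phi q1 by exists (q'i *m map_mx phi q1).
have hy' : pat rl y' by rewrite y'd; apply: patM => //; apply: pat_map.
have p1E : map_mx phi p1 = p' *m y'.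
  by rewrite y'd /p1 map_mxM G1F mulmxA.
have p1e i : phi (p1 i a) = \sum_f p' i f * y' f a.
  by have := congr1 (fun Z : 'M[R']_n => Z i a) p1E; rewrite [map_mx phi p1 i a]mxE [RHS]mxE.
pose z : 'cV[R']_n := \col_f (if S a f then y' f a else 0).
(* The invertible block of [p'] sends [z] to the entries of [p1] in the rows of [S a], which vanish
   by construction. *)
have z0 : z = 0.
  have [W /mulmx1C WE] := iPS.
  rewrite -[z]mul1mx -WE -mulmxA (_ : maskm _ _ *m z = 0) ?mulmx0 //.
  apply/matrixP => i j; rewrite mxE [RHS]mxE.
  have [Si|nSi] := boolP (S a i); last first.
    rewrite big1 // => k _; rewrite [maskm _ _ _ _]mxE (negbTE nSi) /=.
    case: eqP => [<-|_]; last by rewrite mul0r.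
    by rewrite [z i j]mxE (negbTE nSi) mulr0.
  rewrite maskm_sum //; last by move=> k /negbTE nSk; rewrite mxE nSk.
  transitivity (phi (p1 i a)); last by rewrite p1S ?rmorph0.
  have /andP[li ci] := Si.
  rewrite p1e; apply: eq_bigr => k _; rewrite mxE; case: ifP => // /negbT.
  rewrite negb_and negbK => /orP[nl|ck]; last by rewrite (Tsub _ _ ci ck) !mul0r.
  by rewrite hy'.
rewrite p1e big1 // => f _.
have [Sf|nSf] := boolP (S a f).
  by have := congr1 (fun Z : 'cV[R']_n => Z f 0) z0; rewrite !mxE Sf => ->; rewrite mulr0.
move: nSf; rewrite negb_and negbK => /orP[nl|ck]; last by rewrite (Tsub _ _ nrc ck) !mul0r.
by rewrite hy' ?mulr0.
Qed.
End TwoFlags.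

(** * Bruhat decomposition of an invertible matrix *)

Section Bruhat.
Variables (K : fieldType) (n : nat) (G : 'M[K]_n) (kap eta : 'I_n -> nat).
Hypotheses (kap_inj : injective kap) (eta_inj : injective eta) (G0 : \det G != 0).

Let lead (v : 'cV[K]_n) f := v f 0 != 0 /\ forall f', (kap f' < kap f)%N -> v f' 0 = 0.

Let lead_ex v : v != 0 -> exists f, lead v f.
Proof.
move=> v0; have [f0 hf0] : exists f, v f 0 != 0.
  apply: contrapT => no; move/eqP: v0; apply; apply/matrixP => i j.
  rewrite ord1 [RHS]mxE; apply/eqP; apply: contrapT => h; apply: no.
  by exists i; apply/negP.
case: (@arg_minnP _ f0 (fun f => v f 0 != 0) kap) => // f vf fmin.
exists f; split=> // f' lt; apply/eqP; apply: contraLR lt => h.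
by rewrite -leqNgt fmin.
Qed.

(* the column [y] of [q] at [b] is chosen with the leading row of [G y] as far
   down as possible, so that different columns have different leading rows *)
Lemma bruhat : exists (q : 'M[K]_n) (s : 'S_n),
  [/\ forall e b, (eta b < eta e)%N -> q e b = 0, forall b, q b b = 1,
      forall f b, (kap f < kap (s b))%N -> (G *m q) f b = 0
    & forall b, (G *m q) (s b) b != 0].
Proof.
pose P b (y : 'cV[K]_n) := y b 0 = 1 /\ forall e, (eta b < eta e)%N -> y e 0 = 0.
have [Gi GiE] : minv G by apply/minv_field.
have P0 b y : P b y -> G *m y != 0.
  case=> yb _; apply/eqP => e; have : y = 0.
    by rewrite -[y]mul1mx -(mulmx1C GiE) -mulmxA e mulmx0.
  by move=> y0; move/eqP: yb; rewrite y0 mxE eq_sym oner_eq0.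
have Pe b : P b (\col_i (i == b)%:R).
  split=> [|e]; rewrite mxE ?eqxx // => lt.
  by case: eqP => // eb; rewrite eb ltnn in lt.
pose ok b f := `[< exists y, P b y /\ lead (G *m y) f >].
have ex b : exists f, ok b f.
  have [f hf] := lead_ex (P0 _ _ (Pe b)).
  by exists f; apply/asboolP; exists (\col_i (i == b)%:R).
have best b : exists fy : 'I_n * 'cV[K]_n, [/\ P b fy.2, lead (G *m fy.2) fy.1
    & forall y f, P b y -> lead (G *m y) f -> (kap f <= kap fy.1)%N].
  have [f0 hf0] := ex b; case: (@arg_maxnP _ f0 (ok b) kap hf0) => f /asboolP[y [Py ly]] fm.
  by exists (f, y); split=> // y' f' Py' ly'; apply: fm; apply/asboolP; exists y'.
have [fy fyE] := fin_all_exists best.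
pose l b := (fy b).1.
(* If an earlier column had the same leading row, subtracting a multiple of it would give an
   admissible column whose leading row is strictly further down. *)
have linj2 b b' : (eta b' < eta b)%N -> l b != l b'.
  move=> lt; apply/eqP => e.
  have [Pb lb mb] := fyE b; have [Pb' lb' mb'] := fyE b'.
  pose t := (G *m (fy b).2) (l b) 0 / (G *m (fy b').2) (l b) 0.
  pose y := (fy b).2 - t *: (fy b').2.
  have Py : P b y.
    have [h1 h2] := Pb; have [h1' h2'] := Pb'; split=> [|i hi].
      by rewrite !mxE h1 h2' ?mulr0 ?subr0.
    by rewrite !mxE h2 // h2' ?mulr0 ?subr0 // (ltn_trans lt).
  have yE i : (G *m y) i 0 = (G *m (fy b).2) i 0 - t * (G *m (fy b').2) i 0.
    by rewrite mulmxBr -scalemxAr mxE; congr (_ + _); rewrite mxE; congr (- _); rewrite mxE.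
  have [f lf] := lead_ex (P0 _ _ Py).
  have := mb _ _ Py lf; rewrite -/(l b) leq_eqVlt => /orP[/eqP/kap_inj fE|lt'].
    case: lf => + _; rewrite fE yE.
    have [nz _] := lb'; rewrite -/(l b') -e in nz.
    by rewrite /t divfK // subrr eqxx.
  case: lf => + _; rewrite yE.
  have [_ z] := lb; have [_ z'] := lb'.
  by rewrite z // z' ?mulr0 ?subr0 ?eqxx // -/(l b') -e.
have linj : injective l.
  move=> b b' e; apply: eta_inj; apply/eqP; rewrite eqn_leq; apply/andP; split;
    rewrite leqNgt; apply/negP => /linj2; rewrite e eqxx //.
exists (\matrix_(i, b) (fy b).2 i 0), (perm linj).
have colE f b : (G *m \matrix_(i, b) (fy b).2 i 0) f b = (G *m (fy b).2) f 0.
  by rewrite !mxE; apply: eq_bigr => i _; rewrite mxE.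
split=> [e b lt|b|f b|b].
- by rewrite mxE; have [[_ h] _ _] := fyE b; apply: h.
- by rewrite mxE; have [[h _] _ _] := fyE b.
- by rewrite colE permE; have [_ [_ h] _] := fyE b; apply: h.
- by rewrite colE permE; have [_ [h _] _] := fyE b.
Qed.
End Bruhat.

(** * Levels: lexicographic orders along the orbits of a permutation *)

(** Both functions enumerate the same multiset in increasing order. *)
Lemma sorted_unique n (f g : 'I_n -> nat) (s : 'S_n) :
  (forall a b : 'I_n, (a < b)%N -> (f a <= f b)%N) ->
  (forall a b : 'I_n, (a < b)%N -> (g a <= g b)%N) ->
  (forall a, g a = f (s a)) -> f =1 g.
Proof.
have srt (h : 'I_n -> nat) : (forall a b : 'I_n, (a < b)%N -> (h a <= h b)%N) ->
    sorted leq [seq h i | i <- enum 'I_n].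
  move=> hh; rewrite sorted_map; apply: (@sub_sorted _ (relpre val ltn)) => [a b|].
    exact: hh.
  by rewrite -sorted_map val_enum_ord iota_ltn_sorted.
move=> /srt sf /srt sg e.
have pe : perm_eq [seq f i | i <- enum 'I_n] [seq g i | i <- enum 'I_n].
  have -> : [seq g i | i <- enum 'I_n] = [seq f i | i <- [seq s i | i <- enum 'I_n]].
    by rewrite (eq_map e) (map_comp f s).
  apply: perm_map; rewrite perm_sym.
  apply: uniq_perm; [|exact: enum_uniq|].
    by rewrite map_inj_uniq ?enum_uniq //; apply: perm_inj.
  move=> a; rewrite mem_enum; apply/mapP; exists ((s^-1)%g a); rewrite ?mem_enum //.
  by rewrite permKV.
have := sorted_eq leq_trans anti_leq sf sg pe => /eq_in_map h a.
by apply: h; rewrite mem_enum.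
Qed.

Lemma rank_perm n (key : 'I_n -> nat) : injective key ->
  exists rho : 'S_n, forall a b, (rho a < rho b)%N = (key a < key b)%N.
Proof.
move=> kinj; pose rk a := #|[set b | (key b < key a)%N]|.
have rk_lt a : (rk a < n)%N.
  rewrite -[X in (_ < X)%N](card_ord n) -cardsT; apply: proper_card.
  by apply/properP; split; [apply: subsetT|exists a; rewrite ?inE ?ltnn].
have rk_mono a b : (key a < key b)%N -> (rk a < rk b)%N.
  move=> ab; apply: proper_card; apply/properP; split.
    by apply/subsetP => c; rewrite !inE => h; apply: ltn_trans ab.
  by exists a; rewrite !inE ?ltnn.
have inj : injective (fun a => Ordinal (rk_lt a)).
  move=> a b /(congr1 val) /= e; apply: kinj; apply/eqP; rewrite eqn_leq.
  by apply/andP; split; rewrite leqNgt; apply/negP => /rk_mono; rewrite e ltnn.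
exists (perm inj) => a b; rewrite !permE /=; apply/idP/idP; last exact: rk_mono.
rewrite !ltnNge; apply: contra; rewrite leq_eqVlt => /orP[/eqP/kinj->//|/rk_mono].
exact: ltnW.
Qed.

Section Levels.
Variables (n : nat) (dl : 'I_n -> nat) (B : nat).
Hypothesis dlB : forall a, (dl a < B)%N.
Hypothesis dl_mono : forall a b : 'I_n, (a < b)%N -> (dl a <= dl b)%N.
Implicit Types (pi s : 'S_n).

Lemma lex_le x y u v D : (u < D)%N -> (v < D)%N ->
  (x * D + u <= y * D + v)%N = (x < y)%N || ((x == y) && (u <= v)%N).
Proof. by move=> uD vD; case: (ltngtP x y) => [h|h|->] /=; nia. Qed.

Lemma lex_eq x y u v D : (u < D)%N -> (v < D)%N ->
  (x * D + u = y * D + v)%N -> x = y /\ u = v.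
Proof.
move=> uD vD; case: (ltngtP x y) => [h e|h e|->]; [exfalso; nia|exfalso; nia|].
by move/addnI.
Qed.

(* the lexicographic order on the sequences [dl a, dl (pi^-1 a), ..., dl (pi^-k a)],
   read as integers in base [B] *)
Fixpoint lev pi k (a : 'I_n) : nat :=
  if k is k'.+1 then (dl a * B ^ k + lev pi k' ((pi^-1)%g a))%N else dl a.

Lemma lev_lt pi k a : (lev pi k a < B ^ k.+1)%N.
Proof.
elim: k a => [|k IH] a /=; first by rewrite expn1.
have := IH ((pi^-1)%g a); have := dlB a; rewrite (expnS B k.+1); nia.
Qed.

Lemma levS pi k a : lev pi k.+1 (pi a) = (dl (pi a) * B ^ k.+1 + lev pi k a)%N.
Proof. by rewrite /= permK. Qed.

Lemma lev_snoc pi k a :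
  lev pi k.+1 a = (lev pi k a * B + dl (((pi^-1) ^+ k.+1)%g a))%N.
Proof.
elim: k a => [|k IH] a; first by rewrite /= expn1 expg1.
rewrite -[LHS]/(dl a * B ^ k.+2 + lev pi k.+1 ((pi^-1)%g a))%N IH /=.
by rewrite [in RHS]expgS permM mulnDl addnA [(B ^ k.+2)%N]expnSr mulnA.
Qed.

Lemma lev_le pi k a b : (lev pi k.+1 a <= lev pi k.+1 b)%N -> (lev pi k a <= lev pi k b)%N.
Proof. by rewrite !lev_snoc lex_le // => /orP[/ltnW|/andP[/eqP->]]. Qed.

Lemma lev_le0 pi k a b : (lev pi k a <= lev pi k b)%N -> (dl a <= dl b)%N.
Proof. by elim: k => // k IH /lev_le. Qed.

Lemma lev_eqW pi k j a b : (j <= k)%N -> lev pi k a = lev pi k b -> lev pi j a = lev pi j b.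
Proof.
elim: k => [|k IH]; first by case: j.
rewrite leq_eqVlt => /orP[/eqP->//|jk] e; apply: IH => //.
by move: e; rewrite !lev_snoc => /lex_eq[].
Qed.

(** A common multiple of the orders of all permutations; the levels of this order are stable. *)
Definition period : nat := n`!.

Lemma perm_period pi : (pi ^+ period = 1)%g.
Proof.
have /dvdnP[k ->] : (#[pi]%g %| period)%N.
  by rewrite /period -card_Sn -cardsT; apply: (@cardSg _ [set: 'S_n]%G <[pi]>%G); apply: subsetT.
by rewrite mulnC expgM expg_order expg1n.
Qed.

Lemma period_gt0 : (0 < period)%N. Proof. exact: fact_gt0. Qed.

Lemma lev_stable pi a b : dl (pi a) = dl (pi b) ->
  (lev pi period (pi a) <= lev pi period (pi b))%N = (lev pi period a <= lev pi period b)%N.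
Proof.
have [N NE] : exists N, period = N.+1 by case: period period_gt0 => // N _; exists N.
move=> e; rewrite {1 2}NE !levS e lex_le ?lev_lt // ltnn eqxx /=.
apply/idP/idP; last by rewrite NE => /lev_le.
rewrite NE !lev_snoc -NE expVgn perm_period invg1 !perm1 => h.
rewrite lex_le //; case: ltngtP h => //= h _.
have [|e1 _] := @lex_eq (dl a) (dl b) 0 0 1 erefl erefl; last by rewrite e1.
have := lev_eqW (leq0n N) h; rewrite /=; lia.
Qed.

(** Predecessors under [s * pi] and under [pi] differ by [s], which preserves the levels up to order
    [k]. Replacing the permutation at one refinement step thus leaves the refinements already
    constructed intact. *)
Lemma lev_change pi s k : (forall a, lev pi k (s a) = lev pi k a) ->
  forall j, (j <= k.+1)%N -> lev (s * pi)%g j =1 lev pi j.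
Proof.
move=> h; elim=> // j IH jk b.
rewrite -(permKV (s * pi)%g b); move: (((s * pi)^-1)%g b) => a {b}; rewrite levS (IH (ltnW jk)) permM levS; congr (_ + _)%N.
by apply: esym; apply: lev_eqW (h a).
Qed.

Lemma lev_digits pi pi' x y : (forall k, lev pi k x = lev pi' k y) <->
  (forall j, dl (((pi^-1) ^+ j)%g x) = dl (((pi'^-1) ^+ j)%g y)).
Proof.
split=> [h [|j]|h]; first by rewrite !expg0 !perm1; apply: (h 0%N).
  by have := h j.+1; rewrite !lev_snoc => /lex_eq[].
elim=> [|k IH]; first by have := h 0%N; rewrite !expg0 !perm1.
by rewrite !lev_snoc IH h.
Qed.

Lemma expgV_period pi j : ((pi^-1) ^+ j = pi ^+ (period.-1 * j))%g.
Proof.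
have -> : (pi^-1 = pi ^+ period.-1)%g.
  by apply: (mulgI pi); rewrite -expgS prednK ?period_gt0 // perm_period mulgV.
by rewrite expgM.
Qed.

(** Inverses are positive powers by [perm_period], so the backward and forward orbits carry the same
    information. *)
Lemma lev_fwd pi pi' x y : (forall k, lev pi k x = lev pi' k y) <->
  (forall j, dl ((pi ^+ j)%g x) = dl ((pi' ^+ j)%g y)).
Proof.
rewrite lev_digits; split=> h j.
  have e (q : 'S_n) : (q ^+ j = q^-1 ^+ (period.-1 * j))%g by rewrite -(expgV_period (q^-1)%g) invgK.
  by rewrite !e.
by rewrite !expgV_period.
Qed.

(* the forward orbit, ordered by decreasing labels as in the condition [JWperm] *)
Fixpoint fwd pi k (a : 'I_n) : nat :=
  if k is k'.+1 then ((B.-1 - dl (pi a)) * B ^ k' + fwd pi k' (pi a))%N else 0%N.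

Lemma digit_lt a : (B.-1 - dl a < B)%N.
Proof. by have := dlB a; lia. Qed.

Lemma fwd_lt pi k a : (fwd pi k a < B ^ k)%N.
Proof.
elim: k a => [|k IH] a //=; rewrite expnS.
have := IH (pi a); have := digit_lt (pi a); nia.
Qed.

Lemma fwd_snoc pi k a : fwd pi k.+1 a = (fwd pi k a * B + (B.-1 - dl ((pi ^+ k.+1)%g a)))%N.
Proof.
elim: k a => [|k IH] a; first by rewrite /= muln1 addn0 expg1.
rewrite -[LHS]/((B.-1 - dl (pi a)) * B ^ k.+1 + fwd pi k.+1 (pi a))%N IH /=.
by rewrite [in RHS]expgS permM mulnDl addnA [(B ^ k.+1)%N]expnSr mulnA.
Qed.

(** The label, followed by the reversed labels along the forward orbit. For a permutation satisfying
    [JWperm] the order of the indices sorts these keys. *)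
Definition fkey pi a : nat := (dl a * B ^ period + fwd pi period a)%N.

Lemma fkey_le_dl pi a b : (fkey pi a <= fkey pi b)%N -> (dl a <= dl b)%N.
Proof. by rewrite lex_le ?fwd_lt // => /orP[/ltnW|/andP[/eqP->]]. Qed.

Lemma fkey_eq pi pi' x y : fkey pi x = fkey pi' y <->
  (forall j, dl ((pi ^+ j)%g x) = dl ((pi' ^+ j)%g y)).
Proof.
have fE k u v : fwd pi k u = fwd pi' k v <->
    (forall j, (0 < j <= k)%N -> dl ((pi ^+ j)%g u) = dl ((pi' ^+ j)%g v)).
  elim: k => [|k IH]; first by split=> // _ [].
  rewrite !fwd_snoc; split=> [e0|h].
    have [/IH h e] := lex_eq (digit_lt _) (digit_lt _) e0; move=> j /andP[j0].
    rewrite leq_eqVlt => /orP[/eqP->|jk]; last by apply: h; rewrite j0.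
    have := dlB ((pi ^+ k.+1)%g u); have := dlB ((pi' ^+ k.+1)%g v); lia.
  rewrite h ?leqnn //; congr (_ * _ + _)%N; apply/IH => j /andP[j0 jk].
  by rewrite h // j0 ltnW.
split=> [e0|h]; last first.
  rewrite /fkey; have := h 0%N; rewrite !expg0 !perm1 => ->; congr (_ + _)%N.
  by apply/fE => j _; apply: h.
have [e1 /fE h] := lex_eq (fwd_lt _ _ _) (fwd_lt _ _ _) e0.
move=> j; rewrite -(expg_mod j (perm_period pi)) -(expg_mod j (perm_period pi')).
have := ltn_pmod j period_gt0; case: (j %% period)%N => [|i] ip.
  by rewrite !expg0 !perm1.
by apply: h; rewrite /= ltnW.
Qed.

(** The key of [pi a] omits the label of [a] and ends with that of [pi a]; both changes concern
    digits on which [a] and [b] agree. *)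
Lemma fkey_step pi a b : dl a = dl b -> dl (pi a) = dl (pi b) ->
  (fkey pi a <= fkey pi b)%N = (fkey pi (pi a) <= fkey pi (pi b))%N.
Proof.
have [N NE] : exists N, period = N.+1 by case: period period_gt0 => // N _; exists N.
move=> e0 e1.
have pN x : ((pi ^+ N.+1)%g (pi x)) = pi x by rewrite -NE perm_period perm1.
have -> : (fkey pi a <= fkey pi b)%N = (fwd pi N (pi a) <= fwd pi N (pi b))%N.
  by rewrite /fkey e0 leq_add2l NE /= e1 leq_add2l.
rewrite /fkey e1 leq_add2l NE !fwd_snoc !pN e1 leq_add2r leq_pmul2r //.
by have := dlB a; case: B.
Qed.

(** The condition defining ^J W, expressed for pi = x^-1 u^-1. As [x] reverses the order of the
    blocks and keeps the order inside each, monotonicity of u^-1 on a block becomes a decrease of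
    the labels of [pi], with ties kept in order. *)
Definition JWperm pi : Prop := forall a b : 'I_n, (a < b)%N -> dl a = dl b ->
  (dl (pi b) < dl (pi a))%N \/ (dl (pi a) = dl (pi b) /\ (pi a < pi b)%N).

Lemma tie_lt F F' (a b : 'I_n) : (F * n + a < F' * n + b)%N =
  (F < F')%N || ((F == F') && (a < b)%N).
Proof.
have := ltn_ord a; have := ltn_ord b; move: (val a) (val b) => x y.
by case: (ltngtP F F') => [h|h|->] /=; nia.
Qed.

Lemma tie_inj (F : 'I_n -> nat) : injective (fun a : 'I_n => (F a * n + a)%N).
Proof.
move=> a b e; have [_] := lex_eq (ltn_ord a) (ltn_ord b) e.
exact: val_inj.
Qed.

(** Conjugating [pi] by the sorting [rho] of the keys gives the right labels, but possibly the wrong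
    order among indices with equal keys. The images are therefore sorted separately by [eta], and
    [pi'] matches the two sortings. *)
Lemma JW_exists pi : exists pi' rho : 'S_n, [/\ JWperm pi', forall a, dl (rho a) = dl a
  & forall k a, lev pi' k (rho a) = lev pi k a].
Proof.
have [rho rhoE] := rank_perm (tie_inj (F := fkey pi)).
have [eta etaE] := rank_perm (tie_inj (F := fun a => fkey pi (pi a))).
pose pi' := (rho^-1 * eta)%g.
have pi'E a : pi' (rho a) = eta a by rewrite permM permK.
have m1 (x y : 'I_n) : (x < y)%N -> (fkey pi ((rho^-1)%g x) <= fkey pi ((rho^-1)%g y))%N.
  rewrite -{1}(permKV rho x) -{1}(permKV rho y) rhoE tie_lt.
  by case/orP => [/ltnW//|/andP[/eqP->]].
have m2 (x y : 'I_n) : (x < y)%N -> (fkey pi (pi ((eta^-1)%g x)) <= fkey pi (pi ((eta^-1)%g y)))%N.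
  rewrite -{1}(permKV eta x) -{1}(permKV eta y) etaE tie_lt.
  by case/orP => [/ltnW//|/andP[/eqP->]].
have F12 x : fkey pi ((rho^-1)%g x) = fkey pi (pi ((eta^-1)%g x)).
  apply: (@sorted_unique n (fun x => fkey pi ((rho^-1)%g x))
    (fun x => fkey pi (pi ((eta^-1)%g x))) (eta^-1 * pi * rho)%g m1 m2) => a.
  by rewrite !permM permK.
have dlr x : dl ((rho^-1)%g x) = dl x.
  apply: (@sorted_unique n (fun x => dl ((rho^-1)%g x)) dl rho) => [a b /m1/fkey_le_dl|//|a].
    by [].
  by rewrite permK.
have dlrho a : dl (rho a) = dl a by rewrite -dlr permK.
(* This is [pi'] in the numbering before [rho]. Its orbits follow those of [pi] up to indices with
   equal keys, which have equal labels along their orbits. *)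
pose tau a := (rho^-1)%g (eta a).
have tauE a : fkey pi (tau a) = fkey pi (pi a) by rewrite F12 permK.
have tauj j a : fkey pi (iter j tau a) = fkey pi ((pi ^+ j)%g a).
  elim: j => [|j IH]; first by rewrite expg0 perm1.
  rewrite iterS tauE expgSr permM; apply/fkey_eq => i.
  by have /fkey_eq/(_ i.+1) := IH; rewrite !expgS !permM.
have pij j a : (pi' ^+ j)%g (rho a) = rho (iter j tau a).
  elim: j => [|j IH]; first by rewrite expg0 perm1.
  by rewrite expgSr permM IH pi'E iterS /tau permKV.
exists pi', rho; split=> // [x y|k a]; last first.
  move: k; apply/lev_fwd => j; rewrite pij dlrho.
  by have /fkey_eq/(_ 0%N) := tauj j a; rewrite !expg0 !perm1.
rewrite -(permKV rho x) -(permKV rho y) !pi'E; move: ((rho^-1)%g x) ((rho^-1)%g y) => a b.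
have gm c : dl (eta c) = dl (pi c).
  by rewrite -dlr; have /fkey_eq/(_ 0%N) := tauE c; rewrite !expg0 !perm1.
rewrite rhoE tie_lt !dlrho !gm etaE tie_lt => lt e.
have le : (fkey pi a <= fkey pi b)%N.
  by case/orP: lt => [/ltnW//|/andP[/eqP->]].
have [N NE] : exists N, period = N.+1 by case: period period_gt0 => // N _; exists N.
have le2 : (dl (pi b) <= dl (pi a))%N.
  move: le; rewrite /fkey e leq_add2l NE /= lex_le ?fwd_lt //.
  have := dlB (pi a); have := dlB (pi b).
  by move=> ? ? /orP[|/andP[/eqP + _]]; lia.
move: le2; rewrite leq_eqVlt => /orP[/eqP e1|]; [right; split=> //|by left].
have h1 := fkey_step e (esym e1); have h2 := fkey_step (esym e) e1.
by rewrite ltnNge -h2 eqn_leq -h1 -h2 -eqn_leq -ltnNge.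
Qed.

Lemma JW_fkey_mono pi : JWperm pi -> forall a b : 'I_n, (a < b)%N ->
  (fkey pi a <= fkey pi b)%N.
Proof.
move=> J.
have h k (a b : 'I_n) : (a < b)%N -> dl a = dl b -> (fwd pi k a <= fwd pi k b)%N.
  elim: k a b => // k IH a b ab e /=; rewrite lex_le ?fwd_lt //.
  case: (J a b ab e) => [lt|[e1 lt]].
    by have := dlB (pi a); lia.
  by rewrite e1 eqxx IH // orbT.
move=> a b ab; rewrite lex_le ?fwd_lt //; have := dl_mono ab.
by rewrite leq_eqVlt => /orP[/eqP e|->//]; rewrite e eqxx h ?orbT.
Qed.

(** For both permutations the index order sorts the keys, and the multisets of keys agree, so the
    keys coincide. [JWperm] then determines the matching inside each class of equal keys. *)
Lemma JW_unique pi pi' s : JWperm pi -> JWperm pi' ->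
  (forall k a, lev pi k (s a) = lev pi' k a) -> pi = pi'.
Proof.
move=> J J' h.
have FE : fkey pi =1 fkey pi'.
  apply: (sorted_unique (s := s)) => [||a]; [exact: JW_fkey_mono|exact: JW_fkey_mono|].
  by apply/esym/fkey_eq; apply/lev_fwd => k; apply: h.
have FpE a : fkey pi (pi a) = fkey pi' (pi' a).
  by apply/fkey_eq => j; have /fkey_eq/(_ j.+1) := FE a; rewrite !expgS !permM.
(* Inside a class of equal keys [q^-1] is increasing, so the pairs of key and preimage are sorted as
   well, and [sorted_unique] applies once more. *)
have mono q : JWperm q -> forall x y : 'I_n, (x < y)%N ->
   (fkey q x * n + (q^-1)%g x <= fkey q y * n + (q^-1)%g y)%N.
  move=> Jq x y xy; rewrite leqNgt tie_lt; apply/negP => /orP[lt|/andP[/eqP e lt]].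
    by have := JW_fkey_mono Jq xy; rewrite leqNgt lt.
  have e2 j : dl ((q ^+ j)%g ((q^-1)%g y)) = dl ((q ^+ j)%g ((q^-1)%g x)).
    have [N NE] : exists N, period = N.+1 by case: period period_gt0 => // N _; exists N.
    move/fkey_eq: e => /(_ (j + N)%N).
    have eN z : (q ^+ (j + N))%g z = (q ^+ j)%g ((q^-1)%g z).
      by rewrite addnC expgD permM -[(q^-1)%g]expg1 expgV_period NE muln1.
    by rewrite !eN.
  have := Jq _ _ lt; rewrite !permKV; have := e2 0%N; rewrite !expg0 !perm1 => -> /(_ erefl).
  have := e2 1%N; rewrite !expg1 !permKV => ->.
  by rewrite ltnn => -[//|[_]]; rewrite ltnNge ltnW.
suff e x : (pi^-1)%g x = (pi'^-1)%g x.
  by apply/permP => a; rewrite -{1}(permK pi' a) -e permKV.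
have key x' : (fkey pi x' * n + (pi^-1)%g x' = fkey pi' x' * n + (pi'^-1)%g x')%N.
  apply: (sorted_unique (s := (pi'^-1 * pi)%g) (mono _ J) (mono _ J')) => a.
  by rewrite permM permK FpE permKV.
have [_] := lex_eq (ltn_ord _) (ltn_ord _) (key x).
exact: val_inj.
Qed.
End Levels.

(** * Frobenius-semilinear matrices *)

Section SemilinearMatrices.
Variables (n : nat) (dl : 'I_n -> nat) (B : nat).
Hypothesis dlB : forall a, (dl a < B)%N.
Notation lev := (lev dl B).

Definition patL (R : comPzRingType) (l l' : 'I_n -> nat) (T : 'M[R]_n) : Prop :=
  forall b a, (l' a < l b)%N -> T b a = 0.
(** Preservation of the filtration [C]; the labels are compared in the opposite direction from
    [patL] because [C] descends. *)
Definition patC (R : comPzRingType) (pi pi' : 'S_n) (T : 'M[R]_n) : Prop :=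
  forall b a, (dl (pi b) < dl (pi' a))%N -> T b a = 0.
Definition graded (R : comPzRingType) (pi : 'S_n) (Phi : 'M[R]_n) : Prop :=
  forall b a, dl b != dl (pi a) -> Phi b a = 0.
(* The levels of order [k] index the [k]-th refinement of the filtration [D] by
   images of [C] under phi; [Phi] is triangular when its frame is adapted to it. *)
Definition triangular (R : comPzRingType) k (pi : 'S_n) (Phi : 'M[R]_n) : Prop :=
  forall b a, (lev pi k (pi a) < lev pi k b)%N -> Phi b a = 0.
Definition Dpart (R : comPzRingType) (T : 'M[R]_n) : 'M[R]_n :=
  \matrix_(e, x) if dl e == dl x then T e x else 0.
Definition Cpart (R : comPzRingType) (pi pi' : 'S_n) (T : 'M[R]_n) : 'M[R]_n :=
  \matrix_(b, a) if dl (pi b) == dl (pi' a) then T b a else 0.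

Lemma pat_inv_perm (R : comPzRingType) (r : rel 'I_n) (s : 'S_n) (X Y : 'M[R]_n) :
  reflexive r -> transitive r -> (forall b a, ~~ r b (s a) -> X b a = 0) ->
  X *m Y = 1%:M -> forall a b, ~~ r (s a) b -> Y a b = 0.
Proof.
move=> rr tr hX XY.
pose X' : 'M[R]_n := \matrix_(b, x) X b ((s^-1)%g x).
pose Y' : 'M[R]_n := \matrix_(x, b) Y ((s^-1)%g x) b.
have hX' : pat r X' by move=> b x nr; rewrite mxE hX // permKV.
have XY' : X' *m Y' = 1%:M.
  rewrite -XY; apply/matrixP => i j; rewrite !mxE (reindex_inj (@perm_inj _ s)).
  by apply: eq_bigr => k _; rewrite !mxE permK.
move=> a b nr; have := pat_inv rr tr hX' XY' nr.
by rewrite mxE permK.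
Qed.

Lemma minv_level (R : comPzRingType) (l : 'I_n -> nat) (X : 'M[R]_n) :
  (forall b a, (l a < l b)%N -> X b a = 0) -> minv X ->
  minv (\matrix_(i, j) if l i == l j then X i j else 0).
Proof. by move=> h; rewrite !minv_det (det_level h). Qed.

Lemma minv_Dpart (R : comPzRingType) (T : 'M[R]_n) :
  patL dl dl T -> minv T -> minv (Dpart T).
Proof. exact: minv_level. Qed.

Lemma minv_reindex (R : comPzRingType) (s : 'S_n) (X : 'M[R]_n) :
  minv (\matrix_(b, a) X b (s a)) <-> minv X.
Proof.
split=> [[Y h]|[Y h]].
  exists (\matrix_(a, b) Y ((s^-1)%g a) b); rewrite -h; apply/matrixP => i j.
  rewrite !mxE (reindex_inj (@perm_inj _ s)); apply: eq_bigr => k _.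
  by rewrite !mxE permK.
exists (\matrix_(a, b) Y (s a) b); rewrite -h; apply/matrixP => i j.
rewrite !mxE [RHS](reindex_inj (@perm_inj _ s)); apply: eq_bigr => k _.
by rewrite !mxE.
Qed.

Lemma minv_reindexl (R : comPzRingType) (s : 'S_n) (X : 'M[R]_n) :
  minv X -> minv (\matrix_(b, a) X (s b) a).
Proof.
move=> [Y h]; exists (\matrix_(a, b) Y a (s b)); apply/matrixP => i j.
have := congr1 (fun Z : 'M[R]_n => Z (s i) (s j)) h; rewrite !mxE (inj_eq perm_inj) => <-.
by apply: eq_bigr => k _; rewrite !mxE.
Qed.

(** After reindexing the columns, [T] is triangular for the reversed labels [B.-1 - dl (pi b)], and
    [minv_level] applies. *)
Lemma minv_Cpart (R : comPzRingType) (pi pi' : 'S_n) (T : 'M[R]_n) :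
  patC pi pi' T -> minv T -> minv (Cpart pi pi' T).
Proof.
move=> h iT; pose s := (pi' * pi^-1)%g.
have sE a : pi (s a) = pi' a by rewrite permM permKV.
pose T' : 'M[R]_n := \matrix_(b, a) T b ((s^-1)%g a).
have iT' : minv T' by apply/minv_reindex.
have := @minv_level R (fun b => B.-1 - dl (pi b))%N T' _ iT'.
move=> /(_ _)/(minv_reindex s) h'.
have -> : Cpart pi pi' T = \matrix_(b, a) (\matrix_(i, j) if (B.-1 - dl (pi i) == B.-1 - dl (pi j))%N
    then T' i j else 0) b (s a).
  apply/matrixP => i j; rewrite !mxE permK sE.
  have := dlB (pi i); have := dlB (pi' j) => h1 h2.
  by rewrite (_ : (B.-1 - _ == _)%N = (dl (pi i) == dl (pi' j))) //; apply/eqP/eqP; lia.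
apply: h' => b a lt; rewrite mxE h // -sE permKV.
by have := dlB (pi b); have := dlB (pi a); lia.
Qed.

Lemma levS_le (pi : 'S_n) k b a : dl (pi b) = dl (pi a) -> (lev pi k b <= lev pi k a)%N ->
  (lev pi k.+1 (pi b) <= lev pi k.+1 (pi a))%N.
Proof. by move=> e h; rewrite !levS e leq_add2l. Qed.

Lemma triangular_le (R : comPzRingType) k j (pi : 'S_n) (Phi : 'M[R]_n) : (j <= k)%N ->
  triangular k pi Phi -> triangular j pi Phi.
Proof.
move=> jk h b a lt; apply: h; rewrite ltnNge; apply: contraL lt.
rewrite -leqNgt; elim: k jk => [|k IH]; first by case: j.
rewrite leq_eqVlt => /orP[/eqP->//|jk] /(lev_le dlB); exact: IH.
Qed.

Lemma triangular_inv (R : comPzRingType) k pi (Phi Psi : 'M[R]_n) :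
  triangular k pi Phi -> Phi *m Psi = 1%:M ->
  forall a b, (lev pi k b < lev pi k (pi a))%N -> Psi a b = 0.
Proof.
move=> h e a b lt.
apply: (@pat_inv_perm _ (fun x y => (lev pi k x <= lev pi k y)%N) pi Phi) e _ _ _.
- by move=> x; apply: leqnn.
- by move=> x y z; apply: leq_trans.
- by move=> x y; rewrite -ltnNge; apply: h.
- by rewrite -ltnNge.
Qed.

Lemma mulmx_neq0 (R : comPzRingType) (X Y : 'M[R]_n) i j :
  (X *m Y) i j != 0 -> exists k, X i k != 0 /\ Y k j != 0.
Proof.
move=> h; apply: contrapT => no; move/eqP: h; apply; rewrite mxE big1 // => k _.
have [->|Xn] := eqVneq (X i k) 0; first by rewrite mul0r.
have [->|Yn] := eqVneq (Y k j) 0; first by rewrite mulr0.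
by case: no; exists k.
Qed.

Lemma patP (R : comPzRingType) (T : 'M[R]_n) (P : rel 'I_n) :
  (forall b a, ~~ P b a -> T b a = 0) <-> (forall b a, T b a != 0 -> P b a).
Proof.
split=> h b a.
  by move=> nz; apply: contraR nz => /h->.
by move=> nP; apply/eqP; apply: contraR nP => /h.
Qed.

Lemma patLP (R : comPzRingType) (l l' : 'I_n -> nat) (T : 'M[R]_n) :
  patL l l' T <-> (forall b a, T b a != 0 -> (l b <= l' a)%N).
Proof.
rewrite -(patP _ (fun b a => (l b <= l' a)%N)).
by split=> h b a; [rewrite -ltnNge; apply: h|rewrite ltnNge; apply: h].
Qed.

Variable p : nat.
Hypothesis p_prime : prime p.

Definition powmx (R : comPzRingType) (T : 'M[R]_n) : 'M[R]_n := map_mx (fun x => x ^+ p) T.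

Lemma powmx0 (R : comPzRingType) (T : 'M[R]_n) i j : powmx T i j != 0 -> T i j != 0.
Proof.
rewrite mxE; apply: contra => /eqP->.
by rewrite expr0n; case: p (prime_gt0 p_prime).
Qed.

Lemma minv_powmx (R : comPzRingType) (T : 'M[R]_n) : p%:R = 0 :> R -> minv T -> minv (powmx T).
Proof. by move=> ch; apply: (minv_map (frob p_prime ch)). Qed.

(** A change from a frame for [pi] with matrix [Phi] to one for [pi'] with matrix [Phi']. The last
    equation involves only the graded parts of [T], because phi is defined on graded pieces. *)
Definition transition (R : comPzRingType) (pi pi' : 'S_n) (T Phi Phi' : 'M[R]_n) : Prop :=
  [/\ patC pi pi' T, patL dl dl T, minv T
    & Dpart T *m Phi' = Phi *m powmx (Cpart pi pi' T)].

(** The refinements are canonical, so a change of frame respects them. By induction, an entry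
    between equal labels is an entry of T_D = Phi T_C^(p) Phi'^-1, where the middle factor respects
    the levels of order j and the application of phi turns these into levels of order j + 1. *)
Lemma transition_levels (R : comPzRingType) k pi pi' (T Phi Phi' : 'M[R]_n) :
  transition pi pi' T Phi Phi' -> triangular k pi Phi -> triangular k pi' Phi' ->
  minv Phi' -> patL (lev pi k) (lev pi' k) T.
Proof.
case=> hC hD iT e tr tr' [Psi PsiE].
suff h j : (j <= k)%N -> patL (lev pi j) (lev pi' j) T by apply: h.
elim: j => [_|j IH jk]; first exact: hD.
have {}IH := IH (ltnW jk).
apply/patLP => b x nz.
have le : (dl b <= dl x)%N by move/patLP: hD => /(_ b x nz).
move: le; rewrite leq_eqVlt => /orP[/eqP ebx|lt]; last first.
  rewrite -(permKV pi b) -(permKV pi' x) !levS !permKV lex_le ?lev_lt //.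
  by rewrite lt.
have : (Dpart T *m (Phi' *m Psi)) b x != 0 by rewrite PsiE mulmx1 mxE ebx eqxx.
rewrite mulmxA e -mulmxA => /mulmx_neq0[c [h1 /mulmx_neq0[a [/powmx0 h2 h3]]]].
have l1 : (lev pi j.+1 b <= lev pi j.+1 (pi c))%N.
  by rewrite leqNgt; apply: contra h1 => /(triangular_le jk tr)->.
have l3 : (lev pi' j.+1 (pi' a) <= lev pi' j.+1 x)%N.
  by rewrite leqNgt; apply: contra h3 => /(triangular_inv (triangular_le jk tr') PsiE)->.
move: h2; rewrite mxE; case: (dl (pi c) =P dl (pi' a)) => [eca nz2|_]; last by rewrite eqxx.
apply: leq_trans l1 (leq_trans _ l3).
by rewrite !levS eca leq_add2l; move/patLP: IH; apply.
Qed.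

(** The columns are the images of the frame vectors under phi, indexed by their position in [D]: a
    basis adapted to the next refinement of [D]. *)
Definition semi_lift (R : comPzRingType) (pi : 'S_n) (Phi : 'M[R]_n) : 'M[R]_n :=
  \matrix_(b, x) Phi b ((pi^-1)%g x).

(** The transition equation forces the new matrix to be T_D^-1 Phi T_C^(p) with T = G q. Since T_D =
    G q_D, and [G] is [Phi] with columns permuted by [pi], it equals q_D^-1 times T_C^(p) with
    permuted rows, which is triangular one order further. *)
Lemma step_frame (R : comPzRingType) k pi s (Phi q : 'M[R]_n) :
  p%:R = 0 :> R -> graded pi Phi -> minv Phi -> triangular k pi Phi ->
  patL (lev pi k.+1) (lev pi k.+1) q -> minv q ->
  patC pi (s * pi)%g (semi_lift pi Phi *m q) -> (forall a, lev pi k (s a) = lev pi k a) ->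
  exists Phi', [/\ transition pi (s * pi)%g (semi_lift pi Phi *m q) Phi Phi',
    graded (s * pi)%g Phi', minv Phi' & triangular k.+1 (s * pi)%g Phi'].
Proof.
move=> ch gr iPhi tr hq iq hC hs; set G := semi_lift pi Phi; set pi' := (s * pi)%g.
have iG : minv G by apply/minv_reindex.
have Gdl b x : G b x != 0 -> dl b = dl x.
  rewrite mxE => h; apply/eqP; apply: contraR h => h.
  by rewrite gr // permKV.
have hqdl : patL dl dl q.
  apply/patLP => b a; move/patLP: hq => h /h; exact: lev_le0.
have hD : patL dl dl (G *m q).
  apply/patLP => b a /mulmx_neq0[c [/Gdl-> h]]; by move/patLP: hqdl; apply.
have iT : minv (G *m q) by apply: minvM.
have TD : Dpart (G *m q) = G *m Dpart q.
  apply/matrixP => b a; rewrite mxE [in LHS]mxE [RHS]mxE.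
  have [eba|nba] := eqVneq (dl b) (dl a).
    apply: eq_bigr => c _; rewrite [Dpart q c a]mxE.
    have [->|/Gdl e] := eqVneq (G b c) 0; first by rewrite !mul0r.
    by rewrite -e eba eqxx.
  rewrite big1 // => c _; rewrite [Dpart q c a]mxE.
  have [->|/Gdl e] := eqVneq (G b c) 0; first by rewrite !mul0r.
  by rewrite -e (negbTE nba) mulr0.
have [Qi QiE] := minv_Dpart hqdl iq.
have Qidl e x : Qi e x != 0 -> dl e = dl x.
  move=> nz; apply/eqP; move: nz; apply: contraR => h.
  apply/eqP; apply: (pat_inv (r := fun i j => dl i == dl j)) QiE _ _ _ => //.
  - by move=> i j l /eqP-> /eqP->.
  - by move=> i j /negbTE nij; rewrite mxE nij.
have Qilev e x : Qi e x != 0 -> (lev pi k.+1 e <= lev pi k.+1 x)%N.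
  apply: contraR => h; apply/eqP.
  apply: (pat_inv (r := fun i j => lev pi k.+1 i <= lev pi k.+1 j)%N) QiE _ _ _ => //.
  - by move=> i j l; apply: leq_trans.
  - move=> i j; rewrite -ltnNge => lt; rewrite mxE hq //.
    by case: ifP.
pose Tc : 'M[R]_n := \matrix_(x, a) powmx (Cpart pi pi' (G *m q)) ((pi^-1)%g x) a.
have TcE x a : Tc x a != 0 -> dl x = dl (pi' a) /\ (G *m q) ((pi^-1)%g x) a != 0.
  rewrite mxE => /powmx0; rewrite mxE permKV; case: (dl x =P dl (pi' a)) => [e|_]; last by rewrite eqxx.
  by split.
exists (Qi *m Tc); split.
- split=> //; rewrite TD -mulmxA (mulmxA (Dpart q)) QiE mul1mx.
  apply/matrixP => i j; rewrite [LHS]mxE [RHS]mxE (reindex_inj (@perm_inj _ pi)).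
  by apply: eq_bigr => c _; rewrite [G _ _]mxE [Tc _ _]mxE permK.
- move=> b a; apply: contraNeq => /mulmx_neq0[c [/Qidl-> /TcE[-> _]]].
  by [].
- apply: minvM; first exact: minvK QiE.
  apply: minv_reindexl; apply: minv_powmx => //.
  exact: minv_Cpart.
- move=> b a; rewrite !(lev_change dlB hs) // => lt; apply/eqP; apply: contraLR lt.
  move=> /mulmx_neq0[c [/Qilev h1 /TcE[e nz]]]; rewrite -leqNgt.
  apply: leq_trans h1 _; rewrite -{1}(permKV pi c) [pi' a]permM levS_le //.
    by rewrite permKV e permM.
  rewrite hs; move/mulmx_neq0: nz => [x [Gn qn]].
  have l1 : (lev pi k ((pi^-1)%g c) <= lev pi k x)%N.
    move: Gn; rewrite mxE; apply: contraR; rewrite -ltnNge => h.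
    by rewrite tr // permKV.
  apply: leq_trans l1 _; apply: (lev_le dlB).
  by move/patLP: hq; apply.
Qed.

(** The converse of [step_frame] for s = 1. The matrix q is G^-1 T: between equal labels it is a row
    permutation of T_C^(p) times Phi'^-1, so it respects the levels of order k + 1 by
    [transition_levels]. *)
Lemma step_position (R : comPzRingType) k pi (T Phi Phi' : 'M[R]_n) :
  transition pi pi T Phi Phi' -> graded pi Phi -> minv Phi -> minv Phi' ->
  triangular k pi Phi -> triangular k.+1 pi Phi' ->
  in_position (fun b a => dl (pi a) <= dl (pi b))%N
    (fun b a => lev pi k.+1 b <= lev pi k.+1 a)%N (semi_lift pi Phi).
Proof.
move=> tT gr iPhi [Psi PsiE] tr tr'; set G := semi_lift pi Phi.
have iPhi' : minv Phi' by exists Psi.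
have lT := transition_levels tT tr (triangular_le (leqnSn k) tr') iPhi'.
case: tT => hC hD iT e.
have iG : minv G by apply/minv_reindex.
have [Gi GiE] := iG; have GiG := mulmx1C GiE.
have Gidl b x : Gi b x != 0 -> dl b = dl x.
  move=> nz; apply/eqP; move: nz; apply: contraR => h.
  apply/eqP; apply: (pat_inv (r := fun i j => dl i == dl j)) GiE _ _ _ => //.
  - by move=> i j l /eqP-> /eqP->.
  - by move=> i j nij; rewrite mxE gr // permKV.
exists T, (Gi *m T); split=> //.
- by move=> b a; rewrite -ltnNge; apply: hC.
- apply/patP => b x nz.
  have [c [/Gidl ebc nz2]] := mulmx_neq0 nz.
  have le : (dl b <= dl x)%N by rewrite ebc; move/patLP: hD; apply.
  move: le; rewrite leq_eqVlt => /orP[/eqP ebx|lt]; last first.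
    rewrite -(permKV pi b) -(permKV pi x) !levS !permKV lex_le ?lev_lt //.
    by rewrite lt.
  have : (Gi *m Dpart T) b x != 0.
    move: nz; rewrite !mxE; congr (_ != 0); apply: eq_bigr => y _.
    rewrite [Dpart T _ _]mxE; have [->|/Gidl e1] := eqVneq (Gi b y) 0; first by rewrite !mul0r.
    by rewrite -e1 ebx eqxx.
  rewrite -(mulmx1 (Dpart T)) -PsiE (mulmxA (Dpart T)) e !mulmxA.
  have -> : Gi *m Phi = \matrix_(i, j) ((pi^-1)%g i == j)%:R.
    apply/matrixP => i j; rewrite [RHS]mxE.
    have := congr1 (fun Z : 'M[R]_n => Z i (pi j)) GiG; rewrite [LHS]mxE [RHS]mxE => h.
    rewrite [LHS]mxE -(inj_eq (@perm_inj _ pi)) permKV -h; apply: eq_bigr => y _.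
    by rewrite [G _ _]mxE permK.
  move=> /mulmx_neq0[a [/mulmx_neq0[d [h1 /powmx0 h2]] h3]].
  have ed : d = (pi^-1)%g b.
    by move: h1; rewrite mxE; case: ((pi^-1)%g b =P d) => // _; rewrite eqxx.
  move: h2; rewrite mxE ed permKV; case: (dl b =P dl (pi a)) => [eca nz3|_]; last by rewrite eqxx.
  have l3 : (lev pi k.+1 (pi a) <= lev pi k.+1 x)%N.
    by rewrite leqNgt; apply: contra h3 => /(triangular_inv tr' PsiE)->.
  apply: leq_trans l3; rewrite -{1}(permKV pi b) levS_le ?permKV //.
  by move/patLP: lT; apply.
- by apply: minvM => //; apply: minvK GiE.
- by rewrite mulmxA GiE mul1mx.
Qed.

Lemma unitriangular_minv (R : comPzRingType) (eta : 'I_n -> nat) (q : 'M[R]_n) : injective eta ->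
  (forall e b, (eta b < eta e)%N -> q e b = 0) -> (forall b, q b b = 1) -> minv q.
Proof.
move=> ei q1 q2; apply/minv_det; rewrite (@det_level _ _ eta) //.
have -> : \matrix_(i, j) (if eta i == eta j then q i j else 0) = 1%:M.
  apply/matrixP => i j; rewrite !mxE; have [->|ij] := eqVneq i j; first by rewrite eqxx q2.
  by case: eqP => // /ei e; rewrite e eqxx in ij.
by exists 1; rewrite det1 mulr1.
Qed.

Lemma perm_minv (R : comPzRingType) (s : 'S_n) : minv (\matrix_(b, a) (b == s a)%:R : 'M[R]_n).
Proof.
exists (\matrix_(a, b) (b == s a)%:R); apply/matrixP => i j; rewrite !mxE.
rewrite (bigD1 ((s^-1)%g i)) //= big1 => [|k nk].
  by rewrite !mxE permKV eqxx mul1r addr0 eq_sym.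
rewrite !mxE [i == _]eq_sym -{1}(permKV s i) (inj_eq perm_inj) (negbTE nk).
by rewrite mul0r.
Qed.

(** The permutation given by [bruhat] nowhere raises the level of order k, because [G] and [q]
    respect it. The sum of the levels being invariant, it preserves them. *)
Lemma field_position (K : fieldType) k pi (G : 'M[K]_n) : minv G ->
  patL (lev pi k) (lev pi k) G ->
  exists (q : 'M[K]_n) (s : 'S_n), [/\ patL (lev pi k.+1) (lev pi k.+1) q, minv q,
    patC pi (s * pi)%g (G *m q) & forall a, lev pi k (s a) = lev pi k a].
Proof.
move=> iG hG.
have [q [s [q1 q2 q3 q4]]] := bruhat (tie_inj (F := fun f => dl (pi f)))
  (tie_inj (F := lev pi k.+1)) (proj1 (minv_field G) iG).
have hq : patL (lev pi k.+1) (lev pi k.+1) q.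
  by move=> b a lt; apply: q1; rewrite tie_lt lt.
have iq : minv q by apply: unitriangular_minv q1 q2; apply: tie_inj.
exists q, s; split=> //.
  by move=> b a; rewrite permM => lt; apply: q3; rewrite tie_lt lt.
have le a : (lev pi k (s a) <= lev pi k a)%N.
  have /mulmx_neq0[c [Gn qn]] := q4 a.
  apply: leq_trans (_ : lev pi k c <= _)%N; first by move/patLP: hG; apply.
  by apply: (lev_le dlB); move/patLP: hq; apply.
move=> a; apply/eqP; rewrite eqn_leq le /= leqNgt; apply/negP => lt.
have : (\sum_a lev pi k (s a) < \sum_a lev pi k a)%N.
  rewrite [X in (X < _)%N](bigD1 a) // [X in (_ < X)%N](bigD1 a) //= -addSn.
  by apply: leq_add => //; apply: leq_sum.
by rewrite [X in (_ < X)%N](reindex_inj (@perm_inj _ s)) ltnn.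
Qed.

(** A nonzero term of det T gives a permutation comparing the levels of [pi] with those of [pi'],
    and T' bounds their sums in the other direction. Hence all comparisons are equalities and
    [JW_unique] applies. *)
Lemma transition_unique (K : fieldType) pi pi' (T : 'M[K]_n) :
  (forall a b : 'I_n, (a < b)%N -> (dl a <= dl b)%N) ->
  JWperm dl pi -> JWperm dl pi' ->
  (forall k, patL (lev pi k) (lev pi' k) T) ->
  (forall k, exists T', minv T' /\ patL (lev pi' k) (lev pi k) (T' : 'M[K]_n)) ->
  minv T -> pi = pi'.
Proof.
move=> dlm J J' hT hT' /minv_field dT.
have nz (X : 'M[K]_n) : \det X != 0 -> exists s : 'S_n, forall a, X (s a) a != 0.
  move=> dX; apply: contrapT => no; move/eqP: dX; apply.
  rewrite -det_tr /determinant big1 // => s _.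
  have [a Xa] : exists a, X (s a) a = 0.
    apply: contrapT => no2; apply: no; exists s => a; apply/eqP => h; apply: no2.
    by exists a.
  by rewrite (bigD1 a) //= mxE Xa mul0r mulr0.
have [s hs] := nz _ dT.
apply: (@JW_unique n dl B dlB dlm pi pi' s) => // k.
have le a : (lev pi k (s a) <= lev pi' k a)%N by have /patLP := hT k; apply.
have [T' [/minv_field iT' hT'k]] := hT' k.
have [t ht] := nz _ iT'.
have sum_le : (\sum_a lev pi' k a <= \sum_a lev pi k (s a))%N.
  have -> : (\sum_a lev pi k (s a) = \sum_a lev pi k a)%N.
    by rewrite [RHS](reindex_inj (@perm_inj _ s)).
  rewrite [X in (X <= _)%N](reindex_inj (@perm_inj _ t)); apply: leq_sum => a _.
  by move/patLP: hT'k; apply.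
move=> a; apply/eqP; rewrite eqn_leq le /= leqNgt; apply/negP => lt.
move: sum_le; rewrite leqNgt => /negP; apply.
rewrite [X in (X < _)%N](bigD1 a) // [X in (_ < X)%N](bigD1 a) //= -addSn.
by apply: leq_add => //; apply: leq_sum.
Qed.
End SemilinearMatrices.

(** * Frames of F-zips *)

Section SupportedSpan.
Variables (R : comPzRingType) (M : lmodType R) (n : nat) (v : 'I_n -> M) (P : pred 'I_n).

Definition supp_span (w : M) : Prop :=
  exists c : 'I_n -> R, (forall a, ~~ P a -> c a = 0) /\ w = \sum_a c a *: v a.

Fact supp_span0 : supp_span 0.
Proof. by exists (fun=> 0); split=> //; rewrite big1 // => a _; rewrite scale0r. Qed.

Fact supp_spanP a u w : supp_span u -> supp_span w -> supp_span (a *: u + w).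
Proof.
move=> [c [hc ->]] [d [hd ->]]; exists (fun b => a * c b + d b); split.
  by move=> b Pb; rewrite hc // hd // mulr0 addr0.
rewrite scaler_sumr -big_split; apply: eq_bigr => b _.
by rewrite scalerDl scalerA.
Qed.

Definition supp_sub : submod M := Submod supp_span0 supp_spanP.

Lemma supp_span_lin c : (forall a, ~~ P a -> c a = 0) -> supp_span (\sum_a c a *: v a).
Proof. by move=> h; exists c. Qed.

Lemma supp_span_in a : P a -> supp_span (v a).
Proof.
move=> Pa; exists (fun b => (b == a)%:R); split.
  by move=> b; case: eqP => [->|]; rewrite ?Pa.
rewrite (bigD1 a) //= eqxx scale1r big1 ?addr0 // => b /negbTE->.
by rewrite scale0r.
Qed.
End SupportedSpan.

Section Bases.
Variables (R : comPzRingType) (M : lmodType R) (n : nat) (v : 'I_n -> M).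
Hypothesis vb : is_basis v.

Lemma basis_inj (c d : 'I_n -> R) : \sum_a c a *: v a = \sum_a d a *: v a -> c =1 d.
Proof.
move=> e a; have [k [kE kU kL]] := basis_coord vb.
have := kU _ c erefl; rewrite (kU _ d e) => /ffunP/(_ a).
by rewrite !ffunE.
Qed.

Lemma basis_ex w : exists c : 'I_n -> R, w = \sum_a c a *: v a.
Proof. by have [c [h _]] := vb w; exists c. Qed.

Lemma supp_span_coord (P : pred 'I_n) c : supp_span v P (\sum_a c a *: v a) ->
  forall a, ~~ P a -> c a = 0.
Proof. by case=> d [hd /basis_inj e] a /hd; rewrite e. Qed.
End Bases.

Lemma lin_comb_comp (R : comPzRingType) (M : lmodType R) m n (c : 'I_m -> R)
    (T : 'I_n -> 'I_m -> R) (v : 'I_n -> M) :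
  \sum_a c a *: (\sum_b T b a *: v b) = \sum_b (\sum_a T b a * c a) *: v b.
Proof.
under eq_bigr => a _ do rewrite scaler_sumr.
rewrite exchange_big; apply: eq_bigr => b _; rewrite scaler_suml.
by apply: eq_bigr => a _; rewrite scalerA mulrC.
Qed.

Lemma basis_matrix (R : comPzRingType) (M : lmodType R) n (v v' : 'I_n -> M) :
  is_basis v -> is_basis v' ->
  exists T : 'M[R]_n, minv T /\ forall a, v' a = \sum_b T b a *: v b.
Proof.
move=> vb vb'; have [t tE] := choice (fun a => basis_ex vb (v' a)).
have [t' t'E] := choice (fun a => basis_ex vb' (v a)).
pose T : 'M[R]_n := \matrix_(b, a) t a b; pose T' : 'M[R]_n := \matrix_(b, a) t' a b.
have TE a : v' a = \sum_b T b a *: v b.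
  by rewrite {1}tE; apply: eq_bigr => b _; rewrite mxE.
have T'E a : v a = \sum_b T' b a *: v' b.
  by rewrite {1}t'E; apply: eq_bigr => b _; rewrite mxE.
exists T; split=> //; exists T'.
apply/matrixP => i j; rewrite [LHS]mxE [RHS]mxE; move: i.
apply: (basis_inj vb); rewrite -lin_comb_comp.
under eq_bigr => a _ do rewrite -TE.
rewrite -T'E (bigD1 j) //= eqxx scale1r big1 ?addr0 // => i /negbTE->.
by rewrite scale0r.
Qed.

Lemma basis_change (R : comPzRingType) (M : lmodType R) n (v : 'I_n -> M) (T Y : 'M[R]_n) :
  is_basis v -> T *m Y = 1%:M -> is_basis (fun a => \sum_b T b a *: v b).
Proof.
move=> vb TY w; have [c cE] := basis_ex vb w.
exists [ffun a => \sum_b Y a b * c b]; split.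
  rewrite lin_comb_comp cE; apply: eq_bigr => b _; congr (_ *: _).
  under eq_bigr => a _ do rewrite ffunE mulr_sumr.
  rewrite exchange_big (bigD1 b) //= [X in _ + X]big1 ?addr0 => [|d db].
    under eq_bigr => a _ do rewrite mulrA.
    rewrite -mulr_suml; have := congr1 (fun Z : 'M[R]_n => Z b b) TY; rewrite !mxE eqxx => ->.
    by rewrite mul1r.
  under eq_bigr => a _ do rewrite mulrA.
  rewrite -mulr_suml; have := congr1 (fun Z : 'M[R]_n => Z b d) TY; rewrite !mxE eq_sym (negbTE db) => ->.
  by rewrite mul0r.
move=> d; rewrite lin_comb_comp cE => /(basis_inj vb) e.
apply/ffunP => a; rewrite ffunE.
under eq_bigr => b _ do rewrite e mulr_sumr.
rewrite exchange_big (bigD1 a) //= [X in _ + X]big1 ?addr0 => [|x xa].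
  under eq_bigr => b _ do rewrite mulrA.
  rewrite -mulr_suml; have := congr1 (fun Z : 'M[R]_n => Z a a) (mulmx1C TY); rewrite !mxE eqxx => ->.
  by rewrite mul1r.
under eq_bigr => b _ do rewrite mulrA.
rewrite -mulr_suml; have := congr1 (fun Z : 'M[R]_n => Z a x) (mulmx1C TY).
by rewrite !mxE eq_sym (negbTE xa) => ->; rewrite mul0r.
Qed.

Lemma supp_span_change (R : comPzRingType) (M : lmodType R) n (v : 'I_n -> M)
    (T Y : 'M[R]_n) (P Q : pred 'I_n) :
  T *m Y = 1%:M -> (forall b a, ~~ P b -> Q a -> T b a = 0) ->
  (forall a b, ~~ Q a -> P b -> Y a b = 0) ->
  forall w, supp_span v P w <-> supp_span (fun a => \sum_b T b a *: v b) Q w.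
Proof.
move=> TY hT hY w; split.
  case=> c [hc ->]; exists (fun a => \sum_b Y a b * c b); split.
    move=> a nQ; rewrite big1 // => b _; have [Pb|/hc->] := boolP (P b); last by rewrite mulr0.
    by rewrite hY ?mul0r.
  rewrite lin_comb_comp; apply: eq_bigr => b _; congr (_ *: _).
  under eq_bigr => a _ do rewrite mulr_sumr.
  rewrite exchange_big (bigD1 b) //= [X in _ + X]big1 ?addr0 => [|d db].
    under eq_bigr => a _ do rewrite mulrA.
    rewrite -mulr_suml; have := congr1 (fun Z : 'M[R]_n => Z b b) TY; rewrite !mxE eqxx => ->.
    by rewrite mul1r.
  under eq_bigr => a _ do rewrite mulrA.
  rewrite -mulr_suml; have := congr1 (fun Z : 'M[R]_n => Z b d) TY; rewrite !mxE eq_sym (negbTE db) => ->.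
  by rewrite mul0r.
case=> c [hc ->]; rewrite lin_comb_comp; apply: supp_span_lin => b nP.
rewrite big1 // => a _; have [Qa|/hc->] := boolP (Q a); last by rewrite mulr0.
by rewrite hT ?mul0r.
Qed.

Section Frames.
Variables (n : nat) (dl : 'I_n -> nat) (sup : nat -> int) (p : nat).
Hypothesis supE : forall a b, (sup (dl a) <= sup (dl b)) = (dl a <= dl b)%N.
Hypothesis p_prime : prime p.

Lemma sup_eq a b : (sup (dl a) == sup (dl b)) = (dl a == dl b).
Proof. by rewrite eq_le eqn_leq !supE. Qed.

Definition zsemi (R : comPzRingType) (N : zip_data R) : Prop := forall i,
  linear_for (fun (a : R) v => a ^+ p *: v) (zphi (i := i) : zgrC N i -> zgrD N i).

(* [v] is adapted to both filtrations: [v a] has label [dl a] in [D] and label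
   [dl (pi a)] in [C]; the columns of [Phi] represent the images under phi of
   the classes of the [v a]. *)
Record zframe (R : comPzRingType) (N : zip_data R) (pi : 'S_n) (v : 'I_n -> N)
    (Phi : 'M[R]_n) : Prop := ZFrame {
  zf_basis : is_basis v;
  zf_C : forall i w, zC N i w <-> supp_span v (fun a => i <= sup (dl (pi a))) w;
  zf_D : forall i w, zD N i w <-> supp_span v (fun a => sup (dl a) <= i) w;
  zf_phi : forall a, zphi (clC (sup (dl (pi a))) (v a)) =
    clD (sup (dl (pi a))) (\sum_b Phi b a *: v b);
  zf_graded : graded dl pi Phi;
  zf_minv : minv Phi }.

Section OneZip.
Variables (R : comPzRingType) (N : zip_data R).
Hypotheses (char_p : p%:R = 0 :> R) (semi : zsemi N).

Let semiF i : linear_for (fun a v => frob p_prime char_p a *: v)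
  (zphi (i := i) : zgrC N i -> zgrD N i).
Proof. exact: semi. Qed.

Lemma zf_Dmem pi (v : 'I_n -> N) Phi a : zframe pi v Phi ->
  zD N (sup (dl (pi a))) (\sum_b Phi b a *: v b).
Proof.
move=> fr; apply/(zf_D fr); apply: supp_span_lin => b nle.
apply: (zf_graded fr); apply: contra nle => /eqP->.
exact: lexx.
Qed.

(** Vectors of label above [i] vanish in gr^i_C, and membership in C^i excludes lower labels; only
    those of label exactly [i] contribute. *)
Lemma zphi_span pi (v w : 'I_n -> N) i c : is_basis v ->
  (forall i u, zC N i u <-> supp_span v (fun a => i <= sup (dl (pi a))) u) ->
  (forall a, zD N (sup (dl (pi a))) (w a)) ->
  (forall a, zphi (clC (sup (dl (pi a))) (v a)) = clD (sup (dl (pi a))) (w a)) ->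
  zC N i (\sum_a c a *: v a) ->
  let u := \sum_(a | sup (dl (pi a)) == i) c a ^+ p *: w a in
  zD N i u /\ zphi (clC i (\sum_a c a *: v a)) = clD i u.
Proof.
move=> vb vC wD wphi Cc /=.
pose v1 a := if sup (dl (pi a)) == i then v a else 0.
pose w1 a := if sup (dl (pi a)) == i then w a else 0.
have v1C a : zC N i (v1 a).
  rewrite /v1; case: eqP => [e|_]; last exact: smem0.
  by apply/vC; apply: supp_span_in; rewrite e.
have w1D a : zD N i (w1 a).
  by rewrite /w1; case: eqP => [<-|_]; [apply: wD|apply: smem0].
have -> : \sum_(a | sup (dl (pi a)) == i) c a ^+ p *: w a = \sum_a c a ^+ p *: w1 a.
  rewrite big_mkcond; apply: eq_bigr => a _; rewrite /w1.
  by case: ifP => // _; rewrite scaler0.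
have C1 : zC N i (\sum_a c a *: v1 a).
  by apply: smem_sum => a; apply: smemZ.
split; first by apply: smem_sum => a; apply: smemZ.
have -> : clC i (\sum_a c a *: v a) = clC i (\sum_a c a *: v1 a).
  apply/sqclassP => //; apply/vC.
  have cc := supp_span_coord vb (proj1 (vC _ _) Cc).
  rewrite -sumrB; exists (fun a => if sup (dl (pi a)) == i then 0 else c a); split.
    move=> a; rewrite lezD1 -leNgt; case: eqP => // /eqP ne le.
    by apply: cc; rewrite -ltNge lt_neqAle ne.
  apply: eq_bigr => a _; rewrite /v1; case: ifP => _; rewrite ?subrr ?scale0r //.
  by rewrite scaler0 subr0.
rewrite /clC sqclass_sum // (semi_lin (@semiF i)) /clD sqclass_sum //.
apply: eq_bigr => a _; congr (_ *: _); rewrite /v1 /w1; case: eqP => [<-|_]; first exact: wphi.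
by rewrite !sqclass0 (semi0 (@semiF i)).
Qed.

Lemma zframe_phi pi (v : 'I_n -> N) Phi i c : zframe pi v Phi ->
  zC N i (\sum_a c a *: v a) ->
  let w := \sum_(a | sup (dl (pi a)) == i) c a ^+ p *: (\sum_b Phi b a *: v b) in
  zD N i w /\ zphi (clC i (\sum_a c a *: v a)) = clD i w.
Proof.
move=> fr; apply: (zphi_span (zf_basis fr) (zf_C fr)) => a; first exact: zf_Dmem.
exact: zf_phi.
Qed.

(** The image under phi of each new frame vector is computed in both frames and compared modulo
    D_(i-1). On all labels other than [i] both sides of the matrix equation vanish by gradedness. *)
Lemma zframe_transition pi pi' (v v' : 'I_n -> N) Phi Phi' :
  zframe pi v Phi -> zframe pi' v' Phi' ->
  exists T : 'M[R]_n, (forall a, v' a = \sum_b T b a *: v b) /\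
    transition dl p pi pi' T Phi Phi'.
Proof.
move=> fr fr'.
have [T [iT TE]] := basis_matrix (zf_basis fr) (zf_basis fr').
have hC : patC dl pi pi' T.
  move=> b a lt; apply: (supp_span_coord (zf_basis fr) (P := fun b => sup (dl (pi' a)) <= sup (dl (pi b))) (c := T^~ a)).
    by apply/(zf_C fr); rewrite -TE; apply/(zf_C fr'); apply: supp_span_in.
  by rewrite supE -ltnNge.
have hD : patL dl dl T.
  move=> b a lt; apply: (supp_span_coord (zf_basis fr) (P := fun b => sup (dl b) <= sup (dl a)) (c := T^~ a)).
    by apply/(zf_D fr); rewrite -TE; apply/(zf_D fr'); apply: supp_span_in.
  by rewrite supE -ltnNge.
exists T; split=> //; split=> //.
apply/matrixP => e a; rewrite [LHS]mxE [RHS]mxE.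
have [ea|nea] := eqVneq (dl e) (dl (pi' a)); last first.
  rewrite !big1 // => x _.
    have [h|h] := eqVneq (dl e) (dl (pi x)); last by rewrite (zf_graded fr) ?mul0r.
    rewrite !mxE -h (negbTE nea) expr0n; case: p (prime_gt0 p_prime) => // k _.
    by rewrite mulr0.
  have [h|h] := eqVneq (dl x) (dl (pi' a)); last by rewrite (zf_graded fr') ?mulr0.
  by rewrite mxE h (negbTE nea) mul0r.
set i := sup (dl (pi' a)).
have Ca : zC N i (v' a) by apply/(zf_C fr'); apply: supp_span_in.
have CaT : zC N i (\sum_b T b a *: v b) by rewrite -TE.
have [h1 h2] := zframe_phi (i := i) (c := T^~ a) fr CaT.
have h3 := zf_phi fr' a; rewrite -/i {1}TE h2 in h3.
have {}h3 : zD N (i - 1) (\sum_(a0 | sup (dl (pi a0)) == i) T a0 a ^+ p *: (\sum_b Phi b a0 *: v b)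
    - \sum_b Phi' b a *: v' b).
  by apply/(sqclassP (A := zD N i) (zD N (i - 1))) => //; apply: zf_Dmem fr'.
have := supp_span_coord (zf_basis fr) (P := fun b => sup (dl b) <= i - 1)
  (c := fun b => \sum_(a0 | sup (dl (pi a0)) == i) Phi b a0 * T a0 a ^+ p - \sum_x T b x * Phi' x a).
have -> : \sum_b (\sum_(a0 | sup (dl (pi a0)) == i) Phi b a0 * T a0 a ^+ p -
      \sum_x T b x * Phi' x a) *: v b =
   \sum_(a0 | sup (dl (pi a0)) == i) T a0 a ^+ p *: (\sum_b Phi b a0 *: v b)
    - \sum_b Phi' b a *: v' b.
  under eq_bigr => b _ do rewrite scalerBl.
  rewrite sumrB; congr (_ - _); last first.
    by rewrite -lin_comb_comp; apply: eq_bigr => b _; rewrite -TE.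
  under [RHS]eq_bigr => b _ do rewrite scaler_sumr.
  rewrite exchange_big; apply: eq_bigr => b _; rewrite scaler_suml.
  by apply: eq_bigr => x _; rewrite scalerA mulrC.
move=> /(_ (proj1 (zf_D fr _ _) h3) e).
have ei : sup (dl e) = i by apply/eqP; rewrite sup_eq ea.
have ni : ~~ (i <= i - 1) by lia.
rewrite ei => /(_ ni)/eqP; rewrite subr_eq0 => /eqP h4.
transitivity (\sum_x T e x * Phi' x a).
  apply: eq_bigr => x _; rewrite mxE; case: eqP => // /eqP nex.
  by rewrite (zf_graded fr') ?mulr0 // -ea eq_sym.
rewrite -h4 big_mkcond; apply: eq_bigr => x _; rewrite !mxE sup_eq.
case: ifP => // _; rewrite expr0n; case: p (prime_gt0 p_prime) => // k _.
by rewrite mulr0.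
Qed.

Lemma zframe_change pi pi' (v : 'I_n -> N) (T Phi Phi' : 'M[R]_n) :
  zframe pi v Phi -> transition dl p pi pi' T Phi Phi' -> graded dl pi' Phi' ->
  minv Phi' -> zframe pi' (fun a => \sum_b T b a *: v b) Phi'.
Proof.
move=> fr [hC hD [Y TY] e] gr' iPhi'.
have sE a : pi ((pi' * pi^-1)%g a) = pi' a by rewrite permM permKV.
have hCY a b : (dl (pi' a) < dl (pi b))%N -> Y a b = 0.
  move=> lt; apply: (@pat_inv_perm _ _ (fun x y => dl (pi y) <= dl (pi x))%N (pi' * pi^-1)%g T Y) => //.
  - by move=> x y z h1 h2; apply: leq_trans h2 h1.
  - by move=> x y; rewrite sE -ltnNge; apply: hC.
  - by rewrite sE -ltnNge.
have hDY a b : (dl b < dl a)%N -> Y a b = 0.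
  move=> lt; apply: (@pat_inv _ _ (fun x y => dl x <= dl y)%N T Y) => //.
  - by move=> x y z; apply: leq_trans.
  - by move=> x y; rewrite -ltnNge; apply: hD.
  - by rewrite -ltnNge.
split=> //.
- exact: basis_change (zf_basis fr) TY.
- move=> i w; rewrite (zf_C fr); apply: supp_span_change TY _ _ w => b a nP Pa.
    apply: hC; rewrite ltnNge -supE; apply: contra nP; exact: le_trans.
  apply: hCY; rewrite ltnNge -supE; apply: contra nP; exact: le_trans.
- move=> i w; rewrite (zf_D fr); apply: supp_span_change TY _ _ w => b a nP Pa.
    apply: hD; rewrite ltnNge -supE; apply: contra nP => h; exact: le_trans h Pa.
  apply: hDY; rewrite ltnNge -supE; apply: contra nP => h; exact: le_trans h Pa.
- move=> a; set i := sup (dl (pi' a)).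
  have [|h1 ->] := zframe_phi (i := i) (c := T^~ a) fr.
    apply/(zf_C fr); apply: supp_span_lin => b; rewrite /i supE -ltnNge.
    exact: hC.
  rewrite lin_comb_comp.
  have h2 : zD N i (\sum_b (\sum_x T b x * Phi' x a) *: v b).
    apply/(zf_D fr); apply: supp_span_lin => b; rewrite /i supE -ltnNge => lt.
    rewrite big1 // => x _; have [h|h] := eqVneq (dl x) (dl (pi' a)); last by rewrite gr' ?mulr0.
    by rewrite hD ?mul0r // h.
  apply/sqclassP => //; apply/(zf_D fr).
  have -> : \sum_(a0 | sup (dl (pi a0)) == i) T a0 a ^+ p *: (\sum_b Phi b a0 *: v b) =
      \sum_b (\sum_(a0 | sup (dl (pi a0)) == i) Phi b a0 * T a0 a ^+ p) *: v b.
    under eq_bigr => b _ do rewrite scaler_sumr.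
    rewrite exchange_big; apply: eq_bigr => b _; rewrite scaler_suml.
    by apply: eq_bigr => x _; rewrite scalerA mulrC.
  rewrite -sumrB; under eq_bigr => b _ do rewrite -scalerBl.
  apply: supp_span_lin => b nle.
  have {nle} le : (dl (pi' a) <= dl b)%N.
    by rewrite -supE -/i; move: nle; lia.
  apply/eqP; rewrite subr_eq0; apply/eqP.
  have := congr1 (fun Z : 'M[R]_n => Z b a) e; rewrite [LHS]mxE [RHS]mxE.
  move: le; rewrite leq_eqVlt => /orP[/eqP eb|lt].
    move=> e1; transitivity (\sum_j Phi b j * powmx p (Cpart dl pi pi' T) j a).
      rewrite big_mkcond; apply: eq_bigr => x _; rewrite !mxE sup_eq.
      case: ifP => // _; rewrite expr0n; case: p (prime_gt0 p_prime) => // k _.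
      by rewrite mulr0.
    rewrite -e1; apply: eq_bigr => x _; rewrite mxE; case: eqP => // /eqP nex.
    by rewrite gr' ?mulr0 // eb eq_sym.
  move=> _; rewrite !big1 // => x; last first.
    move=> /eqP ex; rewrite (zf_graded fr) ?mul0r //.
    have /eqP -> : dl (pi x) == dl (pi' a) by rewrite -sup_eq ex.
    by rewrite gtn_eqF.
  move=> _; have [h|h] := eqVneq (dl x) (dl (pi' a)); last by rewrite gr' ?mulr0.
  by rewrite hD ?mul0r // h.
Qed.
End OneZip.
End Frames.

Section FramesIso.
Variables (n : nat) (dl : 'I_n -> nat) (sup : nat -> int) (p : nat).
Hypothesis supE : forall a b, (sup (dl a) <= sup (dl b)) = (dl a <= dl b)%N.
Hypothesis p_prime : prime p.
Variables (R : comPzRingType) (N N' : zip_data R).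
Hypothesis char_p : p%:R = 0 :> R.
Notation zframe := (zframe dl sup).

Lemma zip_iso_frames pi (v : 'I_n -> N) (v' : 'I_n -> N') Phi :
  zsemi p N -> zsemi p N' -> zframe pi v Phi -> zframe pi v' Phi -> zip_iso N N'.
Proof.
move=> sN sN' fr fr'.
have [c cE] := choice (basis_ex (zf_basis fr)).
have [c' c'E] := choice (basis_ex (zf_basis fr')).
pose f w := \sum_a c w a *: v' a; pose g w := \sum_a c' w a *: v a.
have fE d : f (\sum_a d a *: v a) = \sum_a d a *: v' a.
  by apply: eq_bigr => a _; congr (_ *: _); apply: (basis_inj (zf_basis fr)); rewrite -cE.
have gE d : g (\sum_a d a *: v' a) = \sum_a d a *: v a.
  by apply: eq_bigr => a _; congr (_ *: _); apply: (basis_inj (zf_basis fr')); rewrite -c'E.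
have gf w : g (f w) = w by rewrite [RHS](cE w) /f gE.
have fg w : f (g w) = w by rewrite [RHS](c'E w) /g fE.
have fL : linear f.
  move=> a u w; rewrite (cE u) (cE w) scaler_sumr -big_split /=.
  under eq_bigr => b _ do rewrite scalerA -scalerDl.
  rewrite (fE (fun b => a * c u b + c w b)) !fE scaler_sumr -big_split.
  by apply: eq_bigr => b _; rewrite scalerDl scalerA.
have sp (P : pred 'I_n) w : supp_span v P w <-> supp_span v' P (f w).
  split; first by case=> d [hd ->]; exists d; split.
  case=> d [hd e]; exists d; split=> //.
  by rewrite -gE -e gf.
exists f; split=> //.
- by exists g.
- by move=> i w; rewrite (zf_C fr) (zf_C fr').
- by move=> i w; rewrite (zf_D fr) (zf_D fr').
move=> i u w Cu Dw e.
have Cu' : zC N i (\sum_a c u a *: v a) by rewrite -cE.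
have [h1 h2] := zframe_phi p_prime char_p sN fr Cu'.
have Cfu : zC N' i (\sum_a c u a *: v' a).
  by apply/(zf_C fr'); rewrite -fE -cE; apply/sp/(zf_C fr).
have [h1' h2'] := zframe_phi p_prime char_p sN' fr' Cfu.
have Dfw : zD N' i (f w) by apply/(zf_D fr')/sp/(zf_D fr).
rewrite -[f u]/(\sum_a c u a *: v' a) h2'.
have {h2}e : clD i (\sum_(a | sup (dl (pi a)) == i) c u a ^+ p *: (\sum_b Phi b a *: v b)) = clD i w.
  by rewrite -e -h2 -cE.
apply/sqclassP => //; move/(sqclassP (zD N (i - 1)) h1 Dw): e => /(zf_D fr)/sp.
rewrite (linB fL) => h; apply/(zf_D fr').
move: h; congr (supp_span _ _ (_ - _)).
have e1 (V : lmodType R) (z : 'I_n -> V) :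
   \sum_(a | sup (dl (pi a)) == i) c u a ^+ p *: (\sum_b Phi b a *: z b) =
   \sum_b (\sum_(a | sup (dl (pi a)) == i) c u a ^+ p * Phi b a) *: z b.
  under eq_bigr => b _ do rewrite scaler_sumr.
  rewrite exchange_big; apply: eq_bigr => b _; rewrite scaler_suml.
  by apply: eq_bigr => x _; rewrite scalerA.
by rewrite !e1 fE.
Qed.

Lemma zframe_iso pi (v' : 'I_n -> N') Phi :
  zip_iso N N' -> zframe pi v' Phi -> exists v : 'I_n -> N, zframe pi v Phi.
Proof.
case=> f [fL [g gf fg] fC fD fphi] fr.
have fs (c : 'I_n -> R) : f (\sum_a c a *: g (v' a)) = \sum_a c a *: v' a.
  by rewrite (lin_sum fL); apply: eq_bigr => a _; rewrite fg.
have sp (P : pred 'I_n) w : supp_span (fun a => g (v' a)) P w <-> supp_span v' P (f w).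
  split; case=> c [hc e]; exists c; split=> //; first by rewrite e fs.
  by apply: (can_inj gf); rewrite e fs.
exists (fun a => g (v' a)); split.
- move=> w; have [c [cE cU]] := zf_basis fr (f w); exists c; split.
    by apply: (can_inj gf); rewrite fs.
  by move=> d e; apply: cU; rewrite e fs.
- by move=> i w; rewrite fC sp (zf_C fr).
- by move=> i w; rewrite fD sp (zf_D fr).
- move=> a; set i := sup (dl (pi a)).
  set z := zphi _; have zE : z = clD i (sqval z) by rewrite /clD sqclass_val.
  have Dz : zD N i (sqval z) by apply: sqval_mem.
  have Cv : zC N i (g (v' a)) by apply/fC; rewrite fg; apply/(zf_C fr); apply: supp_span_in.
  have := fphi i _ _ Cv Dz zE; rewrite fg (zf_phi fr).
  have Df : zD N' i (f (sqval z)) by apply/fD.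
  have Ds := zf_Dmem a fr.
  move/(sqclassP (zD N' (i - 1)) Ds Df) => h.
  rewrite zE; apply/sqclassP => //.
    by apply/fD; rewrite fs.
  apply/fD; rewrite (linB fL) fs; have := smemN h; rewrite opprB.
  by [].
- exact: zf_graded fr.
- exact: zf_minv fr.
Qed.
End FramesIso.

(** * The standard F-zips *)

Section StandardFrames.
Variables (tau : int -> nat) (supp : seq int) (p : nat).
Hypothesis supp_sorted : sorted <%R supp.
Notation n := (dimz tau supp).
Notation r := (size supp).
Notation x := (xperm tau supp).

Definition supi (k : nat) : int := nth 0 supp k.
(* the index, counted from below, of the step of the flag of [D] where [e_a] appears *)
Definition dlab (a : 'I_n) : nat := (r - blk tau supp a)%N.

Lemma supi_mono i j : (i < r)%N -> (j < r)%N -> (supi i <= supi j) = (i <= j)%N.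
Proof. by move=> ir jr; rewrite /supi (lt_sorted_leq_nth 0 supp_sorted). Qed.

Lemma dlab_lt a : (dlab a < r)%N.
Proof. by have [/andP[h1 h2] _ _] := blkP a; rewrite /dlab; lia. Qed.

Lemma supE a b : (supi (dlab a) <= supi (dlab b)) = (dlab a <= dlab b)%N.
Proof. by apply: supi_mono; apply: dlab_lt. Qed.

Lemma dlab_mono (a b : 'I_n) : (a < b)%N -> (dlab a <= dlab b)%N.
Proof.
move=> ab; have [/andP[h1 h2] h3 h4] := blkP a; have [/andP[k1 k2] k3 k4] := blkP b.
rewrite /dlab; suff : (blk tau supp b <= blk tau supp a)%N by lia.
rewrite leqNgt; apply/negP => lt.
have : (msz tau supp (blk tau supp a) <= msz tau supp (blk tau supp b).-1)%N.
  by apply: leq_msz; lia.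
lia.
Qed.

Lemma count_ge (s : seq int) (i : int) m : sorted <%R s -> (m < size s)%N ->
  (i <= nth 0 s m) = (size s - count (fun k => (i <= k)%R) s <= m)%N.
Proof.
elim: s m => // k s IH m srt; have {}IH := IH _ (path_sorted srt).
have cs := count_size (fun k => i <= k) s.
case: m => [|m] /=.
  move=> _; case: (boolP (i <= k)) => ik /=.
    have /eqP -> : count (fun k => (i <= k)%R) s == size s.
      rewrite -all_count; apply/allP => l ls; apply: le_trans ik _; apply: ltW.
      by have /allP := order_path_min lt_trans srt; apply.
    by rewrite add1n subnn.
  by rewrite add0n subSn.
rewrite ltnS => ms; rewrite IH //; case: (boolP (i <= k)) => ik /=; last first.
  by rewrite add0n subSn.
have /eqP -> : count (fun k => (i <= k)%R) s == size s.
  rewrite -all_count; apply/allP => l ls; apply: le_trans ik _; apply: ltW.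
  by have /allP := order_path_min lt_trans srt; apply.
by rewrite add1n !subnn.
Qed.

Lemma count_le (s : seq int) (i : int) m : sorted <%R s -> (m < size s)%N ->
  (nth 0 s m <= i) = (m < count (fun k => (k <= i)%R) s)%N.
Proof.
elim: s m => // k s IH m srt; have {}IH := IH _ (path_sorted srt).
have big l : l \in s -> k < l.
  by have /allP := order_path_min lt_trans srt; apply.
case: m => [|m] /=.
  move=> _; case: (boolP (k <= i)) => // nki.
  rewrite add0n; apply/esym/negbTE; rewrite -has_count; apply/hasPn => l /big kl.
  by apply: contra nki => li; apply: ltW; apply: lt_le_trans kl li.
rewrite ltnS => ms; rewrite IH //; case: (boolP (k <= i)) => // nki.
have : ~~ has (fun k => (k <= i)%R) s.
  apply/hasPn => l /big kl.
  by apply: contra nki => li; apply: ltW; apply: lt_le_trans kl li.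
by rewrite has_count -leqNgt leqn0 => /eqP->.
Qed.

Lemma blk_xle a k : (x a < msz tau supp k)%N = (blk tau supp a <= k)%N.
Proof.
have [/andP[h1 h2] _] := xnat_bounds a.
have -> : (x a : nat) = xnat tau supp a by rewrite permE val_xfun.
have [/andP[b0 br] _ _] := blkP a.
apply/idP/idP => [lt|le]; last by apply: leq_trans h2 _; apply: leq_msz.
rewrite leqNgt; apply/negP => kb.
have : (msz tau supp k <= msz tau supp (blk tau supp a).-1)%N by apply: leq_msz; lia.
lia.
Qed.

Lemma blk_le (a : 'I_n) k : (dimz tau supp - msz tau supp k <= a)%N = (blk tau supp a <= k)%N.
Proof.
have [/andP[b0 br] h1 h2] := blkP a.
apply/idP/idP => [le|le]; last first.
  by have := leq_msz tau supp le; lia.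
rewrite leqNgt; apply/negP => kb.
have : (msz tau supp k <= msz tau supp (blk tau supp a).-1)%N by apply: leq_msz; lia.
have := ltn_ord a; lia.
Qed.

Lemma stdC_lab i a : (x a < msz tau supp (nge supp i))%N = (i <= supi (dlab a)).
Proof.
rewrite blk_xle /supi (count_ge i supp_sorted (dlab_lt a)) /dlab /nge.
have [/andP[b0 br] _ _] := blkP a.
by have := count_size (fun k => (i <= k)%R) supp; lia.
Qed.

Lemma stdD_lab i (a : 'I_n) :
  (a < dimz tau supp - msz tau supp (r - nle supp i))%N = (supi (dlab a) <= i).
Proof.
rewrite ltnNge blk_le /supi (count_le i supp_sorted (dlab_lt a)) /dlab /nle.
have [/andP[b0 br] _ _] := blkP a.
by have := count_size (fun k => (k <= i)%R) supp; lia.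
Qed.

Lemma std_block i a : (msz tau supp (nge supp (i + 1)) <= x a < msz tau supp (nge supp i))%N =
  (supi (dlab a) == i).
Proof. by rewrite leqNgt !stdC_lab; lia. Qed.

Lemma x_lt a b : (x a < x b)%N = (dlab b < dlab a)%N || ((dlab a == dlab b) && (a < b)%N).
Proof.
have [/andP[a1 a2] [a3 a4]] := xnat_bounds a; have [/andP[b1 b2] [b3 b4]] := xnat_bounds b.
have [/andP[a5 a6] _ _] := blkP a; have [/andP[b5 b6] _ _] := blkP b.
have xE c : (x c : nat) = xnat tau supp c by rewrite permE val_xfun.
rewrite !xE /dlab.
case: (ltngtP (blk tau supp a) (blk tau supp b)) => [lt|lt|eq].
- have : (msz tau supp (blk tau supp a) <= msz tau supp (blk tau supp b).-1)%N by apply: leq_msz; lia.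
  lia.
- have : (msz tau supp (blk tau supp b) <= msz tau supp (blk tau supp a).-1)%N by apply: leq_msz; lia.
  lia.
- by rewrite eq in a4 *; rewrite ltnn eqxx /=; lia.
Qed.

(* phi maps the class of [e_a] to the class of [e_b], [b = zperm u a] *)
Definition zperm (u : 'S_n) : 'S_n := (u^-1 * x^-1)%g.

Lemma zpermE u a : x (zperm u a) = (u^-1)%g a.
Proof. by rewrite permM permKV. Qed.

Lemma zperm_inj : injective zperm.
Proof. by move=> u w /mulIg/invg_inj. Qed.

Lemma JW_perm u : in_JW u <-> JWperm dlab (zperm u).
Proof.
split=> [/forallP J a b ab e|J].
  have h : ((u^-1)%g a < (u^-1)%g b)%N.
    have [/andP[a5 a6] a7 a8] := blkP a; have [/andP[b5 b6] b7 b8] := blkP b.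
    have eb : blk tau supp a = blk tau supp b by move: e; rewrite /dlab; lia.
    have := J (Ordinal (a6 : (blk tau supp a < r.+1)%N)) => /forallP/(_ a)/forallP/(_ b)/implyP.
    apply; apply/and4P; split=> //=.
    by move: b8; rewrite -eb.
  by move: h; rewrite -!zpermE x_lt => /orP[h|/andP[/eqP h1 h2]]; [left|right].
apply/forallP => j; apply/forallP => a; apply/forallP => b; apply/implyP.
case/and4P=> j0 ja ab bj.
have e : dlab a = dlab b.
  move: ja; rewrite blk_le => ja; have [/andP[b5 b6] b7 b8] := blkP b.
  have h : (dlab a <= dlab b)%N := dlab_mono ab.
  have : (j <= blk tau supp b)%N.
    rewrite leqNgt; apply/negP => lt; have : (blk tau supp b <= j.-1)%N by lia.
    rewrite -blk_le; lia.
  move: h; rewrite /dlab; have [/andP[a5 a6] _ _] := blkP a; lia.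
rewrite -!zpermE x_lt; case: (J a b ab e) => [->//|[h1 h2]].
by rewrite h1 eqxx h2 orbT.
Qed.

Hypothesis p_prime : prime p.

Section StdZip.
Variables (R : comPzRingType) (u : 'S_n).
Hypothesis char_p : p%:R = 0 :> R.
Notation N := (std_zip p u R).

Let e (a : 'I_n) : N := (\col_b (b == a)%:R : 'cV[R]_n).

Let sumE (c : 'I_n -> R) : \sum_a c a *: e a = (\col_a c a : 'cV[R]_n).
Proof.
apply/colP => b; rewrite summxE mxE (bigD1 b) //= big1 => [|a ab].
  by rewrite !mxE eqxx mulr1 addr0.
by rewrite !mxE eq_sym (negbTE ab) mulr0.
Qed.

Let supp_e (P : pred 'I_n) (w : N) :
  supp_span e P w <-> (forall a, ~~ P a -> (w : 'cV[R]_n) a 0 = 0).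
Proof.
split=> [[c [hc ->]] a nP|h]; first by rewrite sumE mxE hc.
exists (fun a => (w : 'cV[R]_n) a 0); split=> //; rewrite sumE.
by apply/colP => a; rewrite mxE.
Qed.

Let stdF_eq i (v w : 'cV[R]_n) : stdC u R (i + 1) (v - w) -> stdF p u i v = stdF p u i w.
Proof.
move=> h; apply/colP => b; rewrite !mxE std_block; case: eqP => // eb.
have := h (u (x b)); rewrite permK stdC_lab eb => /(_ _)/= h1.
have {h1} : (v - w) (u (x b)) 0 = 0 by apply: h1; lia.
by rewrite !mxE => /eqP; rewrite subr_eq0 => /eqP->.
Qed.

Let stdF_D i (v : 'cV[R]_n) : stdD tau supp R i (stdF p u i v).
Proof.
move=> b; rewrite stdD_lab mxE std_block; case: eqP => // ->.
by rewrite lexx.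
Qed.

Lemma std_semi : zsemi p N.
Proof.
move=> i a z t.
rewrite -[LHS]/(sqclass (stdD tau supp R i) (stdD tau supp R (i - 1)) (stdF p u i (sqval (a *: z + t)))).
have -> : stdF p u i (sqval (a *: z + t)) = a ^+ p *: stdF p u i (sqval z) + stdF p u i (sqval t).
  rewrite (@stdF_eq i _ (a *: (sqval z : 'cV[R]_n) + sqval t)); last first.
    apply/(sqclassP (A := stdC u R i) (stdC u R (i + 1))).
    - exact: sqval_mem.
    - by apply: smemP; apply: sqval_mem.
    - rewrite sqclass_val sqclassL ?sqclass_val //; exact: sqval_mem.
  apply/colP => b; rewrite !mxE; case: ifP => _; last by rewrite mulr0 addr0.
  by rewrite (frobD p_prime char_p) exprMn.
by rewrite sqclassL.
Qed.

Lemma std_frame : zframe dlab supi (zperm u) e (\matrix_(b, a) (b == zperm u a)%:R).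
Proof.
split.
- move=> w; exists [ffun a => (w : 'cV[R]_n) a 0]; split.
    by rewrite sumE; apply/colP => a; rewrite mxE ffunE.
  by move=> c ->; rewrite sumE; apply/ffunP => a; rewrite ffunE mxE.
- move=> i w; rewrite supp_e; split=> [h a|h].
    by rewrite -stdC_lab zpermE; apply: h.
  refine (fun a => _); by have := h a; rewrite -stdC_lab zpermE; apply.
- move=> i w; rewrite supp_e; split=> [h a|h].
    by rewrite -stdD_lab; apply: h.
  refine (fun a => _); by have := h a; rewrite -stdD_lab; apply.
- move=> a; set i := supi _.
  have -> : \sum_b (\matrix_(b, a) (b == zperm u a)%:R : 'M[R]_n) b a *: e b = e (zperm u a).
    rewrite (bigD1 (zperm u a)) //= mxE eqxx scale1r big1 ?addr0 // => b /negbTE nb.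
    by rewrite mxE nb scale0r.
  rewrite /clC /clD -[LHS]/(sqclass (stdD tau supp R i) (stdD tau supp R (i - 1))
    (stdF p u i (sqval (sqclass (stdC u R i) (stdC u R (i + 1)) (e a))))).
  have Ce : stdC u R i (e a).
    move=> b; rewrite /e mxE; case: eqP => // ->; rewrite -zpermE stdC_lab.
    by rewrite lexx.
  rewrite (@stdF_eq i _ (e a)); last first.
    apply/(sqclassP (A := stdC u R i) (stdC u R (i + 1))) => //.
      exact: sqval_mem.
    by rewrite sqclass_val.
  congr (sqclass _ _ _); apply/colP => b; rewrite !mxE std_block.
  have -> : (u (x b) == a) = (b == zperm u a).
    by rewrite -(inj_eq (@perm_inj _ (zperm u))) /zperm permM !permK.
  case: (b =P zperm u a) => [->|_]; first by rewrite eqxx expr1n.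
  by case: ifP => //; rewrite expr0n; case: p (prime_gt0 p_prime).
- by move=> b a; rewrite mxE; case: (b =P zperm u a) => [->|//]; rewrite eqxx.
- exact: perm_minv.
Qed.
End StdZip.
End StandardFrames.

(** * Bases adapted to a filtration *)

Lemma supp_span_mono (R : comPzRingType) (M : lmodType R) n (v : 'I_n -> M) (P Q : pred 'I_n) w :
  (forall a, P a -> Q a) -> supp_span v P w -> supp_span v Q w.
Proof.
move=> PQ [c [hc ->]]; exists c; split=> // a nQ; apply: hc.
by apply: contra nQ; apply: PQ.
Qed.

Section GradedBases.
Variables (R : comPzRingType) (M : lmodType R) (n : nat).

(** The [v a] with [P a] represent a basis of A / (A :&: B). The formulation by lifts is convenient
    for localizing and for assembling a basis of [M]. *)
Definition graded_basis (A B : submod M) (P : pred 'I_n) (v : 'I_n -> M) : Prop :=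
  [/\ forall a, P a -> A (v a),
      forall w, A w -> exists c : 'I_n -> R, B (w - \sum_(a | P a) c a *: v a)
    & forall c : 'I_n -> R, B (\sum_(a | P a) c a *: v a) -> forall a, P a -> c a = 0].

Lemma graded_basis_ex (A B : submod M) (P : pred 'I_n) m (e : 'I_m -> subquo A B) :
  is_basis e -> #|P| = m -> exists v, graded_basis A B P v.
Proof.
move=> eb cP; subst m.
pose pre (a : 'I_n) := [pick j : 'I_#|P| | enum_val j == a].
have preE j : pre (enum_val j) = Some j.
  rewrite /pre; case: pickP => [j' /eqP/enum_val_inj->//|/(_ j)].
  by rewrite eqxx.
have enumP a : P a -> exists j, a = enum_val (A := P) j.
  by move=> Pa; exists (enum_rank_in (Pa : a \in P) a); rewrite enum_rankK_in.
pose v a := if pre a is Some j then sqval (e j) else 0.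
have vE j : v (enum_val j) = sqval (e j) by rewrite /v preE.
have sE (V : zmodType) (F : 'I_n -> V) : \sum_(a | P a) F a = \sum_(j < #|P|) F (enum_val j).
  exact: big_enum_val.
have Ae j : A (sqval (e j)) by apply: sqval_mem.
have cE (c : 'I_n -> R) : \sum_(a | P a) c a *: v a = \sum_j c (enum_val j) *: sqval (e j).
  by rewrite sE; apply: eq_bigr => j _; rewrite vE.
have clE (c : 'I_#|P| -> R) : sqclass A B (\sum_j c j *: sqval (e j)) = \sum_j c j *: e j.
  by rewrite sqclass_sum //; apply: eq_bigr => j _; rewrite sqclass_val.
have As (c : 'I_#|P| -> R) : A (\sum_j c j *: sqval (e j)).
  by apply: smem_sum => j; apply: smemZ.
exists v; split.
- by move=> a /enumP[j ->]; rewrite vE.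
- move=> w Aw; have [c cw] := basis_ex eb (sqclass A B w).
  exists (fun a => if pre a is Some j then c j else 0); rewrite cE.
  under eq_bigr => j _ do rewrite preE.
  by apply/(sqclassP (A := A)) => //; rewrite clE.
- move=> c; rewrite cE => /(sqclass_eq0 B (As _)); rewrite clE => h a /enumP[j ->].
  apply: (basis_inj eb (c := fun j => c (enum_val j)) (d := fun=> 0)).
  by rewrite h big1 // => i _; rewrite scale0r.
Qed.

Variables (F : int -> submod M) (lab : 'I_n -> int) (v : 'I_n -> M) (lo hi : int).
Hypotheses (F_lo : forall i w, i <= lo -> F i w) (F_hi : forall i w, hi <= i -> F i w -> w = 0).
Hypotheses (lab_lo : forall a, lo <= lab a) (lab_hi : forall a, lab a < hi).
Hypothesis F_le : forall i w, lo <= i < hi -> F (i + 1) w -> F i w.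
Hypothesis F_gr : forall i, lo <= i < hi -> graded_basis (F i) (F (i + 1)) (fun a => lab a == i) v.

Let split_lab (c : 'I_n -> R) i :
  \sum_(a | i <= lab a) c a *: v a = \sum_(a | lab a == i) c a *: v a + \sum_(a | i + 1 <= lab a) c a *: v a.
Proof.
rewrite (bigID (fun a => lab a == i)) /=; congr (_ + _); apply: eq_bigl => a.
  by case: eqP => [->|]; rewrite ?lexx // andbF.
by rewrite lezD1 lt_neqAle andbC eq_sym.
Qed.

Let F_span i w : lo <= i -> F i w -> supp_span v (fun a => i <= lab a) w.
Proof.
have h k : forall j w', lo <= j -> hi <= j + k%:Z -> F j w' -> supp_span v (fun a => j <= lab a) w'.
  elim: k => [|k IH] j w' loj hij Fw.
    by rewrite (F_hi _ Fw); [apply: supp_span0|lia].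
  have [hj|hj] := leP hi j; first by rewrite (F_hi hj Fw); apply: supp_span0.
  have rng : lo <= j < hi by rewrite loj.
  have [_ /(_ _ Fw)[c Bw] _] := F_gr rng.
  have le1 : lo <= j + 1 by lia.
  have hi1 : hi <= j + 1 + k%:Z by lia.
  have := IH _ _ le1 hi1 Bw; move=> h.
  rewrite -(subrK (\sum_(a | lab a == j) c a *: v a) w') -[X in X + _]scale1r.
  apply: supp_spanP.
    by apply: supp_span_mono h => a; lia.
  rewrite big_mkcond; exists (fun a => if lab a == j then c a else 0); split.
    by move=> a; case: eqP => // ->; rewrite lexx.
  by apply: eq_bigr => a _; case: ifP => // _; rewrite scale0r.
by move=> loi; apply: (h `|hi - i|%N) => //; lia.
Qed.

Let F_in a i : i <= lab a -> F i (v a).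
Proof.
move=> ia; have [li|li] := leP i lo; first exact: F_lo.
have la : lo <= lab a < hi by rewrite lab_lo lab_hi.
have : F (lab a) (v a) by have [h _ _] := F_gr la; apply: h.
have h k : forall j, lo < i -> i + k%:Z = j -> j <= lab a -> F j (v a) -> F i (v a).
  elim: k => [|k IH] j loi e ja Fj; first by move: Fj; rewrite -e addr0.
  apply: (IH (j - 1)) => //; [lia|lia|].
  apply: F_le; last by rewrite subrK.
  have := lab_hi a; lia.
by move=> Fa; apply: (h `|lab a - i|%N (lab a)) => //; lia.
Qed.

(** For a finite descending filtration, lifts of bases of the graded pieces generate by descending
    induction on the step and are independent by ascending induction on the label. *)
Lemma adapted_basis : is_basis v /\
  forall i w, F i w <-> supp_span v (fun a => i <= lab a) w.
Proof.
have free (c : 'I_n -> R) : \sum_a c a *: v a = 0 -> forall a, c a = 0.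
  move=> e; have h k : forall a, lab a < lo + k%:Z -> c a = 0.
    elim: k => [a|k IH a lt]; first by have := lab_lo a; lia.
    have [lt'|ge] := ltP (lab a) (lo + k%:Z); first exact: IH.
    have la : lab a = lo + k%:Z by lia.
    have rng : lo <= lo + k%:Z < hi by rewrite -la lab_lo lab_hi.
    have [_ _ h] := F_gr rng; apply: h; last by rewrite la.
    have e1 : \sum_(b | lo + k%:Z <= lab b) c b *: v b = 0.
      have e2 : \sum_(b | ~~ (lo + k%:Z <= lab b)) c b *: v b = 0.
        by apply: big1 => b; rewrite -ltNge => /IH->; rewrite scale0r.
      by move: e; rewrite (bigID (fun b => lo + k%:Z <= lab b)) /= e2 addr0.
    have -> : \sum_(b | lab b == lo + k%:Z) c b *: v b = - \sum_(b | lo + k%:Z + 1 <= lab b) c b *: v b.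
      by apply/eqP; rewrite -addr_eq0 -split_lab e1.
    apply: smemN; rewrite big_mkcond; apply: smem_sum => b.
    case: ifP => [le|_]; last exact: smem0.
    by apply: smemZ; apply: F_in.
  by move=> a; apply: (h (absz (lab a - lo + 1)) a); have := lab_lo a; lia.
split.
  move=> w; have [c [_ cE]] := F_span (lexx lo) (F_lo w (lexx lo)).
  exists [ffun a => c a]; split; first by rewrite cE; apply: eq_bigr => a _; rewrite ffunE.
  move=> d dE; apply/ffunP => a; rewrite ffunE; apply/eqP; rewrite -subr_eq0; apply/eqP.
  apply: (free (fun a => c a - d a)).
  by under eq_bigr => b _ do rewrite scalerBl; rewrite sumrB -cE -dE subrr.
move=> i w; split=> [Fw|].
  have [li|li] := leP lo i; first exact: F_span.
  apply: supp_span_mono (F_span (lexx lo) (F_lo w (lexx lo))) => a _.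
  by have := lab_lo a; lia.
case=> c [hc ->]; apply: smem_sum => a.
have [ia|ia] := boolP (i <= lab a); first by apply: smemZ; apply: F_in.
by rewrite hc // scale0r; apply: smem0.
Qed.
End GradedBases.

(** * Graded bases under localization and base change *)

Section GradedBasisLocal.
Variables (R L : comPzRingType) (f : R) (l : {rmorphism R -> L}).
Variables (M : lmodType R) (M' : lmodType L) (alpha : M -> M') (n : nat).
Hypotheses (loc : is_localization f l) (bc : is_base_change l alpha).
Notation im A := (generated (fun v' => exists2 w, A w & v' = alpha w)).

(** Clearing denominators gives an equality in the base change, which holds in [M] after a further
    power of [f] by [loc_bc_kernel]. *)
Lemma generated_frac (B : submod M) u : im B (alpha u) -> exists k, B (f ^+ k *: u).
Proof.
case=> k [y [e [eB aE]]].
have [b bE] := choice (fun j => let: ex_intro2 w Bw ew := eB j in ex_intro _ w (conj Bw ew)).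
have [lam [h1 _ _]] := loc_lam loc.
have [N hN] := ev_ex (ev_all (fun j => h1 (y j))).
pose w := \sum_j lam (y j) N *: b j.
have e0 : alpha (f ^+ N *: u - w) = 0.
  rewrite (semiB (bc_lin bc)) (semiZ (bc_lin bc)) (semi_lin (bc_lin bc)) aE scaler_sumr -sumrB.
  by rewrite big1 // => j _; rewrite hN rmorphXn (proj2 (bE j)) scalerA subrr.
have [m] := loc_bc_kernel loc bc e0; rewrite scalerBr scalerA -exprD => /eqP; rewrite subr_eq0 => /eqP hm.
exists (m + N)%N; rewrite hm; apply: smemZ; apply: smem_sum => j; apply: smemZ.
by case: (bE j).
Qed.

Lemma graded_basis_loc (A B : submod M) (A' B' : submod M') P (v : 'I_n -> M) :
  (forall w, A' w <-> im A w) -> (forall w, B' w <-> im B w) ->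
  graded_basis A B P v -> graded_basis A' B' P (fun a => alpha (v a)).
Proof.
move=> hA hB [vA vS vI]; split.
- by move=> a Pa; apply/hA; apply: generated_sub; exists (v a) => //; apply: vA.
- move=> w /hA; pose C w := exists c : 'I_n -> L, B' (w - \sum_(a | P a) c a *: alpha (v a)).
  have C0 : C 0 by exists (fun=> 0); rewrite big1 ?subr0; [apply: smem0|move=> a _; rewrite scale0r].
  have CP a u t : C u -> C t -> C (a *: u + t).
    move=> [c hc] [d hd]; exists (fun b => a * c b + d b).
    have -> : \sum_(b | P b) (a * c b + d b) *: alpha (v b) =
        a *: (\sum_(b | P b) c b *: alpha (v b)) + \sum_(b | P b) d b *: alpha (v b).
      by rewrite scaler_sumr -big_split; apply: eq_bigr => b _; rewrite scalerDl scalerA.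
    by rewrite opprD addrACA -scalerBr; apply: smemP.
  apply: (generated_min (C := Submod C0 CP)) => _ [u Au ->].
  have [c hc] := vS u Au; exists (fun a => l (c a)).
  apply/hB; apply: generated_sub; exists (u - \sum_(a | P a) c a *: v a) => //.
  rewrite (semiB (bc_lin bc)); congr (_ - _); rewrite (semi_sum (bc_lin bc)).
  by apply: eq_bigr => a _; rewrite (semiZ (bc_lin bc)).
move=> c hc a Pa.
have [lam [h1 _ _]] := loc_lam loc.
have [N hN] := ev_ex (ev_all (fun a => h1 (c a))).
have : im B (alpha (\sum_(a | P a) lam (c a) N *: v a)).
  apply/hB; have -> : alpha (\sum_(a | P a) lam (c a) N *: v a) = l f ^+ N *: \sum_(a | P a) c a *: alpha (v a).
    rewrite (semi_sum (bc_lin bc)) scaler_sumr; apply: eq_bigr => b _.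
    by rewrite (semiZ (bc_lin bc)) hN scalerA.
  exact: smemZ.
case/generated_frac => k Bk.
have {}Bk : B (\sum_(a | P a) (f ^+ k * lam (c a) N) *: v a).
  by move: Bk; rewrite scaler_sumr; under eq_bigr => b _ do rewrite scalerA.
have := congr1 l (vI _ Bk a Pa); rewrite rmorph0 rmorphM hN rmorphXn mulrA -exprD.
case: loc => -[b hb] _ _ /(congr1 ( *%R (b ^+ (k + N)))).
by rewrite mulr0 mulrA -exprMn [b * _]mulrC hb expr1n mul1r.
Qed.
End GradedBasisLocal.

Section GradedQuotients.
Variable n : nat.

Lemma imp_ex (T : Type) (t : T) (P : Prop) (Q : T -> Prop) :
  (P -> exists u, Q u) -> exists u, P -> Q u.
Proof.
by have [hP /(_ hP)[u Qu]|nP _] := pselect P; [exists u|exists t].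
Qed.

Lemma graded_basis_eq (R : comPzRingType) (N : lmodType R) (A C : submod N) (P P' : pred 'I_n) v v' :
  P =1 P' -> (forall a, P a -> v a = v' a) -> graded_basis A C P v -> graded_basis A C P' v'.
Proof.
move=> PE e [vA vS vI].
have sE (c : 'I_n -> R) : \sum_(a | P' a) c a *: v' a = \sum_(a | P a) c a *: v a.
  rewrite (eq_bigl _ _ PE); apply: eq_bigr => a Pa.
  by rewrite e // PE.
split.
- by move=> a; rewrite -PE => Pa; rewrite -e //; apply: vA.
- by move=> w /vS[c hc]; exists c; rewrite sE.
- by move=> c; rewrite sE => h a; rewrite -PE; apply: vI h a.
Qed.

Lemma graded_basis_quo (R : comPzRingType) (N : lmodType R) (A C : submod N) (P : pred 'I_n) v :
  graded_basis A C P v -> is_basis (fun j : 'I_#|P| => sqclass A C (v (enum_val j))).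
Proof.
move=> [vA vS vI].
have Av (j : 'I_#|P|) : A (v (enum_val j)) by apply: vA; apply: (enum_valP j).
have As (c : 'I_#|P| -> R) : A (\sum_j c j *: v (enum_val j)).
  by apply: smem_sum => j; apply: smemZ.
have sE (F : 'I_n -> N) : \sum_(a | P a) F a = \sum_(j < #|P|) F (enum_val j).
  exact: big_enum_val.
move=> z; have Az : A (sqval z) by apply: sqval_mem.
have [c hc] := vS _ Az; exists [ffun j => c (enum_val j)]; split.
  rewrite -[LHS]sqclass_val; under eq_bigr => j _ do rewrite ffunE.
  by rewrite -sqclass_sum //; apply/(sqclassP (A := A)) => //; rewrite -(sE (fun a => c a *: v a)).
move=> d dE; apply/ffunP => j; rewrite ffunE.
pose d' a := if [pick j : 'I_#|P| | enum_val j == a] is Some j then d j else 0.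
have d'E i : d' (enum_val i) = d i.
  rewrite /d'; case: pickP => [i' /eqP/enum_val_inj->//|/(_ i)].
  by rewrite eqxx.
have h : C (sqval z - \sum_j d j *: v (enum_val j)).
  by apply/(sqclassP (A := A)) => //; rewrite sqclass_val dE sqclass_sum.
have : C (\sum_(a | P a) (c a - d' a) *: v a).
  have -> : \sum_(a | P a) (c a - d' a) *: v a = (sqval z - \sum_j d j *: v (enum_val j)) -
      (sqval z - \sum_(a | P a) c a *: v a).
    rewrite opprB addrC addrA subrK !sE -sumrB; apply: eq_bigr => i _.
    by rewrite scalerBl d'E.
  by apply: smemD => //; apply: smemN.
move/vI => /(_ (enum_val j) (enum_valP j))/eqP.
by rewrite d'E subr_eq0 => /eqP.
Qed.

Lemma supp_span_bc (R R' : comPzRingType) (phi : {rmorphism R -> R'}) (N : lmodType R)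
    (N' : lmodType R') (al : N -> N') (A : submod N) (A' : submod N') (v : 'I_n -> N) P :
  is_base_change phi al ->
  (forall w, A' w <-> generated (fun v' => exists2 u, A u & v' = al u) w) ->
  (forall w, A w <-> supp_span v P w) -> forall w, A' w <-> supp_span (fun a => al (v a)) P w.
Proof.
move=> bc hA' hA w; rewrite hA'; split.
  apply: (generated_min (C := supp_sub (fun a => al (v a)) P)) => _ [u /hA[c [hc ->]] ->].
  rewrite (semi_lin (bc_lin bc)); apply: supp_span_lin => a /hc->.
  exact: rmorph0.
case=> c [hc ->]; rewrite -hA'; apply: smem_sum => a.
have [Pa|/hc->] := boolP (P a); last by rewrite scale0r; apply: smem0.
apply: smemZ; apply/hA'; apply: generated_sub; exists (v a) => //.
by apply/hA; apply: supp_span_in.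
Qed.

End GradedQuotients.

Lemma card_ord_lt n m : (m <= n)%N -> #|[pred a : 'I_n | (a < m)%N]| = m.
Proof.
move=> mn; rewrite -sum1_card -[RHS]card_ord -sum1_card.
by rewrite [RHS](big_ord_widen n (fun=> 1%N) mn).
Qed.

(** The indices of label i_k, [k] counted from 0, form the block with j = r - k, that is n - m_j <=
    a < n - m_(j-1), of size n_j. *)
Lemma card_lab (tau : int -> nat) (supp : seq int) i : sorted <%R supp ->
  (forall i, (i \in supp) = (tau i != 0%N)) ->
  #|[pred a : 'I_(dimz tau supp) | supi supp (dlab a) == i]| = tau i.
Proof.
move=> srt suppE; have [iS|iS] := boolP (i \in supp); last first.
  have /eqP -> : tau i == 0%N by move: iS; rewrite suppE negbK.
  apply: eq_card0 => a; rewrite inE; apply: contraNF iS => /eqP<-.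
  by apply: mem_nth; apply: dlab_lt.
have [k kr <-] : exists2 k, (k < size supp)%N & supi supp k = i.
  by exists (index i supp); rewrite ?index_mem // /supi nth_index.
set j := (size supp - k)%N; have j0 : (0 < j)%N by rewrite /j; lia.
have jr : (j <= size supp)%N by rewrite /j; lia.
have hj := leq_msz tau supp jr; have hj1 := leq_msz tau supp (leq_pred j).
rewrite -/(dimz tau supp) in hj.
have le1 : (dimz tau supp - msz tau supp j <= dimz tau supp)%N by lia.
have le2 : (dimz tau supp - msz tau supp j.-1 <= dimz tau supp)%N by lia.
have E : (msz tau supp j = msz tau supp j.-1 + tau (supi supp k))%N.
  by rewrite -{1}(prednK j0) mszS prednK // /nsz /j; congr (_ + tau (nth _ _ _))%N; lia.
have c1 := card_ord_lt le1; have c2 := card_ord_lt le2.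
have := cardID [pred a : 'I_(dimz tau supp) | (a < dimz tau supp - msz tau supp j)%N]
  [pred a : 'I_(dimz tau supp) | (a < dimz tau supp - msz tau supp j.-1)%N].
rewrite c2.
have -> : #|[predI [pred a : 'I_(dimz tau supp) | (a < dimz tau supp - msz tau supp j.-1)%N] &
     [pred a : 'I_(dimz tau supp) | (a < dimz tau supp - msz tau supp j)%N]]| =
    (dimz tau supp - msz tau supp j)%N.
  by rewrite -[RHS]c1; apply: eq_card => a; rewrite !inE; apply/andP/idP; [case|split=> //; lia].
move=> e; have {e} : #|[predD [pred a : 'I_(dimz tau supp) | (a < dimz tau supp - msz tau supp j.-1)%N] &
     [pred a : 'I_(dimz tau supp) | (a < dimz tau supp - msz tau supp j)%N]]| = tau (supi supp k).
  by apply: (@addnI (dimz tau supp - msz tau supp j)%N); apply: (etrans e); lia.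
move=> <-; apply: eq_card => a; rewrite !inE.
have := supi_mono srt (dlab_lt srt a) kr; have := supi_mono srt kr (dlab_lt srt a).
rewrite eq_le => -> ->; have := blk_le srt a j; have := blk_le srt a j.-1.
have [/andP[b0 br] _ _] := blkP a; rewrite /dlab /j; lia.
Qed.

(** * Neighbourhoods of a point *)

Section Loci.
Variable S : zfunctor.

(* Near the point [x], the condition [T] on [Spec A] is closed, with equations
   [E]; near [x] means where [r] is invertible. *)
Definition locus (A : comPzRingType) (K : fieldType) (x : {rmorphism A -> K}) (s : S A)
    (T : forall R : comPzRingType, S R -> Prop) : Prop :=
  exists (r : A) (E : A -> Prop), x r != 0 /\
    forall (R' : comPzRingType) (phi : {rmorphism A -> R'}), (exists b, phi r * b = 1) ->
      ((forall e, E e -> phi e = 0) <-> T R' (act phi s)).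

Definition near (A : comPzRingType) (K : fieldType) (x : {rmorphism A -> K}) (s : S A)
    (T : forall R : comPzRingType, S R -> Prop) : Prop :=
  exists2 r : A, x r != 0 & forall (R' : comPzRingType) (phi : {rmorphism A -> R'}),
    (exists b, phi r * b = 1) -> T R' (act phi s).

(** The properties needed of the map from [A] to A_r / (E), the ring of a locally closed subscheme.
    By the third clause a map out of [C] is determined by its restriction to [A]. *)
Definition local_immersion (A C : comPzRingType) (be : {rmorphism A -> C}) (r : A)
    (E : A -> Prop) : Prop :=
  [/\ exists b, be r * b = 1, forall e, E e -> be e = 0,
      forall c, exists a k, be r ^+ k * c = be a
    & forall (R' : comPzRingType) (phi : {rmorphism A -> R'}), (exists b, phi r * b = 1) ->
        (forall e, E e -> phi e = 0) ->
        exists psi : {rmorphism C -> R'}, forall a, psi (be a) = phi a].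

Lemma loc_immersion (A C : comPzRingType) (r : A) (l : {rmorphism A -> C}) :
  is_localization r l -> local_immersion l r (fun=> False).
Proof.
move=> loc; have [h1 h2 _] := loc; split=> //.
by move=> R' phi u _; apply: (loc_lift loc u).
Qed.

Lemma immersion_ex (A : comPzRingType) (r : A) (E : A -> Prop) :
  exists (C : comPzRingType) (be : {rmorphism A -> C}), local_immersion be r E.
Proof.
pose E' z := exists2 e, E e & z = loc_in r e.
exists (idq E'), (rcomp (idq_pi E') (loc_in r)).
have [[b rb] fr _] := locP r; split.
- by exists (idq_pi E' b); rewrite -[LHS](rmorphM (idq_pi E')) rb rmorph1.
- by move=> e Ee; apply: idq_pi_gen; exists e.
- move=> c; have [z <-] := idq_pi_surj c; have [a [k e]] := fr z.
  by exists a, k; rewrite -[RHS]/(idq_pi E' (loc_in r a)) -e rmorphM rmorphXn.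
- move=> R' phi u z; have [h hE] := loc_lift (locP r) u.
  have [|g gE] := @idq_lift _ E' _ h; first by move=> _ [e Ee ->]; rewrite hE z.
  by exists g => a; rewrite /= gE hE.
Qed.

Lemma unit_mul (R : comPzRingType) (a b : R) :
  (exists c, a * b * c = 1) <-> (exists c, a * c = 1) /\ (exists c, b * c = 1).
Proof.
split=> [[c e]|[[c e] [d f]]].
  by split; [exists (b * c); rewrite mulrA|exists (a * c); rewrite mulrCA mulrA].
by exists (c * d); rewrite mulrACA e f mulr1.
Qed.

Lemma unit_exp (R : comPzRingType) (a : R) k : (exists c, a * c = 1) -> exists c, a ^+ k * c = 1.
Proof. by case=> c e; exists (c ^+ k); apply: unit_pow. Qed.

Lemma unit_reg (R : comPzRingType) (a y : R) : (exists c, a * c = 1) -> a * y = 0 -> y = 0.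
Proof. by case=> c e ay; rewrite -[y]mul1r -e mulrAC ay mul0r. Qed.

(** If the condition already forces the equations [E0] where [r0] is invertible, it suffices to find
    its equations on the locally closed piece: their numerators are added to [E0]. *)
Lemma locus_immersion (A C : comPzRingType) (be : {rmorphism A -> C}) r0 E0 (K : fieldType)
    (x : {rmorphism A -> K}) (y : {rmorphism C -> K}) s T :
  local_immersion be r0 E0 -> (forall a, y (be a) = x a) -> x r0 != 0 ->
  (forall (R' : comPzRingType) (phi : {rmorphism A -> R'}), (exists b, phi r0 * b = 1) ->
     T R' (act phi s) -> forall e, E0 e -> phi e = 0) ->
  locus y (act be s) T -> locus x s T.
Proof.
move=> [bu bE frac lift] yx xr0 hT [r2 [E2 [yr2 h2]]].
have [a2 [k2 e2]] := frac r2.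
have xa2 : x a2 != 0 by rewrite -yx -e2 rmorphM rmorphXn yx mulf_neq0 // expf_neq0.
exists (r0 * a2), (fun a => E0 a \/ exists e k, E2 e /\ be r0 ^+ k * e = be a).
rewrite rmorphM mulf_neq0 //; split=> // R' phi; rewrite rmorphM => /unit_mul[u0 ua].
have fact (psi : {rmorphism C -> R'}) : (forall a, psi (be a) = phi a) ->
    (forall e, E2 e -> psi e = 0) <-> T R' (act phi s).
  move=> pE; rewrite (act_comp (phi := be) (psi := psi)); last by move=> a; rewrite /= pE.
  apply: h2; have [c] := ua; rewrite -pE -e2 rmorphM => e.
  by exists (psi (be r0 ^+ k2) * c); rewrite mulrCA mulrA.
split=> [van|Ts].
  have [|psi pE] := lift R' phi u0; first by move=> e Ee; apply: van; left.
  apply/(fact psi pE) => e Ee; have [a [k ea]] := frac e.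
  have : phi a = 0 by apply: van; right; exists e, k.
  rewrite -pE -ea rmorphM rmorphXn pE; apply: unit_reg; exact: unit_exp.
have van := hT R' phi u0 Ts; have [psi pE] := lift R' phi u0 van.
move=> a [/van//|[e [k [Ee ea]]]].
by rewrite -pE -ea rmorphM (proj2 (fact psi pE) Ts e Ee) mulr0.
Qed.

Lemma near_loc (A C : comPzRingType) (f : A) (l : {rmorphism A -> C}) (K : fieldType)
    (x : {rmorphism A -> K}) (y : {rmorphism C -> K}) s T :
  is_localization f l -> x f != 0 -> (forall a, y (l a) = x a) ->
  near y (act l s) T -> near x s T.
Proof.
move=> lf xf yx [r2 yr2 h2]; have [[b rb] fr _] := lf; have [a [k e]] := fr r2.
exists (f * a).
  by rewrite rmorphM mulf_neq0 // -yx -e rmorphM rmorphXn yx mulf_neq0 // expf_neq0.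
move=> R' phi; rewrite rmorphM => /unit_mul[u ua].
have [g gE] := loc_lift lf u.
rewrite (act_comp (phi := l) (psi := g)); last by move=> t; rewrite /= gE.
apply: h2; case: ua => c; rewrite -gE -e rmorphM => ec.
by exists (g (l f ^+ k) * c); rewrite mulrCA mulrA.
Qed.

(* [l] restricts to a neighbourhood of [x], as far as closed conditions are concerned *)
Definition refines (A C : comPzRingType) (l : {rmorphism A -> C}) (K : fieldType)
    (x : {rmorphism A -> K}) (y : {rmorphism C -> K}) : Prop :=
  (forall a, y (l a) = x a) /\ forall T s, locus y (act l s) T -> locus x s T.

Lemma refines_loc (A C : comPzRingType) (r : A) (l : {rmorphism A -> C}) (K : fieldType)
    (x : {rmorphism A -> K}) : is_localization r l -> x r != 0 ->
  exists y, refines l x y.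
Proof.
move=> loc xr; have [y yE] := loc_point loc xr.
exists y; split=> // T s; by apply: (locus_immersion (loc_immersion loc)).
Qed.

Lemma refines_all (I : eqType) (P : I -> forall R : comPzRingType, S R -> Prop) (L : seq I)
    (A : comPzRingType) (K : fieldType) (x : {rmorphism A -> K}) (s : S A) :
  (forall i (R : comPzRingType) (s : S R), zariski_locally (P i) s) ->
  (forall i (R R' : comPzRingType) (f : R) (l : {rmorphism R -> R'}) (s : S R),
     is_localization f l -> P i R s -> P i R' (act l s)) ->
  exists (C : comPzRingType) (l : {rmorphism A -> C}) (y : {rmorphism C -> K}),
    refines l x y /\ forall i, i \in L -> P i C (act l s).
Proof.
move=> loc pers; elim: L => [|i L [C [l [y [[yx ref] hL]]]]].
  exists A, (ridm A), x; split=> //; split=> // T s'.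
  by rewrite act_id.
have [k [f [fu fP]]] := loc i C (act l s).
have [a ya] := unit_family_point y fu.
have lc := locP (f a); have [z [zy ref']] := refines_loc lc ya.
exists (locr (f a)), (rcomp (loc_in (f a)) l), z.
have ac s' : act (rcomp (loc_in (f a)) l) s' = act (loc_in (f a)) (act l s').
  by apply: act_comp => t.
split.
  split=> [t|T s']; first by rewrite /= zy yx.
  by rewrite ac => /ref'/ref.
move=> j; rewrite inE ac => /orP[/eqP->|jL]; first exact: (fP a _ _ lc).
by apply: pers lc _; apply: hL.
Qed.
End Loci.

Section Locus.
Variable S : zfunctor.
Variables (A : comPzRingType) (K : fieldType) (x : {rmorphism A -> K}).
Hypothesis frac : forall z : K, exists a b : A, x b != 0 /\ z * x b = x a.

Lemma locus_flags m (rc rl : rel 'I_m) (G : 'M[A]_m) (s : S A) T :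
  reflexive rc -> transitive rc -> reflexive rl -> transitive rl ->
  (forall (R' : comPzRingType) (phi : {rmorphism A -> R'}),
     in_position rc rl (map_mx phi G) <-> T R' (act phi s)) ->
  T K (act x s) -> locus x s T.
Proof.
move=> c1 c2 l1 l2 h /h/(two_flags c1 c2 l1 l2 frac)[r [E [xr hE]]].
exists r, E; split=> // R' phi u; rewrite -h; have [h1 h2] := hE R' phi u.
by split.
Qed.
End Locus.

(** * Trivializing a triangular Frobenius matrix *)

Section MaskedDeterminant.
Variables (R : comPzRingType) (n p : nat) (p_gt1 : (1 < p)%N).
Variables (A : 'I_n * 'I_n -> 'I_n * 'I_n -> R) (mask : rel 'I_n).
Notation V := ('I_n * 'I_n)%type.
Notation U := (addalg_ring p_gt1 A).
Notation X k := (addalg_X p A k : U).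

(* The coefficient at the product of the diagonal variables is [1]. *)
Lemma masked_det_neq0 : (1 : R) != 0 -> (forall a, mask a a) ->
  \det (\matrix_(b, a) if mask b a then X (b, a) else 0) != 0.
Proof.
move=> nz mm.
(* The exponent of the product of the variables [X (i, s i)], a reduced monomial since 1 < p. *)
pose al (s : 'S_n) : {ffun V -> 'I_p} :=
  [ffun k : V => if k.2 == s k.1 then Ordinal p_gt1 else Ordinal (ltnW p_gt1)].
have alE (s : 'S_n) : (\prod_i X (i, s i)) = (nfa p A (mon (al s)) : U).
  transitivity (\prod_i \prod_j X (i, j) ^+ mon (al s) (i, j)); last first.
    rewrite pair_bigA /=; apply: etrans (esym (nfa_prod p_gt1 A (mon (al s)))).
    by apply: eq_bigr => -[i j] _.
  apply: eq_bigr => i _; rewrite (bigD1 (s i)) //= !ffunE /= eqxx expr1 big1 ?mulr1 // => j nj.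
  by rewrite !ffunE /= (negbTE nj) expr0.
have [muD muZ _] := addalg_finite_dual p_gt1 A.
pose mu (f : U) : R := (f : addalg R V p) (al 1%g).
have mu0 : mu 0 = 0 by apply: (@addIr _ (mu 0)); rewrite -muD !add0r.
have muS (s : 'S_n) : mu ((-1) ^+ s * (\prod_i X (i, s i))) = (s == 1%g)%:R.
  have -> : (-1) ^+ s = addalg_in p_gt1 A ((-1) ^+ s) by rewrite rmorph_sign.
  rewrite /mu muZ alE (addalg_nf_monE p_gt1).
  have [->|s1] := eqVneq s 1%g; first by rewrite eqxx odd_perm1 expr0 mulr1.
  suff -> : (al 1%g == al s) = false by rewrite mulr0.
  apply: contraNF s1 => /eqP e; apply/eqP/permP => i; rewrite perm1.
  have := congr1 (fun f : {ffun V -> 'I_p} => val (f (i, i))) e.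
  by rewrite !ffunE /= perm1 eqxx; case: (i =P s i) => // <-.
have muT (s : 'S_n) : mu ((-1) ^+ s * \prod_i (\matrix_(b, a) if mask b a then X (b, a) else 0) i (s i)) =
    (s == 1%g)%:R.
  have [/forallP ms|] := boolP [forall i, mask i (s i)].
    rewrite -muS; congr (mu (_ * _)); apply: eq_bigr => i _.
    by rewrite mxE ms.
  rewrite negb_forall => /existsP[i /negbTE nm].
  rewrite (bigD1 i) //= mxE nm mul0r mulr0 mu0.
  case: (s =P 1%g) => // e; by rewrite e perm1 mm in nm.
apply/eqP => /(congr1 mu); rewrite mu0 /determinant (big_morph mu (muD (al 1%g)) mu0).
rewrite (eq_bigr _ (fun s _ => muT s)) (bigD1 1%g) //= eqxx big1 ?addr0 => [e|s /negbTE->//].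
by rewrite -e eqxx in nz.
Qed.
End MaskedDeterminant.

Section Trivialization.
Variables (n : nat) (dl : 'I_n -> nat) (B p : nat).
Hypotheses (dlB : forall a, (dl a < B)%N) (p_prime : prime p).
Variables (R : comPzRingType) (pi : 'S_n) (Phi Psi : 'M[R]_n).
Hypotheses (char_p : p%:R = 0 :> R) (PhiPsi : Phi *m Psi = 1%:M).
Hypotheses (gr : graded dl pi Phi) (tr : triangular dl B (period n) pi Phi).
Notation N := (period n).
Notation lv := (lev dl B pi N).
Notation V := ('I_n * 'I_n)%type.
Let p_gt1 := prime_gt1 p_prime.

(** A solution is sought among matrices that preserve the label in [C] exactly and respect the
    stable levels. By [lev_stable] the equations are consistent with this support. *)
Definition tmask : rel 'I_n := fun b a => (dl (pi b) == dl (pi a)) && (lv b <= lv a)%N.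

Definition pmx (R' : comPzRingType) : 'M[R']_n := \matrix_(b, a) (b == pi a)%:R.

(* the coefficients of the equations [T^(p) = Psi T_D P] for a matrix [T] supported on [tmask],
   where [T_D] is the part of [T] preserving [dl] and [P] is the matrix of [pi] *)
Definition teq (k j : V) : R :=
  if [&& tmask k.1 k.2, j.2 == pi k.2, dl j.1 == dl (pi k.2) & tmask j.1 j.2] then Psi k.1 j.1 else 0.

Section Solution.
Variables (R' : comPzRingType) (g : {rmorphism R -> R'}) (X : V -> R').
Hypothesis Xeq : forall k, X k ^+ p = \sum_j g (teq k j) * X j.

Definition tmx : 'M[R']_n := \matrix_(b, a) if tmask b a then X (b, a) else 0.

Let ch' : p%:R = 0 :> R'.
Proof. by have := congr1 g char_p; rewrite rmorph_nat rmorph0. Qed.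

Let p0 : (0 : R') ^+ p = 0.
Proof. by rewrite expr0n; case: p (prime_gt0 p_prime). Qed.

Let Psi_gr a b : dl b != dl (pi a) -> Psi a b = 0.
Proof.
move=> nab; apply: (@pat_inv_perm _ _ (fun x y => dl x == dl y) pi Phi) PhiPsi _ _ _ => //.
- by move=> x y z /eqP-> /eqP->.
- by rewrite eq_sym.
Qed.

(** Inside the mask this is [Xeq]. Outside it both sides vanish: [Psi] is graded and triangular, and
    [lev_stable] carries the comparison of levels along [pi]. *)
Lemma tmx_eq : powmx p tmx = map_mx g Psi *m Dpart dl tmx *m pmx R'.
Proof.
apply/matrixP => b a; rewrite mxE [RHS]mxE (bigD1 (pi a)) //= [pmx _ _ _]mxE eqxx mulr1.
rewrite big1 ?addr0 => [|d /negbTE nd]; last by rewrite [pmx _ _ _]mxE nd mulr0.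
rewrite [RHS]mxE mxE; case: ifP => mba.
  rewrite Xeq; transitivity (\sum_c \sum_d g (teq (b, a) (c, d)) * X (c, d)).
    by rewrite pair_bigA; apply: eq_bigr => -[].
  apply: eq_bigr => c _; rewrite (bigD1 (pi a)) //= big1 ?addr0 => [|d nd].
    rewrite /teq /= mba eqxx !mxE /=; case: (dl c =P dl (pi a)) => _ /=; last by rewrite rmorph0 mul0r mulr0.
    by case: ifP; rewrite ?rmorph0 ?mul0r ?mulr0.
  by rewrite /teq /= (negbTE nd) andbF rmorph0 mul0r.
rewrite p0 big1 // => c _; rewrite !mxE.
case: (dl c =P dl (pi a)) => [ec|_]; last by rewrite mulr0.
case: ifP => mc; last by rewrite mulr0.
have [e|e] := eqVneq (dl c) (dl (pi b)); last by rewrite Psi_gr // rmorph0 mul0r.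
have [lt|le] := ltnP (lv c) (lv (pi b)).
  by rewrite (triangular_inv tr PhiPsi lt) rmorph0 mul0r.
case/negP: mba; have eab : dl (pi b) = dl (pi a) by rewrite -e ec.
rewrite /tmask eab eqxx -(lev_stable dlB eab) (leq_trans le) //.
by case/andP: mc.
Qed.

Lemma det_Dpart_tmx : \det (Dpart dl tmx) = \det tmx.
Proof.
rewrite [RHS](@det_level _ _ dl) // => b a lt; rewrite mxE ifN // /tmask.
apply/negP => /andP[_ h]; have := lev_le0 dlB h.
by rewrite leqNgt lt.
Qed.

Lemma tmx_transition d : \det tmx * d = 1 -> transition dl p pi pi tmx (map_mx g Phi) (pmx R').
Proof.
move=> hd.
have Cp : Cpart dl pi pi tmx = tmx.
  apply/matrixP => i j; rewrite !mxE /tmask; case: (dl (pi i) =P dl (pi j)) => //=.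
split.
- by move=> b a lt; rewrite mxE /tmask ltn_eqF.
- move=> b a lt; rewrite mxE ifN //; apply/negP => /andP[_ h].
  by have := lev_le0 dlB h; rewrite leqNgt lt.
- by apply/minv_det; exists d.
by rewrite Cp tmx_eq !mulmxA -map_mxM PhiPsi map_mx1 mul1mx.
Qed.

Lemma det_tmx_pow : \det tmx ^+ p = g (\det Psi * \det (pmx R)) * \det tmx.
Proof.
have pE : map_mx g (pmx R) = pmx R'.
  by apply/matrixP => i j; rewrite !mxE rmorph_nat.
rewrite -(frobE p_prime ch') -det_map_mx.
have -> : map_mx (frob p_prime ch') tmx = powmx p tmx by apply/matrixP => i j; rewrite !mxE frobE.
rewrite tmx_eq !det_mulmx det_Dpart_tmx rmorphM -!det_map_mx pE.
by rewrite mulrAC.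
Qed.
End Solution.

Lemma trivializing_cover : exists (Q : comPzRingType) (psi : {rmorphism R -> Q}),
  [/\ exists (J : finType) (mu : J -> Q -> R) e, finite_dual psi mu e,
      presented psi, Spec_surjective psi
    & exists T : 'M[Q]_n, transition dl p pi pi T (map_mx psi Phi) (pmx Q)].
Proof.
pose kap := \det Psi * \det (pmx R).
have [kap' kapE] : exists k, kap * k = 1.
  have [d hd] : exists d, \det (pmx R) * d = 1 := proj1 (minv_det _) (perm_minv R pi).
  by exists (\det Phi * d); rewrite /kap mulrACA hd mulr1 mulrC -det_mulmx PhiPsi det1.
pose U := addalg_ring p_gt1 teq; pose io : {rmorphism R -> U} := addalg_in p_gt1 teq.
pose X k : U := addalg_X p teq k.
have Xeq k : X k ^+ p = \sum_j io (teq k j) * X j by apply: addalg_rel.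
pose D := \det (tmx X); pose e := io kap' * D ^+ p.-1.
have gen (R' : comPzRingType) (g : {rmorphism R -> R'}) (d : R') : d ^+ p = g kap * d ->
    let e := g kap' * d ^+ p.-1 in e * d = d /\ e * e = e.
  move=> h /=; have ed : g kap' * d ^+ p.-1 * d = d.
    rewrite -mulrA -exprSr prednK ?(prime_gt0 p_prime) // h mulrA -rmorphM.
    by rewrite [kap' * _]mulrC kapE rmorph1 mul1r.
  split=> //; rewrite mulrCA; congr (_ * _).
  have edS k : g kap' * d ^+ p.-1 * d ^+ k.+1 = d ^+ k.+1 by rewrite exprS mulrA ed.
  by have := edS p.-2; have -> : p.-2.+1 = p.-1 by have := p_gt1; lia.
have [eD ee] := gen U io D (det_tmx_pow Xeq).
have [J [mu [ej dual]]] : exists (J : finType) (mu : J -> U -> R) ej, finite_dual io mu ej.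
  by do 3 eexists; apply: (addalg_finite_dual p_gt1 teq).
pose Q := idq (fun y : U => y = 1 - e).
pose q : {rmorphism U -> Q} := idq_pi (fun y => y = 1 - e).
have qe : q e = 1.
  apply/eqP; rewrite -subr_eq0 -[1](rmorph1 q) -opprB oppr_eq0 -rmorphB; apply/eqP.
  exact: idq_pi_gen.
exists Q, (rcomp q io); split.
- have [mu' dual'] := idempotent_finite_dual ee dual.
  by do 3 eexists; exact: dual'.
- exact: presented_comp (addalg_presented p_gt1 teq) (quotient_presented _).
- move=> K x.
  (* The fibre over [x] is the same kind of algebra with coefficients in [K]. Its determinant is
     nonzero by [masked_det_neq0], so the direct factor is nonzero and has a residue field. *)
  pose tK k j := x (teq k j); pose UK := addalg_ring p_gt1 tK.
  pose ioK : {rmorphism R -> UK} := rcomp (addalg_in p_gt1 tK) x.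
  pose XK k : UK := addalg_X p tK k.
  have XKeq k : XK k ^+ p = \sum_j ioK (teq k j) * XK j by apply: (addalg_rel p_gt1 tK).
  pose DK := \det (tmx XK); pose eK := ioK kap' * DK ^+ p.-1.
  have [eDK eeK] := gen UK ioK DK (det_tmx_pow XKeq).
  have DK0 : DK != 0.
    by apply: masked_det_neq0; [apply: oner_neq0|move=> a; rewrite /tmask eqxx leqnn].
  have nspan : ~ span (fun y => y = 1 - eK) 1.
    move=> /(span_min (I := fun y => eK * y = 0)) h.
    have : eK * 1 = 0.
      apply: h; last by move=> y ->; rewrite mulrBr mulr1 [eK * eK]eeK subrr.
      split; first exact: mulr0.
        by move=> u v h1 h2; rewrite mulrDr h1 h2 addr0.
      by move=> u v h1; rewrite mulrCA h1 mulr0.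
    rewrite mulr1 => e0; case/eqP: DK0; rewrite -eDK -/eK e0.
    exact: mul0r.
  have [L [z hz]] := residue_field (span_ideal _) nspan.
  have zeK : z eK = 1.
    apply/eqP; rewrite -subr_eq0 -[1](rmorph1 z) -opprB oppr_eq0 -rmorphB; apply/eqP.
    by apply: hz; apply: span_sub.
  have [|h [h1 h2 _]] := @addalg_ev R V p p_gt1 teq L (rcomp z ioK) (fun k => z (XK k)).
    by move=> k; rewrite -rmorphXn XKeq rmorph_sum; apply: eq_bigr => j _; rewrite rmorphM.
  have hD : (h : {rmorphism U -> L}) D = z DK.
    rewrite -!det_map_mx; congr (\det _); apply/matrixP => i j; rewrite !mxE.
    case: ifP => _; last by rewrite !rmorph0.
    exact: h2.
  have [|y yE] := @idq_lift U (fun y => y = 1 - e) L h.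
    move=> _ ->; rewrite -[LHS]/((h : {rmorphism U -> L}) (1 - e)).
    rewrite rmorphB rmorph1 rmorphM rmorphXn hD.
    have -> : (h : {rmorphism U -> L}) (io kap') = z (ioK kap') by apply: h1.
    by rewrite -rmorphXn -rmorphM zeK subrr.
  exists L, (rcomp z (addalg_in p_gt1 tK)), y => r.
  by rewrite -[LHS]/(y (q (io r))) yE; apply: h1.
have XQ k : (q (X k)) ^+ p = \sum_j rcomp q io (teq k j) * q (X j).
  by rewrite -rmorphXn Xeq rmorph_sum; apply: eq_bigr => j _; rewrite rmorphM.
exists (tmx (fun k => q (X k))).
have qD : \det (tmx (fun k => q (X k))) = q D.
  rewrite -det_map_mx; congr (\det _); apply/matrixP => i j; rewrite !mxE.
  by case: ifP => _; rewrite ?rmorph0.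
(* The idempotent kappa^-1 D^(p-1) becomes 1 in [Q], so kappa^-1 D^(p-2) is the inverse of the
   determinant. *)
apply: (tmx_transition XQ (d := q (io kap' * D ^+ p.-2))).
rewrite qD -rmorphM -[RHS]qe; congr (q _).
rewrite mulrCA -exprS; congr (_ * _ ^+ _); have := p_gt1; lia.
Qed.
End Trivialization.

(** * The residue field of a point *)

Section ResidueField.
Variables (A : comPzRingType) (L : fieldType) (x : {rmorphism A -> L}).

Definition is_frac : {pred L} := fun z => `[< exists a b, x b != 0 /\ z * x b = x a >].

Fact is_frac_divring : divring_closed is_frac.
Proof.
split.
- by apply/asboolP; exists 1, 1; rewrite rmorph1 oner_neq0 mulr1.
- move=> u v /asboolP[a [b [nb e]]] /asboolP[c [d [nd f]]]; apply/asboolP.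
  exists (a * d - c * b), (b * d); rewrite rmorphM mulf_neq0 //; split=> //.
  rewrite rmorphB !rmorphM -e -f; ring.
- move=> u v /asboolP[a [b [nb e]]] /asboolP[c [d [nd f]]]; apply/asboolP.
  have [->|nv] := eqVneq v 0; first by exists 0, 1; rewrite invr0 mulr0 mul0r rmorph0 rmorph1 oner_neq0.
  have nc : x c != 0 by rewrite -f mulf_neq0.
  exists (a * d), (b * c); rewrite rmorphM mulf_neq0 //; split=> //.
  by rewrite !rmorphM -e -f; field.
Qed.
HB.instance Definition _ := GRing.isDivringClosed.Build L is_frac is_frac_divring.

Record resfield := ResField { resval : L; resvalP : resval \in is_frac }.
HB.instance Definition _ := [isSub for resval].
HB.instance Definition _ := [Choice of resfield by <:].
HB.instance Definition _ := [SubChoice_isSubIntegralDomain of resfield by <:].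
HB.instance Definition _ := [SubIntegralDomain_isSubField of resfield by <:].
End ResidueField.

(** The fractions x a / x b form a subfield. Matrices over it lift to [A] up to a common
    denominator, as [two_flags] requires. *)
Lemma residue_point (A : comPzRingType) (L : fieldType) (x : {rmorphism A -> L}) :
  exists (K : fieldType) (x0 : {rmorphism A -> K}) (j : {rmorphism K -> L}),
    (forall a, j (x0 a) = x a) /\ forall z : K, exists a b : A, x0 b != 0 /\ z * x0 b = x0 a.
Proof.
have xP a : x a \in is_frac x.
  by apply/asboolP; exists a, 1; rewrite rmorph1 oner_neq0 mulr1.
pose f a := ResField (xP a).
have fD a b : f (a + b) = f a + f b by apply: val_inj; rewrite /= rmorphD.
have f1 : f 1 = 1 by apply: val_inj; rewrite /= rmorph1.
have fM a b : f (a * b) = f a * f b by apply: val_inj; rewrite /= rmorphM.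
exists (resfield x : fieldType), (mkrm fD f1 fM), (val : {rmorphism resfield x -> L}); split=> // z.
have /asboolP[a [b [nb e]]] := resvalP z.
by exists a, b; split; [rewrite -(inj_eq val_inj)|apply: val_inj].
Qed.

(** * Modules over finite products of rings *)

Section ProductModules.
Variables (k : nat) (L : 'I_k -> comPzRingType).
Variables (N : lmodType (prodr L)) (N' : forall a, lmodType (L a)) (al : forall a, N -> N' a).
Hypothesis bc : forall a, is_base_change (prod_pi L a) (al a).
Let alP a := bc_lin (bc a).

Let prod_pi_dual a : finite_dual (prod_pi L a) (J := unit) (fun _ y => prod_in y) (fun _ => 1).
Proof.
split=> [_ y z|_ r y|y]; first exact: prod_inD.
  by rewrite prod_inM.
rewrite (big_pred1 tt) => [|[]//]; rewrite mul1r.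
by rewrite -[RHS]/(prod_in y a) prod_in_id.
Qed.

Let al_ker a w : al a w = 0 -> prod_in (1 : L a) *: w = 0.
Proof.
move=> e; have := germ_dual_kernel (finite_germ_dual (prod_pi_dual a)) (k := 1)
  (y := fun=> 1) (a := fun=> w) tt (bc a).
by rewrite big_ord1 e scaler0 => /(_ erefl)/ev_ex[_]; rewrite big_ord1.
Qed.

Let decomp (w : N) : w = \sum_a prod_in (1 : L a) *: w.
Proof.
rewrite -scaler_suml -[LHS]scale1r; congr (_ *: _).
by rewrite -[LHS]prod_in_sum.
Qed.

(** An element killed in the factor [a] is killed by the idempotent of [a], and these idempotents
    sum to 1. *)
Lemma prod_mod_inj w : (forall a, al a w = 0) -> w = 0.
Proof. by move=> h; rewrite (decomp w) big1 // => a _; apply: al_ker. Qed.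

Lemma prod_mod_ex (w' : forall a, N' a) : exists w, forall a, al a w = w' a.
Proof.
have h a : exists w, al a w = w' a.
  have [m [y [u ->]]] := bc_gen' (bc a) (w' a).
  exists (\sum_j prod_in (y j) *: u j); rewrite (semi_lin (alP a)); apply: eq_bigr => j _.
  by rewrite -[prod_pi _ _ _]/(prod_in (y j) a) prod_in_id.
have [w wE] := fin_all_exists h; exists (\sum_a prod_in (1 : L a) *: w a) => a.
rewrite (semi_lin (alP a)) (bigD1 a) //= big1 ?addr0 => [|b nb].
  by rewrite -[prod_pi _ _ _]/(prod_in (1 : L a) a) prod_in_id scale1r wE.
by rewrite -[prod_pi _ _ _]/(prod_in (1 : L b) a) prod_in_neq // scale0r.
Qed.

Lemma prod_mod_mem (A : submod N) (A' : forall a, submod (N' a)) w :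
  (forall a w', A' a w' <-> generated (fun v' => exists2 u, A u & v' = al a u) w') ->
  A w <-> forall a, A' a (al a w).
Proof.
move=> hA; split=> [Aw a|h].
  by apply/hA; apply: generated_sub; exists w.
rewrite (decomp w); apply: smem_sum => a.
have [m [y [e [eA wE]]]] := proj1 (hA a _) (h a).
have [b bE] := choice (fun j => let: ex_intro2 u Au eu := eA j in ex_intro _ u (conj Au eu)).
pose c := \sum_j prod_in (y j) *: b j.
have Ac : A c by apply: smem_sum => j; apply: smemZ; case: (bE j).
have -> : prod_in (1 : L a) *: w = prod_in (1 : L a) *: c; last exact: smemZ.
apply/eqP; rewrite -subr_eq0 -scalerBr; apply/eqP; apply: al_ker.
rewrite (semiB (alP a)) (semi_lin (alP a)) wE -sumrB big1 // => j _.
by rewrite -[prod_pi _ _ _]/(prod_in (y j) a) prod_in_id (proj2 (bE j)) subrr.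
Qed.

Variables (n : nat) (v : 'I_n -> N).
Hypothesis vb : forall a, is_basis (fun j => al a (v j)).

Let lift_coef w (c : forall a, 'I_n -> L a) :
  (forall a, al a w = \sum_j c a j *: al a (v j)) ->
  w = \sum_j ((fun a => c a j) : prodr L) *: v j.
Proof.
move=> h; apply/eqP; rewrite -subr_eq0; apply/eqP; apply: prod_mod_inj => a.
by rewrite (semiB (alP a)) (semi_lin (alP a)) h subrr.
Qed.

Lemma prod_mod_basis : is_basis v.
Proof.
move=> w; have [c cE] := fin_all_exists (fun a : 'I_k => basis_ex (@vb a) (al a w)).
exists [ffun j => (fun a => c a j) : prodr L]; split.
  by rewrite {1}(lift_coef cE); apply: eq_bigr => j _; rewrite ffunE.
move=> d dE; apply/ffunP => j; rewrite ffunE; apply: functional_extensionality_dep => a.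
apply: (basis_inj (@vb a) (c := c a) (d := fun j => d j a)).
by rewrite -cE dE (semi_lin (alP a)).
Qed.

Lemma prod_mod_supp (A : submod N) (A' : forall a, submod (N' a)) P :
  (forall a w', A' a w' <-> generated (fun v' => exists2 u, A u & v' = al a u) w') ->
  (forall a w', A' a w' <-> supp_span (fun j => al a (v j)) P w') ->
  forall w, A w <-> supp_span v P w.
Proof.
move=> hA hS w; rewrite (prod_mod_mem w hA); split=> [h|[c [hc ->]] a].
  have [c cE] := fin_all_exists (fun a : 'I_k => proj1 (hS a _) (h a)).
  exists (fun j => (fun a => c a j) : prodr L); split; last by apply: lift_coef => a; case: (cE a).
  by move=> j nP; apply: functional_extensionality_dep => a; case: (cE a) => /(_ j nP).
apply/hS; rewrite (semi_lin (alP a)); apply: supp_span_lin => j /hc->.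
exact: rmorph0.
Qed.
End ProductModules.

(** * Open and closed subfunctors *)

Section Near.
Variable S : zfunctor.

Lemma near_and (A : comPzRingType) (K : fieldType) (x : {rmorphism A -> K}) (s : S A)
    (P Q : forall R : comPzRingType, S R -> Prop) :
  near x s P -> near x s Q -> near x s (fun R t => P R t /\ Q R t).
Proof.
move=> [r xr hr] [r' xr' hr']; exists (r * r'); first by rewrite rmorphM mulf_neq0.
by move=> R' phi; rewrite rmorphM => /unit_mul[u u']; split; [apply: hr|apply: hr'].
Qed.

Lemma near_bc (A A' : comPzRingType) (K : fieldType) (f : {rmorphism A -> A'})
    (x : {rmorphism A' -> K}) (s : S A) (P : forall R : comPzRingType, S R -> Prop) :
  near (rcomp x f) s P -> near x (act f s) P.
Proof.
case=> r xr h; exists (f r) => // R' phi u.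
by rewrite -(act_comp (chi := rcomp phi f)) //; apply: h.
Qed.

Lemma locus_bc (A A' : comPzRingType) (K : fieldType) (f : {rmorphism A -> A'})
    (x : {rmorphism A' -> K}) (s : S A) (P : forall R : comPzRingType, S R -> Prop) :
  locus (rcomp x f) s P -> locus x (act f s) P.
Proof.
case=> r [E [xr h]]; exists (f r), (fun e' => exists2 e, E e & e' = f e); split=> // R' phi u.
rewrite -(act_comp (chi := rcomp phi f)) // -(h R' (rcomp phi f) u).
split=> h' e; first by move=> Ee; apply: h'; exists e.
by case=> e0 Ee ->; apply: h'.
Qed.

Lemma loc_unit (R L : comPzRingType) (f : R) (l : {rmorphism R -> L}) :
  is_localization f l -> exists b, l f * b = 1.
Proof. by case. Qed.

Section Subfunctor.
Variable U : subfun S.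

Definition sub_stable := forall (R R' : comPzRingType) (phi : {rmorphism R -> R'}) (s : S R),
  U s -> U (act phi s).
Definition sub_local := forall (R : comPzRingType) (s : S R),
  (forall (K : fieldType) (x : {rmorphism R -> K}), near x s U) -> U s.
Definition sub_generic := forall (R : comPzRingType) (s : S R) (K : fieldType)
  (x : {rmorphism R -> K}), U (act x s) -> near x s U.

Lemma open_criterion : sub_stable -> sub_local -> sub_generic -> open_subfun U.
Proof.
move=> bc loc gen R s.
(* The largest possible choice: all [e] such that [U] holds wherever [e] is invertible. *)
pose E e := forall (R' : comPzRingType) (phi : {rmorphism R -> R'}),
  (exists b, phi e * b = 1) -> U (act phi s).
exists E => R' phi; split=> [Us|[k [e [he ue]]]].
  have [k [e [he ue]]] : exists k (e : 'I_k -> R'), (forall a, exists2 r, E r & e a = phi r) /\ unit_family e.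
    apply: (span_unit_family (E := fun y => exists2 r, E r & y = phi r)); apply: span_unit => K x.
    have [|r xr h] := gen R s K (rcomp x phi).
      by rewrite (act_comp (phi := phi) (psi := x)) //; apply: bc.
    by exists (phi r) => //; exists r.
  have [r rE] := choice (fun a => let: ex_intro2 r h1 h2 := he a in ex_intro _ r (conj h1 h2)).
  exists k, r; split; first by move=> a; case: (rE a).
  case: ue => c ce; exists c; rewrite -ce; apply: eq_bigr => a _; congr (_ * _).
  by case: (rE a).
apply: loc => K x; have [a xa] := unit_family_point x ue.
exists (phi (e a)) => // R2 psi u.
by rewrite -(act_comp (chi := rcomp psi phi)) //; apply: (he a _ (rcomp psi phi)).
Qed.

Hypothesis op : open_subfun U.

Lemma open_stable : sub_stable.
Proof.
move=> R R' phi s Us; have [E h] := op s.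
have [|k [e [Ee ue]]] := proj1 (h R (ridm R)); first by rewrite act_id.
apply/h; exists k, e; split=> //; case: ue => c ce.
exists (fun a => phi (c a)); rewrite -(rmorph1 phi) -ce rmorph_sum.
by apply: eq_bigr => a _; rewrite -[e a in RHS]/(ridm R (e a)) rmorphM.
Qed.

Lemma open_generic : sub_generic.
Proof.
move=> R s K x Ux; have [E h] := op s.
have [k [e [Ee ue]]] := proj1 (h K x) Ux.
have [a xa] : exists a, x (e a) != 0 by apply: (unit_family_point (ridm K) ue).
exists (e a) => // R' phi [b hb]; apply/h; exists 1%N, (fun=> e a); split=> //.
by exists (fun=> b); rewrite big_ord1 mulrC.
Qed.

Lemma open_local : sub_local.
Proof.
move=> R s near; have [E h] := op s.
rewrite -(act_id (phi := ridm R) s) //; apply/h.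
have [k [e [Ee ue]]] : exists k (e : 'I_k -> R), (forall a, E (e a)) /\ unit_family e; last by exists k, e.
apply: span_unit_family; apply: span_unit => K x.
have [r xr hr] := near K x.
have [k [e [Ee ue]]] := proj1 (h K x) (hr K x (ex_intro _ _ (mulfV xr))).
have [a xa] : exists a, x (e a) != 0 by apply: (unit_family_point (ridm K) ue).
by exists (e a).
Qed.
End Subfunctor.

Definition universal (V : subfun S) (A : comPzRingType) (a : S A) : Prop :=
  V A a /\ forall (R : comPzRingType) (s : S R), V R s ->
    exists phi : {rmorphism A -> R}, act phi a = s /\
      forall psi : {rmorphism A -> R}, act psi a = s -> psi =1 phi.

Section AffineChart.
Variables (V : subfun S) (A : comPzRingType) (a : S A).
Hypotheses (op : open_subfun V) (univ : universal V a).

Lemma chart_unique (R : comPzRingType) (phi psi : {rmorphism A -> R}) :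
  act phi a = act psi a -> phi =1 psi.
Proof.
move=> e; have [chi [_ h]] := proj2 univ R (act psi a) (open_stable op psi (proj1 univ)).
by move=> r; rewrite (h phi e) (h psi erefl).
Qed.

Variables (R : comPzRingType) (s : S R) (K : fieldType) (x : {rmorphism R -> K}) (x0 : {rmorphism A -> K}).
Hypothesis xx0 : act x0 a = act x s.

Lemma chart_near : exists (f : R) (y : {rmorphism locr f -> K}) (phi : {rmorphism A -> locr f}),
  [/\ x f != 0, forall r, y (loc_in f r) = x r, act phi a = act (loc_in f) s
    & forall r, y (phi r) = x0 r].
Proof.
have [|f xf h] := open_generic op (s := s) (x := x).
  by rewrite -xx0; apply: (open_stable op); case: univ.
have lf := locP f; have [y yE] := loc_point lf xf.
have [phi [pE _]] := proj2 univ _ _ (h _ _ (loc_unit lf)).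
exists f, y, phi; split=> //.
apply: (chart_unique (phi := rcomp y phi)).
rewrite (act_comp (phi := phi) (psi := y)) // pE xx0; apply/esym; apply: act_comp => r.
by rewrite /= yE.
Qed.

Lemma affine_near (Q : forall R : comPzRingType, S R -> Prop) : near x0 a Q -> near x s Q.
Proof.
have [f [y [phi [xf yE pE yp]]]] := chart_near.
case=> r xr h; apply: (near_loc (locP f) xf yE); rewrite -pE; apply: near_bc.
by exists r; rewrite //= yp.
Qed.

Lemma affine_locus (Q : forall R : comPzRingType, S R -> Prop) : locus x0 a Q -> locus x s Q.
Proof.
have [f [y [phi [xf yE pE yp]]]] := chart_near.
case=> r [E [xr h]]; apply: (locus_immersion (loc_immersion (locP f)) yE xf) => //.
by rewrite -pE; apply: locus_bc; exists r, E; rewrite /= yp.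
Qed.
End AffineChart.

Section ClosedGluing.
Variable Z : subfun S.
Hypotheses (Z_stable : sub_stable Z) (Z_local : sub_local Z).

(** Finitely many pieces R_(r a) / (E a) describe the closed condition locally; the ideal consists
    of the elements that vanish on all of them. *)
Lemma closed_gluing (R : comPzRingType) (s : S R) :
  (forall (K : fieldType) (x : {rmorphism R -> K}), locus x s Z) ->
  exists E : R -> Prop, forall (R' : comPzRingType) (phi : {rmorphism R -> R'}),
    Z (act phi s) <-> forall e, E e -> phi e = 0.
Proof.
move=> lc.
pose good r (E : R -> Prop) := forall (R' : comPzRingType) (phi : {rmorphism R -> R'}),
  (exists b, phi r * b = 1) -> (forall e, E e -> phi e = 0) <-> Z (act phi s).
have [k [r [rE ru]]] : exists k (r : 'I_k -> R), (forall a, exists E, good (r a) E) /\ unit_family r.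
  apply: (span_unit_family (E := fun r => exists E, good r E)); apply: span_unit => K x.
  have [r [E [xr h]]] := lc K x.
  by exists r => //; exists E.
have [E EE] := choice rE.
have [C CE] := choice (fun a => immersion_ex (r a) (E a)); have [be imm] := fin_all_exists CE.
exists (fun y => forall a, be a y = 0) => R' phi; split=> [Zs y hy|van].
  apply: local_zero => K x; have [a xa] := unit_family_point (rcomp x phi) ru.
  have lr := locP (phi (r a)); have ul := loc_unit lr; have [_ _ ker] := lr.
  have [_ _ _ lift] := imm a.
  have [|psi pE] := lift _ (rcomp (loc_in (phi (r a))) phi) ul.
    by apply/(EE a) => //; rewrite (act_comp (phi := phi) (psi := loc_in (phi (r a)))) //; apply: Z_stable.
  have : loc_in (phi (r a)) (phi y) = 0 by rewrite -[LHS]pE hy rmorph0.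
  by case/ker => m em; exists (phi (r a) ^+ m); rewrite // rmorphXn expf_neq0.
apply: Z_local => K x; have [a xa] := unit_family_point (rcomp x phi) ru.
exists (phi (r a)) => // R2 psi u; rewrite -(act_comp (chi := rcomp psi phi)) //.
apply/(EE a) => // e Ee.
(* On the piece [c] the condition [Z] holds, so the equations of the piece [a] vanish there once
   [r a] is inverted. The sum of the exponents serves all pieces at once and gives an element of the
   ideal. *)
have ker c : exists m, be c (r a ^+ m * e) = 0.
  have lr := locP (be c (r a)); have ul := loc_unit lr; have [_ _ kr] := lr.
  have [bu bE _ _] := imm c.
  have : loc_in (be c (r a)) (be c e) = 0.
    apply: (proj2 (EE a _ (rcomp (loc_in (be c (r a))) (be c)) ul)) => //.
    rewrite (act_comp (phi := be c) (psi := loc_in (be c (r a)))) //; apply: Z_stable.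
    exact/(EE c).
  by case/kr => m em; exists m; rewrite rmorphM rmorphXn.
have [m mE] := fin_all_exists ker.
apply: (unit_reg (a := psi (phi (r a)) ^+ (\sum_c m c))); first exact: unit_exp.
rewrite -!rmorphXn -[X in _ * X]/(psi (phi e)) -!rmorphM van ?rmorph0 // => c.
by rewrite (bigD1 c) //= addnC exprD -mulrA rmorphM mE mulr0.
Qed.
End ClosedGluing.
End Near.

(** * Subschemes cut out by conditions on points *)

Section Subfunctor.
Variables (S : scheme) (T : subfun S).
Hypotheses (T_stable : sub_stable T) (T_local : sub_local T).

Lemma sub_inj (R : comPzRingType) (s t : {s : S R | T s}) : sval s = sval t -> s = t.
Proof.
by case: s t => s hs [t ht] /= e; subst t; congr exist; apply: Prop_irrelevance.
Qed.

Definition sub_act (R R' : comPzRingType) (phi : {rmorphism R -> R'}) (s : {s : S R | T s}) :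
  {s : S R' | T s} := exist _ (act phi (sval s)) (T_stable phi (svalP s)).

Fact sub_act_id (R : comPzRingType) (phi : {rmorphism R -> R}) (s : {s : S R | T s}) :
  phi =1 id -> sub_act phi s = s.
Proof. by move=> h; apply: sub_inj; apply: act_id. Qed.

Fact sub_act_comp (R R' R'' : comPzRingType) (phi : {rmorphism R -> R'})
    (psi : {rmorphism R' -> R''}) (chi : {rmorphism R -> R''}) (s : {s : S R | T s}) :
  chi =1 psi \o phi -> sub_act chi s = sub_act psi (sub_act phi s).
Proof. by move=> h; apply: sub_inj; apply: act_comp. Qed.

Definition subz : zfunctor := ZFunctor sub_act_id sub_act_comp.

Definition sub_incl : zmor subz S :=
  @ZMor subz S (fun R s => sval s) (fun R R' phi s => erefl).

Lemma subz_sheaf : zariski_sheaf subz.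
Proof.
move=> R k f L l t fu loc comp.
have [|s [sE sU]] := (proj1 (schemeP S)) R k f L l (fun a => sval (t a)) fu loc.
  by move=> a b C al be h; have := congr1 sval (comp a b C al be h).
have Ts : T s.
  apply: T_local => K x; have [a xa] := unit_family_point x fu.
  have [y yE] := loc_point (loc a) xa; apply: (near_loc (loc a) xa yE).
  exists 1; first by rewrite rmorph1 oner_neq0.
  by move=> R' phi _; apply: T_stable; rewrite sE; apply: svalP.
exists (exist _ s Ts); split=> [a|[s' Ts'] h]; first by apply: sub_inj; apply: sE.
by apply: sub_inj; apply: sU => a; have := congr1 sval (h a).
Qed.
End Subfunctor.

Section SubScheme.
Variables (S : scheme) (T : subfun S) (I : Type) (Z : I -> subfun S).
Hypotheses (T_stable : sub_stable T) (T_local : sub_local T).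
Hypotheses (Z_stable : forall i, sub_stable (Z i)) (Z_local : forall i, sub_local (Z i)).
Hypothesis Z_locus : forall i (A : comPzRingType) (s : S A) (K : fieldType) (x : {rmorphism A -> K}),
  Z i (act x s) -> locus x s (Z i).
Hypothesis ZT : forall i (R : comPzRingType) (s : S R), Z i s -> T s.
Hypothesis T_near : forall i (R : comPzRingType) (s : S R) (K : fieldType) (x : {rmorphism R -> K}),
  T s -> Z i (act x s) -> near x s (Z i).
Hypothesis T_cover : forall (K : fieldType) (s : S K), T s -> exists i, Z i s.

(** In an affine chart of [S], near the given point, [Z i] is represented by the ring of a local
    immersion. This is an affine chart of [T], and it is open in [T] by [T_near]. A single stratum
    is the case of one piece; the disjoint union is the case of all strata. *)
Lemma subz_scheme : is_scheme (subz T_stable).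
Proof.
split; first exact: subz_sheaf.
move=> K [s Ts]; have [i Zs] := T_cover Ts.
have [V [op [A [a univ]] Vs]] := proj2 (schemeP S) K s.
have [x0 [x0E _]] := proj2 univ K s Vs.
have [r [E [xr h]]] : locus x0 a (Z i) by apply: Z_locus; rewrite x0E.
have [C [be imm]] := immersion_ex r E; have [bu bE frac lift] := imm.
pose D : subfun S := fun R t => exists phi : {rmorphism A -> R}, act phi a = t /\ exists b, phi r * b = 1.
pose U : subfun (subz T_stable) := fun R t => D R (sval t) /\ Z i (sval t).
have DV (R : comPzRingType) (t : S R) : D R t -> V R t.
  by case=> phi [<- _]; apply: (open_stable op); case: univ.
have xa : exists b, x0 r * b = 1 by exists (x0 r)^-1; rewrite mulfV.
exists U; split; last by split=> //; exists x0.
  apply: open_criterion.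
  - move=> R R' phi t [[psi [e [b hb]]] Zt]; split; last exact: Z_stable.
    exists (rcomp phi psi); split; first by rewrite /= -e; apply: act_comp.
    by exists (phi b); rewrite -[LHS](rmorphM phi) hb rmorph1.
  - move=> R t nearU; split; last first.
      by apply: Z_local => L x; case: (nearU L x) => e xe he; exists e => // R' phi /he[].
    have Vt : V R (sval t).
      by apply: (open_local op) => L x; case: (nearU L x) => e xe he; exists e => // R' phi /he[/DV].
    have [phi [e _]] := proj2 univ R _ Vt; exists phi; split=> //.
    have [c cE] : exists c, c * phi r = 1.
      have [k [c [y [yE e1]]]] : span (fun z => z = phi r) 1.
        apply: span_unit => L x; exists (phi r) => //.
        have [d xd hd] := nearU L x.
        have [[psi [pE [b hb]]] _] := hd L x (ex_intro _ _ (mulfV xd)).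
        rewrite -[x (phi r)]/(rcomp x phi r) (chart_unique op univ (psi := psi)); last first.
          by rewrite (act_comp (phi := phi) (psi := x)) // e pE.
        exact: (unit_not0 (ridm L) hb).
      exists (\sum_j c j); rewrite mulr_suml e1; apply: eq_bigr => j _.
      by rewrite yE.
    by exists c; rewrite mulrC.
  move=> R [t Tt] L x [[phi [e [b hb]]] Zt].
  have nZ : near x t (Z i) by apply: T_near.
  have nD : near x t D.
    apply: (affine_near op univ e); exists r; first exact: (unit_not0 (ridm L) hb).
    by move=> R' psi u; exists psi.
  exact: (near_and nD nZ).
have Zb : Z i (act be a) by apply/(h C be bu).
exists C, (exist _ (act be a) (ZT Zb)); split; first by split=> //; exists be.
move=> R [t Tt] [[phi [/= e u]] Zt].
have [|psi pE] := lift R phi u; first by apply/(h R phi u); rewrite e.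
exists psi; split.
  by apply: sub_inj; rewrite /= -e; apply/esym; apply: act_comp => z; rewrite /= pE.
move=> psi' /(congr1 sval)/= e'.
have pE' z : psi' (be z) = psi (be z).
  rewrite pE -[psi' (be z)]/(rcomp psi' be z); apply: (chart_unique op univ).
  by rewrite (act_comp (phi := be) (psi := psi')) // e e'.
move=> c; have [z [k kE]] := frac c.
apply/eqP; rewrite -subr_eq0; apply/eqP; apply: (unit_reg (a := psi (be r) ^+ k)).
  by apply: unit_exp; rewrite pE.
have : psi' (be r ^+ k * c) = psi (be r ^+ k * c) by rewrite kE pE'.
by rewrite !rmorphM !rmorphXn pE' mulrBr => ->; rewrite subrr.
Qed.
End SubScheme.

Section LocallyClosed.
Variables (S : scheme) (Z : subfun S) (X : scheme) (iota : zmor X S).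
Hypotheses (Z_stable : sub_stable Z) (Z_local : sub_local Z).
Hypothesis Z_locus : forall (A : comPzRingType) (s : S A) (K : fieldType) (x : {rmorphism A -> K}),
  Z (act x s) -> locus x s Z.
Hypotheses (inj : forall R : comPzRingType, injective (iota R))
  (imZ : forall (R : comPzRingType) (s : S R), image iota s <-> Z s).

Let P (K : fieldType) (s : S K) := exists (V : subfun S) (A : comPzRingType) (a : S A)
  (x : {rmorphism A -> K}), [/\ open_subfun V, universal V a, act x a = s & locus x a Z].

(* [U] is the union of the affine charts in which [Z] is closed. *)
Lemma locus_locally_closed : locally_closed_immersion iota.
Proof.
split=> //; pose U : subfun S := fun R s => forall (K : fieldType) (x : {rmorphism R -> K}), P (act x s).
have UP (K : fieldType) (s : S K) : U K s -> P s.
  by move=> /(_ K (ridm K)); rewrite act_id.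
exists U; split.
  apply: open_criterion.
  - by move=> R R' phi s Us K x; rewrite -(act_comp (chi := rcomp x phi)).
  - move=> R s nearU K x; have [r xr h] := nearU K x.
    exact: UP (h K x (ex_intro _ _ (mulfV xr))).
  move=> R s K x /UP[V [A [a [x0 [op univ e [r [E [xr h]]]]]]]].
  apply: (affine_near op univ e); exists r => // R' psi [b hb] L y.
  exists V, A, a, (rcomp y psi); split=> //; first by apply: act_comp.
  by exists r, E; split=> //; apply: unit_not0 hb.
split=> [R s /imZ Zs K x|R s Us].
  have [V [op [A [a univ]] Vs]] := proj2 (schemeP S) K (act x s).
  have [x0 [x0E _]] := proj2 univ K _ Vs.
  exists V, A, a, x0; split=> //; apply: Z_locus; rewrite x0E.
  exact: Z_stable.
have [E hE] : exists E : R -> Prop, forall (R' : comPzRingType) (phi : {rmorphism R -> R'}),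
    Z (act phi s) <-> forall e, E e -> phi e = 0.
  apply: closed_gluing => // K x; have [V [A [a [x0 [op univ e lc]]]]] := Us K x.
  exact: (affine_locus op univ e).
by exists E => R' phi; rewrite imZ.
Qed.
End LocallyClosed.

(** * Coproducts of disjoint subschemes *)

Section Separated.
Variable Y : scheme.

(** The name refers to separated presheaves, not to separated schemes: agreement near each point
    yields a cover, on which the sheaf condition makes gluing unique. *)
Lemma scheme_separated (R : comPzRingType) (y y' : Y R) :
  (forall (K : fieldType) (x : {rmorphism R -> K}),
     exists2 r, act (loc_in r) y = act (loc_in r) y' & x r != 0) -> y = y'.
Proof.
move=> h; have [k [r [rE ru]]] :=
  span_unit_family (span_unit (E := fun r => act (loc_in r) y = act (loc_in r) y') h).
have [||z [_ zU]] := (proj1 (schemeP Y)) R k r (fun a => locr (r a)) (fun a => loc_in (r a)) (fun a => act (loc_in (r a)) y) ru.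
- by move=> a; apply: locP.
- move=> a b C al be e; rewrite -(act_comp (chi := rcomp al (loc_in (r a)))) //.
  by apply: act_comp => t; rewrite /= e.
by rewrite -(zU y) // -(zU y') // => a; rewrite -rE.
Qed.

Lemma zero_ring_point (R : comPzRingType) (y y' : Y R) : (1 : R) = 0 -> y = y'.
Proof.
move=> e; apply: scheme_separated => K x.
by have := rmorph1 x; rewrite e rmorph0 => /esym/eqP; rewrite oner_eq0.
Qed.
End Separated.

Section Coproduct.
Variables (S : scheme) (T : subfun S) (I : Type) (Z : I -> subfun S).
Hypotheses (T_stable : sub_stable T) (Z_stable : forall i, sub_stable (Z i)).
Hypotheses (XP : forall i, is_scheme (subz (@Z_stable i))) (PP : is_scheme (subz T_stable)).
Hypothesis ZT : forall i (R : comPzRingType) (s : S R), Z i s -> T s.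
Hypothesis Z_disjoint : forall i j (K : fieldType) (s : S K), Z i s -> Z j s -> i = j.
Hypothesis T_cover : forall (R : comPzRingType) (s : S R) (K : fieldType) (x : {rmorphism R -> K}),
  T s -> exists i, near x s (Z i).

Definition sub_inj_mor i : zmor (Scheme (XP i)) (Scheme PP) :=
  @ZMor (subz (@Z_stable i)) (subz T_stable) (fun R s => exist _ (sval s) (ZT (svalP s)))
    (fun R R' phi s => sub_inj (s := exist _ _ _) (t := exist _ _ _) (erefl (act phi (sval s)))).

Variables (Y : scheme) (f : forall i, zmor (Scheme (XP i)) Y).

Let fz i (R : comPzRingType) (s : S R) (h : Z i s) : Y R := f i R (exist _ s h).

Let fz_act i (R R' : comPzRingType) (phi : {rmorphism R -> R'}) (s : S R) (h : Z i s)
    (h' : Z i (act phi s)) : act phi (fz h) = fz h'.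
Proof. by rewrite /fz -app_nat; congr (f i R' _); apply: sub_inj. Qed.

(** Two different pieces have no common field-valued point, so they meet only over the zero ring,
    where any two points of [Y] agree. *)
Let overlap i j (R : comPzRingType) (s t : S R) (hs : Z i s) (ht : Z j t) : s = t -> fz hs = fz ht.
Proof.
move=> e; subst t; have [ij|ij] := pselect (i = j).
  by subst j; congr (f i R _); apply: sub_inj.
apply: zero_ring_point; apply: no_points => K x; apply: ij.
exact: Z_disjoint (Z_stable x hs) (Z_stable x ht).
Qed.

(** The value at [s] of the glued morphism, characterized by all restrictions of [s] that fall into
    some piece. This form is stable under base change, which gives naturality. *)
Let glued (R : comPzRingType) (s : S R) (y : Y R) := forall (R' : comPzRingType)
  (phi : {rmorphism R -> R'}) i (h : Z i (act phi s)), act phi y = fz h.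

Let glued_unique (R : comPzRingType) (s : S R) y y' : T s -> glued s y -> glued s y' -> y = y'.
Proof.
move=> Ts h h'; apply: scheme_separated => K x.
have [i [r xr hr]] := T_cover x Ts; exists r => //.
have Zr : Z i (act (loc_in r) s) by apply: hr; apply: loc_unit (locP r).
by rewrite (h _ _ _ Zr) (h' _ _ _ Zr).
Qed.

Let glued_ex (R : comPzRingType) (s : S R) : T s -> exists y, glued s y.
Proof.
move=> Ts.
have [k [r [rE ru]]] : exists k (r : 'I_k -> R), (forall a, exists i, Z i (act (loc_in (r a)) s)) /\ unit_family r.
  apply: (span_unit_family (E := fun r => exists i, Z i (act (loc_in r) s))); apply: span_unit => K x.
  have [i [r xr hr]] := T_cover x Ts; exists r => //; exists i.
  by apply: hr; apply: loc_unit (locP r).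
have [i iE] := choice rE.
have [||y [yE _]] := (proj1 (schemeP Y)) R k r (fun a => locr (r a)) (fun a => loc_in (r a)) (fun a => fz (iE a)) ru.
- by move=> a; apply: locP.
- move=> a b C al be e.
  rewrite (fz_act _ (Z_stable al (iE a))) (fz_act _ (Z_stable be (iE b))).
  by apply: overlap; rewrite -(act_comp (chi := rcomp al (loc_in (r a)))) //; apply: act_comp => t; rewrite /= e.
exists y => R' phi j h; apply: scheme_separated => K x.
have [a xa] := unit_family_point (rcomp x phi) ru; exists (phi (r a)) => //.
have lr := locP (phi (r a)).
have [g gE] := loc_lift (locP (r a)) (g := rcomp (loc_in (phi (r a))) phi) (loc_unit lr).
have ac (F : zfunctor) (z : F R) : act (loc_in (phi (r a))) (act phi z) = act g (act (loc_in (r a)) z).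
  by rewrite -(act_comp (chi := rcomp (loc_in (phi (r a))) phi)) //; apply: act_comp => t; rewrite /= gE.
rewrite ac yE (fz_act _ (Z_stable g (iE a))) (fz_act _ (Z_stable _ h)).
by apply: overlap; rewrite ac.
Qed.

Let glue (R : comPzRingType) (s : subz T_stable R) : Y R := sval (cid (glued_ex (svalP s))).

Let glueP (R : comPzRingType) (s : subz T_stable R) : glued (sval s) (glue s).
Proof. exact: svalP (cid _). Qed.

Fact glue_nat (R R' : comPzRingType) (phi : {rmorphism R -> R'}) (s : subz T_stable R) :
  glue (act phi s) = act phi (glue s).
Proof.
apply: (glued_unique (svalP (act phi s))); first exact: glueP.
move=> R2 psi i h; rewrite -(act_comp (chi := rcomp psi phi)) //.
have e : act (rcomp psi phi) (sval s) = act psi (sval (act phi s)) by apply: act_comp.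
have h' : Z i (act (rcomp psi phi) (sval s)) by rewrite e.
by rewrite (@glueP R s R2 (rcomp psi phi) i h'); apply: overlap.
Qed.

Lemma disjoint_coproduct_ex : exists g : zmor (Scheme PP) Y,
  (forall i, comp_eq g (sub_inj_mor i) (f i)) /\
  forall g' : zmor (Scheme PP) Y, (forall i, comp_eq g' (sub_inj_mor i) (f i)) -> eq_mor g' g.
Proof.
exists (@ZMor (subz T_stable) Y glue glue_nat); split.
  move=> i R [s Zs]; rewrite -[LHS]/(glue (sub_inj_mor i R (exist _ s Zs))).
  set s' := sub_inj_mor i R _.
  have h : Z i (act (ridm R) (sval s')) by apply: Z_stable.
  rewrite -(act_id (phi := ridm R) (glue s')) // (@glueP R s' R (ridm R) i h).
  by apply: overlap; rewrite act_id.
move=> g' hg' R s; apply: (glued_unique (svalP s)); last exact: glueP.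
move=> R' phi i h; rewrite -app_nat /fz -hg'; congr (g' R' _).
exact: sub_inj.
Qed.
End Coproduct.

(** * Frames of a family of F-zips *)

Section Strata.
Variables (p : nat) (p_prime : prime p) (tau : int -> nat) (supp : seq int).
Hypotheses (supp_sorted : sorted <%R supp) (suppE : forall i, (i \in supp) = (tau i != 0%N)).
Variables (S : scheme) (char_S : has_characteristic p S) (M : fzip p S) (M_type : has_type M tau).
Notation n := (dimz tau supp).
Notation B := (size supp).
Notation dl := (dlab (tau := tau) (supp := supp)).
Notation sup := (supi supp).
Notation frame := (zframe dl sup).
Let dlB := @dlab_lt tau supp supp_sorted.
Let supE := @supE tau supp supp_sorted.
Let MP := fzipP M.

Lemma fib_semi (R : comPzRingType) (s : S R) : zsemi p (M R s).
Proof. by move=> i; case: (phi_iso MP i s). Qed.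

Section AtPoint.
Variables (R : comPzRingType) (s : S R).
Notation N := (M R s).
Let ch : p%:R = 0 :> R := char_S s.

Definition adC (pi : 'S_n) (v : 'I_n -> N) : Prop := is_basis v /\
  forall i w, zC N i w <-> supp_span v (fun a => i <= sup (dl (pi a))) w.
Definition adD (v : 'I_n -> N) : Prop := is_basis v /\
  forall i w, zD N i w <-> supp_span v (fun a => sup (dl a) <= i) w.

(** The matrix consists of the coordinates of representatives of phi (v a), truncated to the graded
    part. The linearization of phi is onto, so each v b is modulo D_(i-1) a combination of its
    columns; the coefficients form a right inverse. *)
Lemma frame_of_basis pi v : adC pi v -> adD v -> exists Phi, frame pi v Phi.
Proof.
move=> [vb vC] [_ vD].
pose z a := sqval (zphi (clC (sup (dl (pi a))) (v a))).
have Dz a : zD N (sup (dl (pi a))) (z a) by apply: sqval_mem.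
have [c cE] := choice (fun a => proj1 (vD _ _) (Dz a)).
pose Phi : 'M[R]_n := \matrix_(b, a) if dl b == dl (pi a) then c a b else 0.
have gr : graded dl pi Phi by move=> b a /negbTE nba; rewrite mxE nba.
have wD a : zD N (sup (dl (pi a))) (\sum_b Phi b a *: v b).
  apply/vD; apply: supp_span_lin => b nle; apply: gr; apply: contra nle => /eqP->.
  exact: lexx.
have wphi a : zphi (clC (sup (dl (pi a))) (v a)) = clD (sup (dl (pi a))) (\sum_b Phi b a *: v b).
  have [hc zE] := cE a; set i := sup _; rewrite -[LHS](sqclass_val (A := zD N i) (B := zD N (i - 1))).
  apply/(sqclassP (A := zD N i)); [exact: Dz|exact: wD|apply/vD].
  rewrite -/(z a) zE -sumrB; exists (fun b => c a b - Phi b a); split.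
    move=> b nle; rewrite mxE; case: eqP => [_|/eqP nba]; first by rewrite subrr.
    rewrite subr0 hc //; apply: contra nle.
    have := sup_eq supE b (pi a); rewrite (negbTE nba) -/i; lia.
  by apply: eq_bigr => b _; rewrite scalerBl.
exists Phi; split=> //.
have span i (y : zgrD N i) : exists e : 'I_n -> R,
    y = clD i (\sum_(a | sup (dl (pi a)) == i) e a *: (\sum_b Phi b a *: v b)).
  pose w1 a := if sup (dl (pi a)) == i then \sum_b Phi b a *: v b else 0.
  have w1D a : zD N i (w1 a) by rewrite /w1; case: eqP => [<-//|_]; apply: smem0.
  have w1E e : \sum_(a | sup (dl (pi a)) == i) e a *: (\sum_b Phi b a *: v b) = \sum_a e a *: w1 a.
    rewrite big_mkcond; apply: eq_bigr => a _; rewrite /w1; case: ifP => // _.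
    by rewrite scaler0.
  have bc : is_base_change (frob p_prime ch) (zphi (z := N) (i := i) : zgrC N i -> zgrD N i).
    exact: (phi_iso MP i s).
  have [k [y' [u ->]]] := bc_gen' bc y.
  have uE j : exists e : 'I_n -> R, zphi (u j) = clD i (\sum_a e a *: w1 a).
    have Cu : zC N i (sqval (u j)) by apply: sqval_mem.
    have [d dE] := basis_ex vb (sqval (u j)).
    rewrite dE in Cu; have [_] := zphi_span p_prime ch (@fib_semi R s) vb vC wD wphi Cu.
    rewrite -dE /clC sqclass_val => ->.
    by exists (fun a => d a ^+ p); rewrite (w1E (fun a => d a ^+ p)).
  have [e eE] := choice uE.
  exists (fun a => \sum_j y' j * e j a); rewrite (w1E (fun a => \sum_j y' j * e j a)) /clD.
  rewrite sqclass_sum //; under [RHS]eq_bigr => a _ do rewrite scaler_suml.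
  rewrite exchange_big; apply: eq_bigr => j _.
  rewrite eE /clD sqclass_sum // scaler_sumr; apply: eq_bigr => a _.
  by rewrite scalerA.
have [e eE] := choice (fun b => span (sup (dl b)) (clD _ (v b))).
pose Psi : 'M[R]_n := \matrix_(a, b) if dl (pi a) == dl b then e b a else 0.
exists Psi; apply/matrixP => c0 b; rewrite [LHS]mxE [RHS]mxE.
have [ecb|ncb] := eqVneq (dl c0) (dl b); last first.
  rewrite big1 => [|a _]; first by case: (c0 =P b) ncb => [->|//]; rewrite eqxx.
  have [h|h] := eqVneq (dl c0) (dl (pi a)); last by rewrite gr ?mul0r.
  by rewrite [Psi _ _]mxE -h (negbTE ncb) mulr0.
have Db : zD N (sup (dl b)) (v b) by apply/vD; apply: supp_span_in.
set i := sup (dl b).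
have Ds : zD N i (\sum_(a | sup (dl (pi a)) == i) e b a *: (\sum_b Phi b a *: v b)).
  rewrite big_mkcond; apply: smem_sum => a; case: eqP => [<-|_]; last exact: smem0.
  exact: smemZ.
have h := proj1 (sqclassP (zD N (i - 1)) Db Ds) (eE b).
have e1 : v b - \sum_(a | sup (dl (pi a)) == i) e b a *: (\sum_b Phi b a *: v b) =
    \sum_x ((x == b)%:R - \sum_a Phi x a * Psi a b) *: v x.
  under [RHS]eq_bigr => x _ do rewrite scalerBl; rewrite sumrB; congr (_ - _).
    rewrite (bigD1 b) //= eqxx scale1r big1 ?addr0 // => x /negbTE->.
    by rewrite scale0r.
  rewrite -lin_comb_comp big_mkcond; apply: eq_bigr => a _.
  by rewrite mxE sup_eq //; case: ifP => // _; rewrite scale0r.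
have := supp_span_coord vb (P := fun x => sup (dl x) <= i - 1)
  (c := fun x => (x == b)%:R - \sum_a Phi x a * Psi a b).
rewrite -e1 => /(_ (proj1 (vD _ _) h) c0).
have ei : sup (dl c0) = i by apply/eqP; rewrite sup_eq // ecb.
have ni : ~~ (i <= i - 1) by lia.
by rewrite ei => /(_ ni)/eqP; rewrite subr_eq0 => /eqP.
Qed.

Lemma adC_change pi pi' (v : 'I_n -> N) (T : 'M[R]_n) : adC pi v -> minv T ->
  patC dl pi pi' T -> adC pi' (fun a => \sum_b T b a *: v b).
Proof.
move=> [vb vC] [Y TY] hC; split; first exact: basis_change vb TY.
have sE a : pi ((pi' * pi^-1)%g a) = pi' a by rewrite permM permKV.
have hCY a b : (dl (pi' a) < dl (pi b))%N -> Y a b = 0.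
  move=> lt; apply: (@pat_inv_perm _ _ (fun x y => dl (pi y) <= dl (pi x))%N (pi' * pi^-1)%g T Y) => //.
  - by move=> x y z h1 h2; apply: leq_trans h2 h1.
  - by move=> x y; rewrite sE -ltnNge; apply: hC.
  - by rewrite sE -ltnNge.
move=> i w; rewrite vC; apply: supp_span_change TY _ _ w => b a nP Pa.
  apply: hC; rewrite ltnNge -supE; apply: contra nP; exact: le_trans.
apply: hCY; rewrite ltnNge -supE; apply: contra nP; exact: le_trans.
Qed.

Lemma adD_change (v : 'I_n -> N) (T : 'M[R]_n) : adD v -> minv T ->
  patL dl dl T -> adD (fun a => \sum_b T b a *: v b).
Proof.
move=> [vb vD] [Y TY] hD; split; first exact: basis_change vb TY.
have hDY a b : (dl b < dl a)%N -> Y a b = 0.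
  move=> lt; apply: (@pat_inv _ _ (fun x y => dl x <= dl y)%N T Y) => //.
  - by move=> x y z; apply: leq_trans.
  - by move=> x y; rewrite -ltnNge; apply: hD.
  - by rewrite -ltnNge.
move=> i w; rewrite vD; apply: supp_span_change TY _ _ w => b a nP Pa.
  apply: hD; rewrite ltnNge -supE; apply: contra nP => h; exact: le_trans h Pa.
apply: hDY; rewrite ltnNge -supE; apply: contra nP => h; exact: le_trans h Pa.
Qed.

Lemma frame_of_pair pi pi' (v w : 'I_n -> N) (G q : 'M[R]_n) : adC pi v -> adD w ->
  (forall a, w a = \sum_b G b a *: v b) -> minv G -> minv q ->
  patC dl pi pi' (G *m q) -> patL dl dl q -> exists (u : 'I_n -> N) Phi, frame pi' u Phi.
Proof.
move=> vC wD wE iG iq hC hq.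
exists (fun a => \sum_b q b a *: w b); apply: frame_of_basis; last exact: adD_change.
have := adC_change vC (minvM iG iq) hC; congr (adC pi' _); apply: funext => a.
under [RHS]eq_bigr => b _ do rewrite wE.
by rewrite lin_comb_comp; apply: eq_bigr => b _; rewrite mxE.
Qed.

Lemma pair_position pi (v w u : 'I_n -> N) (G Phi : 'M[R]_n) : adC pi v -> adD w ->
  (forall a, w a = \sum_b G b a *: v b) -> frame pi u Phi ->
  in_position (fun b a => dl (pi a) <= dl (pi b))%N (fun b a => dl b <= dl a)%N G.
Proof.
move=> [vb vC] [wb wD] wE fr.
have [P [iP PE]] := basis_matrix vb (zf_basis fr).
have [q [iq qE]] := basis_matrix wb (zf_basis fr).
exists P, q; split=> //.
- move=> b a; rewrite -supE => nle.
  apply: (supp_span_coord vb (P := fun b => sup (dl (pi a)) <= sup (dl (pi b))) (c := P^~ a)) => //.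
  by apply/vC; rewrite -PE; apply/(zf_C fr); apply: supp_span_in.
- move=> b a; rewrite -supE => nle.
  apply: (supp_span_coord wb (P := fun b => sup (dl b) <= sup (dl a)) (c := q^~ a)) => //.
  by apply/wD; rewrite -qE; apply/(zf_D fr); apply: supp_span_in.
apply/matrixP => b a; move: b; apply: (basis_inj vb).
rewrite -PE qE; under [RHS]eq_bigr => b _ do rewrite wE.
by rewrite lin_comb_comp; apply: eq_bigr => b _; rewrite mxE.
Qed.
End AtPoint.

Section BaseChange.
Variables (R R' : comPzRingType) (phi : {rmorphism R -> R'}) (s : S R) (s' : S R').
Variable e : act phi s = s'.
Let bc := rst_base_change MP e.

Lemma adC_bc pi (v : 'I_n -> M R s) : adC pi v -> adC pi (fun a => rst M e (v a)).
Proof.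
move=> [vb vC]; split; first exact: (bc_basis bc).
by move=> i; apply: supp_span_bc bc _ (vC i) => w; apply: C_base_change MP _ _ _ _ _ _ _ _.
Qed.

Lemma adD_bc (v : 'I_n -> M R s) : adD v -> adD (fun a => rst M e (v a)).
Proof.
move=> [vb vD]; split; first exact: (bc_basis bc).
by move=> i; apply: supp_span_bc bc _ (vD i) => w; apply: D_base_change MP _ _ _ _ _ _ _ _.
Qed.

Lemma frame_bc pi (v : 'I_n -> M R s) Phi : frame pi v Phi ->
  frame pi (fun a => rst M e (v a)) (map_mx phi Phi).
Proof.
move=> fr.
have [vb vC] : adC pi (fun a => rst M e (v a)).
  by apply: adC_bc; split; [apply: zf_basis fr|apply: zf_C fr].
have [_ vD] : adD (fun a => rst M e (v a)).
  by apply: adD_bc; split; [apply: zf_basis fr|apply: zf_D fr].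
split=> //.
- move=> a.
  have -> : \sum_b map_mx phi Phi b a *: rst M e (v b) = rst M e (\sum_b Phi b a *: v b).
    by rewrite (semi_lin (bc_lin bc)); apply: eq_bigr => b _; rewrite mxE.
  apply: (phi_base_change MP) (zf_phi fr a); last exact: zf_Dmem fr.
  by apply/(zf_C fr); apply: supp_span_in.
- by move=> b a h; rewrite mxE (zf_graded fr) // rmorph0.
- exact: minv_map (zf_minv fr).
Qed.
End BaseChange.

(** For k = 0 this only prescribes the relative position of the filtrations [C] and [D]. *)
Definition tri k pi (R : comPzRingType) (s : S R) : Prop :=
  exists (v : 'I_n -> M R s) Phi, frame pi v Phi /\ triangular dl B k pi Phi.

Lemma tri_bc k pi (R R' : comPzRingType) (phi : {rmorphism R -> R'}) (s : S R) :
  tri k pi s -> tri k pi (act phi s).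
Proof.
move=> [v [Phi [fr tr]]]; exists (fun a => rst M (erefl (act phi s)) (v a)), (map_mx phi Phi).
split; first exact: frame_bc.
by move=> b a lt; rewrite mxE tr // rmorph0.
Qed.

Lemma tri_le k j pi (R : comPzRingType) (s : S R) : (j <= k)%N -> tri k pi s -> tri j pi s.
Proof.
move=> jk [v [Phi [fr tr]]]; exists v, Phi; split=> //.
exact: triangular_le jk tr.
Qed.

Lemma graded_tri0 pi (R : comPzRingType) (Phi : 'M[R]_n) : graded dl pi Phi -> triangular dl B 0 pi Phi.
Proof. by move=> gr b a lt; apply: gr; rewrite gtn_eqF. Qed.

(** The filtrations are bounded, so nestedness and freeness of the graded pieces of type [tau] are
    finitely many Zariski-local conditions. Bases of the pieces of [D] are the images under phi of
    those of the pieces of [C]. *)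
Lemma bases_near (A : comPzRingType) (K : fieldType) (x : {rmorphism A -> K}) (s : S A) :
  exists (C : comPzRingType) (l : {rmorphism A -> C}) (y : {rmorphism C -> K}),
    refines S l x y /\
    exists v w : 'I_n -> M C (act l s), adC 1 v /\ adD w.
Proof.
have [c1 Cf] := C_full MP; have [c2 Cz] := C_zero MP.
have [d1 Dz] := D_zero MP; have [d2 Df] := D_full MP.
(* A bound on all indices where the filtrations can jump and on all labels. *)
pose m := (`|c1| + `|c2| + `|d1| + `|d2| + \sum_(a < n) `|sup (dl a)| + 1)%N.
have lm a : - m%:Z <= sup (dl a) < m%:Z.
  have : (`|sup (dl a)| <= \sum_(a < n) `|sup (dl a)|)%N by rewrite (bigD1 a) //= leq_addr.
  by rewrite /m; lia.
pose P (j : int + int + int) (R : comPzRingType) (s' : S R) : Prop := match j with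
  | inl (inl i) => forall w, zC (M R s') (i + 1) w -> zC (M R s') i w
  | inl (inr i) => forall w, zD (M R s') i w -> zD (M R s') (i + 1) w
  | inr i => exists v, graded_basis (zC (M R s') i) (zC (M R s') (i + 1)) (fun a : 'I_n => sup (dl a) == i) v
  end.
have loc j (R : comPzRingType) (s' : S R) : zariski_locally (P j) s'.
  case: j => [[i|i]|i].
  - have [k [f [fu fP]]] := C_summand MP (i + 1) s'; exists k, f; split=> // a R' phi lphi w.
    by have [h _] := fP a R' phi lphi => /h; rewrite addrK.
  - have [k [f [fu fP]]] := D_summand MP i s'; exists k, f; split=> // a R' phi lphi w.
    by have [h _] := fP a R' phi lphi => /h.
  - have [k [f [fu fP]]] := M_type i s'; exists k, f; split=> // a R' phi lphi.
    have [e eb] := fP a R' phi lphi; apply: graded_basis_ex eb _.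
    exact: card_lab.
have pers j (R R' : comPzRingType) (f : R) (l : {rmorphism R -> R'}) (s' : S R) :
    is_localization f l -> P j R s' -> P j R' (act l s').
  move=> lf; case: j => [[i|i]|i] /=.
  - move=> h w /(C_base_change MP _ (erefl (act l s'))) g.
    apply/(C_base_change MP _ (erefl (act l s'))); apply: (generated_min (C := gensub _)) g => _ [u /h Cu ->].
    by apply: generated_sub; exists u.
  - move=> h w /(D_base_change MP _ (erefl (act l s'))) g.
    apply/(D_base_change MP _ (erefl (act l s'))); apply: (generated_min (C := gensub _)) g => _ [u /h Du ->].
    by apply: generated_sub; exists u.
  - case=> v gv; exists (fun a => rst M (erefl (act l s')) (v a)).
    by apply: (graded_basis_loc lf (rst_base_change MP (erefl (act l s'))) _ _ gv) => w; apply: C_base_change MP _ _ _ _ _ _ _ _.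
pose rg := [seq k%:Z - m%:Z | k <- iota 0 (m + m)].
have rgP i : - m%:Z <= i < m%:Z -> i \in rg.
  move=> h; apply/mapP; exists (absz (i + m%:Z)); last by lia.
  by rewrite mem_iota; lia.
have [C [l [y [ref hP]]]] :=
  refines_all ([seq inl (inl i) | i <- rg] ++ [seq inl (inr i) | i <- rg] ++ [seq inr i | i <- rg])
    x s loc pers.
exists C, l, y; split=> //; set s' := act l s in hP *.
have hC i : - m%:Z <= i < m%:Z -> forall w, zC (M C s') (i + 1) w -> zC (M C s') i w.
  by move=> /rgP ir; apply: (hP (inl (inl i))); rewrite !mem_cat map_f.
have hD i : - m%:Z <= i < m%:Z -> forall w, zD (M C s') i w -> zD (M C s') (i + 1) w.
  by move=> /rgP ir; apply: (hP (inl (inr i))); rewrite !mem_cat map_f ?orbT.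
have hV i : - m%:Z <= i < m%:Z -> exists v, graded_basis (zC (M C s') i) (zC (M C s') (i + 1)) (fun a : 'I_n => sup (dl a) == i) v.
  by move=> /rgP ir; apply: (hP (inr i)); rewrite !mem_cat map_f ?orbT.
have [V VE] := choice (fun i => imp_ex (fun=> 0) (hV i)).
pose v a := V (sup (dl a)) a.
have vg i : - m%:Z <= i < m%:Z -> graded_basis (zC (M C s') i) (zC (M C s') (i + 1)) (fun a : 'I_n => sup (dl a) == i) v.
  move=> /VE; apply: graded_basis_eq => // a /eqP ea.
  by rewrite /v ea.
have sC := @fib_semi C s'.
have ch := char_S s'.
have Wex i : - m%:Z <= i < m%:Z -> exists w, graded_basis (zD (M C s') i) (zD (M C s') (i - 1)) (fun a : 'I_n => sup (dl a) == i) w.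
  move=> /vg/graded_basis_quo eb.
  have bc : is_base_change (frob p_prime ch) (zphi (z := M C s') (i := i) : zgrC (M C s') i -> zgrD (M C s') i).
    exact: (phi_iso MP i s').
  exact: graded_basis_ex (bc_basis bc eb) erefl.
have [W WE] := choice (fun i => imp_ex (fun=> 0) (Wex i)).
pose w a := W (sup (dl a)) a.
have wg i : - m%:Z <= i < m%:Z -> graded_basis (zD (M C s') i) (zD (M C s') (i - 1)) (fun a : 'I_n => sup (dl a) == i) w.
  move=> /WE; apply: graded_basis_eq => // a /eqP ea.
  by rewrite /w ea.
exists v, w; split.
  have [||a|a||i|vb vC] := @adapted_basis C (M C s') n (zC (M C s')) (fun a => sup (dl a)) v (- m%:Z) m%:Z.
  - by move=> i u le; apply: Cf; rewrite /m in le; lia.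
  - by move=> i u le; apply: Cz; rewrite /m in le; lia.
  - by case/andP: (lm a).
  - by case/andP: (lm a).
  - by move=> i u h; apply: hC.
  - exact: vg.
  by split=> // i u; rewrite vC; split; apply: supp_span_mono => a; rewrite perm1.
(* The filtration [D] ascends, so its indices and labels are negated, with the bounds shifted by 1
   accordingly. *)
have [||a|a|i u h|i h|wb wD] := @adapted_basis C (M C s') n (fun j => zD (M C s') (- j)) (fun a => - sup (dl a)) w (1 - m%:Z) (m%:Z + 1).
- by move=> i u le; apply: Df; rewrite /m in le; lia.
- by move=> i u le; apply: Dz; rewrite /m in le; lia.
- by have := lm a; lia.
- by have := lm a; lia.
- have -> : - i = - (i + 1) + 1 by lia.
  have [le|gt] := leP (- m%:Z) (- (i + 1)); first by apply: hD; lia.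
  by move/Dz => ->; [apply: smem0|rewrite /m in gt; lia].
- have := wg (- i); have -> : - (i + 1) = - i - 1 by lia.
  move=> gi; have {gi} := gi ltac:(lia); apply: graded_basis_eq => // a.
  by rewrite eqr_oppLR.
split=> // i u; rewrite -{1}(opprK i) wD; split; apply: supp_span_mono => a; lia.
Qed.

Let refl_c (pi : 'S_n) : reflexive (fun b a => dl (pi a) <= dl (pi b))%N.
Proof. by move=> b; apply: leqnn. Qed.
Let trans_c (pi : 'S_n) : transitive (fun b a => dl (pi a) <= dl (pi b))%N.
Proof. by move=> b a c h1 h2; apply: leq_trans h2 h1. Qed.
Let refl_l (l : 'I_n -> nat) : reflexive (fun b a => l b <= l a)%N.
Proof. by move=> b; apply: leqnn. Qed.
Let trans_l (l : 'I_n -> nat) : transitive (fun b a => l b <= l a)%N.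
Proof. by move=> b a c h1 h2; apply: leq_trans h1 h2. Qed.

Lemma adC_perm pi (R : comPzRingType) (s : S R) (v : 'I_n -> M R s) : adC 1 v ->
  adC pi (fun a => \sum_b (\matrix_(b, a) (b == pi a)%:R : 'M[R]_n) b a *: v b).
Proof.
move=> vC; apply: (adC_change vC); first exact: perm_minv.
move=> b a; rewrite perm1 mxE => lt; case: (b =P pi a) => // e.
by rewrite e ltnn in lt.
Qed.

Lemma locus_tri0 pi (A : comPzRingType) (K : fieldType) (x : {rmorphism A -> K}) (s : S A) :
  (forall z : K, exists a b : A, x b != 0 /\ z * x b = x a) ->
  tri 0 pi (act x s) -> locus x s (fun R s0 => tri 0 pi s0).
Proof.
move=> frac t; have [C [l [y [[yx ref] [v [w [vC wD]]]]]]] := bases_near x s.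
apply: ref; have {}vC := adC_perm pi vC.
have [G [iG GE]] := basis_matrix (proj1 vC) (proj1 wD).
apply: (@locus_flags _ _ _ y _ n _ _ G _ _ (@refl_c pi) (@trans_c pi) (@refl_l dl) (@trans_l dl)).
- move=> z; have [a [b [h1 h2]]] := frac z.
  by exists (l a), (l b); rewrite !yx.
- move=> R' phi; set s' := act phi _.
  have e : act phi (act l s) = s' by [].
  have vC' := adC_bc e vC; have wD' := adD_bc e wD.
  have GE' a : rst M e (w a) = \sum_b map_mx phi G b a *: rst M e (\sum_c (\matrix_(b, a) (b == pi a)%:R : 'M[C]_n) c b *: v c).
    rewrite GE (semi_lin (bc_lin (rst_base_change MP e))); apply: eq_bigr => b _.
    by rewrite mxE.
  split.
    move=> [P [q [hP hq iP iq PE]]].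
    have [||u [Phi fr]] := frame_of_pair (pi' := pi) vC' wD' GE' (minv_map phi iG) iq.
    - by rewrite PE => b a lt; apply: hP; rewrite -ltnNge.
    - by move=> b a lt; apply: hq; rewrite -ltnNge.
    exists u, Phi; split=> //; apply: graded_tri0; exact: zf_graded fr.
  move=> [u [Phi [fr _]]]; exact: (pair_position vC' wD' GE' fr).
rewrite (_ : act y (act l s) = act x s) //; apply/esym; apply: act_comp => a.
by rewrite /= yx.
Qed.

(** By induction the condition of order k cuts out a locally closed piece that carries a frame. On
    this piece order k + 1 is the relative position described by [semi_lift]: [step_frame] with s =
    1 and [step_position] give the two directions. *)
Lemma locus_tri k pi (A : comPzRingType) (K : fieldType) (x : {rmorphism A -> K}) (s : S A) :
  (forall z : K, exists a b : A, x b != 0 /\ z * x b = x a) ->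
  tri k pi (act x s) -> locus x s (fun R s0 => tri k pi s0).
Proof.
move=> frac; elim: k => [|k IH] t; first exact: locus_tri0.
have tk := tri_le (leqnSn k) t.
have [r [E [xr h]]] := IH tk.
have xu : exists b, x r * b = 1 by exists (x r)^-1; rewrite mulfV.
have [C [be imm]] := immersion_ex r E.
have [bu bE _ lift] := imm.
have [y yx] := lift K x xu (proj2 (h K x xu) tk).
have acy : act y (act be s) = act x s.
  by apply/esym; apply: act_comp => a; rewrite /= yx.
apply: (locus_immersion imm yx xr).
  by move=> R' phi u /(tri_le (leqnSn k))/(h R' phi u).
have [v [Phi [fr tr]]] := proj1 (h C be bu) bE.
apply: (@locus_flags _ _ _ y _ n _ _ (semi_lift pi Phi) _ _ (@refl_c pi) (@trans_c pi) (@refl_l (lev dl B pi k.+1)) (@trans_l (lev dl B pi k.+1))).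
- move=> z; have [a [b [h1 h2]]] := frac z.
  by exists (be a), (be b); rewrite !yx.
- move=> R' phi; set s' := act phi _.
  have e : act phi (act be s) = s' by [].
  have ch := char_S s'; have sm := @fib_semi R' s'.
  have fr' := frame_bc e fr.
  have tr' : triangular dl B k pi (map_mx phi Phi) by move=> b a lt; rewrite mxE tr ?rmorph0.
  have -> : map_mx phi (semi_lift pi Phi) = semi_lift pi (map_mx phi Phi).
    by apply/matrixP => i j; rewrite !mxE.
  split.
    move=> [P [q [hP hq iP iq PE]]].
    have hq' : patL (lev dl B pi k.+1) (lev dl B pi k.+1) q.
      by move=> b a lt; apply: hq; rewrite -ltnNge.
    have hP' : patC dl pi (1 * pi)%g (semi_lift pi (map_mx phi Phi) *m q).
      by rewrite PE mul1g => b a lt; apply: hP; rewrite -ltnNge.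
    have lev1 a : lev dl B pi k ((1 : 'S_n)%g a) = lev dl B pi k a by rewrite perm1.
    have [Phi' [tT gr' iP' tr2]] := step_frame dlB p_prime ch (zf_graded fr') (zf_minv fr') tr' hq' iq hP' lev1.
    rewrite mul1g in tT gr' tr2.
    have := zframe_change supE p_prime ch sm fr' tT gr' iP' => fr2.
    by eexists; exists Phi'; split; [exact: fr2|].
  move=> [v2 [Phi2 [fr2 tr2]]].
  have [T [_ tT]] := zframe_transition supE p_prime ch sm fr' fr2.
  exact: (step_position dlB p_prime tT (zf_graded fr') (zf_minv fr') (zf_minv fr2) tr' tr2).
by rewrite acy.
Qed.

Notation N := (period n).

(** * Triangular frames over a field *)

Section Field.
Variables (K : fieldType) (s : S K).
Let ch := char_S s.
Let sm := @fib_semi K s.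

Lemma field_tri0 : exists pi, tri 0 pi s.
Proof.
have [C [l [y [[yx _] [v [w [vC wD]]]]]]] := bases_near (ridm K) s.
have e : act y (act l s) = s.
  by rewrite -(act_comp (chi := ridm K)) ?act_id // => a; rewrite /= yx.
have {}vC := adC_bc e vC; have {}wD := adD_bc e wD.
have [G [iG GE]] := basis_matrix (proj1 vC) (proj1 wD).
have [q [pi [q1 q2 q3 q4]]] := bruhat (tie_inj (F := dl)) (tie_inj (F := dl)) (proj1 (minv_field G) iG).
have [|||u [Phi fr]] := frame_of_pair (pi' := pi) vC wD GE iG (q := q).
- by apply: unitriangular_minv q1 q2; apply: tie_inj.
- by move=> b a; rewrite perm1 => lt; apply: q3; rewrite tie_lt lt.
- by move=> b a lt; apply: q1; rewrite tie_lt lt.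
exists pi, u, Phi; split=> //; apply: graded_tri0; exact: zf_graded fr.
Qed.

(** Each refinement step is possible over a field at the cost of replacing [pi] by [t * pi], where
    [t] preserves the levels reached so far. *)
Lemma field_tri k : exists pi, tri k pi s.
Proof.
elim: k => [|k [pi [v [Phi [fr tr]]]]]; first exact: field_tri0.
have iG : minv (semi_lift pi Phi) by apply/minv_reindex; exact: zf_minv fr.
have hG : patL (lev dl B pi k) (lev dl B pi k) (semi_lift pi Phi).
  by move=> b a lt; rewrite mxE tr // permKV.
have [q [t [hq iq hC ht]]] := field_position dlB iG hG.
have [Phi' [tT gr' iP' tr2]] := step_frame dlB p_prime ch (zf_graded fr) (zf_minv fr) tr hq iq hC ht.
have fr2 := zframe_change supE p_prime ch sm fr tT gr' iP'.
by exists (t * pi)%g; eexists; exists Phi'; split; [exact: fr2|].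
Qed.

(** The permutation found by [field_tri] need not satisfy [JWperm]. Renumbering the frame by [rho]
    from [JW_exists] replaces it by one that does and has the same labels along orbits, so
    gradedness and triangularity persist. *)
Lemma JW_tri : exists pi, JWperm dl pi /\ tri N pi s.
Proof.
have [pi [v [Phi [fr tr]]]] := field_tri N.
have [pi' [rho [J rd rl]]] := JW_exists dlB (dlab_mono supp_sorted) pi.
have fwd a : forall j, dl ((pi' ^+ j)%g (rho a)) = dl ((pi ^+ j)%g a).
  by apply/(lev_fwd dlB) => k; rewrite rl.
have rd' a : dl ((rho^-1)%g a) = dl a by rewrite -{2}(permKV rho a) rd.
have cl a : dl (pi' (rho a)) = dl (pi a) by have := fwd a 1%N; rewrite !expg1.
have cl' a : dl (pi ((rho^-1)%g a)) = dl (pi' a) by rewrite -cl permKV.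
have lv k a : lev dl B pi' k (pi' (rho a)) = lev dl B pi k (pi a).
  move: k; apply/(lev_fwd dlB) => j; have := fwd a j.+1.
  by rewrite !expgS !permM.
pose T : 'M[K]_n := \matrix_(b, a) (b == (rho^-1)%g a)%:R.
pose Phi' : 'M[K]_n := \matrix_(b, a) Phi ((rho^-1)%g b) ((rho^-1)%g a).
have gr' : graded dl pi' Phi'.
  by move=> b a nba; rewrite mxE (zf_graded fr) // rd' cl'.
have iP' : minv Phi'.
  have h := minv_reindexl (rho^-1)%g (zf_minv fr).
  have := proj2 (minv_reindex (rho^-1)%g _) h; congr (minv _).
  by apply/matrixP => i j; rewrite !mxE.
have tT : transition dl p pi pi' T Phi Phi'.
  split.
  - move=> b a lt; rewrite mxE; case: (b =P _) => // e.
    by rewrite e cl' ltnn in lt.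
  - move=> b a lt; rewrite mxE; case: (b =P _) => // e.
    by rewrite e rd' ltnn in lt.
  - exact: perm_minv.
  apply/matrixP => i j; rewrite [LHS]mxE [RHS]mxE.
  rewrite (bigD1 (rho i)) //= [X in _ + X]big1 => [|k nk]; last first.
    rewrite !mxE; case: (i =P _) => [e|_]; last by case: ifP; rewrite mul0r.
    by rewrite e permKV eqxx in nk.
  rewrite (bigD1 ((rho^-1)%g j)) //= [X in _ = _ + X]big1 => [|k nk].
    rewrite !mxE permK !eqxx rd cl' !eqxx expr1n mul1r mulr1 !addr0.
    by [].
  rewrite !mxE (negbTE nk); case: ifP => _; rewrite expr0n; case: p (prime_gt0 p_prime) => // *; exact: mulr0.
have fr2 := zframe_change supE p_prime ch sm fr tT gr' iP'.
exists pi'; split=> //; eexists; exists Phi'; split; first exact: fr2.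
move=> b a; rewrite -(permKV rho b) -(permKV rho a) lv rl => lt.
by rewrite mxE !permK tr.
Qed.

Lemma lev_ge_period pi k x y : (N <= k)%N ->
  (lev dl B pi k x <= lev dl B pi k y)%N = (lev dl B pi N x <= lev dl B pi N y)%N.
Proof.
elim: k x y => [|k IH] x y; first by rewrite leqNgt period_gt0.
rewrite leq_eqVlt => /orP[/eqP<-//|Nk].
rewrite -(permKV pi x) -(permKV pi y); move: (_ x) (_ y) => {}x {}y.
rewrite !levS lex_le ?lev_lt // IH //.
case: (ltngtP (dl (pi x)) (dl (pi y))) => [lt|lt|e] /=.
- apply/esym; rewrite leqNgt; apply/negP => h.
  by have := lev_le0 dlB (ltnW h); rewrite leqNgt lt.
- apply/esym/negbTE; apply/negP => h.
  by have := lev_le0 dlB h; rewrite leqNgt lt.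
- by rewrite (lev_stable dlB).
Qed.

Lemma triangular_all pi (R : comPzRingType) (Phi : 'M[R]_n) : triangular dl B N pi Phi ->
  forall k, triangular dl B k pi Phi.
Proof.
move=> tr k; have [kN|Nk] := leqP k N; first exact: triangular_le kN tr.
by move=> b a; rewrite ltnNge lev_ge_period ?(ltnW Nk) // -ltnNge; apply: tr.
Qed.

Lemma tri_unique pi pi' : JWperm dl pi -> JWperm dl pi' -> tri N pi s -> tri N pi' s -> pi = pi'.
Proof.
move=> J J' [v [Phi [fr /triangular_all tr]]] [v' [Phi' [fr' /triangular_all tr']]].
have [T [_ tT]] := zframe_transition supE p_prime ch sm fr fr'.
have [T' [_ tT']] := zframe_transition supE p_prime ch sm fr' fr.
apply: (transition_unique dlB (T := T) (dlab_mono supp_sorted) J J').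
- by move=> k; apply: (transition_levels dlB p_prime tT) => //; apply: zf_minv fr'.
- move=> k; exists T'; split; first by case: tT'.
  by apply: (transition_levels dlB p_prime tT') => //; apply: zf_minv fr.
- by case: tT.
Qed.
End Field.

(** * Strata *)

(** Triangular frames exist only locally on the base; asking for them near every point makes the
    condition Zariski-local. *)
Definition stratum pi : subfun S := fun R s => forall (K : fieldType) (x : {rmorphism R -> K}),
  near x s (fun R s => tri N pi s).

Lemma act2 (R R' R'' : comPzRingType) (phi : {rmorphism R -> R'}) (psi : {rmorphism R' -> R''}) (s : S R) :
  act psi (act phi s) = act (rcomp psi phi) s.
Proof. by apply/esym; apply: act_comp => a. Qed.

Lemma tri_stratum pi (R : comPzRingType) (s : S R) : tri N pi s -> stratum pi s.
Proof.
move=> t K x; exists 1; first by rewrite rmorph1 oner_neq0.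
by move=> R' phi _; apply: tri_bc.
Qed.

Lemma stratum_bc pi (R R' : comPzRingType) (phi : {rmorphism R -> R'}) (s : S R) :
  stratum pi s -> stratum pi (act phi s).
Proof.
move=> st K x; have [r xr h] := st K (rcomp x phi); exists (phi r) => // R2 psi u.
by rewrite act2; apply: h.
Qed.

Lemma stratum_local pi (R : comPzRingType) (s : S R) :
  (forall (K : fieldType) (x : {rmorphism R -> K}), exists2 r, x r != 0 &
     forall (R' : comPzRingType) (phi : {rmorphism R -> R'}), is_localization r phi ->
       stratum pi (act phi s)) -> stratum pi s.
Proof.
move=> h K x; have [r xr hr] := h K x.
have [y yE] := loc_point (locP r) xr.
exact: near_loc (locP r) xr yE (hr _ _ (locP r) K y).
Qed.

Lemma stratum_field pi (K : fieldType) (s : S K) : stratum pi s -> tri N pi s.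
Proof.
move=> st; have [r xr h] := st K (ridm K).
have := h K (ridm K); rewrite act_id //; apply.
by exists r^-1; rewrite mulfV.
Qed.

(** Over [K] some permutation of ^J W admits a triangular frame; its base change and uniqueness over
    [L] identify it with [pi]. *)
Lemma tri_residue pi (K L : fieldType) (j : {rmorphism K -> L}) (s : S K) :
  JWperm dl pi -> tri N pi (act j s) -> tri N pi s.
Proof.
move=> J t; have [pi' [J' t']] := JW_tri s.
by rewrite (tri_unique J J' t (tri_bc j t')).
Qed.

(** The equations come from [locus_tri] at the residue field. A point of the stratum has triangular
    frames only locally, so the equations vanish locally, hence vanish. *)
Lemma locus_stratum pi (A : comPzRingType) (L : fieldType) (x : {rmorphism A -> L}) (s : S A) :
  JWperm dl pi -> tri N pi (act x s) -> locus x s (stratum pi).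
Proof.
move=> J t; have [K [x0 [j [jE frac]]]] := residue_point x.
have xE : act x s = act j (act x0 s) by apply: act_comp => a; rewrite /= jE.
have [r [E [xr h]]] : locus x0 s (fun R s0 => tri N pi s0).
  by apply: locus_tri frac _; apply: (tri_residue (j := j)) => //; rewrite -xE.
exists r, E; rewrite -jE fmorph_eq0; split=> // R' phi u; split.
  by move/(h R' phi u)/tri_stratum.
move=> st e Ee; apply: local_zero => K' x'; have [r' xr' h'] := st K' x'.
have lr := locP r'; have [[b rb] _ ker] := lr.
have : loc_in r' (phi e) = 0.
  have ur : exists c, rcomp (loc_in r') phi r * c = 1.
    by have [c ec] := u; exists (loc_in r' c); rewrite -[LHS](rmorphM (loc_in r')) ec rmorph1.
  apply: (proj2 (h _ (rcomp (loc_in r') phi) ur)) Ee.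
  by rewrite -act2; apply: h'; exists b.
by move/ker => [k ek]; exists (r' ^+ k); rewrite // rmorphXn expf_neq0.
Qed.

Lemma stratum_unique pi pi' (K : fieldType) (s : S K) : JWperm dl pi -> JWperm dl pi' ->
  stratum pi s -> stratum pi' s -> pi = pi'.
Proof. by move=> J J' /stratum_field t /stratum_field; apply: tri_unique. Qed.

Lemma standard_stratum u (R : comPzRingType) (s : S R) (R' : comPzRingType)
    (phi : {rmorphism R -> R'}) : in_JW u -> fppf_cover phi ->
  zip_iso (M R' (act phi s)) (std_zip p u R') -> stratum (zperm u) s.
Proof.
move=> Ju [fl _ sur] iso; set pi := zperm u.
have J : JWperm dl pi by apply/JW_perm.
have t : tri N pi (act phi s).
  have [v fr] := zframe_iso iso (std_frame supp_sorted p_prime R' u).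
  exists v; eexists; split; first exact: fr.
  by move=> b a lt; rewrite mxE; case: (b =P _) => // e; rewrite e ltnn in lt.
(* The point lifts to [R'] after a field extension, where the standard frame is available;
   [tri_residue] brings triangularity back to [K]. *)
apply: stratum_local => K x; have [L [e [y yE]]] := sur K x.
have tx : tri N pi (act x s).
  apply: (tri_residue (j := e)) => //; rewrite act2.
  have -> : act (rcomp e x) s = act y (act phi s) by apply: act_comp => a; rewrite /= yE.
  exact: tri_bc.
have [r [E [xr h]]] := locus_stratum J tx.
exists r => // R2 psi [ur _ _]; apply/(h R2 psi ur) => d Ed.
have lr := locP (phi r); have [[b rb] _ ker] := lr.
  have : loc_in (phi r) (phi d) = 0.
    apply: (proj2 (h _ (rcomp (loc_in (phi r)) phi) _)) Ed; first by exists b.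
    by rewrite -act2; apply/stratum_bc/tri_stratum.
  (* The equation vanishes in [R'] after multiplication by a power of [r]; faithful flatness gives
     the same relation in [R]. *)
  move/ker => [k]; rewrite -rmorphXn -rmorphM => /(flat_inj fl sur) rd.
  apply: (unit_reg (a := psi r ^+ k)); first exact: unit_exp.
  by rewrite -rmorphXn -rmorphM rd rmorph0.
Qed.

(** The transition between equal bases is the identity. Gradedness removes the ambiguity of
    representatives modulo D_(i-1). *)
Lemma frame_matrix_unique pi (R : comPzRingType) (s : S R) (v : 'I_n -> M R s) Phi Phi' :
  frame pi v Phi -> frame pi v Phi' -> Phi = Phi'.
Proof.
move=> fr fr'; have [T [TE [_ _ _ e]]] := zframe_transition supE p_prime (char_S s) (@fib_semi R s) fr fr'.
have T1 : T = 1%:M.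
  apply/matrixP => b a; rewrite [RHS]mxE; move: b.
  apply: (basis_inj (zf_basis fr)); rewrite -TE (bigD1 a) //= eqxx scale1r big1 ?addr0 // => b /negbTE->.
  by rewrite scale0r.
move: e; have -> : Dpart dl T = 1%:M.
  by rewrite T1; apply/matrixP => b a; rewrite !mxE; case: (b =P a) => [->|_]; [rewrite eqxx|case: ifP].
have -> : powmx p (Cpart dl pi pi T) = 1%:M.
  rewrite T1; apply/matrixP => b a; rewrite !mxE; case: (b =P a) => [->|_]; first by rewrite eqxx expr1n.
  by rewrite if_same expr0n; case: p (prime_gt0 p_prime).
by rewrite mul1mx mulmx1.
Qed.

(** Frames over the factors assemble to a frame over the product, and [frame_matrix_unique]
    identifies the components of its matrix. The local frames on a Zariski cover thus become one
    frame over a single ring. *)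
Lemma tri_prod m pi k (L : 'I_k -> comPzRingType) (s : S (prodr L)) :
  (forall a, tri m pi (act (prod_pi L a) s)) -> tri m pi s.
Proof.
move=> h; have [v' v'P] := fin_all_exists h; have [Phi' fr'] := fin_all_exists v'P.
pose al a := rst M (erefl (act (prod_pi L a) s)).
have bc a : is_base_change (prod_pi L a) (al a) by apply: rst_base_change MP _ _ _ _ _ _.
have [v vE] : exists v : 'I_n -> M _ s, forall a j, al a (v j) = v' a j.
  have [v vE] := fin_all_exists (fun j : 'I_n => prod_mod_ex bc (fun a => v' a j)).
  by exists v.
have vE' a : (fun j => al a (v j)) = v' a by apply: funext.
have vb : is_basis v.
  by apply: (prod_mod_basis bc) => a; rewrite vE'; apply: zf_basis (proj1 (fr' a)).
have [Phi fr] : exists Phi, frame pi v Phi.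
  apply: frame_of_basis; split=> // i.
    apply: (prod_mod_supp bc (A' := fun a => zC (M _ (act (prod_pi L a) s)) i)) => a w.
      exact: C_base_change MP _ _ _ _ _ _ _ _.
    by rewrite vE'; apply: zf_C (proj1 (fr' a)) _ _.
  apply: (prod_mod_supp bc (A' := fun a => zD (M _ (act (prod_pi L a) s)) i)) => a w.
    exact: D_base_change MP _ _ _ _ _ _ _ _.
  by rewrite vE'; apply: zf_D (proj1 (fr' a)) _ _.
exists v, Phi; split=> // b c lt; apply: functional_extensionality_dep => a.
have := frame_bc (erefl (act (prod_pi L a) s)) fr.
have [fra tra] := fr' a.
rewrite -[fun j => rst M _ (v j)]/(fun j => al a (v j)) vE' => /(frame_matrix_unique fra)/matrixP/(_ b c).
by rewrite tra // mxE => e; apply: (esym e).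
Qed.

Lemma stratum_standard u (R : comPzRingType) (s : S R) : stratum (zperm u) s ->
  exists (R' : comPzRingType) (phi : {rmorphism R -> R'}),
    fppf_cover phi /\ zip_iso (M R' (act phi s)) (std_zip p u R').
Proof.
set pi := zperm u => st.
pose E r := forall (R' : comPzRingType) (phi : {rmorphism R -> R'}),
  (exists b, phi r * b = 1) -> tri N pi (act phi s).
have [k [f [fE fu]]] : exists k (f : 'I_k -> R), (forall a, E (f a)) /\ unit_family f.
  apply: span_unit_family; apply: span_unit => K x; have [r xr h] := st K x.
  by exists r.
have lf a := locP (f a).
(* The fppf cover is the composite of the Zariski cover, as a map into the product of the
   localizations, with the finite cover given by [trivializing_cover]. *)
have [phi phiE] := prod_lift (fun a => loc_in (f a)).
have [v [Phi [fr tr]]] : tri N pi (act phi s).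
  apply: tri_prod => a.
  rewrite -(act_comp (chi := loc_in (f a))); last by move=> r; rewrite -phiE.
  by have [ua _ _] := lf a; apply: (fE a _ _ ua).
have ch := char_S (act phi s).
have [Psi PP] := zf_minv fr.
have [Q [psi [[J [mu [e dual]]] pres sur [T tT]]]] :=
  trivializing_cover dlB p_prime ch PP (zf_graded fr) tr.
exists Q, (rcomp psi phi); split.
  split.
  - have [lam [c gd]] := prod_germ_dual lf phiE.
    exact: germ_dual_flat (germ_dual_comp gd dual).
  - exact: presented_fp (presented_comp (prod_presented lf phiE fu) pres).
  move=> K x; have [L [g [y yE]]] := prod_Spec_surj lf phiE fu x.
  have [L' [g' [y' y'E]]] := sur L y.
  exists L', (rcomp g' g), y' => r.
  by rewrite -[LHS]/(y' (psi (phi r))) y'E yE.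
rewrite -act2; set s' := act psi _.
have ch' := char_S s'; have sm := @fib_semi Q s'.
have fr' := frame_bc (erefl s') fr.
have grp : graded dl pi (pmx pi Q).
  by move=> b a; rewrite mxE; case: (b =P pi a) => // ->; rewrite eqxx.
have fr2 := zframe_change supE p_prime ch' sm fr' tT grp (perm_minv Q pi).
have ss : zsemi p (std_zip p u Q) by apply: std_semi.
exact: (zip_iso_frames p_prime ch' sm ss fr2 (std_frame supp_sorted p_prime Q u)).
Qed.

Notation W := (JW tau supp).

(* the strata and their disjoint union, as subfunctors of [S] *)
Definition Zs (u : W) : subfun S := stratum (zperm (sval u)).
Definition Ts : subfun S := fun R s => forall (K : fieldType) (x : {rmorphism R -> K}),
  exists u, near x s (Zs u).

Lemma Zs_stable u : sub_stable (Zs u).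
Proof. by move=> R R' phi s; apply: stratum_bc. Qed.

Lemma Zs_local u : sub_local (Zs u).
Proof.
move=> R s h; apply: stratum_local => K x; have [r xr hr] := h K x.
by exists r => // R' phi /loc_unit; apply: hr.
Qed.

Let zJ (u : W) : JWperm dl (zperm (sval u)).
Proof. exact: (proj1 (JW_perm supp_sorted _) (svalP u)). Qed.

Lemma Zs_locus u (A : comPzRingType) (s : S A) (K : fieldType) (x : {rmorphism A -> K}) :
  Zs u (act x s) -> locus x s (Zs u).
Proof.
by move/stratum_field; apply: (locus_stratum (zJ u)).
Qed.

Lemma Zs_disjoint u w (K : fieldType) (s : S K) : Zs u s -> Zs w s -> u = w.
Proof.
move=> zu zw; have := stratum_unique (zJ u) (zJ w) zu zw.
move/zperm_inj; case: u w {zu zw} => a ha [b hb] /= e; subst b.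
by congr exist; apply: bool_irrelevance.
Qed.

Lemma near_const (T : subfun S) (R : comPzRingType) (s : S R) (K : fieldType) (x : {rmorphism R -> K}) :
  sub_stable T -> T R s -> near x s T.
Proof.
by move=> st h; exists 1; [rewrite rmorph1 oner_neq0|move=> R' phi _; apply: st].
Qed.

Lemma near_point (T : subfun S) (R : comPzRingType) (s : S R) (K : fieldType) (x : {rmorphism R -> K}) :
  near x s T -> T K (act x s).
Proof. by case=> r xr; apply; exists (x r)^-1; rewrite mulfV. Qed.

Lemma Ts_stable : sub_stable Ts.
Proof.
move=> R R' phi s h K x; have [u hu] := h K (rcomp x phi).
by exists u; apply: near_bc.
Qed.

Lemma Ts_local : sub_local Ts.
Proof.
move=> R s h K x; have [r xr hr] := h K x.
have lr := locP r; have [y yE] := loc_point lr xr.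
have [u hu] := hr _ _ (loc_unit lr) K y; exists u.
exact: near_loc lr xr yE hu.
Qed.

Lemma Zs_Ts u (R : comPzRingType) (s : S R) : Zs u s -> Ts s.
Proof. by move=> h K x; exists u; apply: near_const h; apply: Zs_stable. Qed.

Lemma Ts_field (K : fieldType) (s : S K) : Ts s.
Proof.
have [pi [J t]] := JW_tri s.
(* The solution of x^-1 u^-1 = pi. *)
pose u := (pi * xperm tau supp)^-1%g.
have uE : zperm u = pi by rewrite /zperm /u invgK -mulgA mulgV mulg1.
have Ju : in_JW u by apply/(JW_perm supp_sorted); rewrite uE.
apply: (@Zs_Ts (exist _ u Ju)); rewrite /Zs /= uE.
exact: tri_stratum.
Qed.

Lemma Ts_near u (R : comPzRingType) (s : S R) (K : fieldType) (x : {rmorphism R -> K}) :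
  Ts s -> Zs u (act x s) -> near x s (Zs u).
Proof.
move=> /(_ K x)[w nw] zu.
by rewrite (Zs_disjoint zu (near_point nw)).
Qed.

Lemma Xs_scheme u : is_scheme (subz (@Zs_stable u)).
Proof.
apply: (@subz_scheme S (Zs u) unit (fun=> Zs u)).
- exact: Zs_local.
- by move=> _; apply: Zs_stable.
- by move=> _; apply: Zs_local.
- by move=> _; apply: Zs_locus.
- by [].
- by move=> _ R s K x Zu _; apply: (near_const x (@Zs_stable u) Zu).
- by move=> K s Zu; exists tt.
Qed.

Lemma Ps_scheme : is_scheme (subz Ts_stable).
Proof.
apply: (@subz_scheme S Ts W Zs).
- exact: Ts_local.
- exact: Zs_stable.
- exact: Zs_local.
- exact: Zs_locus.
- exact: Zs_Ts.
- exact: Ts_near.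
- by move=> K s /(_ K (ridm K))[u /near_point]; rewrite act_id //; exists u.
Qed.

Definition Xs u : scheme := Scheme (Xs_scheme u).
Definition Ps : scheme := Scheme Ps_scheme.
Definition Xs_incl u : zmor (Xs u) S := sub_incl (@Zs_stable u).

Lemma image_Xs u (R : comPzRingType) (s : S R) : image (Xs_incl u) s <-> Zs u s.
Proof. by split=> [[[t Zt] <-] //|Zu]; exists (exist _ s Zu). Qed.

Lemma Xs_locally_closed u : locally_closed_immersion (Xs_incl u).
Proof.
apply: (locus_locally_closed (@Zs_stable u) (@Zs_local u) (@Zs_locus u)); last exact: image_Xs.
by move=> R s t; apply: sub_inj.
Qed.

Lemma Xs_represents u : represents_stratum M (sval u) (Xs_incl u).
Proof.
move=> T g; split=> [[h hE] R t|hT].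
  have [R' [phi [fp iso]]] := stratum_standard (svalP (h R t)).
  exists R', phi; split=> //=; rewrite app_nat -hE; exact: iso.
have Zg (R : comPzRingType) (t : T R) : Zs u (g R t).
  have [R' [phi [fp iso]]] := hT R t.
  apply: (standard_stratum (svalP u) fp).
  by rewrite /= app_nat in iso.
exists (@ZMor T (Xs u) (fun R t => exist _ (g R t) (Zg R t))
  (fun R R' phi t => sub_inj (s := exist _ _ _) (t := exist _ _ _) (app_nat g phi t))).
by move=> R t.
Qed.
End Strata.

Theorem theorem2 (p : nat) (p_prime : prime p)
    (tau : int -> nat) (supp : seq int)
    (supp_sorted : sorted <%R supp)
    (suppE : forall i : int, (i \in supp) = (tau i != 0%N))
    (S : scheme) (char_S : has_characteristic p S)
    (M : fzip p S) (M_type : has_type M tau) :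
  exists (X : JW tau supp -> scheme) (iota : forall u, zmor (X u) S),
    (forall u, locally_closed_immersion (iota u) /\
               represents_stratum M (sval u) (iota u)) /\
    exists (P : scheme) (inj : forall u, zmor (X u) P) (f : zmor P S),
      [/\ is_coproduct inj, forall u, comp_eq f (inj u) (iota u),
          monomorphism f & bijective_on_points f].
Proof.
exists (Xs p_prime supp_sorted suppE char_S M_type), (Xs_incl p_prime supp_sorted suppE char_S M_type).
split=> [u|]; first by split; [apply: Xs_locally_closed|apply: Xs_represents].
exists (Ps p_prime supp_sorted suppE char_S M_type), (sub_inj_mor (Xs_scheme p_prime supp_sorted suppE char_S M_type)
  (Ps_scheme p_prime supp_sorted suppE char_S M_type) (@Zs_Ts p tau supp S M)),
  (sub_incl (@Ts_stable p tau supp S M)).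
split.
- move=> Y f; apply: disjoint_coproduct_ex.
  + by move=> u w K s; apply: Zs_disjoint.
  + by move=> R s K x /(_ K x).
- by [].
- by move=> T a b h R t; apply: sub_inj; apply: h.
split=> [K L x y [E [a [b e]]]|L s]; first by exists E, a, b; apply: sub_inj.
exists L, (exist _ s (Ts_field p_prime supp_sorted suppE char_S M_type s)), L, (ridm L), (ridm L).
by [].
Qed.
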